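(* Let $M$ be a complete Riemannian surface homeomorphic to $\mathbb R^2$ without conjugate points, satisfying the visibility axiom at some point $p\in M$. Then for any line $\gamma$ in $M$ there exists a line $\sigma$ in $M$ such that $(\gamma,\sigma)$ is a weak hyperbolic pair.
   Context: A complete Riemannian manifold is without conjugate points if no geodesic contains a pair of mutually conjugate points. A line in $M$ is a smooth curve $\gamma:(-\infty,\infty)\to M$ with $d(\gamma(t),\gamma(s))=|t-s|$ for all $t,s\in\mathbb R$. Visibility axiom at $p$: for each $\varepsilon>0$ there exists a constant $R=R(\varepsilon,p)>0$ such that for any geodesic segment $\sigma:[a,b]\to M$ with $d(p,\sigma)>R$ (distance from $p$ to the image of $\sigma$), one has $\measuredangle_p(\sigma(a),\sigma(b))\le\varepsilon$. Here $\measuredangle_p(x,y)$ is the angle at $p$ between the geodesics from $p$ to $x$ and from $p$ to $y$, which are unique since $M$ is complete, simply connected and without conjugate points. Weak hyperbolic pair: let $\gamma_1,\gamma_2:\mathbb R\to M$ be two non-intersecting lines. They bound a region homeomorphic to the band $\mathbb R\times[0,1]$, which has two ends. Changing the orientation of $\gamma_2$ if necessary, assume that $\gamma_1(t)$ and $\gamma_2(t)$ belong to the same end of the band as $t\to+\infty$. Then $(\gamma_1,\gamma_2)$ is a weak hyperbolic pair if there are a sequence $t_k\to+\infty$ with $\lim_{k\to\infty}d(\gamma_1(t_k),\gamma_2(t_k))=\infty$ and a sequence $s_k\to-\infty$ with $\lim_{k\to\infty}d(\gamma_1(s_k),\gamma_2(s_k))=\infty$. *)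

(* Defs.v *)
(* Riemannian surfaces in local coordinates.  Tangent vectors are ROW vectors, so
   a Jacobian acts on the right: its entry (k, l) is the k-th partial derivative
   of the l-th component. *)
From HB Require Import structures.
From mathcomp Require Import all_boot all_order all_algebra.
From mathcomp Require Import all_classical all_reals all_analysis.
Set Implicit Arguments.
Unset Strict Implicit.
Unset Printing Implicit Defensive.
Import Order.TTheory GRing.Theory Num.Theory.
Import numFieldNormedType.Exports.
Local Open Scope classical_set_scope.
Local Open Scope ring_scope.

Definition homeomorphism_on (S T : topologicalType) (A : set S) (B : set T)
    (f : S -> T) : Prop :=
  exists g : T -> S,
    [/\ (forall x, A x -> B (f x) /\ g (f x) = x),
        (forall y, B y -> A (g y) /\ f (g y) = y),
        {within A, continuous f} & {within B, continuous g}].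

Definition homeomorphic (S T : topologicalType) : Prop :=
  exists f : S -> T, homeomorphism_on setT setT f.

Section PlaneCalculus.
Context {R : realType} {V : normedModType R}.

Definition partial (k : 'I_2) (f : 'rV[R]_2 -> V) : 'rV[R]_2 -> V :=
  fun x => 'D_(delta_mx 0 k) f x.

Definition iter_partial (s : seq 'I_2) (f : 'rV[R]_2 -> V) : 'rV[R]_2 -> V :=
  foldr partial f s.

(* C^oo on a set A, meant for open A. *)
Definition smooth_on (A : set 'rV[R]_2) (f : 'rV[R]_2 -> V) : Prop :=
  forall (s : seq 'I_2) x, A x ->
    {for x, continuous (iter_partial s f)} /\
    forall k : 'I_2, derivable (iter_partial s f) x (delta_mx 0 k).

End PlaneCalculus.

(* Outside cdom (resp. its image) the values of coord (resp. param) are junk. *)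
Record plane_chart (R : realType) (T : topologicalType) := PlaneChart {
  cdom : set T;
  coord : T -> 'rV[R]_2;
  param : 'rV[R]_2 -> T;
  cdom_open : open cdom;
  cimage_open : open (coord @` cdom);
  coord_homeo : homeomorphism_on cdom (coord @` cdom) coord;
  coordK : forall x, cdom x -> param (coord x) = x
}.

Definition transition (R : realType) (T : topologicalType)
  (c d : plane_chart R T) : 'rV[R]_2 -> 'rV[R]_2 := coord d \o param c.

Definition overlap (R : realType) (T : topologicalType)
  (c d : plane_chart R T) : set 'rV[R]_2 := coord c @` (cdom c `&` cdom d).

(* A smooth 2-manifold without boundary, with an atlas indexed by atlas_idx,
   and the coordinate expressions gmat i of a smooth Riemannian metric. *)
Record riemannian_surface (R : realType) := RiemannianSurface {
  surface_top :> topologicalType;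
  surface_hausdorff : hausdorff_space surface_top;
  surface_second_countable : @second_countable surface_top;
  atlas_idx : Type;
  chart : atlas_idx -> plane_chart R surface_top;
  chart_at : surface_top -> atlas_idx;
  mem_chart_at : forall x, cdom (chart (chart_at x)) x;
  transition_smooth : forall i j,
    smooth_on (overlap (chart i) (chart j)) (transition (chart i) (chart j));
  gmat : atlas_idx -> 'rV[R]_2 -> 'M[R]_2;
  gmat_smooth : forall i,
    smooth_on (coord (chart i) @` cdom (chart i)) (gmat i);
  gmat_sym : forall i x, cdom (chart i) x ->
    (gmat i (coord (chart i) x))^T = gmat i (coord (chart i) x);
  gmat_posdef : forall i x (v : 'rV[R]_2), cdom (chart i) x -> v != 0 ->
    0 < (v *m gmat i (coord (chart i) x) *m v^T) 0 0;
  gmat_transition : forall i j y, overlap (chart i) (chart j) y ->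
    gmat i y = jacobian (transition (chart i) (chart j)) y
               *m gmat j (transition (chart i) (chart j) y)
               *m (jacobian (transition (chart i) (chart j)) y)^T
}.

Section RiemannianSurface.
Context {R : realType} {M : riemannian_surface R}.
Implicit Types (i j : atlas_idx M) (c gamma sigma : R -> M) (x y p : M).

Definition dom i : set M := cdom (chart i).
Definition crd i : M -> 'rV[R]_2 := coord (chart i).

Definition inner i x (u v : 'rV[R]_2) : R :=
  (u *m gmat i (crd i x) *m v^T) 0 0.

Definition smooth_curve c : Prop :=
  continuous c /\
  forall i t (n : nat), dom i (c t) -> derivable (derive1n n (crd i \o c)) t 1.

Definition velocity i c : R -> 'rV[R]_2 := derive1 (crd i \o c).

Definition speed c (t : R) : R :=
  let i := chart_at (c t) in
  Num.sqrt (inner i (c t) (velocity i c t) (velocity i c t)).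

Definition arc_length c (a b : R) : R :=
  Rintegral lebesgue_measure `[a, b] (speed c).

(* Some piecewise smooth path from x to y has length l. *)
Inductive piecewise_smooth_path : M -> M -> R -> Prop :=
| path_segment c (a b : R) of smooth_curve c & a <= b :
    piecewise_smooth_path (c a) (c b) (arc_length c a b)
| path_concat x y z (l m : R) of
    piecewise_smooth_path x y l & piecewise_smooth_path y z m :
    piecewise_smooth_path x z (l + m).

Definition dist x y : R := inf [set l | piecewise_smooth_path x y l].

(* Gamma^k_ab in the chart i *)
Definition christoffel i (k a b : 'I_2) (z : 'rV[R]_2) : R :=
  2^-1 * \sum_(l < 2) invmx (gmat i z) k l *
    (partial a (fun w => gmat i w b l) z + partial b (fun w => gmat i w a l) z
     - partial l (fun w => gmat i w a b) z).

(* Components of the curvature: R(d_a, d_b) d_m = \sum_l curvature i l m a b d_l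
   with R(X, Y) Z = D_X D_Y Z - D_Y D_X Z - D_[X,Y] Z. *)
Definition curvature i (l m a b : 'I_2) (z : 'rV[R]_2) : R :=
  partial a (christoffel i l b m) z - partial b (christoffel i l a m) z
  + \sum_(n < 2) (christoffel i n b m z * christoffel i l a n z
                  - christoffel i n a m z * christoffel i l b n z).

(* Covariant derivative along c of the field with components V in the chart i *)
Definition cov_deriv i c (V : R -> 'rV[R]_2) (t : R) : 'rV[R]_2 :=
  derive1 V t +
  \row_(k < 2) \sum_(a < 2) \sum_(b < 2)
    christoffel i k a b (crd i (c t)) * velocity i c t 0 a * V t 0 b.

(* Affinely parametrized; on a complete surface every geodesic extends to all
   of R, so geodesic segments are restrictions of these. *)
Definition geodesic c : Prop :=
  smooth_curve c /\
  forall i t, dom i (c t) -> cov_deriv i c (velocity i c) t = 0.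

(* The exponential map is defined on every tangent space; by Hopf-Rinow this is
   the same as metric completeness for dist. *)
Definition geodesically_complete : Prop :=
  forall i x (v : 'rV[R]_2), dom i x ->
    exists c, [/\ geodesic c, c 0 = x & velocity i c 0 = v].

(* A smooth vector field along c, given by its components J i t in every
   chart i around c t. *)
Definition field_along c (J : atlas_idx M -> R -> 'rV[R]_2) : Prop :=
  (forall i t (n : nat), dom i (c t) -> derivable (derive1n n (J i)) t 1) /\
  (forall i j t, dom i (c t) -> dom j (c t) ->
     J j t = J i t *m jacobian (transition (chart i) (chart j)) (crd i (c t))).

(* D^2 J / dt^2 + R(J, c') c' = 0 *)
Definition jacobi_field c (J : atlas_idx M -> R -> 'rV[R]_2) : Prop :=
  field_along c J /\
  forall i t, dom i (c t) ->
    cov_deriv i c (cov_deriv i c (J i)) t +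
    \row_(l < 2) \sum_(a < 2) \sum_(b < 2) \sum_(m < 2)
      curvature i l m a b (crd i (c t)) *
      J i t 0 a * velocity i c t 0 b * velocity i c t 0 m = 0.

Definition conjugate_along c (a b : R) : Prop :=
  exists J, [/\ jacobi_field c J,
    (exists i t, dom i (c t) /\ J i t <> 0),
    (forall i, dom i (c a) -> J i a = 0) &
    (forall i, dom i (c b) -> J i b = 0)].

Definition no_conjugate_points : Prop :=
  forall c (a b : R), geodesic c -> a < b -> ~ conjugate_along c a b.

(* The angle at c 0 = e 0 between two curves with nonzero initial velocities *)
Definition angle0 c e : R :=
  let i := chart_at (c 0) in
  let u := velocity i c 0 in let v := velocity i e 0 in
  acos (inner i (c 0) u v /
        (Num.sqrt (inner i (c 0) u u) * Num.sqrt (inner i (c 0) v v))).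

Definition dist_to_segment p sigma (a b : R) : R :=
  inf [set dist p (sigma t) | t in `[a, b]].

(* c and e are the geodesics from p to the end points of the segment; they are
   unique when there are no conjugate points and the surface is complete and
   simply connected, so the universal quantification refers to just these. *)
Definition visibility_axiom p : Prop :=
  forall eps : R, 0 < eps -> exists2 r : R, 0 < r &
    forall sigma (a b : R), geodesic sigma -> a <= b ->
      r < dist_to_segment p sigma a b ->
      forall c e, geodesic c -> c 0 = p -> c 1 = sigma a ->
                  geodesic e -> e 0 = p -> e 1 = sigma b ->
        angle0 c e <= eps.

Definition line gamma : Prop :=
  smooth_curve gamma /\ forall t s : R, dist (gamma t) (gamma s) = `|t - s|.

Definition band : set (R * R) := [set z | 0 <= z.2 <= 1].

(* h identifies the band R x [0, 1] with a closed region B whose frontier is the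
   union of the two (disjoint) curves, the k-th one being h (R x {k}). *)
Definition bounded_band gamma1 gamma2 (B : set M) (h : R * R -> M) : Prop :=
  [/\ homeomorphism_on band B h, closed B,
      closure B `\` interior B = range gamma1 `|` range gamma2,
      range gamma1 = [set h (s, 0) | s in setT] &
      range gamma2 = [set h (s, 1) | s in setT]].

(* As t -> +oo both curves go to the same end of the band; precomposing h with
   (s, r) |-> (- s, r) this end may be taken to be s = +oo. *)
Definition same_end gamma1 gamma2 : Prop :=
  exists (B : set M) (h : R * R -> M) (u1 u2 : R -> R),
    [/\ bounded_band gamma1 gamma2 B h,
        (forall t, gamma1 t = h (u1 t, 0)),
        (forall t, gamma2 t = h (u2 t, 1)),
        u1 t @[t --> +oo] --> +oo &
        u2 t @[t --> +oo] --> +oo].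

Definition reverse gamma : R -> M := fun t => gamma (- t).

Definition weak_hyperbolic_pair gamma1 gamma2 : Prop :=
  [/\ line gamma1, line gamma2, range gamma1 `&` range gamma2 = set0 &
   exists2 sigma, sigma = gamma2 \/ sigma = reverse gamma2 &
    [/\ same_end gamma1 sigma,
     (exists2 t : nat -> R, t k @[k --> \oo] --> +oo &
        dist (gamma1 (t k)) (sigma (t k)) @[k --> \oo] --> +oo) &
     (exists2 s : nat -> R, s k @[k --> \oo] --> -oo &
        dist (gamma1 (s k)) (sigma (s k)) @[k --> \oo] --> +oo)]].

End RiemannianSurface.

Arguments geodesically_complete {R} M.
Arguments no_conjugate_points {R} M.

(* Main.v *)
(* Without conjugate points every exponential map is a local homeomorphism, by the
   Gauss lemma paths lift through it, and since the surface is a plane it is a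
   global homeomorphism; hence unit speed geodesics are lines and conversely.
   Among five directions at the visibility point p two stay away from both ends of
   gamma and their rays are eventually on the same side of gamma. The geodesics
   joining the n-th points of these two rays do not cross gamma and, by visibility,
   meet a fixed ball around p, so they accumulate at a line sigma whose ends have
   the two given directions. Visibility also forbids tails of gamma and sigma to
   stay at bounded distance, since they are seen from p in different directions.
   In exponential coordinates at a point of gamma the lines become the horizontal
   axis and a curve in the upper half plane meeting every ray from the origin at
   most once; scaling along rays, the region between them is straightened to a band. *)
Require Import Defs.
From HB Require Import structures.
From mathcomp Require Import all_boot all_order all_algebra.
From mathcomp Require Import all_classical all_reals all_analysis.
From mathcomp Require Import ring lra.
Set Implicit Arguments.
Unset Strict Implicit.
Unset Printing Implicit Defensive.
Import Order.TTheory GRing.Theory Num.Theory.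
Import numFieldNormedType.Exports.
Local Open Scope classical_set_scope.
Local Open Scope ring_scope.

(** Completeness supplies all geodesics globally; their smooth dependence on the initial velocity is
    extracted from this family by convergence of difference quotients. Derivatives are taken in the
    strict sense, with two moving points, because strict derivatives compose, vary continuously and
    lead directly to local inversion. A lift through the exponential map could a priori escape to
    infinity in finite time. The Gauss lemma bounds its norm by the length of the path below, and
    this gives a section over each small chart ball through every preimage. Five directions are
    taken because there are four classes, namely the two ends of [gamma] and its two sides. With
    directions more than [6 * h] apart, at most one is within [3 * h] of a given end, so two of them
    share a side. Late points of [gamma] are seen within [h] of its ends and late points of [sigma]
    within [h] of the chosen directions, so all four pairs of ends diverge. Hence the orientation of
    [sigma] may be settled last, by the monotonicity of its slope as seen from a point of
    [gamma]. *)

Module LinearIdentity.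
(** * Identities in modules *)

Section Reflection.
Context {R : comRingType} {V : lmodType R}.

Inductive expr := EVar of nat | EZero | EAdd of expr & expr | EOpp of expr
  | EScale of R & expr.

Fixpoint eval (env : seq V) (e : expr) : V := match e with
  | EVar n => nth 0 env n | EZero => 0 | EAdd a b => eval env a + eval env b
  | EOpp a => - eval env a | EScale k a => k *: eval env a end.

(** Comparison by [Nat.eqb] lets [cbn] turn every coefficient into an explicit ring expression. *)
Fixpoint coef (e : expr) (n : nat) : R := match e with
  | EVar m => if Nat.eqb n m then 1 else 0 | EZero => 0
  | EAdd a b => coef a n + coef b n
  | EOpp a => - coef a n | EScale k a => k * coef a n end.

Fixpoint same_coef (N : nat) (a b : expr) : Prop := match N with
  | O => True | S n => coef a n = coef b n /\ same_coef n a b end.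

Lemma eval_coef env e :
  eval env e = \sum_(n < size env) coef e n *: nth 0 env n.
Proof.
elim: e => [m||a IHa b IHb|a IHa|k a IHa] /=; rewrite ?IHa ?IHb.
- have [mN|Nm] := ltnP m (size env); last first.
    rewrite nth_default// big1// => i _.
    case: PeanoNat.Nat.eqb_spec => [im|]; last by rewrite scale0r.
    by move: (ltn_ord i); rewrite im ltnNge Nm.
  rewrite (bigD1 (Ordinal mN))//= PeanoNat.Nat.eqb_refl scale1r big1 ?addr0// => i im.
  case: PeanoNat.Nat.eqb_spec => [E|]; last by rewrite scale0r.
  by move/eqP: im; case; apply: val_inj.
- by rewrite big1// => i _; rewrite scale0r.
- by rewrite -big_split/=; apply: eq_bigr => i _; rewrite scalerDl.
- by rewrite -sumrN; apply: eq_bigr => i _; rewrite scaleNr.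
- by rewrite scaler_sumr; apply: eq_bigr => i _; rewrite scalerA.
Qed.

Lemma evalP env a b : same_coef (size env) a b -> eval env a = eval env b.
Proof.
rewrite !eval_coef => ab; apply: eq_bigr => -[i iN] _; congr (_ *: _) => /=.
move: ab iN; move: (size env) => N; elim: N => //= N IH [E /IH{}IH].
by rewrite ltnS leq_eqVlt => /predU1P[->|].
Qed.
End Reflection.

(* The same term is often elaborated along different canonical structure paths,
   hence atoms with the same head are compared up to conversion of arguments. *)
Ltac head t := lazymatch t with ?f _ => head f | _ => t end.
Ltac same x y := first [constr_eq x y
  | lazymatch x with ?f ?a => lazymatch y with ?g ?b => same f g; same_arg a b end end]
with same_arg a b := first [same a b
  | let f := head a in let g := head b in tryif constr_eq f g then fail else unify a b].
Ltac index x l := lazymatch l with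
  | nil => constr:(@None nat)
  | cons ?y ?t => match goal with
     | _ => let _ := match goal with _ => same x y end in constr:(Some O)
     | _ => let n := index x t in
            lazymatch n with Some ?n => constr:(Some (S n)) | None => n end end end.
Ltac collect env e := lazymatch e with
  | @Algebra.add _ ?a ?b => let env := collect env a in collect env b
  | @Algebra.opp _ ?a => collect env a
  | @GRing.scale _ _ _ ?a => collect env a
  | @Algebra.zero _ => env
  | _ => let m := index e env in
         lazymatch m with Some _ => env | None => constr:(cons e env) end end.
Ltac quote_lin R env e := lazymatch e with
  | @Algebra.add _ ?a ?b =>
     let a := quote_lin R env a in let b := quote_lin R env b in constr:(@EAdd R a b)
  | @Algebra.opp _ ?a => let a := quote_lin R env a in constr:(@EOpp R a)
  | @GRing.scale _ _ ?k ?a => let a := quote_lin R env a in constr:(@EScale R k a)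
  | @Algebra.zero _ => constr:(@EZero R)
  | _ => let n := index e env in
         lazymatch n with Some ?n => constr:(@EVar R n) end end.
End LinearIdentity.

(** Reifies both sides and compares the coefficients of each atom, which leaves scalar goals for
    [ring] or [field]. The scalar ring is the [realType] found in the context. *)
Ltac linear_id := lazymatch goal with
  | R : realType |- @eq ?T ?a ?b =>
  let env := LinearIdentity.collect (@nil T) a in
  let env := LinearIdentity.collect env b in
  let a' := LinearIdentity.quote_lin R env a in
  let b' := LinearIdentity.quote_lin R env b in
  apply: (@LinearIdentity.evalP R _ env a' b');
  cbn [LinearIdentity.same_coef LinearIdentity.coef Nat.eqb size];
  repeat split; try ring; try (field; done) end.

(** * Calculus of curves *)

Section RealInduction.
Context {R : realType}.

(** Take the supremum of the [t] such that [P] holds on all of [[a, t]]: the limit step puts [P]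
    there, and the right step forbids it to lie before [b]. *)
Lemma real_induction (P : R -> Prop) (a b : R) : a <= b -> P a ->
  (forall t, a <= t -> t < b -> P t ->
     exists2 d : R, 0 < d & forall s, t < s -> s < t + d -> s <= b -> P s) ->
  (forall t, a < t -> t <= b -> (forall s, a <= s -> s < t -> P s) -> P t) ->
  forall t, a <= t -> t <= b -> P t.
Proof.
move=> ab Pa Pr Pl.
pose S := [set t | a <= t <= b /\ forall s, a <= s -> s <= t -> P s].
have Sa : S a.
  split; first by rewrite lexx ab.
  by move=> s as_ sa; have -> : s = a by apply/eqP; rewrite eq_le sa as_.
have supS : has_sup S.
  by split; [exists a | exists b => t [/andP[]]].
have ac : a <= sup S by apply: ub_le_sup Sa; exact: supS.2.
have cb : sup S <= b by apply: ge_sup; [exists a | move=> t [/andP[]]].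
set c := sup S in ac cb.
have Plt s : a <= s -> s < c -> P s.
  move=> as_ sc.
  have [|t [_ St] ct] := @sup_adherent _ S (c - s) _ supS; first by rewrite subr_gt0.
  by apply: St => //; apply: ltW; move: ct; rewrite opprB addrC subrK.
have Pc : P c.
  case: (ltgtP a c) ac => // [ac _|<- _ //]; exact: Pl.
have Sc : S c.
  split; first by rewrite ac cb.
  by move=> s as_; rewrite le_eqVlt => /predU1P[-> //|]; exact: Plt.
suff bc : b <= c by move=> t at_ tb; apply: Sc.2 => //; exact: le_trans bc.
rewrite leNgt; apply/negP => cltb.
have [d d0 Pd] := Pr c ac cltb Pc.
pose e := Num.min b (c + d / 2).
have ce : c < e by rewrite /e lt_min cltb ltrDl divr_gt0.
have : S e.
  split; first by rewrite (le_trans ac (ltW ce)) /= ge_min lexx.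
  move=> s as_ se; have [sc|cs] := leP s c; first exact: Sc.2.
  apply: Pd => //.
    rewrite (le_lt_trans se)// /e gt_min; apply/orP; right.
    by rewrite ltrD2l ltr_pdivrMr// mulr2n mulrDr mulr1 ltrDl.
  by rewrite (le_trans se)// ge_min lexx.
move=> /(ub_le_sup supS.2); rewrite -/c; lra.
Qed.

(** Connectedness of the line: truth of [P] passes between any two points of a window, so the set
    where it holds is open and closed. Continuation along curves is phrased this way below. *)
Lemma locally_constant_prop (P : R -> Prop) :
  (forall t, exists2 d : R, 0 < d &
     forall s s', `|s - t| < d -> `|s' - t| < d -> P s -> P s') ->
  forall a, P a -> forall b, P b.
Proof.
have H (Q : R -> Prop) : (forall t, exists2 d : R, 0 < d &
     forall s s', `|s - t| < d -> `|s' - t| < d -> Q s -> Q s') ->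
  forall a, Q a -> forall b, a <= b -> Q b.
  move=> lQ a Qa b ab.
  apply: (@real_induction Q a b) => //.
    move=> t _ _ Qt; have [d d0 Qd] := lQ t.
    exists d => // s ts std _; apply: Qd Qt; first by rewrite subrr normr0.
    by rewrite ger0_norm; lra.
  move=> t at_ _ Qs; have [d d0 Qd] := lQ t.
  pose s := Num.max a (t - d / 2).
  have st : s < t by rewrite /s gt_max at_ /=; lra.
  have ds : t - d / 2 <= s by rewrite /s le_max lexx orbT.
  apply: (Qd s); first by rewrite ltr0_norm; lra.
    by rewrite subrr normr0.
  by apply: Qs => //; rewrite /s le_max lexx.
move=> lP a Pa b; have [ab|ba] := leP a b; first exact: (H P lP a).
have := H (fun t => P (- t)) _ (- a) _ (- b).
rewrite !opprK; apply => //; last by lra.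
move=> t; have [d d0 Pd] := lP (- t); exists d => // s s' st s't.
by apply: Pd; rewrite -opprD normrN.
Qed.

(** By real induction: the modulus already found on an initial segment is glued with a local one by
    taking the minimum, which is legitimate because [Q] is inherited by smaller [d]. *)
Lemma uniform_on_segment (Q : R -> R -> Prop) (a b : R) :
  (forall s d d', 0 < d' -> d' <= d -> Q s d -> Q s d') ->
  (forall t, a <= t -> t <= b -> exists2 h : R, 0 < h & exists2 d : R, 0 < d &
     forall s, `|s - t| < h -> Q s d) ->
  exists2 d : R, 0 < d & forall s, a <= s -> s <= b -> Q s d.
Proof.
move=> mono loc.
have [ab|ba] := leP a b; last first.
  by exists 1 => // s as_ sb; move: (le_lt_trans (le_trans as_ sb) ba); rewrite ltxx.
suff H t : a <= t -> t <= b -> exists2 d : R, 0 < d & forall s, a <= s -> s <= t -> Q s d.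
  exact: (H b ab (lexx b)).
have glue u h d e r : r < u + h -> u - h < e -> 0 < d ->
    (exists2 d' : R, 0 < d' & forall s, a <= s -> s <= e -> Q s d') ->
    (forall s, `|s - u| < h -> Q s d) ->
    exists2 d' : R, 0 < d' & forall s, a <= s -> s <= r -> Q s d'.
  move=> rh he d0 [d' d'0 Q1] Q2; exists (Num.min d d'); first by rewrite lt_min d0.
  move=> s as_ sr; have m0 : 0 < Num.min d d' by rewrite lt_min d0.
  have [se|es] := leP s e.
    by apply: mono m0 _ (Q1 _ as_ se); rewrite ge_min lexx orbT.
  apply: mono m0 _ (Q2 _ _); first by rewrite ge_min lexx.
  by rewrite ltr_norml; apply/andP; split; lra.
move: t.
pose P t := exists2 d : R, 0 < d & forall s, a <= s -> s <= t -> Q s d.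
suff : forall t, a <= t -> t <= b -> P t by [].
apply: real_induction => //.
- have [h h0 [d d0 Qd]] := loc a (lexx _) ab.
  by exists d => // s as_ sa; apply: Qd; rewrite (_ : s = a) ?subrr ?normr0//; lra.
- move=> t at_ tb Pt; have [h h0 [d d0 Qd]] := loc t at_ (ltW tb).
  exists h => // s ts sh sb; apply: glue d0 Pt Qd; lra.
- move=> t at_ tb Pt; have [h h0 [d d0 Qd]] := loc t (ltW at_) tb.
  pose e := Num.max a (t - h / 2).
  have et : e < t by rewrite /e gt_max at_ /=; lra.
  have he : t - h / 2 <= e by rewrite /e le_max lexx orbT.
  have ae : a <= e by rewrite /e le_max lexx.
  apply: glue d0 (Pt e ae et) Qd; lra.
Qed.

End RealInduction.

Section CurveDerivative.
Context {R : realType}.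
Implicit Types (V W : normedModType R).

(** Little-o form of the derivative; it contains no quotient, so [s = t] is not a special case. *)
Definition curve_derive V (f : R -> V) (t : R) (v : V) : Prop :=
  forall e, 0 < e -> exists2 d : R, 0 < d &
    forall s, `|s - t| < d -> `|f s - f t - (s - t) *: v| <= e * `|s - t|.

(** Vector values admit no intermediate point, so the bound is proved with slope [C + e] by real
    induction, the slack [e] absorbing the little-o remainder at each step. *)
Lemma mean_value_norm V (f f' : R -> V) (a b C : R) : a <= b ->
  (forall t, a <= t -> t <= b -> curve_derive f t (f' t)) ->
  (forall t, a <= t -> t <= b -> `|f' t| <= C) ->
  `|f b - f a| <= C * (b - a).
Proof.
move=> ab df bf.
suff H e : 0 < e -> `|f b - f a| <= (C + e) * (b - a).
  apply/ler_addgt0Pr => e e0.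
  case: (ltgtP a b) ab => // [lab _|<- _]; last by rewrite !subrr mulr0 add0r normr0 ltW.
  have ba : 0 < b - a by rewrite subr_gt0.
  have := H (e / (b - a)) (divr_gt0 e0 ba).
  by rewrite mulrDl divfK// gt_eqF.
move=> e0.
apply: (@real_induction _ (fun t => `|f t - f a| <= (C + e) * (t - a)) a b) => //.
- by rewrite !subrr mulr0 normr0.
- move=> t at_ tb IH.
  have [d d0 fd] := df t at_ (ltW tb) e e0; exists d => // s ts sd sb.
  have st0 : 0 <= s - t by rewrite subr_ge0 ltW.
  have H : `|f s - f t - (s - t) *: f' t| <= e * (s - t).
    by rewrite -[X in _ <= _ * X]ger0_norm// fd// ger0_norm//; lra.
  have -> : f s - f a = (f s - f t - (s - t) *: f' t) + (f t - f a) + (s - t) *: f' t.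
    by linear_id.
  rewrite (le_trans (ler_normD _ _))//.
  have := ler_normD (f s - f t - (s - t) *: f' t) (f t - f a).
  have : `|(s - t) *: f' t| <= (s - t) * C.
    by rewrite normrZ ger0_norm// ler_wpM2l// bf// ltW.
  nra.
- move=> t at_ tb IH.
  have [d d0 fd] := df t (ltW at_) tb e e0.
  pose s := Num.max a (t - d / 2).
  have st : s < t by rewrite /s gt_max at_ /=; lra.
  have ds : t - d / 2 <= s by rewrite /s le_max lexx orbT.
  have as_ : a <= s by rewrite /s le_max lexx.
  have IHs := IH s as_ st.
  have H : `|f s - f t - (s - t) *: f' t| <= e * (t - s).
    by have := fd s; rewrite ltr0_norm ?subr_lt0// opprB; apply; lra.
  have -> : f t - f a = (t - s) *: f' t + (f s - f a) - (f s - f t - (s - t) *: f' t).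
    by linear_id.
  have E : `|(t - s) *: f' t| <= (t - s) * C.
    rewrite normrZ ger0_norm ?subr_ge0 ?(ltW st)// ler_wpM2l ?subr_ge0 ?(ltW st)//.
    by rewrite bf// ltW.
  have N1 := ler_normB ((t - s) *: f' t + (f s - f a)) (f s - f t - (s - t) *: f' t).
  have N2 := ler_normD ((t - s) *: f' t) (f s - f a).
  nra.
Qed.

Lemma curve_derive_cont V (f : R -> V) t v : curve_derive f t v ->
  {for t, continuous f}.
Proof.
move=> df; apply/cvgrPdist_le => e e0.
have [d d0 fd] := df 1 ltr01.
have m0 : 0 < 1 + `|v| by rewrite ltr_pwDl.
apply/nbhs_ballP; exists (Num.min d (e / (1 + `|v|))) => /=.
  by rewrite lt_min d0 divr_gt0.
move=> s; rewrite /ball/= distrC lt_min => /andP[sd se].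
rewrite -normrN opprB.
have -> : f s - f t = (f s - f t - (s - t) *: v) + (s - t) *: v by linear_id.
rewrite (le_trans (ler_normD _ _))// normrZ.
have := fd s sd; move: se; rewrite ltr_pdivlMr// mul1r; nra.
Qed.

Lemma curve_deriveP V (f : R -> V) t v :
  curve_derive f t v <-> derivable f t 1 /\ derive1 f t = v.
Proof.
split=> [df|[dd Ev] e e0]; last first.
  have /derivable1_diffP/diff_locallyP[_ ] := dd.
  rewrite deriv1E// Ev => /eqaddoP/(_ e e0) /nbhs_ballP[d /= d0 Hd].
  exists d => // s sd.
  have := Hd (s - t); rewrite /ball/= sub0r normrN => /(_ sd).
  rewrite [X in `|X| <= _](_ : _ = f s - f t - (s - t) *: v)//.
  by rewrite -addrA -opprD /= !fctE /= subrK.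
suff H : h^-1 *: ((f \o shift t) (h *: (1 : R)) - f t) @[h --> 0^'] --> v.
  split; first by apply/cvg_ex; exists v.
  by rewrite derive1E; exact: cvg_lim H.
apply/cvgrPdist_le => e e0; have [d d0 fd] := df e e0.
apply/nbhs_ballP; exists d => //= h; rewrite /ball/= sub0r normrN => hd h0.
have := fd (h + t); rewrite addrK => /(_ hd) H.
rewrite -(ler_pM2r (_ : 0 < `|h|)) ?normr_gt0// mulrC -normrZ.
have hh : h * h^-1 = 1 by rewrite divff.
suff -> : h *: (v - h^-1 *: (f (h *: 1 + t) - f t)) =
  - (f (h + t) - f t - h *: v) by rewrite normrN.
set y := f (h *: 1 + t); have -> : y = f (h + t).
  by congr (f (_ + _)); exact: mulr1.
by rewrite scalerBr scalerA hh scale1r; linear_id.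
Qed.

Lemma curve_derive_near V (f g : R -> V) t v :
  (\forall s \near t, f s = g s) -> curve_derive f t v -> curve_derive g t v.
Proof.
move=> /nbhs_ballP[d /= d0 fg] df e e0; have [d' d'0 fd] := df e e0.
exists (Num.min d d'); first by rewrite lt_min d0.
move=> s; rewrite lt_min => /andP[sd sd'].
by rewrite -!fg ?fd//; [exact: ballxx | rewrite /ball/= distrC].
Qed.

End CurveDerivative.

(** * Strict derivatives *)

Section BoundedLinear.
Context {R : realType}.
Implicit Types (U V W : normedModType R).

(** A predicate on bare functions with an explicit constant, so that derivatives can be combined by
    writing plain lambda terms. *)
Definition bounded_linear U V (L : U -> V) : Prop :=
  (forall (a : R) u v, L (a *: u + v) = a *: L u + L v) /\
  exists2 C : R, 0 < C & forall u, `|L u| <= C * `|u|.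

Section Algebra.
Context {U V : normedModType R} (L : U -> V) (bL : bounded_linear L).

Lemma blin0 : L 0 = 0.
Proof.
by have := bL.1 1 0 0; rewrite !scale1r addr0 => /eqP; rewrite -subr_eq0 opprD addrA subrr sub0r oppr_eq0 => /eqP.
Qed.

Lemma blinZ a u : L (a *: u) = a *: L u.
Proof. by have := bL.1 a u 0; rewrite !addr0 blin0 addr0. Qed.

Lemma blinD u v : L (u + v) = L u + L v.
Proof. by have := bL.1 1 u v; rewrite !scale1r. Qed.

Lemma blinN u : L (- u) = - L u.
Proof. by rewrite -scaleN1r blinZ scaleN1r. Qed.

Lemma blinB u v : L (u - v) = L u - L v.
Proof. by rewrite blinD blinN. Qed.
End Algebra.

Lemma blin_id U : bounded_linear (@id U).
Proof. by split=> //; exists 1 => // u; rewrite mul1r. Qed.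

Lemma blin_zero U V : bounded_linear (fun _ : U => 0 : V).
Proof.
split=> [a u v|]; first by rewrite scaler0 addr0.
by exists 1 => // u; rewrite normr0 mulr_ge0.
Qed.

Lemma blin_comp U V W (L : V -> W) (K : U -> V) :
  bounded_linear L -> bounded_linear K -> bounded_linear (L \o K).
Proof.
move=> bL bK; have [C C0 LC] := bL.2; have [D D0 KD] := bK.2; split=> [a u v|] /=.
  by rewrite bK.1 bL.1.
exists (C * D) => [|u /=]; first by rewrite mulr_gt0.
by rewrite (le_trans (LC _))// -mulrA ler_wpM2l// ltW.
Qed.

Lemma blin_add U V (L K : U -> V) :
  bounded_linear L -> bounded_linear K -> bounded_linear (fun u => L u + K u).
Proof.
move=> bL bK; have [C C0 LC] := bL.2; have [D D0 KD] := bK.2; split=> [a u v|] /=.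
  by rewrite bK.1 bL.1; linear_id.
exists (C + D) => [|u /=]; first by rewrite addr_gt0.
by rewrite (le_trans (ler_normD _ _))// mulrDl lerD.
Qed.

Lemma blin_scale U V (L : U -> V) (k : R) :
  bounded_linear L -> bounded_linear (fun u => k *: L u).
Proof.
move=> bL; have [C C0 LC] := bL.2; split=> [a u v|] /=.
  by rewrite bL.1; linear_id.
exists ((`|k| + 1) * C) => [|u /=]; first by rewrite mulr_gt0// ltr_wpDl.
rewrite normrZ -mulrA ler_pM//; first by rewrite lerDl.
Qed.

Lemma blin_pair U V W (L : U -> V) (K : U -> W) :
  bounded_linear L -> bounded_linear K -> bounded_linear (fun u => (L u, K u)).
Proof.
move=> bL bK; have [C C0 LC] := bL.2; have [D D0 KD] := bK.2; split=> [a u v|] /=.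
  by rewrite bK.1 bL.1.
exists (C + D) => [|u /=]; first by rewrite addr_gt0.
rewrite prod_normE /= ge_max mulrDl; have := normr_ge0 u.
have := LC u; have := KD u; have := normr_ge0 (L u); have := normr_ge0 (K u).
by move=> *; apply/andP; split; nra.
Qed.

Lemma norm_fst V W (u : V * W) : `|u.1| <= `|u|.
Proof. by rewrite prod_normE /= le_max lexx. Qed.

Lemma norm_snd V W (u : V * W) : `|u.2| <= `|u|.
Proof. by rewrite prod_normE /= le_max lexx orbT. Qed.

Lemma norm_pair_le V W (u : V * W) C : `|u.1| <= C -> `|u.2| <= C -> `|u| <= C.
Proof. by move=> *; rewrite prod_normE /= ge_max; apply/andP. Qed.

Lemma blin_fst V W : bounded_linear (fun u : V * W => u.1).
Proof. by split=> //; exists 1 => // u; rewrite mul1r norm_fst. Qed.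

Lemma blin_snd V W : bounded_linear (fun u : V * W => u.2).
Proof. by split=> //; exists 1 => // u; rewrite mul1r norm_snd. Qed.

Lemma blin_line V (v : V) : bounded_linear (fun h : R => h *: v).
Proof.
split=> [a u w|]; first by rewrite scalerDl scalerA.
exists (`|v| + 1) => [|u]; first by rewrite ltr_wpDl.
by rewrite normrZ mulrC ler_wpM2r// lerDl.
Qed.

Lemma norm_coord_le n (u : 'rV[R]_n) j : `|u 0 j| <= `|u|.
Proof.
rewrite [X in _ <= X]mx_normrE.
exact: (le_bigmax _ (fun ij => `|u ij.1 ij.2|) (0, j)).
Qed.

Lemma norm_row_le n (u : 'rV[R]_n) C : 0 <= C -> (forall j, `|u 0 j| <= C) -> `|u| <= C.
Proof.
move=> C0 uC; rewrite [X in X <= _]mx_normrE; apply: bigmax_le => // -[i j] _ /=.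
by rewrite ord1.
Qed.

Lemma blin_coord n (j : 'I_n) : bounded_linear (fun u : 'rV[R]_n => u 0 j : R).
Proof.
by split=> [a u v|]; [rewrite !mxE | exists 1 => // u; rewrite mul1r norm_coord_le].
Qed.

Lemma blin_row n U (L : U -> 'rV[R]_n) :
  (forall j, bounded_linear (fun u => L u 0 j : R)) -> bounded_linear L.
Proof.
move=> bL; split=> [a u v|].
  by apply/rowP => j; rewrite !mxE (bL j).1.
have /choice[C HC] : forall j, exists C : R, 0 < C /\ forall u, `|L u 0 j| <= C * `|u|.
  by move=> j; have [C C0 H] := (bL j).2; exists C.
exists (1 + \sum_j C j) => [|u].
  by rewrite ltr_pwDl// sumr_ge0// => j _; rewrite ltW// (HC j).1.
apply: norm_row_le => [|j].
  by rewrite mulr_ge0// addr_ge0// sumr_ge0// => j _; rewrite ltW// (HC j).1.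
rewrite (le_trans ((HC j).2 u))// ler_wpM2r//.
rewrite (bigD1 j)//= addrCA lerDl addr_ge0// sumr_ge0// => k _.
by rewrite ltW// (HC k).1.
Qed.

Lemma blin_mulmx m n (A : 'M[R]_(m, n)) : bounded_linear (fun u : 'rV[R]_m => u *m A).
Proof.
split=> [a u v|]; first by rewrite mulmxDl scalemxAl.
exists (1 + \sum_i \sum_j `|A i j|) => [|u].
  by rewrite ltr_pwDl// sumr_ge0// => i _; rewrite sumr_ge0.
have S0 : 0 <= \sum_i \sum_j `|A i j| by rewrite sumr_ge0// => i _; rewrite sumr_ge0.
apply: norm_row_le => [|j]; first by rewrite mulr_ge0// addr_ge0.
rewrite mxE (le_trans (ler_norm_sum _ _ _))// mulrDl mul1r ler_wpDl//.
rewrite mulr_suml ler_sum// => i _; rewrite normrM mulrC ler_pM// ?norm_coord_le//.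
by rewrite (bigD1 j)//= lerDl sumr_ge0.
Qed.

End BoundedLinear.
Section StrictDerivative.
Context {R : realType}.
Implicit Types (U V W : normedModType R).

(** Both points of the increment may move. This plays the role of C^1: it yields a local Lipschitz
    bound and, when the derivative is invertible, local injectivity, neither of which follows from
    ordinary differentiability at one point. *)
Definition strict_derive U V (f : U -> V) (x : U) (L : U -> V) : Prop :=
  bounded_linear L /\
  forall e, 0 < e -> exists2 d : R, 0 < d &
    forall u w, `|u - x| < d -> `|w - x| < d ->
      `|f u - f w - L (u - w)| <= e * `|u - w|.

Lemma sd_lipschitz U V (f : U -> V) x L : strict_derive f x L ->
  exists2 C : R, 0 < C & exists2 d : R, 0 < d &
    forall u w, `|u - x| < d -> `|w - x| < d -> `|f u - f w| <= C * `|u - w|.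
Proof.
move=> [bL df]; have [C C0 LC] := bL.2; have [d d0 fd] := df 1 ltr01.
exists (1 + C); first by rewrite addr_gt0.
exists d => // u w ux wx.
have -> : f u - f w = (f u - f w - L (u - w)) + L (u - w) by linear_id.
by rewrite (le_trans (ler_normD _ _))// mulrDl lerD// fd.
Qed.

Lemma sd_cont U V (f : U -> V) x L : strict_derive f x L -> {for x, continuous f}.
Proof.
move=> /sd_lipschitz[C C0 [d d0 fd]]; apply/cvgrPdist_le => e e0.
apply/nbhs_ballP; exists (Num.min d (e / C)) => /=; first by rewrite lt_min d0 divr_gt0.
move=> u; rewrite -ball_normE/= lt_min => /andP[ud ue].
rewrite (le_trans (fd _ _ _ _))// ?subrr ?normr0//; first by rewrite distrC.
by move: ue; rewrite ltr_pdivlMr// mulrC => /ltW.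
Qed.

Lemma near_norm U (x : U) (A : set U) :
  nbhs x A <-> exists2 d : R, 0 < d & forall y, `|y - x| < d -> A y.
Proof.
split=> [/nbhs_ballP[d /= d0 H]|[d d0 H]].
  by exists d => // y yx; apply: H; rewrite -ball_normE /= distrC.
by apply/nbhs_ballP; exists d => //= y; rewrite -ball_normE /= distrC; exact: H.
Qed.

Lemma continuous_norm U V (f : U -> V) (x : U) : {for x, continuous f} <->
  forall e, 0 < e -> exists2 d : R, 0 < d & forall y, `|y - x| < d -> `|f y - f x| <= e.
Proof.
split=> [/cvgrPdistC_le fx e /fx/near_norm//|H].
by apply/cvgrPdistC_le => e /H ?; exact/near_norm.
Qed.

Lemma sd_near U V (f g : U -> V) x L :
  (\forall u \near x, f u = g u) -> strict_derive f x L -> strict_derive g x L.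
Proof.
move=> /nbhs_ballP[d /= d0 fg] [bL df]; split=> // e e0; have [d' d'0 fd] := df e e0.
exists (Num.min d d'); first by rewrite lt_min d0.
move=> u w; rewrite !lt_min => /andP[ud ud'] /andP[wd wd'].
by rewrite -!fg ?fd//; rewrite -ball_normE/= distrC.
Qed.

Lemma sd_ext U V (f : U -> V) x L K : L =1 K -> strict_derive f x L -> strict_derive f x K.
Proof. by move=> /funext ->. Qed.

Lemma sd_curve V (f : R -> V) t L : strict_derive f t L -> curve_derive f t (L 1).
Proof.
move=> [bL df] e e0; have [d d0 fd] := df e e0; exists d => // s sd.
have -> : (s - t) *: L 1 = L (s - t).
  by rewrite -(blinZ bL); congr L; exact: mulr1.
by apply: fd => //; rewrite subrr normr0.
Qed.

Lemma sd_linear U V (L : U -> V) x : bounded_linear L -> strict_derive L x L.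
Proof.
move=> bL; split=> // e e0; exists 1 => // u w _ _.
by rewrite -(blinB bL) subrr normr0 mulr_ge0// ltW.
Qed.

Lemma sd_cst U V (c : V) (x : U) : strict_derive (fun=> c) x (fun=> 0).
Proof.
split; first exact: blin_zero.
by move=> e e0; exists 1 => // u w _ _; rewrite !subrr normr0 mulr_ge0// ltW.
Qed.

Lemma sd_add U V (f g : U -> V) x L K : strict_derive f x L -> strict_derive g x K ->
  strict_derive (fun u => f u + g u) x (fun h => L h + K h).
Proof.
move=> [bL df] [bK dg]; split; first exact: blin_add.
move=> e e0; have e20 : 0 < e / 2 by rewrite divr_gt0.
have [d d0 fd] := df _ e20; have [d' d'0 gd] := dg _ e20.
exists (Num.min d d'); first by rewrite lt_min d0.
move=> u w; rewrite !lt_min => /andP[ud ud'] /andP[wd wd'].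
have -> : f u + g u - (f w + g w) - (L (u - w) + K (u - w)) =
  (f u - f w - L (u - w)) + (g u - g w - K (u - w)) by linear_id.
rewrite (le_trans (ler_normD _ _))// [leRHS](_ : _ = e / 2 * `|u - w| + e / 2 * `|u - w|).
  by rewrite lerD ?fd ?gd.
by field.
Qed.

Lemma sd_comp U V W (g : V -> W) (f : U -> V) x L K :
  strict_derive f x L -> strict_derive g (f x) K -> strict_derive (g \o f) x (K \o L).
Proof.
move=> df dg; have [bL df'] := df; have [bK dg'] := dg; split; first exact: blin_comp.
move=> e e0; have [C C0 [d1 d10 fC]] := sd_lipschitz df; have [D D0 KD] := bK.2.
have [d2 d20 gd] := dg' (e / 2 / C) (divr_gt0 (divr_gt0 e0 (ltr0n _ 2)) C0).
have [d3 d30 fd] := df' (e / 2 / D) (divr_gt0 (divr_gt0 e0 (ltr0n _ 2)) D0).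
exists (Num.min d1 (Num.min (d2 / C) d3)); first by rewrite !lt_min d10 d30 divr_gt0.
have near_f u : `|u - x| < d1 -> `|u - x| < d2 / C -> `|f u - f x| < d2.
  move=> u1 u2; rewrite (le_lt_trans (fC _ _ u1 _))// ?subrr ?normr0//.
  by rewrite mulrC -ltr_pdivlMr.
move=> u w; rewrite !lt_min => /and3P[u1 u2 u3] /and3P[w1 w2 w3] /=.
have -> : g (f u) - g (f w) - K (L (u - w)) =
  (g (f u) - g (f w) - K (f u - f w)) + K (f u - f w - L (u - w)).
  by rewrite (blinB bK (f u - f w)); linear_id.
have H1 := gd _ _ (near_f u u1 u2) (near_f w w1 w2).
have H2 := KD (f u - f w - L (u - w)).
have H3 := fd u w u3 w3; have H4 := fC u w u1 w1.
rewrite (le_trans (ler_normD _ _))//.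
have E1 : e / 2 / C * `|f u - f w| <= e / 2 * `|u - w|.
  rewrite -mulrA ler_wpM2l ?divr_ge0// ?(ltW e0)// mulrC ler_pdivrMr// mulrC //.
have E2 : D * `|f u - f w - L (u - w)| <= e / 2 * `|u - w|.
  rewrite (le_trans (ler_wpM2l (ltW D0) H3))// mulrA.
  by rewrite [D * _]mulrC divfK// gt_eqF.
have -> : e * `|u - w| = e / 2 * `|u - w| + e / 2 * `|u - w| by field.
by apply: lerD; [exact: le_trans H1 E1 | exact: le_trans H2 E2].
Qed.

Lemma sd_comp_eq U V W (g : V -> W) (f : U -> V) x L K y :
  strict_derive f x L -> f x = y -> strict_derive g y K -> strict_derive (g \o f) x (K \o L).
Proof. by move=> df <-; exact: sd_comp. Qed.

Lemma sd_scale U V (f : U -> V) (k : R) x L : strict_derive f x L ->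
  strict_derive (fun u => k *: f u) x (fun h => k *: L h).
Proof.
by move=> df; apply: (sd_comp df (sd_linear _ (blin_scale k (@blin_id _ V)))).
Qed.

Lemma sd_opp U V (f : U -> V) x L : strict_derive f x L ->
  strict_derive (fun u => - f u) x (fun h => - L h).
Proof.
move=> /(sd_scale (-1)) H.
have -> : (fun u => - f u) = (fun u => -1 *: f u) by apply/funext => u; rewrite scaleN1r.
by apply: sd_ext H => h; rewrite scaleN1r.
Qed.

Lemma sd_sub U V (f g : U -> V) x L K : strict_derive f x L -> strict_derive g x K ->
  strict_derive (fun u => f u - g u) x (fun h => L h - K h).
Proof. by move=> df dg; apply: sd_add => //; exact: sd_opp. Qed.

Lemma sd_pair U V W (f : U -> V) (g : U -> W) x L K :
  strict_derive f x L -> strict_derive g x K ->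
  strict_derive (fun u => (f u, g u)) x (fun h => (L h, K h)).
Proof.
move=> [bL df] [bK dg]; split; first exact: blin_pair.
move=> e e0; have [d d0 fd] := df _ e0; have [d' d'0 gd] := dg _ e0.
exists (Num.min d d'); first by rewrite lt_min d0.
move=> u w; rewrite !lt_min => /andP[ud ud'] /andP[wd wd'].
by apply: norm_pair_le; [exact: fd | exact: gd].
Qed.

Lemma sd_coord n (x : 'rV[R]_n) j :
  strict_derive (fun u : 'rV[R]_n => u 0 j : R) x (fun h => h 0 j).
Proof. exact: sd_linear (blin_coord j). Qed.

Lemma sd_row n U (f : U -> 'rV[R]_n) x (L : U -> 'rV[R]_n) :
  (forall j, strict_derive (fun u => f u 0 j : R) x (fun h => L h 0 j)) ->
  strict_derive f x L.
Proof.
move=> df; split; first by apply: blin_row => j; have [] := df j.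
move=> e e0.
have /choice[d Hd] : forall j, exists d : R, 0 < d /\
    forall u w, `|u - x| < d -> `|w - x| < d ->
      `|(f u - f w - L (u - w)) 0 j| <= e * `|u - w|.
  move=> j; have [d d0 H] := (df j).2 e e0; exists d; split=> // u w ux wx.
  by rewrite !mxE; exact: H.
exists (\big[Num.min/1]_j d j); first by apply: lt_bigmin => // j _; exact: (Hd j).1.
move=> u w ux wx; apply: norm_row_le => [|j]; first by rewrite mulr_ge0// ltW.
by apply: (Hd j).2; [apply: lt_le_trans ux _|apply: lt_le_trans wx _];
  exact: bigmin_le.
Qed.

Lemma sd_sum U V n (f : 'I_n -> U -> V) x (L : 'I_n -> U -> V) :
  (forall i, strict_derive (f i) x (L i)) ->
  strict_derive (fun u => \sum_i f i u) x (fun h => \sum_i L i h).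
Proof.
elim: n f L => [|n IH] f L df.
  rewrite (_ : (fun u => _) = fun=> 0); last by apply/funext => u; rewrite big_ord0.
  by apply: sd_ext (sd_cst _ _) => h; rewrite big_ord0.
rewrite (_ : (fun u => _) = fun u => f ord0 u + \sum_i f (lift ord0 i) u).
  apply: sd_ext (sd_add (df ord0) (IH _ _ (fun i => df (lift ord0 i)))) => h.
  by rewrite big_ord_recl.
by apply/funext => u; rewrite big_ord_recl.
Qed.

Lemma sd_mul U (f g : U -> R) x L K :
  strict_derive f x L -> strict_derive g x K ->
  strict_derive (fun u => f u * g u) x (fun h => L h * g x + f x * K h).
Proof.
move=> df dg; have [bL df'] := df; have [bK dg'] := dg.
split.
  have := blin_add (blin_scale (g x) bL) (blin_scale (f x) bK).
  congr bounded_linear; apply/funext => h; rewrite mulrC; congr (_ + _).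
move=> e e0.
pose F := 1 + `|f x|; pose G := 1 + `|g x|.
have F0 : 0 < F by rewrite ltr_wpDr.
have G0 : 0 < G by rewrite ltr_wpDr.
have [C C0 LC] := bL.2; have [D D0 KD] := bK.2.
have [A A0 [d1 d10 fA]] := sd_lipschitz df.
have [B B0 [d2 d20 gB]] := sd_lipschitz dg.
have e40 : 0 < e / 4 by rewrite divr_gt0.
have [d3 d30 fd] := df' (e / 4 / G) (divr_gt0 e40 G0).
have [d4 d40 gd] := dg' (e / 4 / F) (divr_gt0 e40 F0).
pose m := Num.min (Num.min d1 d2) (Num.min (Num.min d3 d4) (Num.min 1 (Num.min (e / 4 / (A * B)) (e / 4 / (A * B))))).
pose d := Num.min m (Num.min (A^-1) (Num.min B^-1 m)).
exists d.
  by rewrite /d /m !lt_min d10 d20 d30 d40 ltr01 !invr_gt0 A0 B0 !divr_gt0// mulr_gt0.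
move=> u w; rewrite /d /m !lt_min -!andbA.
case/and5P => u1 u2 u3 u4 /and5P[u5 u6 _ u7 /andP[u8 _]].
case/and5P => w1 w2 w3 w4 /and5P[w5 w6 _ w7 /andP[w8 _]].
have xx (r : R) : 0 < r -> `|x - x| < r by rewrite subrr normr0.
set n := `|u - w|; have n0 : 0 <= n by exact: normr_ge0.
(* Two remainders of the factors and two products of small increments; each is made at most a
   quarter of [e * n]. *)
have -> : f u * g u - f w * g w - (L (u - w) * g x + f x * K (u - w)) =
   (f u - f w - L (u - w)) * g x + f x * (g u - g w - K (u - w))
   + (f u - f w) * (g u - g x) + (f w - f x) * (g u - g w) by ring.
have H1 : `|(f u - f w - L (u - w)) * g x| <= e / 4 * n.
  rewrite normrM (le_trans (ler_wpM2r (normr_ge0 _) (fd u w u3 w3)))//.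
  rewrite mulrAC ler_wpM2r// -[leRHS](divfK (lt0r_neq0 G0)) ler_wpM2l ?divr_ge0 ?ltW//.
  by rewrite /G ltrDr.
have H2 : `|f x * (g u - g w - K (u - w))| <= e / 4 * n.
  rewrite normrM (le_trans (ler_wpM2l (normr_ge0 _) (gd u w u4 w4)))//.
  rewrite mulrA mulrC [X in _ * X <= _]mulrC [leRHS]mulrC ler_wpM2l//.
  rewrite -[leRHS](divfK (lt0r_neq0 F0)) ler_wpM2l ?divr_ge0 ?ltW//.
  by rewrite /F ltrDr.
have AB0 : 0 < A * B by rewrite mulr_gt0.
have H3 : `|(f u - f w) * (g u - g x)| <= e / 4 * n.
  rewrite normrM (le_trans (ler_pM _ _ (fA u w u1 w1) (gB u x u2 (xx _ d20))))//.
  rewrite -/n mulrACA mulrA mulrAC ler_wpM2r//.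
  by move/ltW: u6; rewrite ler_pdivlMr// mulrC.
have H4 : `|(f w - f x) * (g u - g w)| <= e / 4 * n.
  rewrite normrM (le_trans (ler_pM _ _ (fA w x w1 (xx _ d10)) (gB u w u2 w2)))//.
  rewrite -/n mulrACA mulrA ler_wpM2r//.
  by move/ltW: w6; rewrite ler_pdivlMr// mulrC.
have -> : e * n = e / 4 * n + e / 4 * n + e / 4 * n + e / 4 * n by field.
by do 3!(rewrite (le_trans (ler_normD _ _))// lerD//).
Qed.

(** Both derivatives approximate the same increment along the short vector [m *: h]; after division
    by [m] they differ by at most [e]. *)
Lemma sd_unique U V (f : U -> V) x L K :
  strict_derive f x L -> strict_derive f x K -> L =1 K.
Proof.
move=> [bL df] [bK dg] h.
apply/eqP; rewrite -subr_eq0 -normr_eq0; apply/eqP/le_anti; rewrite normr_ge0 andbT.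
apply/ler_addgt0Pr => e e0; rewrite add0r.
have n0 : 0 < 1 + `|h| by rewrite ltr_wpDr.
have e2 : 0 < e / 2 / (1 + `|h|) by rewrite !divr_gt0.
have [d d0 fd] := df _ e2; have [d' d'0 fd'] := dg _ e2.
pose m := Num.min d d' / 2 / (1 + `|h|).
have m0 : 0 < m by rewrite !divr_gt0// lt_min d0.
pose u := x + m *: h.
have ux : `|u - x| < Num.min d d'.
  have -> : u - x = m *: h by rewrite /u; linear_id.
  have mm : 0 < Num.min d d' by rewrite lt_min d0.
  rewrite normrZ gtr0_norm// /m -mulrA -[ltRHS]mulr1 -mulrA ltr_pM2l//.
  have : (1 + `|h|)^-1 * `|h| < 1 by rewrite mulrC ltr_pdivrMr//; lra.
  lra.
move: ux; rewrite lt_min => /andP[ud ud'].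
have := fd u x ud; have := fd' u x ud'; rewrite subrr normr0 => /(_ d'0) + /(_ d0).
have -> : u - x = m *: h by rewrite /u; linear_id.
rewrite (blinZ bL) (blinZ bK) normrZ gtr0_norm//.
set p := f u - f x => H1 H2.
have : `|m *: (L h - K h)| <= m * e.
  have -> : m *: (L h - K h) = (p - m *: K h) - (p - m *: L h) by linear_id.
  rewrite (le_trans (ler_normB _ _))//.
  have -> : m * e = m * (e / 2) + m * (e / 2) by field.
  have hh : e / 2 / (1 + `|h|) * (m * `|h|) <= m * (e / 2).
    by rewrite mulrCA ler_pM2l// -[leRHS](divfK (lt0r_neq0 n0)) ler_wpM2l ?(ltW e2)// lerDr.
  by apply: lerD; [exact: le_trans H1 hh | exact: le_trans H2 hh].
by rewrite normrZ gtr0_norm// ler_pM2l.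
Qed.

End StrictDerivative.

(** * Smooth maps of the plane are strictly differentiable *)

Section SmoothStrict.
Context {R : realType}.
Implicit Types (V : normedModType R).

Lemma I2_ind (P : 'I_2 -> Prop) : P 0 -> P 1 -> forall i, P i.
Proof.
move=> P0 P1 [[|[|//]] i].
  by rewrite (_ : Ordinal i = 0)//; exact/val_inj.
by rewrite (_ : Ordinal i = 1)//; exact/val_inj.
Qed.

Lemma sum_I2 (W : zmodType) (F : 'I_2 -> W) : \sum_k F k = F 0 + F 1.
Proof.
rewrite !big_ord_recl big_ord0 addr0.
by rewrite (_ : lift ord0 ord0 = 1)//; apply/val_inj.
Qed.

Lemma curve_derive_line (U V : normedModType R) (f : U -> V) (y v : U) (s0 : R) :
  derivable f (y + s0 *: v) v ->
  curve_derive (fun s : R => f (y + s *: v)) s0 ('D_v f (y + s0 *: v)).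
Proof.
move=> /derivableP df e e0.
have : h^-1 *: ((f \o shift (y + s0 *: v)) (h *: v) - f (y + s0 *: v)) @[h --> 0^']
   --> 'D_v f (y + s0 *: v).
  have dd : derivable f (y + s0 *: v) v by [].
  by move: dd; rewrite /derivable /derive => /cvgP.
move=> /cvgrPdist_le/(_ _ e0) /nbhs_ballP[d /= d0 H].
exists d => // s sd.
have [->|ns] := eqVneq s s0; first by rewrite !subrr scale0r subr0 !normr0 mulr0.
have h0 : s - s0 != 0 by rewrite subr_eq0.
have := H (s - s0); rewrite -ball_normE /= sub0r normrN => /(_ sd h0).
have -> : (s - s0) *: v + (y + s0 *: v) = y + s *: v by linear_id.
set D := 'D_v f _; set p := f _ - f _ => K.
have -> : p - (s - s0) *: D = - ((s - s0) *: (D - (s - s0)^-1 *: p)).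
  by rewrite scalerBr scalerA divff// scale1r; linear_id.
by rewrite normrN normrZ mulrC ler_wpM2r.
Qed.

Definition plane_diff V (f : 'rV[R]_2 -> V) (x h : 'rV[R]_2) : V :=
  \sum_k h 0 k *: partial k f x.

Lemma blin_plane_diff V (f : 'rV[R]_2 -> V) x : bounded_linear (plane_diff f x).
Proof.
rewrite /plane_diff; have -> : (fun h : 'rV[R]_2 => \sum_k h 0 k *: partial k f x) =
   fun h : 'rV[R]_2 => h 0 0 *: partial 0 f x + h 0 1 *: partial 1 f x.
  by apply/funext => h; rewrite sum_I2.
by apply: blin_add; apply: (@blin_comp _ _ _ _ (fun r : R => r *: _));
  [exact: blin_line | exact: blin_coord | exact: blin_line | exact: blin_coord].
Qed.

Lemma row2_decomp (u w : 'rV[R]_2) :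
  u = w + (u 0 0 - w 0 0) *: delta_mx 0 0 + (u 0 1 - w 0 1) *: delta_mx 0 1.
Proof.
apply/rowP => j; rewrite !mxE.
by elim/I2_ind: j; rewrite /= ?mulr1 ?mulr0 ?addr0; ring.
Qed.

(** Go from [w] to [u] along the two coordinate directions and apply the mean value inequality on
    each leg, where the partial derivative is within [e / 2] of its value at [x]. The norm is the
    maximum norm, so the corner [v] stays in the ball. *)
Lemma smooth_sd V (A : set 'rV[R]_2) (f : 'rV[R]_2 -> V) x :
  smooth_on A f -> nbhs x A -> strict_derive f x (plane_diff f x).
Proof.
move=> sf Ax; split; first exact: blin_plane_diff.
move=> e e0; have e20 : 0 < e / 2 by rewrite divr_gt0.
have [dA dA0 HA] := iffLR (near_norm _ _) Ax.
have [/continuous_norm/(_ _ e20)[d0 d00 H0] _] := sf [:: 0] x (nbhs_singleton Ax).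
have [/continuous_norm/(_ _ e20)[d1 d10 H1] _] := sf [:: 1] x (nbhs_singleton Ax).
pose d := Num.min dA (Num.min d0 d1).
have dpos : 0 < d by rewrite !lt_min dA0 d00.
have Hd (y : 'rV[R]_2) : `|y - x| < d -> A y /\ forall k, `|partial k f y - partial k f x| <= e / 2.
  rewrite !lt_min => /and3P[yA y0 y1]; split; first exact: HA.
  by elim/I2_ind; [exact: H0 | exact: H1].
exists d => // u w ud wd.
have inb (y : 'rV[R]_2) : (forall k, `|y 0 k - x 0 k| < d) -> A y /\ forall k, `|partial k f y - partial k f x| <= e / 2.
  move=> yd; apply: Hd.
  by rewrite [ltLHS]mx_normrE; apply: bigmax_lt => // -[i j] _ /=; rewrite ord1 !mxE.
have co (y : 'rV[R]_2) : `|y - x| < d -> forall k, `|y 0 k - x 0 k| < d.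
  by move=> yd k; have := norm_coord_le (y - x) k; rewrite !mxE => /le_lt_trans; exact.
have step (y : 'rV[R]_2) k r : 0 <= r -> (forall s, 0 <= s -> s <= r ->
    forall j, `|(y + s *: delta_mx 0 k) 0 j - x 0 j| < d) ->
    `|f (y + r *: delta_mx 0 k) - f y - r *: partial k f x| <= e / 2 * r.
  move=> r0 H.
  pose g s := f (y + s *: delta_mx 0 k) - s *: partial k f x.
  have -> : f (y + r *: delta_mx 0 k) - f y - r *: partial k f x = g r - g 0.
    have E0 : y + 0 *: delta_mx 0 k = y by rewrite scale0r addr0.
    by rewrite /g E0 scale0r subr0 addrAC.
  rewrite -[X in _ * X]subr0.
  apply: (@mean_value_norm _ _ g (fun s => partial k f (y + s *: delta_mx 0 k) - partial k f x)) => //.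
    move=> s s0 sr e' e'0.
    have [A1 _] := inb _ (H s s0 sr).
    have [d' d'0 K] := curve_derive_line ((sf [::] _ A1).2 k) e'0.
    exists d' => // s' s's; rewrite /g.
    have : `|f (y + s' *: delta_mx 0 k) - f (y + s *: delta_mx 0 k)
      - (s' - s) *: partial k f (y + s *: delta_mx 0 k)| <= e' * `|s' - s| := K s' s's.
    congr (`|_| <= _); linear_id.
  by move=> s s0 sr; have [_] := inb _ (H s s0 sr); exact.
have step2 (y : 'rV[R]_2) k r : (forall j, `|y 0 j - x 0 j| < d) ->
    (forall j, `|(y + r *: delta_mx 0 k) 0 j - x 0 j| < d) ->
    `|f (y + r *: delta_mx 0 k) - f y - r *: partial k f x| <= e / 2 * `|r|.
  have conv (z : 'rV[R]_2) c : 0 <= c -> (forall j, `|z 0 j - x 0 j| < d) ->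
    (forall j, `|(z + c *: delta_mx 0 k) 0 j - x 0 j| < d) ->
    forall s, 0 <= s -> s <= c -> forall j, `|(z + s *: delta_mx 0 k) 0 j - x 0 j| < d.
    move=> c0 zd zcd s s0 sc j; move: (zd j) (zcd j); rewrite !mxE.
    rewrite !ltr_norml => /andP[a1 a2] /andP[]; set D := (_%:R : R).
    have D0 : 0 <= D by exact: ler0n.
    by move=> a3 a4; apply/andP; split; nra.
  move=> yd yrd; have [r0|r0] := leP 0 r.
    by rewrite ger0_norm//; apply: step => //; exact: conv.
  have E : y = (y + r *: delta_mx 0 k) + (- r) *: delta_mx 0 k by linear_id.
  have : `|f y - f (y + r *: delta_mx 0 k) - - r *: partial k f x| <= e / 2 * - r.
    have := step (y + r *: delta_mx 0 k) k (- r); rewrite -E; apply; first by lra.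
    by apply: conv => //; [lra | rewrite -E].
  rewrite ltr0_norm// -normrN; congr (`|_| <= _); linear_id.
pose v := w + (u 0 0 - w 0 0) *: delta_mx 0 0.
have Eu : u = v + (u 0 1 - w 0 1) *: delta_mx 0 1 by exact: row2_decomp.
have vd j : `|v 0 j - x 0 j| < d.
  have := co u ud j; have := co w wd j; rewrite !mxE.
  elim/I2_ind: j => /=; rewrite ?mulr1 ?mulr0 ?addr0 => + H.
    by move=> _; move: H; congr (`|_| < _); ring.
  exact.
have S1 := step2 w 0 (u 0 0 - w 0 0) (co w wd) vd.
have S2 : `|f u - f v - (u 0 1 - w 0 1) *: partial 1 f x| <= e / 2 * `|u 0 1 - w 0 1|.
  have := @step2 v 1 (u 0 1 - w 0 1) vd; rewrite -Eu; apply; exact: co.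
have -> : f u - f w - plane_diff f x (u - w) =
  (f v - f w - (u 0 0 - w 0 0) *: partial 0 f x) +
  (f u - f v - (u 0 1 - w 0 1) *: partial 1 f x).
  by rewrite /plane_diff sum_I2 !mxE; linear_id.
rewrite (le_trans (ler_normD _ _))//.
have -> : e * `|u - w| = e / 2 * `|u - w| + e / 2 * `|u - w| by field.
apply: lerD.
  rewrite (le_trans S1)// ler_wpM2l ?(ltW e20)//.
  by have := norm_coord_le (u - w) 0; rewrite !mxE.
rewrite (le_trans S2)// ler_wpM2l ?(ltW e20)//.
by have := norm_coord_le (u - w) 1; rewrite !mxE.
Qed.

Lemma sd_differentiable n m (f : 'rV[R]_n -> 'rV[R]_m) x L : strict_derive f x L ->
  forall h, h *m jacobian f x = L h.
Proof.
move=> [bL df] h.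
have cL : continuous L by move=> y; apply: sd_cont (sd_linear y bL).
have [Ll HL] : exists Ll : {linear 'rV[R]_n -> 'rV[R]_m}, Ll = L :> (_ -> _).
  have lL : linear L := bL.1.
  pose l := HB.pack L (@GRing.isLinear.Build _ _ _ _ _ lL) : {linear 'rV[R]_n -> 'rV[R]_m}.
  by exists l.
rewrite /jacobian; have -> : 'd f x = Ll :> (_ -> _).
  apply: diff_unique; first by rewrite HL.
  apply/eqaddoP => e e0; have [d d0 fd] := df e e0.
  apply/nbhs_ballP; exists d => // u; rewrite -ball_normE /= sub0r normrN => ud.
  rewrite [X in `|X| <= _](_ : _ = f (u + x) - f x - L (u + x - x)).
    rewrite (le_trans (fd _ _ _ _))// ?addrK// subrr normr0//.
  by rewrite !fctE /= HL addrK opprD addrA.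
by rewrite mul_rV_lin1 HL.
Qed.

End SmoothStrict.

(** * Smooth dependence of solutions on parameters *)

Section OdeDependence.
Context {R : realType}.
Implicit Types (U V W : normedModType R).

Lemma curve_derive_sub V (f g : R -> V) t u v : curve_derive f t u ->
  curve_derive g t v -> curve_derive (fun s => f s - g s) t (u - v).
Proof.
move=> df dg e e0; have e20 : 0 < e / 2 by rewrite divr_gt0.
have [d d0 fd] := df _ e20; have [d' d'0 gd] := dg _ e20.
exists (Num.min d d'); first by rewrite lt_min d0.
move=> s; rewrite lt_min => /andP[sd sd'].
have -> : f s - g s - (f t - g t) - (s - t) *: (u - v) =
  (f s - f t - (s - t) *: u) - (g s - g t - (s - t) *: v) by linear_id.
rewrite (le_trans (ler_normB _ _))// [leRHS](_ : _ = e / 2 * `|s - t| + e / 2 * `|s - t|).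
  by rewrite lerD ?fd ?gd.
by field.
Qed.

Lemma curve_derive_blin V W (f : R -> V) t v (L : V -> W) : bounded_linear L ->
  curve_derive f t v -> curve_derive (L \o f) t (L v).
Proof.
move=> bL df e e0; have [C C0 LC] := bL.2.
have [d d0 fd] := df (e / C) (divr_gt0 e0 C0); exists d => // s sd /=.
rewrite -(blinB bL) -(blinZ bL) -(blinB bL) (le_trans (LC _))//.
rewrite (le_trans (ler_wpM2l (ltW C0) (fd _ sd)))// mulrA [C * _]mulrC divfK// gt_eqF//.
Qed.

Lemma curve_derive_comp V W (g : V -> W) L (f : R -> V) t v :
  strict_derive g (f t) L -> curve_derive f t v -> curve_derive (fun s => g (f s)) t (L v).
Proof.
move=> [bL dg] df e e0; have [C C0 LC] := bL.2.
have M0 : 0 < 1 + `|v| by rewrite ltr_wpDr.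
have [d1 d10 gd] := dg (e / 2 / (1 + `|v|)) (divr_gt0 (divr_gt0 e0 (ltr0n _ 2)) M0).
have m0 : 0 < Num.min 1 (e / 2 / C) by rewrite lt_min ltr01 !divr_gt0.
have [d2 d20 fd] := df _ m0.
have [d3 d30 H] := iffLR (continuous_norm _ _) (curve_derive_cont df) (d1 / 2) (divr_gt0 d10 (ltr0n _ 2)).
exists (Num.min d2 d3); first by rewrite lt_min d20.
move=> s; rewrite lt_min => /andP[s2 s3].
have F := fd s s2; have F1 : `|f s - f t - (s - t) *: v| <= `|s - t|.
  by rewrite (le_trans F)// ler_piMl// ge_min lexx.
have F2 : `|f s - f t - (s - t) *: v| <= e / 2 / C * `|s - t|.
  by rewrite (le_trans F)// ler_wpM2r// ge_min lexx orbT.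
have fst : `|f s - f t| <= (1 + `|v|) * `|s - t|.
  rewrite -[X in `|X| <= _](subrK ((s - t) *: v)) (le_trans (ler_normD _ _))//.
  by rewrite normrZ mulrDl mul1r lerD// mulrC.
have -> : g (f s) - g (f t) - (s - t) *: L v =
   (g (f s) - g (f t) - L (f s - f t)) + L (f s - f t - (s - t) *: v).
  by rewrite (blinB bL _ (_ *: _)) (blinZ bL); linear_id.
rewrite (le_trans (ler_normD _ _))// [leRHS](_ : _ = e / 2 * `|s - t| + e / 2 * `|s - t|); last by field.
apply: lerD.
  rewrite (le_trans (gd _ _ _ _))// ?subrr ?normr0//; first by rewrite (le_lt_trans (H s s3))//; lra.
  by rewrite -mulrA ler_wpM2l ?divr_ge0 ?(ltW e0)// mulrC ler_pdivrMr// mulrC.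
rewrite (le_trans (LC _))// (le_trans (ler_wpM2l (ltW C0) F2))// mulrA.
by rewrite [C * _]mulrC divfK// gt_eqF.
Qed.

Lemma curve_derive_unique V (f : R -> V) t u v : curve_derive f t u ->
  curve_derive f t v -> u = v.
Proof. by move=> /curve_deriveP[_ <-] /curve_deriveP[_ <-]. Qed.

Lemma curve_derive_pair V W (f : R -> V) (g : R -> W) t u v : curve_derive f t u ->
  curve_derive g t v -> curve_derive (fun s => (f s, g s)) t (u, v).
Proof.
move=> df dg e e0; have [d d0 fd] := df _ e0; have [d' d'0 gd] := dg _ e0.
exists (Num.min d d'); first by rewrite lt_min d0.
move=> s; rewrite lt_min => /andP[sd sd'].
by apply: norm_pair_le; [exact: fd | exact: gd].
Qed.

Lemma curve_derive_scale V (f : R -> V) t v k : curve_derive f t v ->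
  curve_derive (fun s => k *: f s) t (k *: v).
Proof. exact: (curve_derive_blin (blin_scale k (@blin_id _ V))). Qed.

Lemma curve_derive_linear V (v : V) a t : curve_derive (fun s : R => (s - a) *: v) t v.
Proof.
move=> e e0; exists 1 => // s _.
have -> : (s - a) *: v - (t - a) *: v - (s - t) *: v = 0 by linear_id.
by rewrite normr0 mulr_ge0// ltW.
Qed.

Lemma mean_value_ball V (f f' : R -> V) (t d C : R) :
  (forall r, `|r - t| < d -> curve_derive f r (f' r)) ->
  (forall r, `|r - t| < d -> `|f' r| <= C) ->
  forall s s', `|s - t| < d -> `|s' - t| < d -> `|f s' - f s| <= C * `|s' - s|.
Proof.
move=> df bf s s'.
wlog ss' : s s' / s <= s'.
  move=> H st s't; have [ss'|/ltW ss'] := leP s s'; first exact: H.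
  by rewrite distrC [`|s' - s|]distrC; exact: H.
move=> st s't; rewrite (@ger0_norm _ (s' - s)) ?subr_ge0//.
have inb r : s <= r -> r <= s' -> `|r - t| < d.
  by move: st s't; rewrite !ltr_norml => /andP[? ?] /andP[? ?] ? ?; apply/andP; split; lra.
by apply: (@mean_value_norm _ _ f f') => // r sr rs; [exact: df (inb _ sr rs) | exact: bf (inb _ sr rs)].
Qed.

(** A short window replaces the exponential factor: at the point [c] where the norm is largest, [|f
    c - f s| <= (K |f c| + e) 2 d <= |f c| / 2 + 2 d e], and the first term is absorbed on the
    left. *)
Lemma gronwall_short V (f f' : R -> V) (t d K e : R) : 0 <= K -> 0 <= e -> K * (4 * d) <= 1 ->
  (forall r, `|r - t| < d -> curve_derive f r (f' r)) ->
  (forall r, `|r - t| < d -> `|f' r| <= K * `|f r| + e) ->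
  forall s s', `|s - t| < d -> `|s' - t| < d -> `|f s'| <= 2 * `|f s| + 4 * d * e.
Proof.
move=> K0 e0 Kd df bf s s' st s't.
pose a := Num.min s s'; pose b := Num.max s s'.
have ab : a <= b by rewrite /a /b ge_min !le_max lexx.
have inb r : a <= r -> r <= b -> `|r - t| < d.
  move: st s't; rewrite /a /b ge_min le_max !ltr_norml => /andP[? ?] /andP[? ?].
  by move=> /orP[] ? /orP[] ?; apply/andP; split; lra.
have [|c /andP[ac cb] cmax] := @EVT_max R (fun r => `|f r|) a b ab.
  apply: continuous_in_subspaceT => r /set_mem/andP[ar rb].
  apply: (@continuous_comp _ _ _ f (fun v : V => `|v|)); last exact: norm_continuous.
  exact: curve_derive_cont (df _ (inb r ar rb)).
rewrite /= !bnd_simp in ac cb.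
have cm r : a <= r -> r <= b -> `|f r| <= `|f c|.
  by move=> ar rb; apply: cmax; rewrite in_itv /= ar.
have sab : a <= s /\ s <= b by rewrite /a /b ge_min le_max !lexx.
have s'ab : a <= s' /\ s' <= b by rewrite /a /b ge_min le_max !lexx !orbT.
have H : `|f c - f s| <= (K * `|f c| + e) * (2 * d).
  have B r : a <= r -> r <= b -> `|f' r| <= K * `|f c| + e.
    by move=> ar rb; rewrite (le_trans (bf _ (inb _ ar rb)))// lerD2r ler_wpM2l// cm.
  have M0 : 0 <= K * `|f c| + e by rewrite addr_ge0// mulr_ge0.
  have cst : `|c - s| <= 2 * d.
    have := inb _ ac cb; move: st; rewrite !ltr_norml ler_norml.
    by move=> /andP[? ?] /andP[? ?]; apply/andP; split; lra.
  rewrite (@le_trans _ _ ((K * `|f c| + e) * `|c - s|))//; last by rewrite ler_wpM2l.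
  have [sc|/ltW cs] := leP s c.
    rewrite (@ger0_norm _ (c - s)) ?subr_ge0//.
    by apply: (mean_value_norm (f' := f')) => // r sr rc; [apply: df; apply: inb|apply: B]; lra.
  rewrite distrC (distrC c) (@ger0_norm _ (s - c)) ?subr_ge0//.
  by apply: (mean_value_norm (f' := f')) => // r sr rc; [apply: df; apply: inb|apply: B]; lra.
have T : `|f c| <= `|f s| + `|f c - f s|.
  by rewrite -[X in `|X| <= _](subrK (f s)) addrC ler_normD.
have := cm s' s'ab.1 s'ab.2; have := normr_ge0 (f c).
have : K * `|f c| * (4 * d) <= `|f c| by rewrite mulrAC ler_piMl.
lra.
Qed.

Lemma norm_limit_le V (u : nat -> V) (l : V) (C : R) :
  (forall e, 0 < e -> exists N, forall n, (N <= n)%N -> `|u n - l| <= e) ->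
  (exists N, forall n, (N <= n)%N -> `|u n| <= C) -> `|l| <= C.
Proof.
move=> ul [N uC]; apply/ler_addgt0Pr => e e0; have [N' H] := ul e e0.
have := H (maxn N N') (leq_maxr _ _); have := uC (maxn N N') (leq_maxl _ _).
set v := u _ => vC vl.
have -> : l = v - (v - l) by linear_id.
by rewrite (le_trans (ler_normB _ _))// lerD.
Qed.

(** Stated through sequences so that it passes from rows to phase space, the product of two of
    them. *)
Definition norm_complete V := forall u : nat -> V,
  (forall e, 0 < e -> exists N, forall m n, (N <= m)%N -> (N <= n)%N -> `|u m - u n| <= e) ->
  exists l, forall e, 0 < e -> exists N, forall n, (N <= n)%N -> `|u n - l| <= e.

Lemma norm_complete_row k : norm_complete 'rV[R]_k.
Proof.
move=> u uC.
have /cauchy_cvg/cvg_ex[l ul] : cauchy (u n @[n --> \oo]).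
  apply/cauchyP => e e0; have [N H] := uC _ (divr_gt0 e0 (ltr0n _ 2)).
  exists (u N); exists N => // n /= Nn; rewrite -ball_normE /=.
  by rewrite (le_lt_trans (H _ _ (leqnn _) Nn))//; lra.
exists l => e e0; have /cvgrPdistC_le/(_ e e0)[N _ H] := ul.
by exists N.
Qed.

Lemma norm_complete_pair V W : norm_complete V -> norm_complete W -> norm_complete (V * W)%type.
Proof.
move=> cV cW u uC.
have [l lP] : exists l, forall e, 0 < e -> exists N, forall n, (N <= n)%N -> `|(u n).1 - l| <= e.
  apply: (cV (fun n => (u n).1)) => e /uC[N H]; exists N => m n Nm Nn.
  exact: le_trans (norm_fst (u m - u n)) (H m n Nm Nn).
have [k kP] : exists l, forall e, 0 < e -> exists N, forall n, (N <= n)%N -> `|(u n).2 - l| <= e.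
  apply: (cW (fun n => (u n).2)) => e /uC[N H]; exists N => m n Nm Nn.
  exact: le_trans (norm_snd (u m - u n)) (H m n Nm Nn).
exists (l, k) => e e0; have [N1 H1] := lP e e0; have [N2 H2] := kP e e0.
exists (maxn N1 N2) => n; rewrite geq_max => /andP[n1 n2].
by apply: norm_pair_le; [exact: H1 | exact: H2].
Qed.

Lemma exists_small_inv (e : R) : 0 < e ->
  exists N, forall n, (N <= n)%N -> n.+1%:R^-1 < e.
Proof. by move=> e0; have [N _ H] := near_infty_natSinv_lt (PosNum e0); exists N. Qed.

Section Dependence.
(** [z l] is a given family of integral curves of [X] near time [t], [A s] the derivative of [X]
    along the central curve [z l0], and [s0] a time at which the dependence on [l] is already known
    to have the strict derivative [Y0]. *)
Context {Lam V : normedModType R} (X : V -> V) (z : Lam -> R -> V) (A : R -> V -> V).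
Context (l0 : Lam) (t d K s0 : R) (Y0 : Lam -> V).
Hypothesis d0 : 0 < d.
Hypothesis K0 : 0 <= K.
Hypothesis Kd : K * (4 * d) <= 1.
Hypothesis s0t : `|s0 - t| < d.
Hypothesis cV : norm_complete V.
Hypothesis zX : exists2 r : R, 0 < r & forall l, `|l - l0| < r ->
  forall s, `|s - t| < d -> curve_derive (z l) s (X (z l s)).
Hypothesis blinA : forall s, `|s - t| < d -> bounded_linear (A s).
Hypothesis boundA : forall s h, `|s - t| < d -> `|A s h| <= K * `|h|.
Hypothesis contA : forall s e, `|s - t| < d -> 0 < e -> exists2 r : R, 0 < r &
  forall s', `|s' - s| < r -> forall h, `|A s' h - A s h| <= e * `|h|.
Hypothesis lipz : exists2 r : R, 0 < r & forall l m, `|l - l0| < r -> `|m - l0| < r ->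
  forall s, `|s - t| < d -> `|z l s - z m s| <= 2 * `|z l s0 - z m s0|.
Hypothesis strictX : forall e, 0 < e -> exists2 r : R, 0 < r &
  forall s u w, `|s - t| < d -> `|u - z l0 s| < r -> `|w - z l0 s| < r ->
    `|X u - X w - A s (u - w)| <= e * `|u - w|.
Hypothesis zY0 : strict_derive (z^~ s0) l0 Y0.

Let linear_gronwall (f : R -> V) :
  (forall s, `|s - t| < d -> curve_derive f s (A s (f s))) ->
  forall s, `|s - t| < d -> `|f s| <= 2 * `|f s0|.
Proof.
move=> df s st.
have := @gronwall_short V f (fun s => A s (f s)) t d K 0 K0 (lexx _) Kd df _ s0 s s0t st.
by rewrite mulr0 addr0; apply => r rt; rewrite addr0; exact: boundA.
Qed.

(* z l and z m stay close on the window, so X may be linearized along z l0. *)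
Let strict_along : forall e, 0 < e -> exists2 r : R, 0 < r &
  forall l m, `|l - l0| < r -> `|m - l0| < r -> forall s, `|s - t| < d ->
    [/\ curve_derive (z l) s (X (z l s)), curve_derive (z m) s (X (z m s)),
        `|z l s - z m s| <= 2 * `|z l s0 - z m s0| &
        `|X (z l s) - X (z m s) - A s (z l s - z m s)| <= e * `|z l s - z m s|].
Proof.
move=> e e0; have [r1 r10 H1] := zX; have [r2 r20 H2] := lipz.
have [r3 r30 H3] := strictX e0; have [C C0 [r4 r40 H4]] := sd_lipschitz zY0.
pose r := Num.min (Num.min r1 r2) (Num.min r4 (r3 / (2 * C))).
have C20 : 0 < 2 * C by rewrite mulr_gt0.
exists r; first by rewrite !lt_min r10 r20 r40 divr_gt0.
have l00 : forall q : R, 0 < q -> `|l0 - l0| < q by move=> q q0; rewrite subrr normr0.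
have close l : `|l - l0| < r -> forall s, `|s - t| < d -> `|z l s - z l0 s| < r3.
  rewrite !lt_min -!andbA => /and4P[l1 l2 l4 l3] s st.
  rewrite (le_lt_trans (H2 _ _ l2 (l00 _ r20) s st))//.
  have := H4 _ _ l4 (l00 _ r40); move: l3; rewrite ltr_pdivlMr//; lra.
move=> l m lr mr s st; have := close l lr s st; have := close m mr s st.
move: lr mr; rewrite !lt_min -!andbA => /and4P[l1 l2 l4 l3] /and4P[m1 m2 m4 m3] cm cl.
by split; [exact: H1|exact: H1|exact: H2|exact: H3].
Qed.

(* The solution of the linearized equation is the limit of difference quotients
   of the given family of solutions; no existence theorem for ODEs is used. *)
Let linearized w : exists y : R -> V, y s0 = Y0 w /\
  forall s, `|s - t| < d -> curve_derive y s (A s (y s)).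
Proof.
pose h n : R := n.+1%:R^-1.
have h0 n : 0 < h n by rewrite invr_gt0 ltr0Sn.
pose m n := l0 + h n *: w.
pose D n s := (h n)^-1 *: (z (m n) s - z l0 s).
have mE n : m n - l0 = h n *: w by rewrite /m; linear_id.
have near_m r : 0 < r -> exists N, forall n, (N <= n)%N -> `|m n - l0| < r.
  move=> r0; have w0 : 0 < 1 + `|w| by rewrite ltr_wpDr.
  have [N H] := exists_small_inv (divr_gt0 r0 w0); exists N => n Nn.
  rewrite mE normrZ gtr0_norm//; have := H n Nn; rewrite ltr_pdivlMr//.
  by rewrite -/(h n); have := h0 n; have := normr_ge0 w; nra.
have l00 : forall q : R, 0 < q -> `|l0 - l0| < q by move=> q q0; rewrite subrr normr0.
have Ds0 e : 0 < e -> exists N, forall n, (N <= n)%N -> `|D n s0 - Y0 w| <= e.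
  move=> e0; have w0 : 0 < 1 + `|w| by rewrite ltr_wpDr.
  have [r r0 H] := zY0.2 _ (divr_gt0 e0 w0); have [N HN] := near_m r r0.
  exists N => n Nn; have := H (m n) l0 (HN n Nn) (l00 _ r0).
  rewrite mE (blinZ zY0.1) normrZ gtr0_norm// => H1.
  have -> : D n s0 - Y0 w = (h n)^-1 *: (z (m n) s0 - z l0 s0 - h n *: Y0 w).
    have hh : (h n)^-1 * h n = 1 by rewrite mulVf// gt_eqF.
    by rewrite -[Y0 w in LHS]scale1r -hh -scalerA /D -scalerBr.
  rewrite normrZ gtr0_norm ?invr_gt0// mulrC ler_pdivrMr//.
  rewrite (le_trans H1)// mulrCA [leRHS]mulrC ler_pM2l// mulrAC ler_pdivrMr//.
  by rewrite ler_pM2l// lerDr.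
(* A common bound for the difference quotients on the window: at [s0] they are within 1 of [Y0 w],
   and elsewhere they are at most twice as large. *)
pose B := 2 * (`|Y0 w| + 1).
have B0 : 0 < B by rewrite mulr_gt0// ltr_wpDl.
have [N0 HN0] : exists N, forall n, (N <= n)%N -> forall s, `|s - t| < d -> `|D n s| <= B.
  have [r r0 H] := strict_along ltr01; have [N1 HN1] := near_m r r0.
  have [N2 HN2] := Ds0 1 ltr01; exists (maxn N1 N2) => n; rewrite geq_max => /andP[n1 n2] s st.
  have [_ _ H1 _] := H _ _ (HN1 n n1) (l00 _ r0) s st.
  have : `|D n s| <= 2 * `|D n s0|.
    by rewrite /D !normrZ mulrCA ler_pM2l// gtr0_norm invr_gt0.
  have := HN2 n n2; have : `|D n s0| <= `|D n s0 - Y0 w| + `|Y0 w|.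
    by rewrite -[X in `|X| <= _](subrK (Y0 w)) ler_normD.
  rewrite /B; lra.
pose D' n s := (h n)^-1 *: (X (z (m n) s) - X (z l0 s)).
have err e : 0 < e -> exists N, forall n, (N <= n)%N -> forall s, `|s - t| < d ->
    curve_derive (D n) s (D' n s) /\ `|D' n s - A s (D n s)| <= e.
  move=> e0; have [r r0 H] := strict_along (divr_gt0 e0 B0); have [N1 HN1] := near_m r r0.
  exists (maxn N1 N0) => n; rewrite geq_max => /andP[n1 n0] s st.
  have [c1 c2 _ H1] := H _ _ (HN1 n n1) (l00 _ r0) s st; split.
    by apply: curve_derive_scale; exact: curve_derive_sub.
  rewrite /D' /D (blinZ (blinA st)) -scalerBr normrZ.
  rewrite (le_trans (ler_wpM2l _ H1))// mulrCA -normrZ.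
  by rewrite mulrAC ler_pdivrMr// ler_pM2l//; exact: HN0.
have /choice[y Hy] : forall s, exists l, `|s - t| < d ->
    forall e, 0 < e -> exists N, forall n, (N <= n)%N -> `|D n s - l| <= e.
  move=> s; have [st|] := boolP (`|s - t| < d); last by exists 0.
  have [|l Hl] := cV (u := D ^~ s); last by exists l.
  (* Two difference quotients solve the linearized equation up to a small error, so [gronwall_short]
     makes the sequence Cauchy; [e / 8] leaves room for its constants. *)
  move=> e e0; pose e1 := e / 8; have e10 : 0 < e1 by rewrite divr_gt0.
  pose e2 := e1 / d; have e20 : 0 < e2 by rewrite divr_gt0.
  have [N1 H1] := err (e2 / 4) (divr_gt0 e20 (ltr0n _ 4)); have [N2 H2] := Ds0 e1 e10.
  exists (maxn N1 N2) => p q; rewrite !geq_max => /andP[p1 p2] /andP[q1 q2].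
  have := @gronwall_short V (fun s => D p s - D q s) (fun s => D' p s - D' q s)
    t d K (e2 / 2) K0 (divr_ge0 (ltW e20) (ler0n _ 2)) Kd _ _ s0 s s0t st.
  have -> : 4 * d * (e2 / 2) = 2 * e1 by rewrite /e2; field; rewrite gt_eqF.
  have : `|D p s0 - D q s0| <= 2 * e1.
    have -> : D p s0 - D q s0 = (D p s0 - Y0 w) - (D q s0 - Y0 w) by linear_id.
    by rewrite (le_trans (ler_normB _ _))//; have := H2 p p2; have := H2 q q2; lra.
  move=> T G; apply: (le_trans (G _ _)).
  - by move=> r rt; apply: curve_derive_sub; [exact: (H1 p p1 r rt).1 | exact: (H1 q q1 r rt).1].
  - move=> r rt; have [_ E1] := H1 p p1 r rt; have [_ E2] := H1 q q1 r rt.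
    have -> : D' p r - D' q r = A r (D p r - D q r) + ((D' p r - A r (D p r)) - (D' q r - A r (D q r))).
      by rewrite (blinB (blinA rt)); linear_id.
    rewrite (le_trans (ler_normD _ _))// lerD ?boundA//.
    by rewrite (le_trans (ler_normB _ _))//; lra.
  - by rewrite /e1 in T *; lra.
exists y; split.
  apply/eqP; rewrite -subr_eq0 -normr_le0; apply/ler_addgt0Pr => e e0; rewrite add0r.
  have e20 : 0 < e / 2 by rewrite divr_gt0.
  have [N1 H1] := Hy s0 s0t _ e20; have [N2 H2] := Ds0 _ e20.
  have := H1 _ (leq_maxl N1 N2); have := H2 _ (leq_maxr N1 N2); set v := D _ s0 => E1 E2.
  have -> : y s0 - Y0 w = (v - Y0 w) - (v - y s0) by linear_id.
  by rewrite (le_trans (ler_normB _ _))//; lra.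
move=> s st e e0.
pose C := (K + 1) * B; have C0 : 0 < C by rewrite mulr_gt0// ltr_wpDl.
pose e1 := e / 3; have e10 : 0 < e1 by rewrite divr_gt0.
have [r1 r10 H1] := contA st (divr_gt0 e10 B0).
have K10 : 0 < K + 1 by rewrite ltr_wpDl.
pose r2 := e1 / (C * (K + 1)); have r20 : 0 < r2 by rewrite !divr_gt0// mulr_gt0.
pose r3 := d - `|s - t|; have r30 : 0 < r3 by rewrite subr_gt0.
pose r := Num.min r1 (Num.min r2 r3); have r0 : 0 < r by rewrite !lt_min r10 r20.
have inw q : `|q - s| < r -> `|q - t| < d.
  rewrite !lt_min => /and3P[_ _ q3].
  have -> : q - t = (q - s) + (s - t) by ring.
  by rewrite (le_lt_trans (ler_normD _ _))//; move: q3; rewrite /r3; lra.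
have m0 : 0 < Num.min e1 B by rewrite lt_min e10.
have [N1 HN1] := err _ m0.
exists r => // s' s's; have s't := inw _ s's.
apply: (@norm_limit_le _ (fun n => D n s' - D n s - (s' - s) *: A s (D n s))).
  move=> e' e'0; pose q := e' / (2 + `|s' - s| * K).
  have P0 : 0 < 2 + `|s' - s| * K by rewrite ltr_wpDr// mulr_ge0.
  have q0 : 0 < q by rewrite divr_gt0.
  have [M1 HM1] := Hy s' s't _ q0; have [M2 HM2] := Hy s st _ q0.
  exists (maxn M1 M2) => n; rewrite geq_max => /andP[n1 n2].
  set a := D n s'; set b := D n s.
  have -> : a - b - (s' - s) *: A s b - (y s' - y s - (s' - s) *: A s (y s)) =
     (a - y s') - (b - y s) - (s' - s) *: A s (b - y s).
    by rewrite (blinB (blinA st)); linear_id.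
  have E1 := HM1 n n1; have E2 := HM2 n n2.
  have E3 : `|(s' - s) *: A s (b - y s)| <= `|s' - s| * K * q.
    by rewrite normrZ -mulrA ler_wpM2l// (le_trans (boundA _ st))// ler_wpM2l.
  rewrite (le_trans (ler_normB _ _))//.
  have := ler_normB (a - y s') (b - y s).
  have -> : e' = (2 + `|s' - s| * K) * q by rewrite mulrC divfK// gt_eqF.
  lra.
exists (maxn N1 N0) => n; rewrite geq_max => /andP[n1 n0].
have Dlip q : `|q - s| < r -> `|D n q - D n s| <= C * `|q - s|.
  move=> qs; apply: (@mean_value_ball _ (D n) (D' n) t d C) => //; last exact: inw.
    by move=> p pt; exact: (HN1 n n1 p pt).1.
  move=> p pt; have [_ E] := HN1 n n1 p pt.
  have -> : D' n p = A p (D n p) + (D' n p - A p (D n p)) by linear_id.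
  rewrite (le_trans (ler_normD _ _))// /C mulrDl mul1r lerD//.
    by rewrite (le_trans (boundA _ pt))// ler_wpM2l// HN0.
  by rewrite (le_trans E)// ge_min lexx orbT.
(* Subtracting the tangent line reduces the little-o estimate to a bound [e] for the derivative of
   [g], which splits into three errors of size [e1]. *)
pose g q := D n q - (q - s) *: A s (D n s).
have -> : D n s' - D n s - (s' - s) *: A s (D n s) = g s' - g s.
  by rewrite /g subrr scale0r subr0; linear_id.
apply: (@mean_value_ball _ g (fun q => D' n q - A s (D n s)) s r) => //; last by rewrite subrr normr0.
  move=> q qs; apply: curve_derive_sub; last exact: curve_derive_linear.
  exact: (HN1 n n1 q (inw _ qs)).1.
move=> q qs; have qt := inw _ qs; have [_ E] := HN1 n n1 q qt.
have -> : D' n q - A s (D n s) = (D' n q - A q (D n q)) + (A q (D n q) - A s (D n q)) + A s (D n q - D n s).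
  by rewrite (blinB (blinA st)); linear_id.
have E1 : `|D' n q - A q (D n q)| <= e1 by rewrite (le_trans E)// ge_min lexx.
move: (qs); rewrite !lt_min => /and3P[q1 q2 _].
have E2 : `|A q (D n q) - A s (D n q)| <= e1.
  by rewrite (le_trans (H1 _ q1 _))// mulrAC ler_pdivrMr// ler_pM2l// HN0.
have E3 : `|A s (D n q - D n s)| <= e1.
  rewrite (le_trans (boundA _ st))// (@le_trans _ _ (K * (C * `|q - s|)))//.
    by rewrite ler_wpM2l// Dlip.
  move: q2; rewrite /r2 ltr_pdivlMr ?mulr_gt0// => q2.
  rewrite (le_trans _ (ltW q2))// mulrC -mulrA mulrCA ler_wpM2l// ler_wpM2l ?(ltW C0)//.
  by rewrite lerDl.
rewrite (le_trans (ler_normD _ _))//.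
have := ler_normD (D' n q - A q (D n q)) (A q (D n q) - A s (D n q)).
by rewrite (_ : e = e1 + e1 + e1); [lra | rewrite /e1; field].
Qed.

(** The remainder [z l - z m - Y (l - m)] solves the linearized equation up to an error [o(l - m)]
    coming from the strict differentiability of [X], so its smallness at [s0] spreads over the
    window by [gronwall_short]. Linearity of [Y s] is uniqueness for the linearized equation. *)
Lemma ode_dependence : exists Y : R -> Lam -> V, forall s, `|s - t| < d ->
  strict_derive (z^~ s) l0 (Y s) /\ forall w, curve_derive (Y^~ w) s (A s (Y s w)).
Proof.
have /choice[y Hy] := linearized.
pose Y s w := y w s.
have dY s w : `|s - t| < d -> curve_derive (Y^~ w) s (A s (Y s w)) by exact: (Hy w).2.
have [C C0 HC] := zY0.1.2.
have bY s : `|s - t| < d -> bounded_linear (Y s).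
  move=> st; split=> [a u v|].
    apply/eqP; rewrite -subr_eq0 -normr_le0.
    pose f s := Y s (a *: u + v) - (a *: Y s u + Y s v).
    have <- : 2 * `|f s0| = 0.
      rewrite /f /Y !(Hy _).1 zY0.1.1 subrr normr0 mulr0 //.
    apply: (linear_gronwall (f := f)) => // r rt.
    have -> : A r (f r) = A r (Y r (a *: u + v)) - (a *: A r (Y r u) + A r (Y r v)).
      by rewrite /f (blinB (blinA rt)) (blinD (blinA rt)) (blinZ (blinA rt)).
    apply: curve_derive_sub; first exact: dY.
    have -> : a *: A r (Y r u) + A r (Y r v) = a *: A r (Y r u) - (-1) *: A r (Y r v) by linear_id.
    have -> : (fun s1 => a *: Y s1 u + Y s1 v) = fun s1 => a *: Y s1 u - (-1) *: Y s1 v.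
      by apply/funext => q; linear_id.
    by apply: curve_derive_sub; apply: curve_derive_scale; exact: dY.
  exists (2 * C) => [|u]; first by rewrite mulr_gt0.
  rewrite (le_trans (linear_gronwall (f := Y^~ u) _ st))// => [r rt|]; first exact: dY.
  by rewrite /Y (Hy u).1 -mulrA ler_wpM2l.
exists Y => s st; split; last by move=> w; exact: dY.
split; first exact: bY.
move=> e e0.
have [L L0 [r1 r10 H1]] := sd_lipschitz zY0.
pose e1 := e / 4; have e10 : 0 < e1 by rewrite divr_gt0.
pose e2 := e1 / (4 * d * L); have dL0 : 0 < 4 * d * L by rewrite !mulr_gt0.
have e20 : 0 < e2 by rewrite divr_gt0.
have [r2 r20 H2] := strict_along e20; have [r3 r30 H3] := zY0.2 e1 e10.
exists (Num.min r1 (Num.min r2 r3)); first by rewrite !lt_min r10 r20.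
move=> l m; rewrite !lt_min => /and3P[l1 l2 l3] /and3P[m1 m2 m3].
pose f s := z l s - z m s - Y s (l - m).
pose f' s := X (z l s) - X (z m s) - A s (Y s (l - m)).
have ee0 : 0 <= e2 * (2 * (L * `|l - m|)) by rewrite mulr_ge0 ?(ltW e20)// mulr_ge0// mulr_ge0// ltW.
have := @gronwall_short V f f' t d K (e2 * (2 * (L * `|l - m|))) K0 ee0 Kd _ _ s0 s s0t st.
have E0 : `|f s0| <= e1 * `|l - m|.
  by rewrite /f /Y (Hy _).1; exact: H3.
move=> G; apply: (le_trans (G _ _)).
- move=> r rt; have [c1 c2 _ _] := H2 l m l2 m2 r rt.
  by apply: curve_derive_sub (dY _ _ rt); exact: curve_derive_sub.
- move=> r rt; have [_ _ E1 E2] := H2 l m l2 m2 r rt.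
  have -> : f' r = A r (f r) + (X (z l r) - X (z m r) - A r (z l r - z m r)).
    by rewrite /f' /f (blinB (blinA rt)); linear_id.
  rewrite (le_trans (ler_normD _ _))// lerD ?boundA// (le_trans E2)// ler_wpM2l ?(ltW e20)//.
  by rewrite (le_trans E1)// ler_wpM2l// H1.
- have -> : 4 * d * (e2 * (2 * (L * `|l - m|))) = 2 * e1 * `|l - m|.
    by rewrite /e2; field; rewrite !gt_eqF.
  by rewrite [leRHS](_ : _ = 4 * e1 * `|l - m|); [nra | rewrite /e1; field].
Qed.

End Dependence.
End OdeDependence.

(** * Smooth functions and curves *)

Section SmoothFunctions.
Context {R : realType} (A : set 'rV[R]_2).
Hypothesis oA : open A.
Implicit Types (V : normedModType R).

Let nA x : A x -> nbhs x A.
Proof. by move=> Ax; apply: open_nbhs_nbhs. Qed.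

(** Finite order makes closure under products and inverses provable by induction: differentiation
    costs one order, and the undifferentiated factors are weakened by [smooth_upto_pred]. *)
Fixpoint smooth_upto V (n : nat) (f : 'rV[R]_2 -> V) : Prop :=
  (forall x, A x -> {for x, continuous f} /\ forall k : 'I_2, derivable f x (delta_mx 0 k)) /\
  match n with O => True | S m => forall k, smooth_upto m (partial k f) end.

(** [iter_partial] applies the last letter of the word first, hence the recursion through
    [rcons]. *)
Lemma smooth_onP V (f : 'rV[R]_2 -> V) : smooth_on A f <-> forall n, smooth_upto n f.
Proof.
split=> [sf n|sf s].
  elim: n f sf => [|n IH] f sf /=; split=> //; try by move=> x Ax; exact: (sf [::] x Ax).
  by move=> k; apply: IH => s x Ax; have := sf (rcons s k) x Ax; rewrite /iter_partial foldr_rcons.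
have := sf (size s); elim/last_ind: s f {sf} => [|s k IH] f.
  by move=> [H _] x Ax; exact: H.
rewrite size_rcons /= => -[_ H] x Ax; rewrite /iter_partial foldr_rcons.
exact: (IH _ (H k)).
Qed.

Lemma smooth_upto_base V n (f : 'rV[R]_2 -> V) : smooth_upto n f ->
  forall x, A x -> {for x, continuous f} /\ forall k : 'I_2, derivable f x (delta_mx 0 k).
Proof. by case: n => [|n] []. Qed.

Lemma smooth_upto_pred V n (f : 'rV[R]_2 -> V) : smooth_upto n.+1 f -> smooth_upto n f.
Proof.
elim: n f => [|n IH] f [H1 H2]; first by split.
by split=> // k; apply: IH; exact: H2.
Qed.

Lemma eq_partial V (f g : 'rV[R]_2 -> V) k x : (forall y, A y -> f y = g y) -> A x ->
  partial k f x = partial k g x.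
Proof.
move=> fg Ax; apply: near_eq_derive; first by apply: filterS (nA Ax) => y Ay; rewrite fg.
Qed.

Lemma eq_smooth_upto V n (f g : 'rV[R]_2 -> V) : (forall y, A y -> f y = g y) ->
  smooth_upto n f -> smooth_upto n g.
Proof.
elim: n f g => [|n IH] f g fg [H1 H2].
  split=> // x Ax; have [cf df] := H1 x Ax.
  have E : \near x, f x = g x by apply: filterS (nA Ax) => y Ay; rewrite fg.
  split=> [|k].
    rewrite /prop_for /continuous_at -(fg x Ax); apply: cvg_trans cf.
    exact: near_eq_cvg E.
  exact: near_eq_derivable (df k).
have H := smooth_upto_base (IH f g fg (smooth_upto_pred (conj H1 H2))).
split=> // k; apply: IH (H2 k) => y Ay; exact: eq_partial.
Qed.

Lemma smooth_upto_cst V n (c : V) : smooth_upto n (fun=> c).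
Proof.
elim: n c => [|n IH] c; (split; first by move=> x _; split=> [|k]; [exact: cst_continuous|exact: derivable_cst]) => // k.
by apply: eq_smooth_upto (IH 0) => y _; rewrite /partial derive_cst.
Qed.

Implicit Types (f g : 'rV[R]_2 -> R).

Lemma smooth_upto_add n f g : smooth_upto n f -> smooth_upto n g ->
  smooth_upto n (fun x => f x + g x).
Proof.
elim: n f g => [|n IH] f g [f1 f2] [g1 g2]; (split;
  first by move=> x Ax; have [? ?] := f1 x Ax; have [? ?] := g1 x Ax; split=> [|k];
    [exact: continuousD | exact: derivableD]) => // k.
apply: eq_smooth_upto (IH _ _ (f2 k) (g2 k)) => y Ay.
by rewrite /partial deriveD//; [exact: (f1 y Ay).2 | exact: (g1 y Ay).2].
Qed.

Lemma smooth_upto_mul n f g : smooth_upto n f -> smooth_upto n g ->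
  smooth_upto n (fun x => f x * g x).
Proof.
elim: n f g => [|n IH] f g sf sg; have [f1 f2] := sf; have [g1 g2] := sg; (split;
  first by move=> x Ax; have [? ?] := f1 x Ax; have [? ?] := g1 x Ax; split=> [|k];
    [exact: continuousM | exact: derivableM]) => // k.
apply: (@eq_smooth_upto _ _ (fun x => f x * partial k g x + g x * partial k f x)).
  by move=> y Ay; rewrite /partial deriveM//; [exact: (f1 y Ay).2 | exact: (g1 y Ay).2].
by apply: smooth_upto_add; apply: IH (f2 k) || apply: IH (g2 k); exact: smooth_upto_pred.
Qed.

Lemma smooth_upto_inv n f : (forall x, A x -> f x != 0) -> smooth_upto n f ->
  smooth_upto n (fun x => (f x)^-1).
Proof.
move=> f0; elim: n => [|n IH] sf; have [f1 f2] := sf; (split;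
  first by move=> x Ax; have [cf df] := f1 x Ax; split=> [|k];
    [exact: (continuousV (f0 x Ax) cf) | exact: (derivableV (f0 x Ax) (df k))]) => // k.
apply: (@eq_smooth_upto _ _ (fun x => (-1) * (((f x)^-1 * (f x)^-1) * partial k f x))).
  move=> y Ay; rewrite /partial deriveV//; [|exact: f0|exact: (f1 y Ay).2].
  by rewrite mulN1r [_ *: _]/(_ * _) -mulNr expr2 invfM.
have := IH (smooth_upto_pred sf) => si.
by apply: smooth_upto_mul; [exact: smooth_upto_cst|apply: smooth_upto_mul (f2 k); exact: smooth_upto_mul].
Qed.

Lemma smooth_upto_entry p q n (F : 'rV[R]_2 -> 'M[R]_(p, q)) a b :
  smooth_upto n F -> smooth_upto n (fun x => F x a b : R).
Proof.
elim: n F => [|n IH] F [F1 F2]; (split;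
  first by move=> x Ax; have [cF dF] := F1 x Ax; split=> [|k];
    [apply: (@continuous_comp _ _ _ F (fun M : 'M[R]_(p, q) => M a b)) => //; exact: coord_continuous
    |have /derivable_mxP/(_ a b) := dF k]) => // k.
apply: eq_smooth_upto (IH _ (F2 k)) => y Ay.
by rewrite /partial derive_mx ?mxE//; exact: (F1 y Ay).2.
Qed.

Lemma smooth_on_partial V (f : 'rV[R]_2 -> V) k : smooth_on A f -> smooth_on A (partial k f).
Proof. by move=> /smooth_onP sf; apply/smooth_onP => n; have [_] := sf n.+1; exact. Qed.

Lemma smooth_on_entry p q (F : 'rV[R]_2 -> 'M[R]_(p, q)) a b :
  smooth_on A F -> smooth_on A (fun x => F x a b : R).
Proof. by move=> /smooth_onP sf; apply/smooth_onP => n; exact: smooth_upto_entry. Qed.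

Lemma smooth_on_add f g : smooth_on A f -> smooth_on A g -> smooth_on A (fun x => f x + g x).
Proof.
by move=> /smooth_onP sf /smooth_onP sg; apply/smooth_onP => n; exact: smooth_upto_add.
Qed.

Lemma smooth_on_mul f g : smooth_on A f -> smooth_on A g -> smooth_on A (fun x => f x * g x).
Proof.
by move=> /smooth_onP sf /smooth_onP sg; apply/smooth_onP => n; exact: smooth_upto_mul.
Qed.

Lemma smooth_on_cst (c : R) : smooth_on A (fun=> c).
Proof. by apply/smooth_onP => n; exact: smooth_upto_cst. Qed.

Lemma smooth_on_opp f : smooth_on A f -> smooth_on A (fun x => - f x).
Proof.
move=> /(smooth_on_mul (smooth_on_cst (-1))); congr smooth_on.
by apply/funext => x; rewrite mulN1r.
Qed.

Lemma smooth_on_inv f : (forall x, A x -> f x != 0) -> smooth_on A f ->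
  smooth_on A (fun x => (f x)^-1).
Proof. by move=> f0 /smooth_onP sf; apply/smooth_onP => n; exact: smooth_upto_inv. Qed.

Lemma eq_smooth_on f g : (forall y, A y -> f y = g y) -> smooth_on A f -> smooth_on A g.
Proof. by move=> fg /smooth_onP sf; apply/smooth_onP => n; exact: eq_smooth_upto (sf n). Qed.

(** Cramer's rule: in size two the cofactors are entries up to sign, and the determinant is expanded
    along row 0. *)
Lemma smooth_on_invmx (F : 'rV[R]_2 -> 'M[R]_2) k l : smooth_on A F ->
  (forall x, A x -> F x \in unitmx) -> smooth_on A (fun x => invmx (F x) k l : R).
Proof.
move=> sF uF.
have scof a b : smooth_on A (fun x => cofactor (F x) a b : R).
  apply: (@eq_smooth_on (fun x => (-1) ^+ (a + b) * F x (lift a 0) (lift b 0))).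
    by move=> y _; rewrite /cofactor det_mx11 !mxE.
  by apply: smooth_on_mul; [exact: smooth_on_cst | exact: smooth_on_entry].
apply: (@eq_smooth_on (fun x => (F x 0 0 * cofactor (F x) 0 0 + F x 0 1 * cofactor (F x) 0 1)^-1
   * cofactor (F x) l k)).
  by move=> y Ay; rewrite /invmx uF// !mxE (expand_det_row _ 0) sum_I2.
apply: smooth_on_mul => //; apply: smooth_on_inv.
  move=> x /uF; rewrite unitmxE unitfE (expand_det_row _ 0) sum_I2//.
by apply: smooth_on_add; apply: smooth_on_mul => //; exact: smooth_on_entry.
Qed.

End SmoothFunctions.

Section SmoothCurves.
Context {R : realType} (I : set R).
Hypothesis oI : open I.
Implicit Types (V : normedModType R).

Let nI x : I x -> nbhs x I.
Proof. by move=> Ix; apply: open_nbhs_nbhs. Qed.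

Fixpoint csmooth_upto V (n : nat) (f : R -> V) : Prop :=
  (forall t, I t -> derivable f t 1) /\
  match n with O => True | S m => csmooth_upto m (derive1 f) end.

Definition csmooth V (f : R -> V) := forall n, csmooth_upto n f.

Lemma csmoothP V (f : R -> V) :
  csmooth f <-> forall t n, I t -> derivable (derive1n n f) t 1.
Proof.
split=> [sf t n It|sf n].
  have := sf n; elim: n f {sf} => [|n IH] f [H1 H2]; first exact: H1.
  by rewrite derive1Sn; exact: IH.
elim: n f sf => [|n IH] f sf; split=> //; try by move=> t It; exact: (sf t 0%N It).
by apply: IH => t m It; have := sf t m.+1 It; rewrite derive1Sn.
Qed.

Lemma csmooth_upto_base V n (f : R -> V) : csmooth_upto n f ->
  forall t, I t -> derivable f t 1.
Proof. by case: n => [|n] []. Qed.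

Lemma csmooth_upto_pred V n (f : R -> V) : csmooth_upto n.+1 f -> csmooth_upto n f.
Proof.
elim: n f => [|n IH] f [H1 H2]; first by split.
by split=> //; apply: IH; exact: H2.
Qed.

Lemma eq_csmooth_upto V n (f g : R -> V) : (forall y, I y -> f y = g y) ->
  csmooth_upto n f -> csmooth_upto n g.
Proof.
elim: n f g => [|n IH] f g fg [H1 H2].
  split=> // x Ix; apply: near_eq_derivable (H1 x Ix).
  by apply: filterS (nI Ix) => y Iy; rewrite fg.
have H := csmooth_upto_base (IH f g fg (csmooth_upto_pred (conj H1 H2))).
split=> //; apply: IH H2 => y Iy; rewrite !derive1E; apply: near_eq_derive.
by apply: filterS (nI Iy) => u Iu; rewrite fg.
Qed.

Implicit Types (f g : R -> R).

Lemma csmooth_upto_cst n (c : R) : csmooth_upto n (fun=> c).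
Proof.
elim: n c => [|n IH] c; split=> //; try by move=> x _; exact: derivable_cst.
by apply: eq_csmooth_upto (IH 0) => y _; rewrite derive1_cst.
Qed.

Lemma csmooth_upto_add n f g : csmooth_upto n f -> csmooth_upto n g ->
  csmooth_upto n (fun x => f x + g x).
Proof.
elim: n f g => [|n IH] f g [f1 f2] [g1 g2]; (split;
  first by move=> x Ix; apply: derivableD; [exact: f1|exact: g1]) => //.
apply: eq_csmooth_upto (IH _ _ f2 g2) => y Iy.
by rewrite !derive1E deriveD//; [exact: f1 | exact: g1].
Qed.

Lemma csmooth_upto_mul n f g : csmooth_upto n f -> csmooth_upto n g ->
  csmooth_upto n (fun x => f x * g x).
Proof.
elim: n f g => [|n IH] f g sf sg; have [f1 f2] := sf; have [g1 g2] := sg; (split;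
  first by move=> x Ix; apply: derivableM; [exact: f1|exact: g1]) => //.
apply: (@eq_csmooth_upto _ _ (fun x => f x * derive1 g x + g x * derive1 f x)).
  by move=> y Iy; rewrite !derive1E deriveM//; [exact: f1 | exact: g1].
by apply: csmooth_upto_add; apply: IH f2 || apply: IH g2; exact: csmooth_upto_pred.
Qed.

Lemma csmooth_upto_entry p q n (F : R -> 'M[R]_(p, q)) a b :
  csmooth_upto n F -> csmooth_upto n (fun x => F x a b : R).
Proof.
elim: n F => [|n IH] F [F1 F2]; (split;
  first by move=> x Ix; have /derivable_mxP/(_ a b) := F1 x Ix) => //.
apply: eq_csmooth_upto (IH _ F2) => y Iy.
by rewrite !derive1E derive_mx ?mxE//; exact: F1.
Qed.

Lemma csmooth_upto_row p n (F : R -> 'rV[R]_p) :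
  (forall j, csmooth_upto n (fun x => F x 0 j : R)) -> csmooth_upto n F.
Proof.
elim: n F => [|n IH] F H; have dF x : I x -> derivable F x 1 by
  move=> Ix; apply/derivable_mxP => i j; rewrite ord1; have [H1 _] := H j; exact: H1.
  by split.
split=> //; apply: IH => j; have [_] := H j; apply: eq_csmooth_upto => y Iy.
by rewrite !derive1E derive_mx ?mxE//; exact: dF.
Qed.

(** By the chain rule the derivative is a sum of products of a component of the derivative of [x]
    with a partial derivative of [f'] along [x], to which the induction applies again. *)
Lemma csmooth_upto_comp (A : set 'rV[R]_2) n (f' : 'rV[R]_2 -> R) (x : R -> 'rV[R]_2) : open A ->
  (forall t, I t -> A (x t)) -> smooth_on A f' -> csmooth x ->
  csmooth_upto n (fun t => f' (x t) : R).
Proof.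
move=> oA Ax sf sx; have D (g : 'rV[R]_2 -> R) t : smooth_on A g -> I t ->
    curve_derive (fun t => g (x t) : R) t (plane_diff g (x t) (derive1 x t)).
  move=> sg It.
  have sd := smooth_sd sg (open_nbhs_nbhs (conj oA (Ax t It))).
  have cd : curve_derive x t (derive1 x t).
    by apply/curve_deriveP; split=> //; have [H _] := sx 0%N; exact: H.
  exact: curve_derive_comp sd cd.
elim: n f' sf => [|n IH] f' sf; (split;
  first by move=> t It; have /curve_deriveP[] := D _ t sf It) => //.
apply: (@eq_csmooth_upto _ _ (fun t => derive1 x t 0 0 * partial 0 f' (x t)
   + derive1 x t 0 1 * partial 1 f' (x t))).
  by move=> t It; have /curve_deriveP[_ ->] := D _ t sf It; rewrite /plane_diff sum_I2.
have sx' : csmooth_upto n (derive1 x) by have [_] := sx n.+1.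
by apply: csmooth_upto_add; apply: csmooth_upto_mul; (exact: csmooth_upto_entry) || (apply: IH; exact: smooth_on_partial).
Qed.

End SmoothCurves.

(** * Charts and geodesics *)

Section Charts.
Context {R : realType} {M : riemannian_surface R}.
Implicit Types (i j : atlas_idx M) (c : R -> M) (x y p : M) (z : 'rV[R]_2).

Definition prm i : 'rV[R]_2 -> M := param (chart i).
Definition img i : set 'rV[R]_2 := crd i @` dom i.

Lemma crdK i x : dom i x -> prm i (crd i x) = x.
Proof. exact: coordK. Qed.

Lemma img_crd i x : dom i x -> img i (crd i x).
Proof. by move=> ix; exists x. Qed.

Lemma prmK i z : img i z -> crd i (prm i z) = z.
Proof. by move=> [x ix <-]; rewrite crdK. Qed.

Lemma dom_prm i z : img i z -> dom i (prm i z).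
Proof. by move=> [x ix <-]; rewrite crdK. Qed.

Lemma open_img i : open (img i).
Proof. exact: cimage_open. Qed.

Lemma open_dom i : open (dom i).
Proof. exact: cdom_open. Qed.

Lemma nbhs_img i z : img i z -> nbhs z (img i).
Proof. by move=> iz; apply: open_nbhs_nbhs; split=> //; exact: open_img. Qed.

Lemma nbhs_dom i x : dom i x -> nbhs x (dom i).
Proof. by move=> ix; apply: open_nbhs_nbhs; split=> //; exact: open_dom. Qed.

Lemma continuous_crd i x : dom i x -> {for x, continuous (crd i)}.
Proof.
move=> ix; have [g [_ _ cc _]] := coord_homeo (chart i).
by move: cc; rewrite continuous_open_subspace; [apply; rewrite inE|exact: open_dom].
Qed.

Lemma continuous_prm i z : img i z -> {for z, continuous (prm i)}.
Proof.
move=> iz; have [g [_ g2 _ cg]] := coord_homeo (chart i).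
move: cg; rewrite continuous_open_subspace; last exact: open_img.
move=> cg; have gz : {for z, continuous g} by apply: cg; rewrite inE.
have E (y : 'rV[R]_2) : img i y -> g y = prm i y.
  by move=> /g2[dy E]; rewrite -[in RHS]E; apply/esym; exact: crdK.
rewrite /prop_for /continuous_at -(E z iz); apply: cvg_trans gz.
have N : \near z, g z = prm i z by apply: filterS (nbhs_img iz) => y; exact: E.
exact: near_eq_cvg N.
Qed.

Lemma near_path c t (A : set M) : {for t, continuous c} -> nbhs (c t) A ->
  exists2 d : R, 0 < d & forall s, `|s - t| < d -> A (c s).
Proof. by move=> cc /cc/near_norm. Qed.

Definition smooth_at_dom c := forall i t, dom i (c t) ->
  [/\ {for t, continuous c}, derivable (crd i \o c) t 1 & derivable (derive1 (crd i \o c)) t 1].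

Lemma smooth_curve_at c : smooth_curve c -> smooth_at_dom c.
Proof.
move=> [cc sc] i t it; split; first exact: cc.
  exact: (sc i t 0%N it).
exact: (sc i t 1%N it).
Qed.

Lemma velocity_derive c i t : smooth_curve c -> dom i (c t) ->
  curve_derive (fun s => crd i (c s)) t (velocity i c t).
Proof.
move=> /smooth_curve_at sc it; have [_ H _] := sc i t it.
by apply: (iffRL (curve_deriveP (crd i \o c) t _)); split.
Qed.

Lemma accel_derive c i t : smooth_curve c -> dom i (c t) ->
  curve_derive (velocity i c) t (derive1 (velocity i c) t).
Proof.
move=> /smooth_curve_at sc it; have [_ _ H] := sc i t it.
by apply: (iffRL (curve_deriveP (velocity i c) t _)); split.
Qed.

Lemma nbhs_overlap i j x : dom i x -> dom j x ->
  nbhs (crd i x) (overlap (chart i) (chart j)).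
Proof.
move=> ix jx; have iz := img_crd ix.
have H : \forall z \near crd i x, img i z /\ dom j (prm i z).
  apply: filterI; first exact: nbhs_img.
  have := @continuous_prm i _ iz; apply; rewrite crdK//; exact: nbhs_dom.
apply: filterS H => z [[y iy <-]]; rewrite crdK// => jy; by exists y.
Qed.

Definition tr i j : 'rV[R]_2 -> 'rV[R]_2 := transition (chart i) (chart j).

Lemma tr_crd i j x : dom i x -> tr i j (crd i x) = crd j x.
Proof. by move=> ix; rewrite /tr /transition /= -[param _ _]/(prm i (crd i x)) crdK. Qed.

Lemma tr_strict i j x : dom i x -> dom j x ->
  strict_derive (tr i j) (crd i x) (plane_diff (tr i j) (crd i x)).
Proof.
by move=> ix jx; apply: smooth_sd (nbhs_overlap ix jx); exact: transition_smooth.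
Qed.

Lemma tr_jacobian i j x (h : 'rV[R]_2) : dom i x -> dom j x ->
  h *m jacobian (tr i j) (crd i x) = plane_diff (tr i j) (crd i x) h.
Proof. by move=> ix jx; apply: sd_differentiable; exact: tr_strict. Qed.

Lemma velocity_tr c i j t : smooth_curve c -> dom i (c t) -> dom j (c t) ->
  velocity j c t = velocity i c t *m jacobian (tr i j) (crd i (c t)).
Proof.
move=> sc it jt; rewrite tr_jacobian//.
apply: (curve_derive_unique (velocity_derive sc jt)).
apply: curve_derive_near (curve_derive_comp (tr_strict it jt) (velocity_derive sc it)).
have [d d0 H] := near_path (sc.1 t) (nbhs_dom it).
by apply/near_norm; exists d => // s /H ?; rewrite tr_crd.
Qed.

Lemma inner_tr i j x (u v : 'rV[R]_2) : dom i x -> dom j x ->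
  inner i x u v = inner j x (u *m jacobian (tr i j) (crd i x)) (v *m jacobian (tr i j) (crd i x)).
Proof.
move=> ix jx; rewrite /inner (@gmat_transition _ _ i j); last first.
  exact: nbhs_singleton (nbhs_overlap ix jx).
by rewrite trmx_mul -!mulmxA -[transition _ _ _]/(tr i j (crd i x)) tr_crd.
Qed.

Lemma gmat_unit i z : img i z -> gmat i z \in unitmx.
Proof.
move=> [x ix <-]; rewrite unitmxE unitfE; apply/det0P => -[v v0 vg].
by have := gmat_posdef ix v0; rewrite -[Defs.coord _ _]/(crd i x) vg mul0mx mxE ltxx.
Qed.

Lemma inner_sym i x (u v : 'rV[R]_2) : dom i x -> inner i x u v = inner i x v u.
Proof.
move=> ix; rewrite /inner; set g := gmat i _; have gT : g^T = g by exact: gmat_sym.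
transitivity ((u *m g *m v^T)^T 0 0); first by rewrite [RHS]mxE.
by rewrite !trmx_mul trmxK gT mulmxA.
Qed.

Lemma innerE i x (u v : 'rV[R]_2) :
  inner i x u v = \sum_a \sum_b u 0 a * gmat i (crd i x) a b * v 0 b.
Proof.
rewrite /inner mxE exchange_big/=; apply: eq_bigr => b _.
by rewrite !mxE mulr_suml.
Qed.

Lemma gmat_symE i z a b : img i z -> gmat i z a b = gmat i z b a.
Proof. by move=> [x ix <-]; have /matrixP/(_ b a) := gmat_sym ix; rewrite mxE. Qed.

Lemma christoffel_smooth i k a b : smooth_on (img i) (christoffel i k a b).
Proof.
have oi := @open_img i.
have sg a' b' : smooth_on (img i) (fun w => gmat i w a' b' : R).
  by apply: smooth_on_entry => //; exact: gmat_smooth.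
have E : christoffel i k a b = fun z => 2^-1 * (invmx (gmat i z) k 0 *
   (partial a (fun w => gmat i w b 0) z + partial b (fun w => gmat i w a 0) z
     + - partial 0 (fun w => gmat i w a b) z) + invmx (gmat i z) k 1 *
   (partial a (fun w => gmat i w b 1) z + partial b (fun w => gmat i w a 1) z
     + - partial 1 (fun w => gmat i w a b) z)).
  by apply/funext => z; rewrite /christoffel sum_I2.
have sP a' b' l' : smooth_on (img i) (partial l' (fun w => gmat i w a' b' : R)).
  exact: smooth_on_partial.
have sI l : smooth_on (img i) (fun z => invmx (gmat i z) k l : R).
  by apply: smooth_on_invmx => //; [exact: gmat_smooth | exact: gmat_unit].
have sB l := smooth_on_add oi (smooth_on_add oi (sP b l a) (sP a l b)) (smooth_on_opp oi (sP a b l)).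
rewrite E; apply: (smooth_on_mul oi (smooth_on_cst oi _)).
exact: (smooth_on_add oi (smooth_on_mul oi (sI 0) (sB 0)) (smooth_on_mul oi (sI 1) (sB 1))).
Qed.

Lemma christoffel_sym i k a b z : img i z -> christoffel i k a b z = christoffel i k b a z.
Proof.
move=> iz; rewrite /christoffel; congr (_ * _); apply: eq_bigr => l _; congr (_ * _).
have -> : partial l (fun w => gmat i w a b) z = partial l (fun w => gmat i w b a) z.
  by apply: (eq_partial (@open_img i)) => // y; exact: gmat_symE.
by rewrite [X in X - _]addrC.
Qed.

End Charts.

Local Opaque derive derive1.

Section Paths.
Context {R : realType}.
Implicit Types (V : normedModType R).

Lemma curve_derive_affine V (f : R -> V) (a b t : R) v :
  curve_derive f (a * t + b) v -> curve_derive (fun s => f (a * s + b)) t (a *: v).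
Proof.
move=> df e e0; have a0 : 0 < 1 + `|a| by rewrite ltr_wpDr.
have [d d0 fd] := df _ (divr_gt0 e0 a0).
exists (d / (1 + `|a|)); first by rewrite divr_gt0.
move=> s; rewrite ltr_pdivlMr// => sd.
have E : a * s + b - (a * t + b) = a * (s - t) by ring.
have := fd (a * s + b); rewrite E scalerA mulrC => /(_ _)/le_trans; apply.
  by rewrite normrM; have := normr_ge0 (s - t); nra.
rewrite normrM mulrCA [leRHS]mulrC ler_wpM2l// mulrAC ler_pdivrMr// ler_pM2l// lerDr//.
Qed.

(** Parametrizing the segment from [s] to [s'] by [[0, 1]] treats both orders of the end points at
    once. *)
Lemma mean_value_path V (f f' : R -> V) (s s' C : R) :
  (forall r, 0 <= r -> r <= 1 ->
     curve_derive f ((s' - s) * r + s) (f' ((s' - s) * r + s))) ->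
  (forall r, 0 <= r -> r <= 1 -> `|f' ((s' - s) * r + s)| <= C) ->
  `|f s' - f s| <= C * `|s' - s|.
Proof.
move=> df bf.
have := @mean_value_norm R V (fun r => f ((s' - s) * r + s))
  (fun r => (s' - s) *: f' ((s' - s) * r + s)) 0 1 (C * `|s' - s|) ler01.
rewrite mulr1 mulr0 add0r subrK subr0 mulr1; apply => r r0 r1.
  exact: curve_derive_affine (df r r0 r1).
by rewrite normrZ mulrC ler_wpM2r// bf.
Qed.

Lemma compact_cball n (x : 'rV[R]_n) (r : R) : compact [set y : 'rV[R]_n | `|y - x| <= r].
Proof.
case: n x => [|n] x.
  have [r0|r0] := leP 0 r; last first.
    rewrite (_ : [set _ | _] = set0); first exact: compact0.
    by rewrite -subset0 => y /= H; have := le_lt_trans H r0; rewrite ltNge normr_ge0.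
  rewrite (_ : [set _ | _] = [set x]); first exact: compact_set1.
  by apply/seteqP; split=> y /= _; [apply/rowP => -[] | rewrite (_ : y - x = 0) ?normr0//; apply/rowP => -[]].
apply: bounded_closed_compact.
  exists (r + `|x|); split; first exact: num_real.
  move=> C rC y /= yr; apply: ltW; apply: le_lt_trans rC.
  by rewrite -[y](subrK x) (le_trans (ler_normD _ _))// lerD2r.
rewrite -openC openE => y /= /negP; rewrite -ltNge => ry.
apply/near_norm; exists (`|y - x| - r); first by rewrite subr_gt0.
move=> w wy /= wx; suff : r < `|w - x| by rewrite ltNge wx.
have : `|y - x| <= `|w - y| + `|w - x|.
  have -> : y - x = - (w - y) + (w - x) by linear_id.
  by rewrite -(normrN (w - y)) ler_normD.
lra.
Qed.

End Paths.

(** * Geodesics as integral curves of the spray *)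

Section Geodesics.
Context {R : realType} {M : riemannian_surface R}.
Implicit Types (i j : atlas_idx M) (c e : R -> M) (x y : M).
Local Notation E := ('rV[R]_2).

Definition phase i c (t : R) : E * E := (crd i (c t), velocity i c t).

Definition chr i (x u v : E) : E :=
  \row_k \sum_a \sum_b christoffel i k a b x * u 0 a * v 0 b.

(** The geodesic equation as a first-order system for pairs of position and velocity in chart
    [i]. *)
Definition spray i (z : E * E) : E * E := (z.2, - chr i z.1 z.2 z.2).

Definition dspray i (z h : E * E) : E * E :=
  (h.2, - (\row_k \sum_a \sum_b plane_diff (christoffel i k a b) z.1 h.1 * z.2 0 a * z.2 0 b
           + chr i z.1 h.2 z.2 + chr i z.1 z.2 h.2)).

Lemma spray_strict i z : img i z.1 -> strict_derive (spray i) z (dspray i z).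
Proof.
move=> iz.
have d1 : strict_derive (fun u : E * E => u.1) z (fun h => h.1) by exact: sd_linear (blin_fst _ _).
have d2 : strict_derive (fun u : E * E => u.2) z (fun h => h.2) by exact: sd_linear (blin_snd _ _).
apply: sd_pair; first exact: d2.
apply: sd_opp; apply: sd_row => k.
have dv a : strict_derive (fun u : E * E => u.2 0 a : R) z (fun h => h.2 0 a).
  exact: sd_comp d2 (sd_coord _ a).
have dG a b : strict_derive (fun u : E * E => christoffel i k a b u.1) z
    (fun h => plane_diff (christoffel i k a b) z.1 h.1).
  apply: (sd_comp d1 (smooth_sd (@christoffel_smooth _ _ i k a b) (nbhs_img iz))).
rewrite (_ : (fun u => _) = fun u : E * E =>
    \sum_a \sum_b christoffel i k a b u.1 * u.2 0 a * u.2 0 b); last first.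
  by apply/funext => u; rewrite /chr mxE.
apply: sd_ext (sd_sum (fun a => sd_sum (fun b =>
  sd_mul (sd_mul (dG a b) (dv a)) (dv b)))) => h.
rewrite !mxE -big_split -big_split /=; apply: eq_bigr => a _.
rewrite -big_split -big_split /=; apply: eq_bigr => b _; ring.
Qed.

Lemma phase_derive i c t : geodesic c -> dom i (c t) ->
  curve_derive (phase i c) t (spray i (phase i c t)).
Proof.
move=> [sc gc] it; apply: curve_derive_pair; first exact: velocity_derive.
have -> : - chr i (phase i c t).1 (phase i c t).2 (phase i c t).2 = derive1 (velocity i c) t.
  by have /eqP := gc i t it; rewrite /cov_deriv addr_eq0 => /eqP ->.
exact: accel_derive.
Qed.

Lemma open_time i c : continuous c -> open (c @^-1` dom i).
Proof. by move=> /continuousP; apply; exact: open_dom. Qed.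

Lemma smooth_curve_affine c (a b : R) : smooth_curve c -> smooth_curve (fun t => c (a * t + b)).
Proof.
move=> [cc sc]; have ca : continuous (fun t => c (a * t + b)).
  move=> t; apply: (@continuous_comp _ _ _ (fun t => a * t + b) c); last exact: cc.
  apply: (@continuousD _ R^o); last exact: cst_continuous.
  by apply: (@continuousM _ _ (cst a) id); [exact: cst_continuous|exact: cvg_id].
split=> // i t n it.
(* The factor [k] collects the powers of [a] produced by repeated differentiation, so that the
   statement is stable under [derive1]. *)
suff H m (k : R) (f : R -> E) : csmooth_upto (c @^-1` dom i) m f ->
    csmooth_upto ((fun t => c (a * t + b)) @^-1` dom i) m (fun t => k *: f (a * t + b)).
  have : csmooth ((fun t => c (a * t + b)) @^-1` dom i) (crd i \o (fun t => c (a * t + b))).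
    move=> m; apply: (@eq_csmooth_upto _ _ (open_time ca) _ _ (fun t => 1 *: (crd i \o c) (a * t + b))).
      by move=> y _; rewrite scale1r.
    by apply: H; have /csmoothP : forall t n, (c @^-1` dom i) t -> derivable (derive1n n (crd i \o c)) t 1 by move=> *; exact: sc.
  by move/csmoothP; exact.
elim: m k f => [|m IH] k f [f1 f2].
all: have D s : dom i (c (a * s + b)) -> curve_derive (fun t => k *: f (a * t + b)) s ((k * a) *: derive1 f (a * s + b)).
  1,3: move=> is_; rewrite -scalerA; apply: curve_derive_scale; apply: curve_derive_affine; apply/curve_deriveP; split=> //; exact: f1.
- by split=> // s /D/curve_deriveP[].
- split; first by move=> s /D/curve_deriveP[].
  apply: (@eq_csmooth_upto _ _ (open_time ca) _ _ (fun s => (k * a) *: derive1 f (a * s + b))).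
    by move=> s /D/curve_deriveP[].
  exact: IH.
Qed.

Lemma velocity_affine i c (a b t : R) : smooth_curve c -> dom i (c (a * t + b)) ->
  velocity i (fun s => c (a * s + b)) t = a *: velocity i c (a * t + b).
Proof.
move=> sc it; apply: (curve_derive_unique (velocity_derive (smooth_curve_affine a b sc) it)).
exact: (curve_derive_affine (velocity_derive sc it)).
Qed.

Lemma geodesic_affine c (a b : R) : geodesic c -> geodesic (fun t => c (a * t + b)).
Proof.
move=> [sc gc]; have sa := smooth_curve_affine a b sc; split=> // i t it.
have [d d0 near_t] := near_path (sa.1 t) (nbhs_dom it).
have -> : 0 = (a * a) *: cov_deriv i c (velocity i c) (a * t + b) by rewrite gc// scaler0.
rewrite /cov_deriv scalerDr; congr (_ + _).
  apply: (curve_derive_unique (accel_derive sa it)); rewrite -scalerA.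
  apply: (curve_derive_near _ (curve_derive_scale a (curve_derive_affine (accel_derive sc it)))).
  by apply/near_norm; exists d => // s /near_t is_; rewrite velocity_affine.
apply/rowP => k; rewrite !mxE mulr_sumr; apply: eq_bigr => u _.
rewrite mulr_sumr; apply: eq_bigr => v _; rewrite velocity_affine// !mxE; ring.
Qed.

(** A window common to all geodesics close to [c] in phase space. Phases move with speed at most [B]
    in the ball of radius [2 * r], and [B * (2 * d) <= r / 2], so a geodesic that is in the ball of
    radius [r] at one time cannot leave the larger one during the window. As [e] is a curve in the
    manifold, its staying in the chart is part of the claim. *)
Lemma geodesic_window c t i : geodesic c -> dom i (c t) -> exists d r K : R,
  [/\ 0 < d, 0 < r, 0 < K, K * (4 * d) <= 1 &
  [/\ forall s, `|s - t| < d -> dom i (c s) /\ `|phase i c s - phase i c t| < r,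
      forall u w, `|u - phase i c t| < 2 * r -> `|w - phase i c t| < 2 * r ->
        img i u.1 /\ `|spray i u - spray i w| <= K * `|u - w| &
      forall e s s', geodesic e -> `|s - t| < d -> `|s' - t| < d -> dom i (e s) ->
        `|phase i e s - phase i c t| < r ->
        dom i (e s') /\ `|phase i e s' - phase i c t| < 2 * r]].
Proof.
move=> gc it; set z := phase i c t.
have iz : img i z.1 by exact: img_crd.
have [K K0 [d1 d10 lip]] := sd_lipschitz (spray_strict iz).
have [d2 d20 imgz] := iffLR (near_norm _ _) (nbhs_img iz).
pose r := Num.min d1 d2 / 2; have r0 : 0 < r by rewrite divr_gt0// lt_min d10.
have r1 : 2 * r <= d1 by rewrite /r mulrC divfK// ge_min lexx.
have r2 : 2 * r <= d2 by rewrite /r mulrC divfK// ge_min lexx orbT.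
have imgb u : `|u - z| < 2 * r -> img i u.1.
  by move=> uz; apply: imgz; apply: le_lt_trans (norm_fst (u - z)) (lt_le_trans uz r2).
pose B := `|spray i z| + K * (2 * r).
have B0 : 0 < B by rewrite ltr_wpDl// mulr_gt0// mulr_gt0.
have bB u : `|u - z| < 2 * r -> `|spray i u| <= B.
  move=> uz; rewrite -[spray i u](subrK (spray i z)) (le_trans (ler_normD _ _))// addrC.
  rewrite lerD2l (le_trans (lip _ _ (lt_le_trans uz r1) _))// ?subrr ?normr0//.
  by rewrite ler_wpM2l ?ltW.
have [d3 d30 domc] := near_path (gc.1.1 t) (nbhs_dom it).
have r20 : 0 < r / 2 by rewrite divr_gt0.
have [d4 d40 phc] := iffLR (continuous_norm _ _) (curve_derive_cont (phase_derive gc it)) _ r20.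
(* The four bounds keep [c] in the chart, keep its phase within [r / 2], give the smallness demanded
   by [gronwall_short], and limit the drift of other geodesics. *)
pose d := Num.min (Num.min d3 d4) (Num.min (K^-1 / 4) (r / (4 * B))).
have d0 : 0 < d by rewrite !lt_min d30 d40 /=; apply/andP; split;
    apply: divr_gt0 => //; rewrite ?invr_gt0 ?mulr_gt0.
have dB : B * (2 * d) <= r / 2.
  have : d <= r / (4 * B) by rewrite /d !ge_min lexx !orbT.
  rewrite ler_pdivlMr ?mulr_gt0//; lra.
exists d, r, K; split=> //.
  have : d <= K^-1 / 4 by rewrite /d !ge_min lexx !orbT.
  rewrite ler_pdivlMr// => /(ler_wpM2l (ltW K0)).
  by rewrite divff ?gt_eqF// [4 * d]mulrC.
split.
- move=> s; rewrite !lt_min -!andbA => /and4P[s3 s4 _ _]; split; first exact: domc.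
  by rewrite (le_lt_trans (phc s s4))// ltr_pdivrMr// ltr_pMr// ltr1n.
- move=> u w uz wz; split; first exact: imgb.
  by apply: lip; [exact: lt_le_trans uz r1 | exact: lt_le_trans wz r1].
move=> e s s' ge st s't ise es.
pose S (q : R) : R := (s' - s) * q + s.
have Sd q : 0 <= q -> q <= 1 -> `|S q - s| <= 2 * d.
  move=> q0 q1; rewrite /S addrK normrM (ger0_norm q0).
  have : `|s' - s| < 2 * d.
    by move: st s't; rewrite !ltr_norml => /andP[? ?] /andP[? ?]; apply/andP; split; lra.
  by have := normr_ge0 (s' - s); nra.
pose Q q := dom i (e q) /\ `|phase i e q - z| < 2 * r.
have drift q : 0 <= q -> q <= 1 -> (forall p, 0 <= p -> p <= q -> Q (S p)) ->
    `|phase i e (S q) - z| < 3 / 2 * r.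
  move=> q0 q1 H.
  have HS p : 0 <= p -> p <= 1 -> Q ((S q - s) * p + s).
    move=> p0 p1; have -> : (S q - s) * p + s = S (q * p) by rewrite /S; ring.
    by apply: H; [exact: mulr_ge0 | rewrite ler_piMr].
  have := @mean_value_path R _ (phase i e) (fun q => spray i (phase i e q)) s (S q) B.
  move=> /(_ _ _)/= G.
  have {}G : `|phase i e (S q) - phase i e s| <= B * `|S q - s|.
    apply: G => p p0 p1; have [Hd Hp] := HS p p0 p1; first exact: phase_derive.
    exact: bB.
  have -> : phase i e (S q) - z = (phase i e (S q) - phase i e s) + (phase i e s - z) by linear_id.
  rewrite (le_lt_trans (ler_normD _ _))//.
  have : B * `|S q - s| <= B * (2 * d) by rewrite ler_wpM2l ?(ltW B0)// Sd.
  have aux (a b n : R) : a <= B * n -> B * n <= B * (2 * d) -> b < r -> a + b < 3 / 2 * r.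
    by clear - dB; lra.
  by move=> /(aux _ _ _ G); apply.
have S0 : S 0 = s by rewrite /S mulr0 add0r.
have S1 : S 1 = s' by rewrite /S mulr1 subrK.
have cS : continuous S.
  move=> q; apply: (@continuousD _ R^o); last exact: cst_continuous.
  by apply: (@continuousM _ _ (cst (s' - s)) id); [exact: cst_continuous|exact: cvg_id].
have ceS : continuous (fun q => e (S q)).
  by move=> q; apply: (@continuous_comp _ _ _ S e); [exact: cS | exact: ge.1.1].
have openQ q : Q (S q) -> exists2 h : R, 0 < h & forall p, `|p - q| < h -> Q (S p).
  move=> [Qd Qp].
  have [h1 h10 H1] := near_path (ceS q) (nbhs_dom Qd).
  have cp : {for q, continuous (fun q => phase i e (S q))}.
    apply: (@continuous_comp _ _ _ S (phase i e)); first exact: cS.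
    exact: curve_derive_cont (phase_derive ge Qd).
  have g0 : 0 < (2 * r - `|phase i e (S q) - z|) / 2 by rewrite divr_gt0// subr_gt0.
  have [h2 h20 H2] := iffLR (continuous_norm _ _) cp _ g0.
  exists (Num.min h1 h2); first by rewrite lt_min h10.
  move=> p; rewrite lt_min => /andP[p1 p2]; split; first exact: H1.
  have -> : phase i e (S p) - z = (phase i e (S p) - phase i e (S q)) + (phase i e (S q) - z) by linear_id.
  have aux (a b : R) : a <= (2 * r - b) / 2 -> 0 < (2 * r - b) / 2 -> a + b < 2 * r.
    by clear; lra.
  exact: le_lt_trans (ler_normD _ _) (aux _ _ (H2 p p2) g0).
suff H : forall q, 0 <= q -> q <= 1 -> forall p, 0 <= p -> p <= q -> Q (S p).
  by have := H 1 ler01 (lexx _) 1 ler01 (lexx _); rewrite S1.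
apply: real_induction => //.
- move=> p p0 p1; rewrite (_ : p = 0) ?S0; last by apply/le_anti; rewrite p0 p1.
  by split=> //; apply: lt_trans es _; rewrite ltr_pMl// ltr1n.
- move=> q q0 q1 H; have [h h0 Hh] := openQ q (H q q0 (lexx _)).
  exists h => // q' qq' q'h q'1 p p0 pq'; have [pq|qp] := leP p q; first exact: H.
  by apply: Hh; rewrite gtr0_norm; clear - qp qq' q'h pq'; lra.
- move=> q q0 q1 H.
  have lt_q p : 0 <= p -> p < q -> Q (S p) by move=> p0 pq; apply: (H p p0 pq).
  have close p : 0 <= p -> p < q -> `|phase i e (S p) - z| < 3 / 2 * r.
    by move=> p0 pq; apply: drift => //; [exact: le_trans (ltW pq) q1 | move=> p' p'0 p'p; apply: lt_q => //; exact: le_lt_trans p'p pq].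
  (* A compact coordinate ball is closed in the Hausdorff surface, so the limit point at time [q]
     still lies in the chart. *)
  pose C := prm i @` [set y : E | `|y - z.1| <= 3 / 2 * r].
  have sub (y : E) : `|y - z.1| <= 3 / 2 * r -> img i y.
    move=> yz; apply: imgz; apply: le_lt_trans yz (lt_le_trans _ r2).
    by rewrite ltr_pM2r// ltr_pdivrMr//; rewrite -natrM ltr_nat.
  have cC : closed C.
    apply: compact_closed; first exact: surface_hausdorff.
    apply: continuous_compact; last exact: compact_cball.
    by apply: continuous_in_subspaceT => y /set_mem /sub; exact: continuous_prm.
  have approach (h : R) : 0 < h -> exists p, [/\ 0 <= p, p < q & `|p - q| < h].
    move=> h0; exists (Num.max 0 (q - h / 2)).
    rewrite gt_max q0 le_max lexx /=; split=> //; first by clear - h0; lra.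
    have : q - h / 2 <= Num.max 0 (q - h / 2) by rewrite le_max lexx orbT.
    have : Num.max 0 (q - h / 2) < q by rewrite gt_max q0 /=; clear - h0; lra.
    by clear - h0 => *; rewrite ltr0_norm; lra.
  have Cq : C (e (S q)).
    apply: contrapT => nC.
    have [h h0 Hh] := near_path (ceS q) (open_nbhs_nbhs (conj (closed_openC cC) nC)).
    have [p [p0 pq ph]] := approach h h0; apply: (Hh p ph).
    have [Qd _] := lt_q p p0 pq; exists (crd i (e (S p))); last exact: crdK.
    by rewrite /= ltW// (le_lt_trans (norm_fst (phase i e (S p) - z)))// close.
  have dq : dom i (e (S q)) by have [y /sub iy <-] := Cq; exact: dom_prm.
  have Qq : Q (S q).
    split=> //.
    have cp : {for q, continuous (fun q => phase i e (S q))}.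
      apply: (@continuous_comp _ _ _ S (phase i e)); first exact: cS.
      exact: curve_derive_cont (phase_derive ge dq).
    have g0 : 0 < r / 4 by rewrite divr_gt0.
    have [h h0 H2] := iffLR (continuous_norm _ _) cp _ g0.
    have [p [p0 pq ph]] := approach h h0; have := H2 p ph; have := close p p0 pq.
    move=> E1 E2.
    have -> : phase i e (S q) - z = (phase i e (S p) - z) - (phase i e (S p) - phase i e (S q)) by linear_id.
    have aux (a b : R) : a < 3 / 2 * r -> b <= r / 4 -> a + b < 2 * r by clear - r0; lra.
    exact: le_lt_trans (ler_normB _ _) (aux _ _ E1 E2).
  move=> p p0; rewrite le_eqVlt => /predU1P[->//|]; exact: lt_q.
Qed.

Lemma phase_tr i j c t : smooth_curve c -> dom i (c t) -> dom j (c t) ->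
  phase j c t = (tr i j (phase i c t).1, (phase i c t).2 *m jacobian (tr i j) (phase i c t).1).
Proof. by move=> sc it jt; rewrite /phase /= (velocity_tr sc it jt) tr_crd. Qed.

(** Agreement of phases in some chart is a locally constant property: on a window the difference of
    phases satisfies a homogeneous Gronwall inequality, so it vanishes throughout once it vanishes
    at one time. *)
Lemma geodesic_unique c e i t : geodesic c -> geodesic e ->
  dom i (c t) -> dom i (e t) -> phase i c t = phase i e t -> c = e.
Proof.
move=> gc ge ict iet pt; apply/funext.
pose P s := exists j, [/\ dom j (c s), dom j (e s) & phase j c s = phase j e s].
have Pcoinc s : P s -> c s = e s.
  by move=> [j [jc je [E _]]]; rewrite -(crdK jc) E crdK.
suff : forall s, P s by move=> H s; exact: Pcoinc.
apply: (@locally_constant_prop _ P _ t); last by exists i.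
move=> {pt ict iet i}t; pose i := chart_at (c t).
have it : dom i (c t) by exact: mem_chart_at.
have [d [r [K [d0 r0 K0 Kd [Hc lip He]]]]] := geodesic_window gc it.
exists d; first exact: d0.
move=> s s' st s't Ps.
have E := Pcoinc s Ps; have [j [jc je pj]] := Ps.
have [ic cr] := Hc s st; have ie : dom i (e s) by rewrite -E.
have pi : phase i c s = phase i e s.
  by rewrite (phase_tr gc.1 jc ic) (phase_tr ge.1 je ie) pj.
have win q : `|q - t| < d -> dom i (e q) /\ `|phase i e q - phase i c t| < 2 * r.
  by move=> qt; apply: (He e s q ge st qt ie); rewrite -pi; exact: cr.
exists i; have [ic' cr'] := Hc s' s't; have [ie' er'] := win s' s't; split; [exact: ic'|exact: ie'|].
apply/eqP; rewrite -subr_eq0 -normr_le0.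
have := @gronwall_short R _ (fun q => phase i c q - phase i e q)
  (fun q => spray i (phase i c q) - spray i (phase i e q)) t d K 0 (ltW K0) (lexx _) Kd.
move=> G; apply: (le_trans (G _ _ s s' st s't)).
- move=> q qt; have [icq _] := Hc q qt; have [ieq _] := win q qt.
  exact: (curve_derive_sub (phase_derive gc icq) (phase_derive ge ieq)).
- move=> q qt; rewrite addr0; have [icq cq] := Hc q qt; have [ieq eq] := win q qt.
  have cq2 : `|phase i c q - phase i c t| < 2 * r.
    apply: (lt_trans cq); rewrite ltr_pMl; [by rewrite ltr1n | exact: r0].
  exact: (lip _ _ cq2 eq).2.
- by rewrite pi subrr normr0 !mulr0 addr0.
Qed.

End Geodesics.

Section RealBounds.
Context {R : realType}.
Implicit Types a b h r u v s z x e : R.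

Lemma lt_half_quarter a b h : 0 < h -> a < h / 2 -> b <= h / 4 -> a + b < h.
Proof. lra. Qed.

Lemma le_half_lt a h : 0 < h -> a <= h / 2 -> a < h.
Proof. lra. Qed.

Lemma le_half_gap a b r : b < r -> a <= (r - b) / 2 -> a + b < r.
Proof. lra. Qed.

Lemma below_midpoint u v s z : u - v <= (s - v) / 2 -> - ((s - v) / 2) < z - s -> u < z.
Proof. lra. Qed.

Lemma above_midpoint u v s z : - ((v - s) / 2) <= u - v -> z - s < (v - s) / 2 -> z < u.
Proof. lra. Qed.

Lemma le_window x r e u : x - r < u -> u < x + r -> r < e -> - e <= u - x <= e.
Proof. by move=> *; apply/andP; split; lra. Qed.

End RealBounds.

Section StrictMore.
Context {R : realType} {U V : normedModType R}.

Lemma small_scale (h : U) (d : R) : 0 < d -> exists2 e : R, 0 < e & `|e *: h| < d.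
Proof.
move=> d0; have h0 : 0 < 1 + `|h| by rewrite ltr_wpDr.
exists (d / (1 + `|h|)); first by rewrite divr_gt0.
rewrite normrZ gtr0_norm ?divr_gt0// mulrAC ltr_pdivrMr// ltr_pM2l// ltrDr.
exact: ltr01.
Qed.

Lemma sd_bound (f : U -> V) x L (K d : R) : strict_derive f x L -> 0 < d ->
  (forall u w, `|u - x| < d -> `|w - x| < d -> `|f u - f w| <= K * `|u - w|) ->
  forall h, `|L h| <= K * `|h|.
Proof.
move=> [bL df] d0 lip h; apply/ler_addgt0Pr => e e0.
have h0 : 0 < 1 + `|h| by rewrite ltr_wpDr.
have [d' d'0 fd] := df _ (divr_gt0 e0 h0).
have m0 : 0 < Num.min d d' by rewrite lt_min d0.
have [k k0] := small_scale h m0; rewrite lt_min => /andP[kd kd'].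
have E : x + k *: h - x = k *: h by linear_id.
have x0 (q : R) : 0 < q -> `|x - x| < q by rewrite subrr normr0.
have := lip (x + k *: h) x; have := fd (x + k *: h) x; rewrite E => /(_ kd' (x0 _ d'0)) H1 /(_ kd (x0 _ d0)) H2.
have : `|L (k *: h)| <= (K + e / (1 + `|h|)) * `|k *: h|.
  set p := f _ - f _ in H1 H2.
  have -> : L (k *: h) = p - (p - L (k *: h)) by linear_id.
  by rewrite (le_trans (ler_normB _ _))// mulrDl lerD.
rewrite (blinZ bL) !normrZ mulrCA ler_pM2l ?normr_gt0 ?gt_eqF// mulrDl => /le_trans; apply.
by rewrite lerD2l mulrAC ler_pdivrMr// ler_pM2l// lerDr.
Qed.

(** Strictness at [x] controls short increments based at every nearby [y]; comparing them with the
    derivative at [y] bounds the difference of the two derivatives. *)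
Lemma sd_derivative_continuous (f : U -> V) x L (e : R) : strict_derive f x L -> 0 < e ->
  exists2 d : R, 0 < d & forall y L', `|y - x| < d -> strict_derive f y L' ->
    forall h, `|L' h - L h| <= e * `|h|.
Proof.
move=> [bL df] e0; have e20 : 0 < e / 2 by rewrite divr_gt0.
have [d d0 fd] := df _ e20; exists d => // y L' yx [bL' df'] h.
have [d' d'0 fd'] := df' _ e20.
have m0 : 0 < Num.min (d - `|y - x|) d' by rewrite lt_min subr_gt0 yx.
have [k k0] := small_scale h m0; rewrite lt_min => /andP[kd kd'].
have E : y + k *: h - y = k *: h by linear_id.
have ux : `|y + k *: h - x| < d.
  have -> : y + k *: h - x = k *: h + (y - x) by linear_id.
  by rewrite (le_lt_trans (ler_normD _ _))// -ltrBrDr.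
have y0 (q : R) : 0 < q -> `|y - y| < q by rewrite subrr normr0.
have := fd (y + k *: h) y ux yx; have := fd' (y + k *: h) y; rewrite E => /(_ kd' (y0 _ d'0)).
set p := f _ - f _ => H1 H2.
have : `|k *: (L' h - L h)| <= e * `|k *: h|.
  have -> : k *: (L' h - L h) = (p - L (k *: h)) - (p - L' (k *: h)).
    by rewrite (blinZ bL) (blinZ bL'); linear_id.
  rewrite (le_trans (ler_normB _ _))// [leRHS](_ : _ = e / 2 * `|k *: h| + e / 2 * `|k *: h|); last by field.
  by rewrite lerD.
by rewrite !normrZ mulrCA ler_pM2l ?normr_gt0 ?gt_eqF.
Qed.

End StrictMore.

(** * The geodesic flow *)

Section Flow.
Context {R : realType} {M : riemannian_surface R}.
Implicit Types (i j : atlas_idx M) (x : M).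
Local Notation E := ('rV[R]_2).

Lemma open_overlap i j : open (overlap (chart i) (chart j) : set E).
Proof. by rewrite openE => z [x [ix jx] <-]; exact: nbhs_overlap. Qed.

(** The change of charts on phase space; its derivative contains second derivatives of the
    transition map. *)
Definition trph i j (z : E * E) : E * E := (tr i j z.1, plane_diff (tr i j) z.1 z.2).

Lemma trph_strict i j x (v : E) : dom i x -> dom j x ->
  exists L, strict_derive (trph i j) (crd i x, v) L.
Proof.
move=> ix jx; set z := (crd i x, v).
have oz : nbhs z.1 (overlap (chart i) (chart j)) by exact: nbhs_overlap.
have d1 : strict_derive (fun u : E * E => u.1) z (fun h => h.1) by exact: sd_linear (blin_fst _ _).
have d2 : strict_derive (fun u : E * E => u.2) z (fun h => h.2) by exact: sd_linear (blin_snd _ _).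
have T1 := sd_comp d1 (tr_strict ix jx : strict_derive (tr i j) z.1 _).
have oo := @open_overlap i j.
have sp k l : smooth_on (overlap (chart i) (chart j)) (fun y => partial k (tr i j) y 0 l : R).
  apply: (smooth_on_entry oo); apply: smooth_on_partial; exact: transition_smooth.
have dv k : strict_derive (fun u : E * E => u.2 0 k : R) z (fun h => h.2 0 k).
  exact: sd_comp d2 (sd_coord _ k).
have dp k l : strict_derive (fun u : E * E => partial k (tr i j) u.1 0 l : R) z
    (fun h => plane_diff (fun y => partial k (tr i j) y 0 l : R) z.1 h.1).
  exact: (sd_comp d1 (smooth_sd (sp k l) oz)).
pose L2 (h : E * E) : E := \row_l \sum_k (h.2 0 k * partial k (tr i j) z.1 0 l
   + z.2 0 k * plane_diff (fun y => partial k (tr i j) y 0 l : R) z.1 h.1).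
exists (fun h => (plane_diff (tr i j) (crd i x) h.1, L2 h)).
apply: sd_pair; first exact: T1.
apply: sd_row => l.
rewrite (_ : (fun u => _) = fun u : E * E => \sum_k u.2 0 k * partial k (tr i j) u.1 0 l); last first.
  by apply/funext => u; rewrite /plane_diff summxE; apply: eq_bigr => k _; rewrite mxE.
apply: sd_ext (sd_sum (fun k => sd_mul (dv k) (dp k l))) => h.
by rewrite mxE.
Qed.

Context {Lam : normedModType R} (gam : Lam -> R -> M) (l0 : Lam).
Hypothesis geo : forall l, geodesic (gam l).

(** The middle clause keeps nearby geodesics inside chart [i] at time [t], because [phase i] has
    junk values outside the chart. *)
Definition flow_at i t (Y : Lam -> E * E) : Prop :=
  [/\ dom i (gam l0 t),
      exists2 r : R, 0 < r & forall l, `|l - l0| < r -> dom i (gam l t) &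
      strict_derive (fun l => phase i (gam l) t) l0 Y].

Lemma flow_continuous i t Y : flow_at i t Y -> {for l0, continuous (fun l => gam l t)}.
Proof.
move=> [it [r r0 near_i] sY].
have iz := img_crd it.
have c1 : {for l0, continuous (fun l => (phase i (gam l) t).1)}.
  exact: sd_cont (sd_comp sY (sd_linear _ (blin_fst _ _))).
have c2 : {for l0, continuous (fun l => prm i (phase i (gam l) t).1)}.
  apply: (@continuous_comp _ _ _ (fun l => (phase i (gam l) t).1) (prm i)) => //.
  exact: continuous_prm.
have N2 : \forall l \near l0, prm i (phase i (gam l) t).1 = gam l t.
  by apply/near_norm; exists r => // l /near_i il; exact: crdK.
rewrite /prop_for /continuous_at -(nbhs_singleton N2); apply: cvg_trans c2.
exact: near_eq_cvg N2.
Qed.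

Lemma flow_tr i j t Y : flow_at i t Y -> dom j (gam l0 t) -> exists Y', flow_at j t Y'.
Proof.
move=> fY jt; have [it [r r0 near_i] sY] := fY.
have [r' r'0 near_j] := iffLR (near_norm _ _) (flow_continuous fY (nbhs_dom jt)).
have [L sL] := trph_strict (velocity i (gam l0) t) it jt.
exists (L \o Y); split=> //; first by exists r'.
apply: sd_near (sd_comp sY (sL : strict_derive _ (phase i (gam l0) t) _)).
apply/near_norm; exists (Num.min r r'); first by rewrite lt_min r0.
move=> l; rewrite lt_min => /andP[/near_i il /near_j jl].
by rewrite (phase_tr (geo l).1 il jl) /trph /= tr_jacobian.
Qed.

(** Verifies the hypotheses of [ode_dependence] for the spray along [gam l0]: a derivative at one
    time of the window yields one at all its times, solving the linearized equation. *)
Lemma flow_window i t : dom i (gam l0 t) -> exists2 d : R, 0 < d &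
  forall s Y0, `|s - t| < d -> flow_at i s Y0 -> exists Y : R -> Lam -> E * E,
    forall s', `|s' - t| < d -> flow_at i s' (Y s') /\
      forall w, curve_derive (Y^~ w) s' (dspray i (phase i (gam l0) s') (Y s' w)).
Proof.
move=> it; set c := gam l0.
have [d1 [r [K [d10 r0 K0 Kd1 [Hc lip He]]]]] := geodesic_window (geo l0) it.
(* With half the radius the closed window lies inside the open one, so the modulus of strict
   differentiability of the spray along [c] becomes uniform by compactness. *)
pose d := d1 / 2; have d0 : 0 < d by rewrite divr_gt0.
have dd1 : d < d1 by rewrite /d ltr_pdivrMr// ltr_pMr// ltr1n.
have Kd : K * (4 * d) <= 1.
  apply: le_trans Kd1; rewrite ler_wpM2l ?(ltW K0)// ler_wpM2l//; exact: ltW.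
have win s : `|s - t| < d -> `|s - t| < d1 by move=> /lt_trans; apply.
have win' s : t - d <= s -> s <= t + d -> `|s - t| < d1.
  move=> s1 s2; apply: le_lt_trans dd1; rewrite ler_norml lerBlDl s2 andbT.
  by rewrite -opprB lerN2 lerBlDr addrC -lerBlDr.
have sX s : `|s - t| < d1 -> strict_derive (spray i) (phase i c s) (dspray i (phase i c s)).
  by move=> /Hc[ic _]; apply: spray_strict; exact: img_crd.
have r2 : r < 2 * r by rewrite ltr_pMl// ltr1n.
have cc s : `|s - t| < d1 -> {for s, continuous (phase i c)}.
  by move=> /Hc[ic _]; exact: curve_derive_cont (phase_derive (geo l0) ic).
have strictX e : 0 < e -> exists2 h : R, 0 < h & forall s u w, `|s - t| < d ->
    `|u - phase i c s| < h -> `|w - phase i c s| < h ->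
    `|spray i u - spray i w - dspray i (phase i c s) (u - w)| <= e * `|u - w|.
  move=> e0; have e20 : 0 < e / 2 by rewrite divr_gt0.
  have [||h h0 H] := @uniform_on_segment R (fun s h => forall u w,
      `|u - phase i c s| < h -> `|w - phase i c s| < h ->
    `|spray i u - spray i w - dspray i (phase i c s) (u - w)| <= e * `|u - w|) (t - d) (t + d).
  - by move=> s h h' _ h'h H u w uh wh; apply: H; exact: lt_le_trans h'h.
  - move=> s s1 s2; have sd1 := win' s s1 s2.
    have [h1 h10 H1] := (sX s sd1).2 _ e20.
    have [h2 h20 H2] := sd_derivative_continuous (sX s sd1) e20.
    have m0 : 0 < Num.min (h1 / 4) (h2 / 2) by rewrite lt_min !divr_gt0.
    have [h3 h30 H3] := iffLR (continuous_norm _ _) (cc s sd1) _ m0.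
    exists (Num.min h3 (d1 - `|s - t|)); first by rewrite lt_min h30 subr_gt0.
    exists (h1 / 2); first by rewrite divr_gt0.
    move=> s'; rewrite lt_min => /andP[s's s'd].
    have s't : `|s' - t| < d1.
      have -> : s' - t = (s' - s) + (s - t) by ring.
      by rewrite (le_lt_trans (ler_normD _ _))// -ltrBrDr.
    have := H3 s' s's; rewrite le_min => /andP[c1 c2].
    have near1 u : `|u - phase i c s'| < h1 / 2 -> `|u - phase i c s| < h1.
      move=> ub; have -> : u - phase i c s = (u - phase i c s') + (phase i c s' - phase i c s) by linear_id.
      exact: le_lt_trans (ler_normD _ _) (lt_half_quarter h10 ub c1).
    move=> u w ub wb.
    have E1 := H1 u w (near1 u ub) (near1 w wb).
    have c3 := le_half_lt h20 c2.
    have E2 := H2 _ _ c3 (sX s' s't) (u - w).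
    set A := dspray i (phase i c s') _ in E2 *; set B := dspray i (phase i c s) _ in E1 E2.
    have -> : spray i u - spray i w - A = (spray i u - spray i w - B) - (A - B) by linear_id.
    rewrite (le_trans (ler_normB _ _))// [leRHS](_ : _ = e / 2 * `|u - w| + e / 2 * `|u - w|); last by field.
    exact: lerD.
  exists h => // s u w; rewrite ltr_norml ltrBrDl ltrBlDl => /andP[s1 s2].
  by apply: H; [rewrite lerBlDl ltW | rewrite -lerBlDl ltW].
exists d => // s Y0 st [ic [r1 r10 near_i] sY0].
have tube : exists2 q : R, 0 < q & forall l, `|l - l0| < q ->
    forall s', `|s' - t| < d -> dom i (gam l s') /\ `|phase i (gam l) s' - phase i c t| < 2 * r.
  have [_ cr] := Hc s (win s st).
  have g0 : 0 < (r - `|phase i c s - phase i c t|) / 2 by rewrite divr_gt0// subr_gt0.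
  have [r3 r30 H3] := iffLR (continuous_norm _ _) (sd_cont sY0) _ g0.
  exists (Num.min r1 r3); first by rewrite lt_min r10.
  move=> l; rewrite lt_min => /andP[l1 l3] s' s't.
  apply: (He (gam l) s s' (geo l) (win s st) (win s' s't) (near_i l l1)).
  have -> : phase i (gam l) s - phase i c t = (phase i (gam l) s - phase i c s) + (phase i c s - phase i c t) by linear_id.
  exact: le_lt_trans (ler_normD _ _) (le_half_gap cr (H3 l l3)).
have [q q0 Hq] := tube.
have [||||||||Y HY] := @ode_dependence R Lam (E * E)%type (spray i) (fun l s => phase i (gam l) s)
  (fun s => dspray i (phase i c s)) l0 t d K s Y0 d0 (ltW K0) Kd st.
- by apply: norm_complete_pair; exact: norm_complete_row.
- exists q => // l lq s' s't; apply: phase_derive => //; exact: (Hq l lq s' s't).1.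
- by move=> s' /win/sX[].
- move=> s' h s't; have [ic' cr'] := Hc s' (win s' s't).
  have g0 : 0 < 2 * r - `|phase i c s' - phase i c t| by rewrite subr_gt0 (lt_trans cr').
  have near2 u : `|u - phase i c s'| < 2 * r - `|phase i c s' - phase i c t| -> `|u - phase i c t| < 2 * r.
    move=> ub.
    have -> : u - phase i c t = (u - phase i c s') + (phase i c s' - phase i c t) by linear_id.
    by rewrite (le_lt_trans (ler_normD _ _))// -ltrBrDr.
  apply: (sd_bound (sX s' (win s' s't)) g0) => u w /near2 ub /near2 wb.
  exact: (lip u w ub wb).2.
- move=> s' e s't e0; have s't1 := win s' s't.
  have [h2 h20 H2] := sd_derivative_continuous (sX s' s't1) e0.
  have h220 : 0 < h2 / 2 by rewrite divr_gt0.
  have [h3 h30 H3] := iffLR (continuous_norm _ _) (cc s' s't1) _ h220.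
  exists (Num.min h3 (d1 - `|s' - t|)); first by rewrite lt_min h30 subr_gt0.
  move=> p; rewrite lt_min => /andP[ps pd] h.
  have pt : `|p - t| < d1.
    have -> : p - t = (p - s') + (s' - t) by ring.
    by rewrite (le_lt_trans (ler_normD _ _))// -ltrBrDr.
  exact: H2 (le_half_lt h20 (H3 p ps)) (sX p pt) h.
- exists q => // l m lq mq s' s't.
  have := @gronwall_short R _ (fun p => phase i (gam l) p - phase i (gam m) p)
    (fun p => spray i (phase i (gam l) p) - spray i (phase i (gam m) p)) t d K 0 (ltW K0) (lexx _) Kd.
  rewrite mulr0 => G; rewrite -[leRHS]addr0; apply: (G _ _ s s' st s't).
    move=> p pt; apply: curve_derive_sub; apply: phase_derive => //.
      exact: (Hq l lq p pt).1.
    exact: (Hq m mq p pt).1.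
  move=> p pt; rewrite addr0.
  exact: (lip _ _ (Hq l lq p pt).2 (Hq m mq p pt).2).2.
- exact: strictX.
- exact: sY0.
exists Y => s' s't; have [H1 H2] := HY s' s't; split=> //; split=> //.
  exact: (Hc s' (win s' s't)).1.
by exists q => // l lq; exact: (Hq l lq s' s't).1.
Qed.

Context (i0 : atlas_idx M) (t0 : R) (Yinit : Lam -> E * E).
Hypothesis init : flow_at i0 t0 Yinit.

(** Differentiability spreads along the geodesic from the initial time, passing from chart to chart
    by [flow_tr]. *)
Lemma flow_exists i t : dom i (gam l0 t) -> exists Y, flow_at i t Y.
Proof.
suff H : exists j Y, flow_at j t Y by have [j [Y fY]] := H; exact: flow_tr fY.
apply: (@locally_constant_prop _ (fun t => exists j Y, flow_at j t Y) _ t0); last by exists i0, Yinit.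
move=> {}t; pose j := chart_at (gam l0 t).
have jt : dom j (gam l0 t) by exact: mem_chart_at.
have [d1 d10 H1] := flow_window jt.
have [d2 d20 H2] := near_path ((geo l0).1.1 t) (nbhs_dom jt).
exists (Num.min d1 d2); first by rewrite lt_min d10.
move=> s s'; rewrite !lt_min => /andP[s1 s2] /andP[s'1 s'2] [k [Y fY]].
have [Y' fY'] := flow_tr fY (H2 s s2); have [Z HZ] := H1 s Y' s1 fY'.
by exists j, (Z s'); exact: (HZ s' s'1).1.
Qed.

Definition variation i t : Lam -> E * E := xget (fun=> 0) [set Y | flow_at i t Y].

Lemma variationP i t : dom i (gam l0 t) -> flow_at i t (variation i t).
Proof. by move=> /flow_exists[Y fY]; apply: (@xgetPex _ (fun=> 0) [set Y | flow_at i t Y]); exists Y. Qed.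

Lemma variation_unique i t Y : flow_at i t Y -> variation i t =1 Y.
Proof.
move=> fY; have [it _ sY] := fY; have [_ _ sV] := variationP it.
exact: sd_unique sV sY.
Qed.

Lemma variation_ode i t w : dom i (gam l0 t) ->
  curve_derive (fun s => variation i s w) t
    (dspray i (phase i (gam l0) t) (variation i t w)).
Proof.
move=> it; have [d d0 H] := flow_window it.
have tt : `|t - t| < d by rewrite subrr normr0.
have [Y HY] := H t _ tt (variationP it).
have [fY dY] := HY t tt; rewrite (variation_unique fY); apply: curve_derive_near (dY w).
by apply/near_norm; exists d => // s /HY[fs _]; rewrite (variation_unique fs).
Qed.

End Flow.

(** * Jacobi fields *)

Section JacobiIdentity.
Context {R : comRingType}.

Lemma sum_I2r (F : 'I_2 -> R) : \sum_k F k = F 0 + F 1.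
Proof.
rewrite !big_ord_recl big_ord0 addr0.
by rewrite (_ : lift ord0 ord0 = 1)//; apply/val_inj.
Qed.

(* G and D stand for the Christoffel symbols and their partial derivatives, the
   first line is the linearized geodesic equation. *)
Lemma jacobi_identity (G : 'I_2 -> 'I_2 -> 'I_2 -> R) (D : 'I_2 -> 'I_2 -> 'I_2 -> 'I_2 -> R)
    (v J K : 'I_2 -> R) (k : 'I_2) :
  (forall k, G k 1 0 = G k 0 1) -> (forall m k, D m k 1 0 = D m k 0 1) ->
  - (\sum_a \sum_b (\sum_m J m * D m k a b) * v a * v b
     + \sum_a \sum_b G k a b * K a * v b + \sum_a \sum_b G k a b * v a * K b)
  + \sum_a \sum_b (((\sum_m v m * D m k a b) * v a
       + G k a b * - (\sum_p \sum_q G a p q * v p * v q)) * J b + G k a b * v a * K b)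
  + \sum_a \sum_b G k a b * v a * (K b + \sum_p \sum_q G b p q * v p * J q)
  + \sum_a \sum_b \sum_m (D a k b m - D b k a m
       + \sum_n (G n b m * G k a n - G n a m * G k b n)) * J a * v b * v m = 0.
Proof. by move=> Gs Ds; rewrite !sum_I2r !Gs !Ds; ring. Qed.

End JacobiIdentity.

Section CurveRules.
Context {R : realType}.
Implicit Types (V : normedModType R).

Lemma curve_derive_add V (f g : R -> V) s a b : curve_derive f s a -> curve_derive g s b ->
  curve_derive (fun s => f s + g s) s (a + b).
Proof.
move=> /curve_deriveP[f1 f2] /curve_deriveP[g1 g2]; apply/curve_deriveP; split.
  exact: derivableD.
by rewrite derive1E deriveD// -!derive1E f2 g2.
Qed.

Lemma curve_derive_mul (f g : R -> R) s a b : curve_derive f s a -> curve_derive g s b ->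
  curve_derive (fun s => f s * g s) s (a * g s + f s * b).
Proof.
move=> df dg; have dM : strict_derive (fun z : R * R => z.1 * z.2) (f s, g s) _ :=
  sd_mul (sd_linear _ (blin_fst _ _)) (sd_linear _ (blin_snd _ _)).
exact: (curve_derive_comp (f := fun s => (f s, g s)) dM (curve_derive_pair df dg)).
Qed.

Lemma curve_derive_sum2 V (F : 'I_2 -> R -> V) (F' : 'I_2 -> V) t :
  (forall a, curve_derive (F a) t (F' a)) ->
  curve_derive (fun s => \sum_a F a s) t (\sum_a F' a).
Proof.
move=> H; have -> : (fun s => \sum_a F a s) = fun s => F 0 s + F 1 s.
  by apply/funext => s; rewrite sum_I2.
by rewrite sum_I2; apply: curve_derive_add; exact: H.
Qed.

Lemma curve_derive_coord n (f : R -> 'rV[R]_n) s a k : curve_derive f s a ->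
  curve_derive (fun s => f s 0 k : R) s (a 0 k).
Proof. exact: (curve_derive_blin (blin_coord k)). Qed.

Lemma curve_derive_row n (f : R -> 'rV[R]_n) s (a : 'rV[R]_n) :
  (forall k, curve_derive (fun s => f s 0 k : R) s (a 0 k)) -> curve_derive f s a.
Proof.
move=> H; apply/curve_deriveP.
have df : derivable f s 1 by apply/derivable_mxP => p k; rewrite ord1; have /curve_deriveP[] := H k.
split=> //; apply/rowP => k; rewrite derive1E derive_mx// mxE -derive1E.
by have /curve_deriveP[] := H k.
Qed.

End CurveRules.

Section Jacobi.
Context {R : realType} {M : riemannian_surface R}.
Implicit Types (i j : atlas_idx M).
Local Notation E := ('rV[R]_2).
Context {Lam : normedModType R} (gam : Lam -> R -> M) (l0 : Lam).
Hypothesis geo : forall l, geodesic (gam l).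
Context (i0 : atlas_idx M) (t0 : R) (Yinit : Lam -> E * E).
Hypothesis init : flow_at gam l0 i0 t0 Yinit.
Context (w : Lam).

Local Notation c := (gam l0).
(** The field obtained by varying the geodesic in direction [w]; [jac'] below is its derivative in
    coordinates, not the covariant one. *)
Definition jac i (t : R) : E := (variation gam l0 i t w).1.
Definition jac' i (t : R) : E := (variation gam l0 i t w).2.

Lemma jac_derive i t : dom i (c t) -> curve_derive (jac i) t (jac' i t).
Proof.
by move=> it; have := curve_derive_blin (blin_fst _ _) (variation_ode geo init w it).
Qed.

Lemma jac'_derive i t : dom i (c t) -> curve_derive (jac' i) t
  (- (\row_k \sum_a \sum_b plane_diff (christoffel i k a b) (crd i (c t)) (jac i t)
        * velocity i c t 0 a * velocity i c t 0 b
      + chr i (crd i (c t)) (jac' i t) (velocity i c t)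
      + chr i (crd i (c t)) (velocity i c t) (jac' i t))).
Proof.
by move=> it; have := curve_derive_blin (blin_snd _ _) (variation_ode geo init w it).
Qed.

Let I i := c @^-1` dom i.

Let oI i : open (I i).
Proof. by apply: open_time; exact: (geo l0).1.1. Qed.

(** Bootstrapping: the linearized equation expresses the derivatives of [jac] and [jac'] through
    these two functions and smooth data along [c]. *)
Lemma jac_csmooth i n : csmooth_upto (I i) n (jac i) /\ csmooth_upto (I i) n (jac' i).
Proof.
have oi := @oI i; have oim := @open_img _ M i.
have sx : csmooth (I i) (crd i \o c).
  by apply/csmoothP => t m It; exact: (geo l0).1.2.
have sv m : csmooth_upto (I i) m (velocity i c) by have [_] := sx m.+1.
have imgx t : I i t -> img i ((crd i \o c) t) by exact: img_crd.
have sG m k a b : csmooth_upto (I i) m (fun t => christoffel i k a b ((crd i \o c) t)).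
  exact: (csmooth_upto_comp oi _ oim imgx (christoffel_smooth k a b) sx).
have sP m l k a b : csmooth_upto (I i) m (fun t => partial l (christoffel i k a b) ((crd i \o c) t)).
  apply: (csmooth_upto_comp oi _ oim imgx _ sx).
  by apply: smooth_on_partial; exact: christoffel_smooth.
have ssum m (F : 'I_2 -> R -> R) : (forall k, csmooth_upto (I i) m (F k)) ->
    csmooth_upto (I i) m (fun t => \sum_k F k t).
  move=> H; apply: (eq_csmooth_upto oi _ (csmooth_upto_add oi (H 0) (H 1))) => t _.
  by rewrite sum_I2.
elim: n => [|n [IJ IK]].
  by split; split=> // t it; [have /curve_deriveP[] := jac_derive it | have /curve_deriveP[] := jac'_derive it].
split; split.
- by move=> t it; have /curve_deriveP[] := jac_derive it.
- by apply: (eq_csmooth_upto oi _ IK) => t it; have /curve_deriveP[] := jac_derive it.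
- by move=> t it; have /curve_deriveP[] := jac'_derive it.
pose term k t := (-1) * (\sum_a \sum_b (\sum_l jac i t 0 l * partial l (christoffel i k a b) ((crd i \o c) t)) * velocity i c t 0 a * velocity i c t 0 b
  + \sum_a \sum_b christoffel i k a b ((crd i \o c) t) * jac' i t 0 a * velocity i c t 0 b
  + \sum_a \sum_b christoffel i k a b ((crd i \o c) t) * velocity i c t 0 a * jac' i t 0 b).
apply: (eq_csmooth_upto oi (f := fun t => \row_k term k t)).
  move=> t it; have /curve_deriveP[_ ->] := jac'_derive it.
  apply/rowP => k; rewrite !mxE /term mulN1r; congr (- (_ + _ + _)).
apply: (csmooth_upto_row oi) => k.
apply: (eq_csmooth_upto oi (f := term k)); first by move=> t _; rewrite mxE.
have sJ a : csmooth_upto (I i) n (fun t => jac i t 0 a : R) by exact: csmooth_upto_entry.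
have sK a : csmooth_upto (I i) n (fun t => jac' i t 0 a : R) by exact: csmooth_upto_entry.
have sV a : csmooth_upto (I i) n (fun t => velocity i c t 0 a : R) by exact: csmooth_upto_entry.
apply: (csmooth_upto_mul oi (csmooth_upto_cst oi _ _)).
apply: (csmooth_upto_add oi); first apply: (csmooth_upto_add oi).
- apply: (ssum) => a; apply: (ssum) => b; apply: (csmooth_upto_mul oi) (sV b).
  apply: (csmooth_upto_mul oi) (sV a); apply: (ssum) => l; exact: (csmooth_upto_mul oi (sJ l) (sP _ _ _ _ _)).
- apply: (ssum) => a; apply: (ssum) => b; apply: (csmooth_upto_mul oi) (sV b).
  exact: (csmooth_upto_mul oi (sG _ _ _ _) (sK a)).
- apply: (ssum) => a; apply: (ssum) => b; apply: (csmooth_upto_mul oi) (sK b).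
  exact: (csmooth_upto_mul oi (sG _ _ _ _) (sV a)).
Qed.

Lemma jac_tr i j t : dom i (c t) -> dom j (c t) ->
  jac j t = jac i t *m jacobian (tr i j) (crd i (c t)).
Proof.
move=> it jt; rewrite tr_jacobian//.
have [_ [r r0 near_i] si] := variationP geo init it.
have [_ [r' r'0 near_j] sj] := variationP geo init jt.
have s1 := sd_comp sj (sd_linear _ (blin_fst _ _)).
have s2 := sd_comp (sd_comp si (sd_linear _ (blin_fst _ _))) (tr_strict it jt).
suff N : \forall l \near l0, (tr i j \o ((fun z => z.1) \o (fun l => phase i (gam l) t))) l
    = ((fun z => z.1) \o (fun l => phase j (gam l) t)) l.
  exact: (sd_unique s1 (sd_near N s2) w).
apply/near_norm; exists (Num.min r r'); first by rewrite lt_min r0.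
by move=> l; rewrite lt_min => /andP[/near_i il /near_j jl]; exact: tr_crd.
Qed.

(** [W] is the covariant derivative of the field written without [derive1]; differentiating it by
    means of the linearized equation reduces the claim to the polynomial identity
    [jacobi_identity]. *)
Lemma jac_jacobi_field : jacobi_field c jac.
Proof.
split.
  split; last by move=> i j t it jt; exact: jac_tr.
  move=> i t n it; have /csmoothP H : csmooth (I i) (jac i) by move=> m; exact: (jac_csmooth i m).1.
  exact: H.
move=> i t it; set x := crd i (c t); set v := velocity i c t.
have iz : img i x by exact: img_crd.
have [d d0 near_i] := near_path ((geo l0).1.1 t) (nbhs_dom it).
have dx : curve_derive (fun s => crd i (c s)) t v by exact: velocity_derive (geo l0).1 it.
have dv : curve_derive (velocity i c) t (- chr i x v v).
  exact: (curve_derive_blin (blin_snd _ _) (phase_derive (geo l0) it)).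
have dJ := jac_derive it; have dK := jac'_derive it.
pose W s := jac' i s + chr i (crd i (c s)) (velocity i c s) (jac i s).
have WE s : dom i (c s) -> cov_deriv i c (jac i) s = W s.
  by move=> is_; rewrite /cov_deriv; have /curve_deriveP[_ ->] := jac_derive is_.
pose W' : E := \row_k (
  - (\sum_a \sum_b plane_diff (christoffel i k a b) x (jac i t) * v 0 a * v 0 b
      + \sum_a \sum_b christoffel i k a b x * jac' i t 0 a * v 0 b
      + \sum_a \sum_b christoffel i k a b x * v 0 a * jac' i t 0 b)
  + \sum_a \sum_b ((plane_diff (christoffel i k a b) x v * v 0 a
      + christoffel i k a b x * - (\sum_p \sum_q christoffel i a p q x * v 0 p * v 0 q)) * jac i t 0 b
      + christoffel i k a b x * v 0 a * jac' i t 0 b)).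
have dW : curve_derive W t W'.
  apply: curve_derive_row => k.
  have -> : (fun s => W s 0 k : R) = fun s => jac' i s 0 k + \sum_a \sum_b
      christoffel i k a b (crd i (c s)) * velocity i c s 0 a * jac i s 0 b.
    by apply/funext => s; rewrite !mxE.
  rewrite mxE; apply: curve_derive_add.
    by have := curve_derive_coord k dK; rewrite !mxE.
  apply: curve_derive_sum2 => a; apply: curve_derive_sum2 => b; apply: curve_derive_mul; last exact: curve_derive_coord.
  apply: curve_derive_mul; last first.
    by have := curve_derive_coord a dv; rewrite !mxE.
  exact: (curve_derive_comp (smooth_sd (christoffel_smooth k a b) (nbhs_img iz)) dx).
have -> : cov_deriv i c (cov_deriv i c (jac i)) t = W' + chr i x v (W t).
  rewrite {1}/cov_deriv; congr (_ + _); last by rewrite WE.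
  apply: (iffLR (curve_deriveP _ _ _) _).2; apply: curve_derive_near dW.
  by apply/near_norm; exists d => // s /near_i is_; rewrite WE.
apply/rowP => k; rewrite !mxE.
have := @jacobi_identity R (fun k a b => christoffel i k a b x)
  (fun m k a b => partial m (christoffel i k a b) x) (fun a => v 0 a)
  (fun a => jac i t 0 a) (fun a => jac' i t 0 a) k.
have Gs q : christoffel i q 1 0 x = christoffel i q 0 1 x by exact: christoffel_sym.
have Ds m q : partial m (christoffel i q 1 0) x = partial m (christoffel i q 0 1) x.
  apply: (eq_partial (@open_img _ _ i)) => // y iy; exact: christoffel_sym.
move=> /(_ Gs Ds) id0; apply: etrans id0; congr (_ + _ + _ + _).
by apply: eq_bigr => a _; apply: eq_bigr => b _; rewrite !mxE.
Qed.

End Jacobi.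

(** * Energy and the Gauss lemma *)

Section Lowering.
Context {R : realType}.

(* D m a b stands for the derivative of the metric coefficient g a b in direction m. *)
Lemma metric_derivative (g : 'I_2 -> 'I_2 -> R) (D G : 'I_2 -> 'I_2 -> 'I_2 -> R)
    (v u u' : 'I_2 -> R) :
  (forall b p q, \sum_a g a b * G a p q = 2^-1 * (D p q b + D q p b - D b p q)) ->
  \sum_a \sum_b (((- \sum_p \sum_q G a p q * v p * v q) * g a b + v a * (\sum_m v m * D m a b)) * u b
     + v a * g a b * u' b)
  = 2^-1 * (\sum_b \sum_p \sum_q D b p q * v p * v q * u b) + \sum_a \sum_b v a * g a b * u' b.
Proof.
move=> H; apply/eqP; rewrite -subr_eq0; apply/eqP.
transitivity (\sum_b \sum_p \sum_q v p * v q * u b *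
   (2^-1 * (D p q b + D q p b - D b p q) - \sum_a g a b * G a p q)).
  by rewrite !sum_I2r; field.
rewrite big1// => b _; rewrite big1// => p _; rewrite big1// => q _.
by rewrite H subrr mulr0.
Qed.

Lemma metric_chr (g : 'I_2 -> 'I_2 -> R) (G : 'I_2 -> 'I_2 -> 'I_2 -> R) (v : 'I_2 -> R) :
  g 1 0 = g 0 1 ->
  \sum_a \sum_b v a * g a b * - (\sum_p \sum_q G b p q * v p * v q) =
  - \sum_b \sum_p \sum_q v p * v q * v b * (\sum_a g a b * G a p q).
Proof. by move=> gs; rewrite !sum_I2r gs; ring. Qed.

Lemma metric_cancel (D : 'I_2 -> 'I_2 -> 'I_2 -> R) (v : 'I_2 -> R) :
  2^-1 * (\sum_b \sum_p \sum_q D b p q * v p * v q * v b)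
  - \sum_b \sum_p \sum_q v p * v q * v b * (2^-1 * (D p q b + D q p b - D b p q)) = 0.
Proof. by rewrite !sum_I2r; field. Qed.

(** The last hypothesis says that the derivative of the energy with respect to the initial velocity
    is the same at time 0 and at a later time; the conclusion is half of it, after use of the
    symmetries. *)
Lemma energy_variation (g0 g : 'I_2 -> 'I_2 -> R) (D : 'I_2 -> 'I_2 -> 'I_2 -> R)
    (v0 w v J K : 'I_2 -> R) :
  g0 1 0 = g0 0 1 -> g 1 0 = g 0 1 -> (forall m, D m 1 0 = D m 0 1) ->
  \sum_a \sum_b ((w a * g0 a b + v0 a * 0) * v0 b + v0 a * g0 a b * w b) =
  \sum_a \sum_b ((K a * g a b + v a * (\sum_m J m * D m a b)) * v b + v a * g a b * K b) ->
  2^-1 * (\sum_b \sum_p \sum_q D b p q * v p * v q * J b) + \sum_a \sum_b v a * g a b * K b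
  = \sum_a \sum_b v0 a * g0 a b * w b.
Proof. by move=> s0 s Ds; rewrite !sum_I2r s0 s !Ds => H; lra. Qed.

End Lowering.

Section Exponential.
Context {R : realType} {M : riemannian_surface R}.
Implicit Types (i j : atlas_idx M) (x q : M).
Local Notation E := ('rV[R]_2).

Lemma christoffel_lower i z b p r : img i z ->
  \sum_a gmat i z a b * christoffel i a p r z =
  2^-1 * (partial p (fun w => gmat i w r b) z + partial r (fun w => gmat i w p b) z
          - partial b (fun w => gmat i w p r) z).
Proof.
move=> iz; pose T l := partial p (fun w => gmat i w r l) z
  + partial r (fun w => gmat i w p l) z - partial l (fun w => gmat i w p r) z.
rewrite -/(T b) /christoffel; under eq_bigr do rewrite mulrCA mulr_sumr.
rewrite -mulr_sumr exchange_big /=; congr (_ * _).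
under eq_bigr => l _ do under eq_bigr => a _ do rewrite mulrA.
under eq_bigr => l _.
  rewrite -mulr_suml.
  have -> : \sum_a gmat i z a b * invmx (gmat i z) a l = (gmat i z *m invmx (gmat i z)) b l.
    by rewrite mxE; apply: eq_bigr => a _; rewrite (gmat_symE _ _ iz).
  rewrite mulmxV ?gmat_unit// mxE.
  over.
rewrite (bigD1 b)//= eqxx mul1r big1 ?addr0// => l lb.
by rewrite eq_sym (negbTE lb) mul0r.
Qed.

Definition metric i (z u v : E) : R := \sum_a \sum_b u 0 a * gmat i z a b * v 0 b.

Lemma inner_metric i x (u v : E) : inner i x u v = metric i (crd i x) u v.
Proof. exact: innerE. Qed.

Lemma gmat_entry_strict i z a b : img i z -> strict_derive (fun w => gmat i w a b : R) z
  (plane_diff (fun w => gmat i w a b : R) z).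
Proof.
move=> iz; apply: smooth_sd (nbhs_img iz).
by apply: (smooth_on_entry (@open_img _ _ i)); exact: gmat_smooth.
Qed.

(** The derivative is the product of the velocity with the covariant derivative of [u], written out
    in coordinates: [c] has no acceleration, and of the metric only the derivative in the direction
    [u] survives. *)
Lemma inner_velocity_derive i (c : R -> M) t (u : R -> E) (u' : E) : geodesic c -> dom i (c t) ->
  curve_derive u t u' ->
  curve_derive (fun s => inner i (c s) (velocity i c s) (u s)) t
    (2^-1 * (\sum_b \sum_p \sum_q partial b (fun w => gmat i w p q) (crd i (c t)) *
        velocity i c t 0 p * velocity i c t 0 q * u t 0 b)
     + metric i (crd i (c t)) (velocity i c t) u').
Proof.
move=> gc it du; have iz := img_crd it.
have dx := velocity_derive gc.1 it.
have dv : curve_derive (velocity i c) t (- chr i (crd i (c t)) (velocity i c t) (velocity i c t)).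
  exact: (curve_derive_blin (blin_snd _ _) (phase_derive gc it)).
have -> : (fun s => inner i (c s) (velocity i c s) (u s)) = fun s => \sum_a \sum_b
    velocity i c s 0 a * gmat i (crd i (c s)) a b * u s 0 b.
  by apply/funext => s; rewrite innerE.
rewrite /metric -(@metric_derivative _ (fun a b => gmat i (crd i (c t)) a b)
   (fun m a b => partial m (fun w => gmat i w a b : R) (crd i (c t)))
   (fun a p r => christoffel i a p r (crd i (c t))) (fun a => velocity i c t 0 a)
   (fun b => u t 0 b) (fun b => u' 0 b)); last by move=> *; exact: christoffel_lower.
apply: curve_derive_sum2 => a; apply: curve_derive_sum2 => b.
apply: curve_derive_mul; last exact: curve_derive_coord.
apply: curve_derive_mul.
  by have := curve_derive_coord a dv; rewrite !mxE.
exact: (curve_derive_comp (gmat_entry_strict a b iz) dx).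
Qed.

Definition energy (c : R -> M) t := inner (chart_at (c t)) (c t)
  (velocity (chart_at (c t)) c t) (velocity (chart_at (c t)) c t).

Lemma inner_curve_tr (c : R -> M) i j t (u u' : E) : smooth_curve c -> dom i (c t) -> dom j (c t) ->
  u' = u *m jacobian (tr i j) (crd i (c t)) ->
  inner i (c t) (velocity i c t) u = inner j (c t) (velocity j c t) u'.
Proof. by move=> sc it jt ->; rewrite (velocity_tr sc it jt) -inner_tr. Qed.

Lemma energyE c i t : smooth_curve c -> dom i (c t) ->
  energy c t = inner i (c t) (velocity i c t) (velocity i c t).
Proof.
move=> sc it; rewrite /energy; apply: inner_curve_tr => //; first exact: mem_chart_at.
by apply: velocity_tr => //; exact: mem_chart_at.
Qed.

Lemma constant_of_derive0 (f : R -> R) : (forall t, curve_derive f t 0) -> forall s t, f s = f t.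
Proof.
move=> df s t; apply/eqP; rewrite -subr_eq0 -normr_le0.
rewrite -(mul0r `|s - t|); apply: (mean_value_path (f' := fun=> 0)) => r _ _.
  exact: df.
by rewrite normr0.
Qed.

Lemma energy_constant c : geodesic c -> forall s t, energy c s = energy c t.
Proof.
move=> gc; apply: constant_of_derive0 => t; pose i := chart_at (c t).
have it : dom i (c t) by exact: mem_chart_at.
have iz := img_crd it.
have [d d0 near_i] := near_path (gc.1.1 t) (nbhs_dom it).
have dv : curve_derive (velocity i c) t (- chr i (crd i (c t)) (velocity i c t) (velocity i c t)).
  exact: (curve_derive_blin (blin_snd _ _) (phase_derive gc it)).
have := inner_velocity_derive gc it dv.
have -> : 2^-1 * (\sum_b \sum_p \sum_q partial b (fun w => gmat i w p q) (crd i (c t)) *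
        velocity i c t 0 p * velocity i c t 0 q * velocity i c t 0 b)
     + metric i (crd i (c t)) (velocity i c t) (- chr i (crd i (c t)) (velocity i c t) (velocity i c t)) = 0.
  pose D m a b := partial m (fun w => gmat i w a b : R) (crd i (c t)).
  pose v a := velocity i c t 0 a.
  have -> : metric i (crd i (c t)) (velocity i c t) (- chr i (crd i (c t)) (velocity i c t) (velocity i c t)) =
    - \sum_b \sum_p \sum_q v p * v q * v b * (\sum_a gmat i (crd i (c t)) a b * christoffel i a p q (crd i (c t))).
    rewrite -(@metric_chr _ (fun a b => gmat i (crd i (c t)) a b)
      (fun a p r => christoffel i a p r (crd i (c t))) v); last exact: gmat_symE.
    by apply: eq_bigr => a _; apply: eq_bigr => b _; rewrite !mxE.
  transitivity (2^-1 * (\sum_b \sum_p \sum_q D b p q * v p * v q * v b)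
     - \sum_b \sum_p \sum_q v p * v q * v b * (2^-1 * (D p q b + D q p b - D b p q))).
    congr (_ - _); apply: eq_bigr => b _; apply: eq_bigr => p _; apply: eq_bigr => q _.
    by rewrite christoffel_lower.
  exact: metric_cancel.
apply: curve_derive_near; apply/near_norm; exists d; first exact: d0.
  move=> s /near_i is_.
by rewrite (energyE gc.1 is_).
Qed.

Section Gauss.
Context (gam : E -> R -> M) (v0 : E) (q : M) (i0 : atlas_idx M).
Hypothesis i0q : dom i0 q.
Hypothesis geo : forall v, geodesic (gam v).
Hypothesis gam0 : forall v, gam v 0 = q.
Hypothesis gam'0 : forall v, velocity i0 (gam v) 0 = v.

Lemma radial_init : flow_at gam v0 i0 0 (fun w => (0, w)).
Proof.
split; first by rewrite gam0.
  by exists 1 => // l _; rewrite gam0.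
have -> : (fun l => phase i0 (gam l) 0) = fun l => (crd i0 q, l).
  by apply/funext => l; rewrite /phase gam0 gam'0.
by apply: sd_pair; [exact: sd_cst | exact: sd_linear (blin_id _)].
Qed.

Lemma jac_init i w : dom i q -> jac gam v0 w i 0 = 0.
Proof.
move=> iq; have H : jac gam v0 w i0 0 = 0.
  by rewrite /jac (variation_unique geo radial_init radial_init).
by rewrite (jac_tr geo radial_init w (i := i0)) ?gam0// H mul0mx.
Qed.

Lemma jac'_init w : jac' gam v0 w i0 0 = w.
Proof. by rewrite /jac' (variation_unique geo radial_init radial_init). Qed.

(** A Jacobi field vanishing at times 0 and 1 vanishes identically for lack of conjugate points, and
    its derivative at time 0 is [w]. *)
Lemma jac_nondegenerate w i : no_conjugate_points M -> dom i (gam v0 1) ->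
  jac gam v0 w i 1 = 0 -> w = 0.
Proof.
move=> nc i1 J1; apply: contrapT => w0.
apply: (nc (gam v0) 0 1 (geo v0) ltr01); exists (jac gam v0 w); split.
- by have := jac_jacobi_field geo radial_init w.
- apply: contrapT => nJ; apply: w0.
  have i00 : dom i0 (gam v0 0) by rewrite gam0.
  have [d d0 near_i] := near_path ((geo v0).1.1 0) (nbhs_dom i00).
  have dJ := jac_derive geo radial_init w i00.
  rewrite jac'_init in dJ; apply: (curve_derive_unique dJ).
  have c0 : curve_derive (fun _ : R => 0 : E) 0 0.
    by have := sd_curve (sd_cst (0 : E) (0 : R)).
  apply: curve_derive_near c0; apply/near_norm; exists d; first exact: d0.
  move=> s /near_i is_.
  apply/esym; apply: contrapT => Js; apply: nJ; exists i0, s.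
  split; [exact: is_ | exact: Js].
- by move=> j; rewrite gam0 => jq; exact: jac_init.
- by move=> j j1; rewrite (jac_tr geo radial_init w i1 j1) J1 mul0mx.
Qed.

Definition radial_product w t := let i := chart_at (gam v0 t) in
  inner i (gam v0 t) (velocity i (gam v0) t) (jac gam v0 w i t).

Lemma radial_productE w i t : dom i (gam v0 t) ->
  radial_product w t = inner i (gam v0 t) (velocity i (gam v0) t) (jac gam v0 w i t).
Proof.
move=> it; have ct := mem_chart_at (gam v0 t).
apply: inner_curve_tr => //; first exact: (geo v0).1.
by have := jac_tr geo radial_init w ct it.
Qed.

(** The derivative is the product of the velocity with the covariant derivative of the field, hence
    half the variation of the energy in direction [w]; energy is constant in time, so this may be
    evaluated at time 0. *)
Lemma radial_product_derive w t : curve_derive (radial_product w) t (inner i0 q v0 w).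
Proof.
pose c := gam v0; pose i := chart_at (c t).
have it : dom i (c t) by exact: mem_chart_at.
have iz := img_crd it.
have [d d0 near_i] := near_path ((geo v0).1.1 t) (nbhs_dom it).
have dJ := jac_derive geo radial_init w it.
have := inner_velocity_derive (geo v0) it dJ.
suff -> : 2^-1 * (\sum_b \sum_p \sum_q0 partial b (fun w0 => gmat i w0 p q0) (crd i (c t)) *
     velocity i c t 0 p * velocity i c t 0 q0 * jac gam v0 w i t 0 b) +
  metric i (crd i (c t)) (velocity i c t) (jac' gam v0 w i t) = inner i0 q v0 w.
  move=> H; apply: (curve_derive_near _ H).
  apply/near_norm; exists d; first exact: d0.
  move=> s /near_i is_; rewrite (radial_productE w is_); reflexivity.
have [_ [r r0 near_l] sV] := variationP geo radial_init it.
set z := phase i c t in sV.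
have d1 : strict_derive (fun u : E * E => u.1) z (fun h => h.1) by exact: sd_linear (blin_fst _ _).
have d2 : strict_derive (fun u : E * E => u.2) z (fun h => h.2) by exact: sd_linear (blin_snd _ _).
have dv a : strict_derive (fun u : E * E => u.2 0 a : R) z (fun h => h.2 0 a).
  exact: sd_comp d2 (sd_coord _ a).
have dg a b : strict_derive (fun u : E * E => gmat i u.1 a b : R) z
    (fun h => plane_diff (fun w => gmat i w a b : R) z.1 h.1).
  exact: (sd_comp d1 (gmat_entry_strict a b iz)).
have den := sd_sum (fun a => sd_sum (fun b => sd_mul (sd_mul (dv a) (dg a b)) (dv b))).
pose FE (l : E) : R := \sum_a \sum_b velocity i (gam l) t 0 a * gmat i (crd i (gam l t)) a b * velocity i (gam l) t 0 b.
pose FQ (l : E) : R := \sum_a \sum_b l 0 a * gmat i0 (crd i0 q) a b * l 0 b.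
have dE : strict_derive FE v0 _ := sd_comp sV den.
have dQ : strict_derive FQ v0 _ :=
  sd_sum (fun a => sd_sum (fun b => sd_mul (sd_mul (sd_coord v0 a) (sd_cst (gmat i0 (crd i0 q) a b) v0)) (sd_coord v0 b))).
have EQ : \forall l \near v0, FQ l = FE l.
  apply/near_norm; exists r; first exact: r0.
  move=> l /near_l il.
  have i00 : dom i0 (gam l 0) by rewrite gam0.
  have := energy_constant (geo l) 0 t; rewrite (energyE (geo l).1 i00) (energyE (geo l).1 il).
  rewrite !innerE gam'0 gam0 /FQ /FE => ->; reflexivity.
have := sd_unique (sd_near EQ dQ) dE w; rewrite /= -/z.
rewrite -/(jac gam v0 w i t) -/(jac' gam v0 w i t) innerE.
apply: (@energy_variation _ (fun a b => gmat i0 (crd i0 q) a b) (fun a b => gmat i (crd i (c t)) a b)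
  (fun m a b => partial m (fun w => gmat i w a b) (crd i (c t))) (fun a => v0 0 a) (fun a => w 0 a)
  (fun a => velocity i c t 0 a) (fun a => jac gam v0 w i t 0 a) (fun a => jac' gam v0 w i t 0 a)).
- exact: gmat_symE (img_crd i0q).
- exact: gmat_symE.
- by move=> m; apply: (eq_partial (@open_img _ _ i)) => // y iy; exact: gmat_symE.
Qed.

Lemma gauss w i : dom i (gam v0 1) ->
  inner i (gam v0 1) (velocity i (gam v0) 1) (jac gam v0 w i 1) = inner i0 q v0 w.
Proof.
move=> i1; rewrite -radial_productE//.
have i00 : dom i0 (gam v0 0) by rewrite gam0.
have R0 : radial_product w 0 = 0.
  by rewrite (radial_productE w i00) jac_init// /inner trmx0 mulmx0 mxE.
pose k := inner i0 q v0 w.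
have D t : curve_derive (fun t => radial_product w t - (t - 0) *: k) t 0.
  by have := curve_derive_sub (radial_product_derive w t) (curve_derive_linear k 0 t); rewrite subrr.
have := constant_of_derive0 D 1 0.
have aux (a b : R) : a - (1 - 0) * b = 0 - (0 - 0) * b -> a = b.
  by rewrite !subr0 mul1r mul0r subr0 => /eqP; rewrite subr_eq0 => /eqP.
by rewrite R0; exact: aux.
Qed.

End Gauss.

End Exponential.

(** * Local inversion *)

Section LocalInverse.
Context {R : realType} {n : nat}.
Local Notation V := 'rV[R]_n.

(** The linear part expands at least by [1 / C], and a remainder of relative size [1 / (2 C)] costs
    half of that. *)
Lemma sd_expanding (f : V -> V) (x : V) (A : 'M[R]_n) : A \in unitmx ->
  strict_derive f x (fun h => h *m A) -> exists2 C : R, 0 < C & exists2 d : R, 0 < d &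
  forall u w, `|u - x| < d -> `|w - x| < d -> `|u - w| <= C * `|f u - f w|.
Proof.
move=> uA [_ df]; have [C C0 HC] := (blin_mulmx (invmx A)).2.
have e0 : 0 < (2 * C)^-1 by rewrite invr_gt0 mulr_gt0.
have [d d0 fd] := df _ e0; exists (2 * C); first by rewrite mulr_gt0.
exists d; first exact: d0.
move=> u w ux wx; have H := fd u w ux wx.
have : `|u - w| <= C * (`|f u - f w| + (2 * C)^-1 * `|u - w|).
  have := HC ((u - w) *m A); rewrite mulmxK// => /le_trans; apply; rewrite ler_wpM2l ?(ltW C0)//.
  have -> : (u - w) *m A = (f u - f w) - (f u - f w - (u - w) *m A) by linear_id.
  by rewrite (le_trans (ler_normB _ _))// lerD2l.
rewrite mulrDr mulrA invfM mulrCA divff ?gt_eqF// mulr1.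
have := normr_ge0 (u - w); move: (`|u - w|) (`|f u - f w|) => a b; lra.
Qed.

Lemma sd_locally_injective (f : V -> V) (x : V) (A : 'M[R]_n) : A \in unitmx ->
  strict_derive f x (fun h => h *m A) -> exists2 d : R, 0 < d &
  forall u w, `|u - x| < d -> `|w - x| < d -> f u = f w -> u = w.
Proof.
move=> uA sf; have [C C0 [d d0 H]] := sd_expanding uA sf; exists d; first exact: d0.
move=> u w ux wx fuw; apply/eqP; rewrite -subr_eq0 -normr_le0.
by rewrite (le_trans (H u w ux wx))// fuw subrr normr0 mulr0.
Qed.

End LocalInverse.

Section LocalSurjectivity.
Context {R : realType} {n : nat}.
Local Notation V := 'rV[R]_n.+1.

(* A point of the closed ball minimizing the distance from f u to y is a
   preimage of y: otherwise a Newton step would improve it. *)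
Lemma sd_locally_surjective (f : V -> V) (x : V) (A : 'M[R]_n.+1) (r : R) : A \in unitmx ->
  strict_derive f x (fun h => h *m A) -> 0 < r -> exists2 d : R, 0 < d &
  forall y, `|y - f x| < d -> exists2 u, `|u - x| < r & f u = y.
Proof.
move=> uA sf r0; have [C C0 [d1 d10 Hexp]] := sd_expanding uA sf.
have [D D0 HD] := (blin_mulmx (invmx A)).2.
have [L L0 [d2 d20 lip]] := sd_lipschitz sf.
have e0 : 0 < (2 * D)^-1 by rewrite invr_gt0 mulr_gt0.
have [d3 d30 fd] := sf.2 _ e0.
pose m := Num.min r (Num.min d1 (Num.min d2 d3)).
have m0 : 0 < m by rewrite !lt_min r0 d10 d20.
pose s := m / 2; have s0 : 0 < s by rewrite divr_gt0.
have sm : s < m by rewrite /s ltr_pdivrMr// ltr_pMr// ltr1n.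
have sub w : `|w - x| <= s -> [/\ `|w - x| < r, `|w - x| < d1, `|w - x| < d2 & `|w - x| < d3].
  by move=> /le_lt_trans/(_ sm); rewrite !lt_min => /and4P[].
have xs : `|x - x| <= s by rewrite subrr normr0 ltW.
pose d := s / (3 * C); have d0 : 0 < d by rewrite divr_gt0// mulr_gt0.
exists d; first exact: d0.
move=> y yx.
have cont u : `|u - x| <= s -> {for u, continuous (fun u => `|f u - y|)}.
  move=> us; have [_ _ ud2 _] := sub u us.
  apply/continuous_norm => e e'0.
  have g0 : 0 < Num.min (d2 - `|u - x|) (e / L) by rewrite lt_min subr_gt0 ud2 divr_gt0.
  exists (Num.min (d2 - `|u - x|) (e / L)); first exact: g0.
  move=> w; rewrite lt_min => /andP[w1 w2].
  have wd2 : `|w - x| < d2.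
    have -> : w - x = (w - u) + (u - x) by linear_id.
    by rewrite (le_lt_trans (ler_normD _ _))// -ltrBrDr.
  rewrite (le_trans (ler_dist_dist _ _))//.
  have -> : f w - y - (f u - y) = f w - f u by linear_id.
  by rewrite (le_trans (lip _ _ wd2 ud2))// mulrC -ler_pdivlMr// ltW.
have [|||u us umin] := @EVT_min_rV R n.+1 (fun u => `|f u - y|) [set u | `|u - x| <= s].
- by exists x.
- exact: compact_cball.
- by apply: continuous_in_subspaceT => u /set_mem us; exact: cont.
move/set_mem: us => /= us.
have fx : `|f u - y| < d.
  apply: le_lt_trans (umin x _) _; first by rewrite inE.
  by rewrite distrC.
have [xr xd1 xd2 xd3] := sub x xs; have [ur ud1 ud2 ud3] := sub u us.
exists u => //.
have u_int : `|u - x| < s.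
  apply: le_lt_trans (Hexp u x ud1 xd1) _.
  have -> : f u - f x = (f u - y) + (y - f x) by linear_id.
  have : `|(f u - y) + (y - f x)| < 2 * d.
    by rewrite (le_lt_trans (ler_normD _ _))// mulr_natl mulr2n ltrD.
  move: (`|_ + _|) => a ad; rewrite mulrC -ltr_pdivlMr//.
  apply: lt_trans ad _; rewrite /d mulrA invfM mulrA ltr_pM2r ?invr_gt0// mulrAC mulrC mulrA.
  by clear - s0; lra.
apply/eqP; rewrite -subr_eq0 -normr_eq0; apply: contraT => fu0.
have p0 : 0 < `|f u - y| by rewrite lt_neqAle eq_sym fu0 normr_ge0.
pose h := (y - f u) *m invmx A.
have hD : `|h| <= D * `|f u - y| by rewrite distrC; exact: HD.
have g0 : 0 < s - `|u - x| by rewrite subr_gt0.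
have [e e'0 eh] := small_scale h g0.
pose k := Num.min e 1; have k0 : 0 < k by rewrite lt_min e'0 ltr01.
have k1 : k <= 1 by rewrite ge_min lexx orbT.
have kh : `|k *: h| < s - `|u - x|.
  apply: le_lt_trans eh; rewrite !normrZ !gtr0_norm// ler_wpM2r//.
  by rewrite ge_min lexx.
pose w := u + k *: h.
have wu : w - u = k *: h by rewrite /w; linear_id.
have ws : `|w - x| <= s.
  have -> : w - x = k *: h + (u - x) by rewrite -wu; linear_id.
  by rewrite (le_trans (ler_normD _ _))// -lerBrDr ltW.
have [_ _ _ wd3] := sub w ws.
have := umin w; rewrite inE => /(_ ws); rewrite leNgt => /negP; case.
have H := fd w u wd3 ud3; rewrite wu in H.
have E : (k *: h) *m A = k *: (y - f u) by rewrite -scalemxAl /h mulmxKV.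
rewrite E in H.
have -> : f w - y = (f w - f u - k *: (y - f u)) + (1 - k) *: (f u - y) by linear_id.
apply: le_lt_trans (ler_normD _ _) _.
rewrite (normrZ (1 - k)) (@ger0_norm _ (1 - k)) ?subr_ge0//.
have H2 : (2 * D)^-1 * `|k *: h| <= k / 2 * `|f u - y|.
  rewrite normrZ gtr0_norm//.
  have hD' : D^-1 * `|h| <= `|f u - y| by rewrite ler_pdivrMl.
  have -> : (2 * D)^-1 * (k * `|h|) = k / 2 * (D^-1 * `|h|) by rewrite invfM; ring.
  by apply: ler_wpM2l => //; apply: divr_ge0; [exact: ltW|].
move: H H2 p0 k0; move: (`|f w - _ - _|) (`|f u - y|) (_ * `|k *: h|) => a b c' ac cb b0 k0; nra.
Qed.

End LocalSurjectivity.

Section StrictLift.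
Context {R : realType} {U : normedModType R} {n : nat}.
Local Notation V := 'rV[R]_n.

(** Since [f] is expanding near [p z], the continuous lift [p] is Lipschitz; then the increment of
    [f \o p], computed in two ways, can be solved for the increment of [p]. *)
Lemma sd_lift (f : V -> V) (p : U -> V) (z : U) (A : 'M[R]_n) K : A \in unitmx ->
  strict_derive f (p z) (fun h => h *m A) -> {for z, continuous p} ->
  strict_derive (f \o p) z K -> strict_derive p z (fun h => K h *m invmx A).
Proof.
move=> uA sf cp sfp; split; first exact: blin_comp (blin_mulmx _) sfp.1.
have [C C0 [d1 d10 Hexp]] := sd_expanding uA sf.
have [D D0 HD] := (blin_mulmx (invmx A)).2.
have [L L0 [d2 d20 lip]] := sd_lipschitz sfp.
move=> e e0; have e1 : 0 < e / (2 * D) by rewrite divr_gt0// mulr_gt0.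
have e2 : 0 < e / (2 * D * (C * L)) by rewrite divr_gt0// !mulr_gt0.
have [d3 d30 H3] := sf.2 _ e2; have [d4 d40 H4] := sfp.2 _ e1.
have m0 : 0 < Num.min d1 d3 / 2 by rewrite divr_gt0// lt_min d10.
have [d5 d50 H5] := iffLR (continuous_norm _ _) cp _ m0.
exists (Num.min d2 (Num.min d4 d5)); first by rewrite !lt_min d20 d40.
move=> u w; rewrite !lt_min => /and3P[u2 u4 u5] /and3P[w2 w4 w5].
have close y : `|y - z| < d5 -> `|p y - p z| < d1 /\ `|p y - p z| < d3.
  move=> /H5 H; have m1 : 0 < Num.min d1 d3 by rewrite lt_min d10.
  have := le_half_lt m1 H; rewrite lt_min => /andP[]; by split.
have [pu1 pu3] := close u u5; have [pw1 pw3] := close w w5.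
have P : `|p u - p w| <= C * L * `|u - w|.
  rewrite (le_trans (Hexp _ _ pu1 pw1))// -mulrA ler_pM2l//.
  exact: lip u w u2 w2.
have E1 := H4 u w u4 w4; have E2 := H3 _ _ pu3 pw3.
pose Q := (f (p u) - f (p w) - K (u - w)) - (f (p u) - f (p w) - (p u - p w) *m A).
have QE : Q *m invmx A = p u - p w - K (u - w) *m invmx A.
  have -> : Q = (p u - p w) *m A - K (u - w) by rewrite /Q; linear_id.
  by rewrite mulmxBl mulmxK.
rewrite -QE (le_trans (HD _))//.
have Qn : `|Q| <= e / (2 * D) * `|u - w| + e / (2 * D * (C * L)) * `|p u - p w|.
  by rewrite (le_trans (ler_normB _ _))// lerD.
have a0 : 0 < C * L by rewrite mulr_gt0.
move: Qn P D0 a0 e2; move: (`|Q|) (`|p u - p w|) (`|u - w|) (C * L) => q a b c Qn P D0 a0 e2'.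
have H : q <= e / (2 * D) * b + e / (2 * D * c) * (c * b).
  by rewrite (le_trans Qn)// lerD2l ler_wpM2l// ltW.
have -> : e * b = D * (e / (2 * D) * b + e / (2 * D * c) * (c * b)).
  by field; rewrite !gt_eqF.
by rewrite ler_pM2l.
Qed.

End StrictLift.

(** * The exponential map *)

Section InnerProduct.
Context {R : realType} {M : riemannian_surface R}.
Implicit Types (i : atlas_idx M) (x : M).
Local Notation E := ('rV[R]_2).

Lemma innerDl i x (u v w : E) : inner i x (u + v) w = inner i x u w + inner i x v w.
Proof. by rewrite /inner !mulmxDl mxE. Qed.

Lemma innerZl i x a (u w : E) : inner i x (a *: u) w = a * inner i x u w.
Proof. by rewrite /inner -!scalemxAl mxE. Qed.

Lemma innerDr i x (u v w : E) : inner i x u (v + w) = inner i x u v + inner i x u w.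
Proof. by rewrite /inner linearD /= mulmxDr mxE. Qed.

Lemma innerZr i x a (u w : E) : inner i x u (a *: w) = a * inner i x u w.
Proof. by rewrite /inner linearZ /= -scalemxAr mxE. Qed.

Lemma inner0r i x (u : E) : inner i x u 0 = 0.
Proof. by rewrite -(scale0r (0 : E)) innerZr mul0r. Qed.

Lemma inner_gt0 i x (u : E) : dom i x -> u != 0 -> 0 < inner i x u u.
Proof. exact: gmat_posdef. Qed.

Lemma inner_ge0 i x (u : E) : dom i x -> 0 <= inner i x u u.
Proof.
by move=> ix; have [->|/(inner_gt0 ix)/ltW//] := eqVneq u 0; rewrite inner0r.
Qed.

Lemma inner_eq0 i x (u : E) : dom i x -> inner i x u u = 0 -> u = 0.
Proof.
by move=> ix u0; apply/eqP; apply: contraT => /(inner_gt0 ix); rewrite u0 ltxx.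
Qed.

Lemma inner_combination i x (a b : R) (u v : E) : dom i x ->
  inner i x (a *: u + b *: v) (a *: u + b *: v) =
  a ^+ 2 * inner i x u u + 2 * a * b * inner i x u v + b ^+ 2 * inner i x v v.
Proof.
move=> ix; rewrite !innerDl !innerDr !innerZl !innerZr (inner_sym v u ix).
by move: (inner i x u u) (inner i x u v) (inner i x v v) => A B C; ring.
Qed.

Lemma cauchy_schwarz i x (u v : E) : dom i x ->
  inner i x u v ^+ 2 <= inner i x u u * inner i x v v.
Proof.
move=> ix; have [->|v0] := eqVneq v 0; first by rewrite !inner0r expr0n mulr0.
have := inner_ge0 (inner i x v v *: u + - inner i x u v *: v) ix.
have := inner_gt0 ix v0; rewrite inner_combination//.
move: (inner i x u u) (inner i x u v) (inner i x v v) => A B C C0.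
have -> : C ^+ 2 * A + 2 * C * - B * B + (- B) ^+ 2 * C = C * (A * C - B ^+ 2) by ring.
by rewrite pmulr_rge0// subr_ge0.
Qed.

Lemma abs_inner_le i x (u v : E) : dom i x ->
  `|inner i x u v| <= Num.sqrt (inner i x u u) * Num.sqrt (inner i x v v).
Proof.
move=> ix; rewrite -sqrtrM ?inner_ge0// -[leLHS]sqrtr_sqr ler_wsqrtr//.
exact: cauchy_schwarz.
Qed.

(** For a positive definite form in two variables, the reciprocal of the least eigenvalue is at most
    trace over determinant. *)
Lemma inner_coercive i x : dom i x -> exists2 K : R, 0 < K &
  forall u, `|u| ^+ 2 <= K * inner i x u u.
Proof.
move=> ix; pose a := gmat i (crd i x) 0 0; pose b := gmat i (crd i x) 0 1; pose c := gmat i (crd i x) 1 1.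
have Q u : inner i x u u = a * u 0 0 ^+ 2 + 2 * b * u 0 0 * u 0 1 + c * u 0 1 ^+ 2.
  rewrite innerE !sum_I2 -/a -/b -/c (gmat_symE 1 0 (img_crd ix)) -/b; ring.
pose row2 (s t : R) : E := \row_k (if k == 0 then s else t).
have r0 s t : row2 s t 0 0 = s by rewrite mxE.
have r1 s t : row2 s t 0 1 = t by rewrite mxE.
have a0 : 0 < a.
  have := @inner_gt0 i x (row2 1 0) ix; rewrite Q r0 r1 => H.
  have : row2 1 0 != 0 by apply/eqP => /rowP/(_ 0); rewrite r0 mxE => /eqP; rewrite oner_eq0.
  by move/H; clear; lra.
have d0 : 0 < a * c - b ^+ 2.
  have := @inner_gt0 i x (row2 (- b) a) ix; rewrite Q r0 r1 => H.
  have : row2 (- b) a != 0 by apply/eqP => /rowP/(_ 1); rewrite r1 mxE => /eqP; rewrite gt_eqF.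
  move/H; have -> : a * (- b) ^+ 2 + 2 * b * (- b) * a + c * a ^+ 2 = a * (a * c - b ^+ 2) by ring.
  by rewrite pmulr_rgt0.
have c0 : 0 < c by clear - a0 d0; nra.
exists ((a + c) / (a * c - b ^+ 2)); first by rewrite divr_gt0// addr_gt0.
move=> u; rewrite mulrAC ler_pdivlMr//.
have H k : u 0 k ^+ 2 * (a * c - b ^+ 2) <= (a + c) * inner i x u u.
  have Hk : u 0 k = u 0 0 \/ u 0 k = u 0 1 by move: k; apply: I2_ind; [left|right].
  rewrite Q; move: Hk; move: (u 0 k) (u 0 0) (u 0 1) => z s t Hz.
  have H1 : 0 <= a * s ^+ 2 + 2 * b * s * t + c * t ^+ 2.
    by have := @inner_ge0 i x (row2 s t) ix; rewrite Q r0 r1.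
  clear - a0 c0 H1 Hz.
  have := sqr_ge0 (c * t + b * s); have := sqr_ge0 (a * s + b * t).
  by case: Hz => -> h1 h2; nra.
rewrite -ler_pdivlMr//; set B := _ / _.
have B0 : 0 <= B := divr_ge0 (mulr_ge0 (ltW (addr_gt0 a0 c0)) (inner_ge0 u ix)) (ltW d0).
rewrite -(sqr_sqrtr B0) ler_sqr ?nnegrE ?normr_ge0 ?sqrtr_ge0//.
apply: norm_row_le; first exact: sqrtr_ge0.
move=> k; rewrite -sqrtr_sqr ler_wsqrtr// /B ler_pdivlMr//.
Qed.

End InnerProduct.

Section ExponentialMap.
Context {R : realType} {M : riemannian_surface R}.
Implicit Types (i j : atlas_idx M) (x q : M).
Local Notation E := ('rV[R]_2).

Section Distance.
Hypothesis complete : geodesically_complete M.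

(** Tangent vectors at [q] are identified with rows through the chart [chart_at q], here and in all
    later uses of the exponential map. *)
Definition geo q (v : E) : R -> M := projT1 (cid (complete v (mem_chart_at q))).

Lemma geo_geodesic q v : geodesic (geo q v).
Proof. by rewrite /geo; case: cid => c []. Qed.

Lemma geo_start q v : geo q v 0 = q.
Proof. by rewrite /geo; case: cid => c []. Qed.

Lemma geo_velocity q v : velocity (chart_at q) (geo q v) 0 = v.
Proof. by rewrite /geo; case: cid => c []. Qed.

Lemma geo_unique c q v : geodesic c -> c 0 = q -> velocity (chart_at q) c 0 = v -> c = geo q v.
Proof.
move=> gc c0 cv; have qq := mem_chart_at q.
apply: (@geodesic_unique _ _ c (geo q v) (chart_at q) 0 gc (geo_geodesic q v)).
- by rewrite c0.
- by rewrite geo_start.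
- by rewrite /phase c0 geo_start cv geo_velocity.
Qed.

Lemma geo_scale q v a : (fun t => geo q v (a * t)) = geo q (a *: v).
Proof.
have gg := geo_geodesic q v; have E0 : a * 0 + 0 = 0 :> R by rewrite mulr0 addr0.
have -> : (fun t => geo q v (a * t)) = fun t => geo q v (a * t + 0) by apply/funext => t; rewrite addr0.
apply: geo_unique; first exact: geodesic_affine.
  by rewrite E0 geo_start.
rewrite velocity_affine ?E0 ?geo_velocity ?geo_start//; [exact: gg.1 | exact: mem_chart_at].
Qed.

Definition expo q (v : E) : M := geo q v 1.

Lemma geo_expo q v t : geo q v t = expo q (t *: v).
Proof. by rewrite /expo -geo_scale mulr1. Qed.

Lemma expo0 q : expo q 0 = q.
Proof. by rewrite -(scale0r (0 : E)) -geo_expo geo_start. Qed.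

Definition nsq q (v : E) : R := inner (chart_at q) q v v.

Lemma geo_energy q v i t : dom i (geo q v t) ->
  inner i (geo q v t) (velocity i (geo q v) t) (velocity i (geo q v) t) = nsq q v.
Proof.
move=> it; have g := geo_geodesic q v.
have i0 : dom (chart_at q) (geo q v 0) by rewrite geo_start; exact: mem_chart_at.
rewrite -(energyE g.1 it) (energy_constant g t 0) (energyE g.1 i0) geo_start geo_velocity.
reflexivity.
Qed.

Hypothesis no_conj : no_conjugate_points M.

Definition dexpo q i (v : E) : 'M[R]_2 := jacobian (fun w => crd i (expo q w)) v.

Let radial q v := radial_init v (mem_chart_at q) (geo_start q) (geo_velocity q).

Lemma expo_flow q v i : dom i (expo q v) -> 
  flow_at (geo q) v i 1 (variation (geo q) v i 1).
Proof. by move=> iv; apply: (variationP (geo_geodesic q) (radial q v)). Qed.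

Lemma expo_continuous q : continuous (expo q).
Proof. by move=> v; exact: (flow_continuous (expo_flow (mem_chart_at (expo q v)))). Qed.

Lemma dexpo_jac q v i w : dom i (expo q v) -> w *m dexpo q i v = jac (geo q) v w i 1.
Proof.
move=> iv; have [_ _ sV] := expo_flow iv.
exact: (sd_differentiable (sd_comp sV (sd_linear _ (blin_fst _ _)))).
Qed.

Lemma expo_strict q v i : dom i (expo q v) ->
  strict_derive (fun w => crd i (expo q w)) v (fun h => h *m dexpo q i v).
Proof.
move=> iv; have [_ _ sV] := expo_flow iv.
apply: sd_ext (sd_comp sV (sd_linear _ (blin_fst _ _))) => w.
by rewrite dexpo_jac.
Qed.

Lemma dexpo_unit q v i : dom i (expo q v) -> dexpo q i v \in unitmx.
Proof.
move=> iv; rewrite unitmxE unitfE; apply/det0P => -[w /eqP w0 wA]; apply: w0.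
apply: (jac_nondegenerate (mem_chart_at q) (geo_geodesic q) (geo_start q) (geo_velocity q) no_conj iv).
by rewrite -dexpo_jac.
Qed.

Lemma expo_gauss q v i w : dom i (expo q v) ->
  inner i (expo q v) (velocity i (geo q v) 1) (w *m dexpo q i v) = inner (chart_at q) q v w.
Proof.
move=> iv; rewrite dexpo_jac//.
exact: (gauss (mem_chart_at q) (geo_geodesic q) (geo_start q) (geo_velocity q)).
Qed.

Lemma expo_injective_near q v : exists2 d : R, 0 < d &
  forall u w, `|u - v| < d -> `|w - v| < d -> expo q u = expo q w -> u = w.
Proof.
have iv := mem_chart_at (expo q v).
have [d d0 H] := sd_locally_injective (dexpo_unit iv) (expo_strict iv).
by exists d; [exact: d0 | move=> u w uv wv euw; apply: (H u w uv wv); rewrite euw].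
Qed.

Lemma expo_open q v (r : R) : 0 < r ->
  \forall x \near expo q v, exists2 u, `|u - v| < r & expo q u = x.
Proof.
move=> r0; pose i := chart_at (expo q v); have iv : dom i (expo q v) by exact: mem_chart_at.
have [s s0 near_i] := iffLR (near_norm _ _) (@expo_continuous q v _ (nbhs_dom iv)).
have m0 : 0 < Num.min r s by rewrite lt_min r0.
have [d d0 H] := sd_locally_surjective (dexpo_unit iv) (expo_strict iv) m0.
have := continuous_crd iv; move/(_ (ball (crd i (expo q v)) d)).
move=> /(_ (nbhsx_ballx _ _ d0)) N.
have N' : \forall x \near expo q v, ball (crd i (expo q v)) d (crd i x) := N.
apply: (@filterS M (nbhs (expo q v)) _ _ _ _ (filterI N' (nbhs_dom iv))) => x [].
rewrite /= -ball_normE /= distrC => xd ix.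
have [u] := H (crd i x) xd; rewrite lt_min => /andP[ur us] eu.
exists u; first exact: ur.
by rewrite -(crdK ix) -eu crdK//; exact: near_i.
Qed.

End Distance.
End ExponentialMap.

(** * Lifting of paths *)

Section Clamp.
Context {R : realType}.

(** Extends paths on [[0, 1]] by constants, so that continuity and lifting can be stated on the
    whole line. *)
Definition clamp (s : R) : R := Num.max 0 (Num.min s 1).

Lemma clamp_ge0 s : 0 <= clamp s. Proof. by rewrite le_max lexx. Qed.
Lemma clamp_le1 s : clamp s <= 1. Proof. by rewrite ge_max ler01 ge_min lexx orbT. Qed.
Lemma clampE s : 0 <= s -> s <= 1 -> clamp s = s.
Proof. by move=> s0 s1; rewrite /clamp min_l// max_r. Qed.
Lemma clamp_le0 s : s <= 0 -> clamp s = 0.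
Proof. by move=> s0; rewrite /clamp max_l// ge_min s0. Qed.
Lemma clamp_ge1 s : 1 <= s -> clamp s = 1.
Proof. by move=> s1; rewrite /clamp min_r// max_r. Qed.

Lemma continuous_maxr (a : R) (f : R -> R) : continuous f -> continuous (fun s => Num.max a (f s)).
Proof. by move=> cf s; apply: (@continuous_max _ _ (fun=> a) f s); [exact: cvg_cst | exact: cf]. Qed.

Lemma continuous_minl (a : R) : continuous (fun s => Num.min s a).
Proof. by move=> s; apply: (@continuous_min _ _ id (fun=> a) s); [exact: cvg_id | exact: cvg_cst]. Qed.

Lemma clamp_continuous : continuous clamp.
Proof. by apply: continuous_maxr; exact: continuous_minl. Qed.

Lemma quarters_lt (d : R) : 0 < d -> d / 4 + d / 4 < d.
Proof. lra. Qed.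

End Clamp.

Lemma line_continuous (R : realType) (Y : normedModType R) (y w : Y) : continuous (fun s : R => y + s *: w).
Proof. by move=> s; exact: sd_cont (sd_add (sd_cst y s) (sd_linear s (blin_line w))). Qed.

Section Lifting.
Context {R : realType} {n : nat} {M : topologicalType}.
Local Notation X := 'rV[R]_n.
Hypothesis hM : hausdorff_space M.
Context (f : X -> M).
Hypothesis f_cont : continuous f.
Hypothesis f_open : forall v (r : R), 0 < r ->
  \forall x \near f v, exists2 u, `|u - v| < r & f u = x.
Hypothesis f_inj : forall v, exists2 d : R, 0 < d &
  forall u w, `|u - v| < d -> `|w - v| < d -> f u = f w -> u = w.

(** Openness makes the image of the ball of injectivity a neighbourhood and the inverse on it
    continuous. *)
Lemma local_section v : exists A : set M, exists g : M -> X, exists2 d : R, 0 < d &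
  [/\ nbhs (f v) A, forall x, A x -> f (g x) = x /\ {for x, continuous g} &
      forall u, `|u - v| < d -> A (f u) /\ g (f u) = u].
Proof.
have [d d0 inj] := f_inj v.
pose A x := exists2 u, `|u - v| < d & f u = x.
pose g x := xget v [set u | `|u - v| < d /\ f u = x].
have gP x : A x -> `|g x - v| < d /\ f (g x) = x.
  move=> [u uv ux]; apply: (@xgetPex _ v [set u | `|u - v| < d /\ f u = x]); by exists u.
have gf u : `|u - v| < d -> g (f u) = u.
  move=> uv; have [h1 h2] := gP (f u) (ex_intro2 _ _ u uv erefl); exact: inj.
exists A, g, d; first exact: d0.
split; first exact: f_open.
- move=> x Ax; have [gv gx] := gP x Ax; split; first exact: gx.
  apply/cvgrPdistC_le => e e0; rewrite -gx gf//.
  have m0 : 0 < Num.min e (d - `|g x - v|) by rewrite lt_min e0 subr_gt0.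
  have := f_open (g x) m0; apply: filterS => y [u]; rewrite lt_min => /andP[ue ud] <-.
  rewrite gf; first exact: ltW.
  have -> : u - v = (u - g x) + (g x - v) by linear_id.
  by rewrite (le_lt_trans (ler_normD _ _))// -ltrBrDr.
- move=> u uv; split; last exact: gf.
  by exists u.
Qed.

(** Agreement is locally constant: by local injectivity where the lifts agree, and by continuity
    where they differ. *)
Lemma lift_unique (p p' : R -> X) a : continuous p -> continuous p' -> f \o p =1 f \o p' ->
  p a = p' a -> forall b, p b = p' b.
Proof.
move=> cp cp' fpp; apply: (@locally_constant_prop _ (fun s => p s = p' s)) => t.
have [e|ne] := eqVneq (p t) (p' t).
  have [d d0 inj] := f_inj (p t); have d2 : 0 < d / 2 by rewrite divr_gt0.
  have [d1 d10 H1] := iffLR (continuous_norm _ _) (cp t) _ d2.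
  have [d3 d30 H3] := iffLR (continuous_norm _ _) (cp' t) _ d2.
  exists (Num.min d1 d3); first by rewrite lt_min d10.
  move=> s s' _; rewrite lt_min => /andP[s1 s3] _; apply: inj; last exact: fpp.
  - exact: le_half_lt (H1 _ s1).
  - by rewrite e; exact: le_half_lt (H3 _ s3).
have n0 : 0 < `|p t - p' t| / 4 by rewrite divr_gt0// normr_gt0 subr_eq0.
have [d1 d10 H1] := iffLR (continuous_norm _ _) (cp t) _ n0.
have [d3 d30 H3] := iffLR (continuous_norm _ _) (cp' t) _ n0.
exists (Num.min d1 d3); first by rewrite lt_min d10.
move=> s s'; rewrite lt_min => /andP[/H1 s1 /H3 s3] _ es; exfalso.
have : `|p t - p' t| <= `|p t - p' t| / 4 + `|p t - p' t| / 4.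
  have -> : `|p t - p' t| / 4 + `|p t - p' t| / 4 = `|p t - p' t| / 2 by field.
  have : `|p' s - p' t| + `|p s - p t| <= `|p t - p' t| / 4 + `|p t - p' t| / 4 by exact: lerD.
  have -> : `|p t - p' t| / 4 + `|p t - p' t| / 4 = `|p t - p' t| / 2 by field.
  apply: le_trans; apply: le_trans (ler_normB _ _).
  by rewrite es (_ : p' s - p' t - (p' s - p t) = p t - p' t)//; linear_id.
by move: n0; move: (`|p t - p' t|) => a0; lra.
Qed.

Lemma glue_lift (c : R -> M) (p : R -> X) (g : M -> X) (s s' : R) : continuous c -> s <= s' ->
  continuous p -> g (c s) = p s ->
  (forall r, s <= r -> r <= s' -> {for c r, continuous g}) ->
  exists p', [/\ continuous p', forall r, r <= s -> p' r = p r &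
    forall r, s <= r -> r <= s' -> p' r = g (c r)].
Proof.
move=> cc ss' cp gs cg.
have wP r : s <= Num.max s (Num.min r s') /\ Num.max s (Num.min r s') <= s'.
  by rewrite le_max lexx ge_max ss' ge_min lexx orbT.
(* On each side of [s] one of the first two summands is frozen at [p s], so the sum is continuous
   without a case distinction. *)
exists (fun r => (p (Num.min r s) + g (c (Num.max s (Num.min r s')))) - p s); split.
- move=> r; apply: (@continuousB _ _ _ (fun r => p (Num.min r s) + g (c (Num.max s (Num.min r s')))) (fun=> p s)).
    apply: (@continuousD _ _ _ (fun r => p (Num.min r s)) (fun r => g (c (Num.max s (Num.min r s'))))).
      apply: (@continuous_comp _ _ _ (fun r => Num.min r s) p); last exact: cp.
      exact: continuous_minl.
    have [w1 w2] := wP r.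
    apply: (@continuous_comp _ _ _ (fun r => c (Num.max s (Num.min r s'))) g); last exact: cg.
    apply: (@continuous_comp _ _ _ (fun r => Num.max s (Num.min r s')) c); last exact: cc.
    by apply: continuous_maxr; exact: continuous_minl.
  exact: cvg_cst.
- move=> r rs; rewrite (min_l rs) (min_l (le_trans rs ss')) (max_l rs) gs; exact: addrK.
- move=> r sr rs'; rewrite (min_r sr) (min_l rs') (max_r sr) addrC; exact: addKr.
Qed.

Lemma continuous_pair (S T U : topologicalType) (a : S -> T) (b : S -> U) (x : S) :
  {for x, continuous a} -> {for x, continuous b} -> {for x, continuous (fun y => (a y, b y))}.
Proof. by move=> ca cb; exact: (cvg_pair ca cb). Qed.

Lemma segment_curve (s s' : R) : exists w : R -> R,
  [/\ continuous w, w 0 = s, w 1 = s' &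
      forall t d r, `|s - t| < d -> `|s' - t| < d -> `|w r - t| < d].
Proof.
exists (fun r => s + clamp r * (s' - s)); split.
- move=> r; apply: (@continuousD _ _ _ (fun=> s) (fun r => clamp r * (s' - s))); first exact: cvg_cst.
  by apply: (@continuousM _ _ clamp (fun=> s' - s)); [exact: clamp_continuous | exact: cvg_cst].
- by rewrite clamp_le0// mul0r addr0.
- by rewrite clamp_ge1// mul1r addrC subrK.
move=> t d r sd s'd; have := clamp_ge0 r; have := clamp_le1 r; move: (clamp r) => k k1 k0.
have -> : s + k * (s' - s) - t = (1 - k) * (s - t) + k * (s' - t) by ring.
apply: (@le_lt_trans _ _ (Num.max `|s - t| `|s' - t|)); last by rewrite gt_max sd.
rewrite (le_trans (ler_normD _ _))// !normrM (ger0_norm k0) ger0_norm ?subr_ge0//.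
have -> : Num.max `|s - t| `|s' - t| = (1 - k) * Num.max `|s - t| `|s' - t| + k * Num.max `|s - t| `|s' - t| by ring.
by apply: lerD; rewrite ler_wpM2l ?subr_ge0// le_max lexx ?orbT.
Qed.

(* Continuity in y of the lift at time s propagates along the segment: where a
   local inverse of f is available, nearby lifts are given by it. *)
Lemma straight_section (Y : normedModType R) (C : set Y) (y0 : Y) (h : Y -> M) (u0 : X) :
  open C -> C y0 -> (forall y s, C y -> 0 <= s -> s <= 1 -> C (y0 + s *: (y - y0))) ->
  (forall y, C y -> {for y, continuous h}) ->
  (forall y, C y -> exists p : R -> X, [/\ continuous p, p 0 = u0 &
     forall s, f (p s) = h (y0 + clamp s *: (y - y0))]) ->
  exists H : Y -> X, H y0 = u0 /\ forall y, C y -> f (H y) = h y /\ {for y, continuous H}.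
Proof.
move=> oC Cy0 star ch lifts.
pose path y s := h (y0 + clamp s *: (y - y0)).
pose good y (p : R -> X) := [/\ continuous p, p 0 = u0 & forall s, f (p s) = path y s].
pose G y := xget (fun=> u0) [set p | good y p].
have GP y : C y -> good y (G y).
  by move=> /lifts[p gp]; apply: (@xgetPex _ (fun=> u0) [set p | good y p]); exists p.
have C_path y s : C y -> C (y0 + clamp s *: (y - y0)).
  by move=> Cy; apply: star => //; [exact: clamp_ge0 | exact: clamp_le1].
have c_path y s : C y -> {for (y, s), continuous (fun z : Y * R => path z.1 z.2)}.
  move=> Cy; apply: (@continuous_comp _ _ _ (fun z : Y * R => y0 + clamp z.2 *: (z.1 - y0)) h); last first.
    by apply: ch; exact: C_path.
  apply: (@continuousD _ _ _ (fun=> y0) (fun z : Y * R => clamp z.2 *: (z.1 - y0))); first exact: cvg_cst.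
  apply: (@cvgZ _ _ _ _ _ (fun z : Y * R => clamp z.2) (fun z => z.1 - y0)).
    apply: (@continuous_comp _ _ _ (fun z : Y * R => z.2) clamp); first exact: cvg_snd.
    exact: clamp_continuous.
  apply: (@continuousB _ _ _ (fun z : Y * R => z.1) (fun=> y0)); first exact: cvg_fst.
  exact: cvg_cst.
have c_path2 y s : C y -> {for y, continuous (fun y => path y s)}.
  move=> Cy; apply: (@continuous_comp _ _ _ (fun y => (y, s)) (fun z : Y * R => path z.1 z.2)).
    by apply: (@continuous_pair Y Y R id (fun=> s) y); [exact: cvg_id | exact: cvg_cst].
  exact: c_path.
exists (fun y => G y 1); split.
  have [c0 G0 fG] := GP y0 Cy0; rewrite -G0.
  apply: (@lift_unique (G y0) (fun=> G y0 0) 0); [exact: c0 | by move=> ?; exact: cvg_cst | | reflexivity].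
  by move=> s; rewrite /= !fG /path subrr !scaler0.
move=> y Cy; have [cG G0 fG] := GP y Cy; split.
  by rewrite fG /path clamp_ge1// scale1r addrC subrK.
apply: (@locally_constant_prop _ (fun s => {for y, continuous (fun y => G y s)}) _ 0); last first.
  apply/continuous_norm => e e0; have [d d0 H] := iffLR (near_norm _ _) (open_nbhs_nbhs (conj oC Cy)).
  exists d; first exact: d0.
  by move=> y' /H/GP[_ -> _]; rewrite G0 subrr normr0 ltW.
move=> t; have [A [g [d d0 [nA gA gf]]]] := local_section (G y t).
rewrite fG in nA.
have [d1 d10 H1] := iffLR (near_norm _ _) (c_path y t Cy _ nA).
have d2 : 0 < d / 4 by rewrite divr_gt0.
have [d3 d30 H3] := iffLR (continuous_norm _ _) (cG t) _ d2.
have [d4 d40 H4] := iffLR (near_norm _ _) (open_nbhs_nbhs (conj oC Cy)).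
exists (Num.min d1 d3); first by rewrite lt_min d10.
move=> s s'; rewrite !lt_min => /andP[s1 s3] /andP[s'1 s'3] Qs.
have A_path y' r : `|y' - y| < d1 -> `|r - t| < d1 -> A (path y' r).
  move=> y1 r1; apply: (H1 (y', r)); rewrite prod_normE /= gt_max.
  by apply/andP.
suff E : \forall y' \near y, g (path y' s') = G y' s'.
  have cg : {for y, continuous (fun y' => g (path y' s'))}.
    apply: (@continuous_comp _ _ _ (fun y' => path y' s') g); first exact: c_path2.
    by apply: (gA _ _).2; apply: A_path => //; rewrite subrr normr0.
  rewrite /prop_for /continuous_at -(nbhs_singleton E).
  by apply: cvg_trans cg; exact: near_eq_cvg.
have [d5 d50 H5] := iffLR (continuous_norm _ _) Qs _ d2.
apply/near_norm; exists (Num.min d1 (Num.min d4 d5)); first by rewrite !lt_min d10 d40.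
move=> y'; rewrite !lt_min => /and3P[y1 y4 y5].
have Cy' := H4 _ y4; have [cG' G0' fG'] := GP y' Cy'.
have near_s : `|G y' s - G y t| < d.
  have -> : G y' s - G y t = (G y' s - G y s) + (G y s - G y t) by linear_id.
  rewrite (le_lt_trans (ler_normD _ _))//.
  have := lerD (H5 _ y5) (H3 _ s3); move/le_lt_trans; apply.
  exact: quarters_lt.
(* The local inverse and the lift agree at time [s]; uniqueness of lifts along the segment from [s]
   to [s'] carries this over to time [s']. *)
have [w [cw w0 w1 wt]] := segment_curve s s'.
have cpw : continuous (fun r => path y' (w r)).
  move=> r; apply: (@continuous_comp _ _ _ (fun r => (y', w r)) (fun z : Y * R => path z.1 z.2)).
    by apply: (@continuous_pair R Y R (fun=> y') w r); [exact: cvg_cst | exact: cw].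
  exact: c_path.
have Aw r : A (path y' (w r)) by apply: A_path => //; exact: wt.
have := @lift_unique (fun r => g (path y' (w r))) (fun r => G y' (w r)) 0.
rewrite -w1 => L; apply: L.
- move=> r; apply: (@continuous_comp _ _ _ (fun r => path y' (w r)) g); first exact: cpw.
  exact: (gA _ (Aw r)).2.
- move=> r; apply: (@continuous_comp _ _ _ w (G y')); first exact: cw.
  exact: cG'.
- by move=> r; rewrite /= fG' (gA _ (Aw r)).1.
- by rewrite w0 -fG'; exact: (gf _ near_s).2.
Qed.

(** Constant before time 0 and a lift up to time [t]; beyond [t] the values are free, so that an
    extension may overwrite them. *)
Definition partial_lift (c : R -> M) (u : X) (t : R) (p : R -> X) : Prop :=
  [/\ continuous p, forall r, r <= 0 -> p r = u & forall r, r <= t -> f (p r) = c (clamp r)].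

Lemma clamp_path_continuous (c : R -> M) : continuous c -> continuous (c \o clamp).
Proof. by move=> cc r; apply: continuous_comp; [exact: clamp_continuous | exact: cc]. Qed.

Lemma extend_lift (c : R -> M) (u : X) (s s' : R) p g : continuous c -> partial_lift c u s p ->
  s <= s' -> g (c (clamp s)) = p s ->
  (forall r, s <= r -> r <= s' -> f (g (c (clamp r))) = c (clamp r) /\
     {for c (clamp r), continuous g}) -> exists p', partial_lift c u s' p'.
Proof.
move=> cc [cp p0 fp] ss' gs gP.
have [s'0|/ltW s'0] := leP s' 0.
  exists p; split=> // r rs; have r0 := le_trans rs s'0; have s0 := le_trans ss' s'0.
  by rewrite p0// clamp_le0// -(clamp_le0 s0) -fp// p0.
have [p' [cp' p'1 p'2]] := @glue_lift (c \o clamp) p g s s' (clamp_path_continuous cc) ss' cp gs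
  (fun r a b => (gP r a b).2).
exists p'; split=> // r rs.
  have [sr|/ltW sr] := leP r s; first by rewrite p'1// p0.
  have s0 := le_trans sr rs; have r1 := le_trans rs s'0.
  by rewrite p'2//= clamp_le0// -(clamp_le0 s0) gs; exact: p0.
have [sr|/ltW sr] := leP r s; first by rewrite p'1// fp.
by rewrite p'2//; exact: (gP r sr rs).1.
Qed.

Lemma partial_lift_clamp (c : R -> M) (u : X) p : partial_lift c u 1 p ->
  exists p', [/\ continuous p', p' 0 = u & forall r, f (p' r) = c (clamp r)].
Proof.
move=> [cp p0 fp]; exists (p \o clamp); split.
- by move=> r; apply: continuous_comp; [exact: clamp_continuous | exact: cp].
- by rewrite /= clamp_le0// p0.
- by move=> r; rewrite /= fp ?clamp_le1// (clampE (clamp_ge0 r) (clamp_le1 r)).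
Qed.

Lemma partial_lift0 (c : R -> M) (u : X) : f u = c 0 -> partial_lift c u 0 (fun=> u).
Proof.
by move=> fu; split=> //; [move=> ?; exact: cvg_cst | move=> r r0; rewrite clamp_le0].
Qed.

(** The neighbourhood [B] depends on the point below and not on the preimage, so the time by which a
    lift can be continued is locally uniform. *)
Lemma path_lift (c : R -> M) (u : X) : continuous c -> f u = c 0 ->
  (forall x : M, exists2 B, nbhs x B & forall u, B (f u) -> exists2 g : M -> X, g (f u) = u &
     forall x', B x' -> f (g x') = x' /\ {for x', continuous g}) ->
  exists p, [/\ continuous p, p 0 = u & forall r, f (p r) = c (clamp r)].
Proof.
move=> cc fu sections; suff [p] : exists p, partial_lift c u 1 p by exact: partial_lift_clamp.
apply: (@locally_constant_prop _ (fun t => exists p, partial_lift c u t p) _ 0); last first.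
  by exists (fun=> u); exact: partial_lift0.
move=> t; have [B nB gB] := sections (c (clamp t)).
have [d d0 H] := iffLR (near_norm _ _) (clamp_path_continuous cc nB).
exists d; first exact: d0.
move=> s s' sd s'd [p pl]; have [cp p0 fp] := pl.
have [s's|/ltW ss'] := leP s' s.
  by exists p; split=> // r rs'; apply: fp; exact: le_trans s's.
have Bs : B (f (p s)) by rewrite fp//; exact: H.
have [g gs gP] := gB _ Bs; apply: (extend_lift cc pl ss' (g := g)); first by rewrite -fp.
move=> r sr rs'; apply: gP; apply: H.
by move: sd s'd; rewrite !ltr_norml => /andP[a1 a2] /andP[b1 b2]; clear - a1 b2 sr rs'; apply/andP; split; lra.
Qed.

(* By compactness of the ball, the local inverses of f at its points can be
   followed for a time that does not depend on the point. *)
Lemma path_lift_bounded (c : R -> M) (u : X) (K : R) : continuous c -> f u = c 0 ->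
  (forall p t, t <= 1 -> partial_lift c u t p -> `|p t| <= K) ->
  exists p, [/\ continuous p, p 0 = u & forall r, f (p r) = c (clamp r)].
Proof.
(* Cutting time at 1 makes the property meaningful on the whole line, while the bound is invoked
   only for times up to 1. *)
move=> cc fu bounded; suff [p pl] : exists p, partial_lift c u (Num.min 1 1) p.
  by apply: partial_lift_clamp; rewrite minxx in pl; exact: pl.
apply: (@locally_constant_prop _ (fun t => exists p, partial_lift c u (Num.min t 1) p) _ 0); last first.
  by rewrite min_l//; exists (fun=> u); exact: partial_lift0.
move=> t.
pose window (d : R) (v : X) := forall s, `|s - t| < d -> f v = c (clamp s) ->
  exists2 g : M -> X, g (f v) = v & forall r, `|r - t| < d ->
    f (g (c (clamp r))) = c (clamp r) /\ {for c (clamp r), continuous g}.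
have [d d0 win] : exists2 d : R, 0 < d & forall v, `|v| <= K -> window d v.
  have /compact_near_coveringP cov := @compact_cball R n (0 : X) K.
  have := cov R (0^'+) window _; move=> /(_ _).
  have H : forall v : X, [set y | `|y - 0| <= K] v -> 
     \forall v' \near v & d \near (0 : R)^'+, window d v'.
    move=> v _; have [e|ne] := pselect (f v = c (clamp t)).
      have [A [g [d d0 [nA gA gf]]]] := local_section v.
      rewrite e in nA; have [d1 d10 H1] := iffLR (near_norm _ _) (clamp_path_continuous cc nA).
      exists ([set v' | `|v' - v| < d], [set d' | d' < d1]) => /=; first split.
      - by apply/near_norm; exists d.
      - exact: nbhs_right_lt.
      move=> [v' d'] [/= v'd d'd1] s sd' _; exists g; first exact: (gf v' v'd).2.
      by move=> r rd'; apply: gA; apply: H1; exact: lt_trans d'd1.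
    (* When [f v] is not the point of the curve at time [t], Hausdorff separation makes the window
       property vacuous near [v]. *)
    have := hM; rewrite open_hausdorff => /(_ _ _ (introN eqP ne))[[A B] /= [Av Bt] [oA oB AB]].
    have [d1 d10 H1] := iffLR (near_norm _ _) (clamp_path_continuous cc (open_nbhs_nbhs (conj oB (set_mem Bt)))).
    exists (f @^-1` A, [set d' | d' < d1]) => /=; first split.
    - by apply: f_cont; apply: open_nbhs_nbhs; split=> //; exact: set_mem.
    - exact: nbhs_right_lt.
    move=> [v' d'] [/= v'A d'd1] s sd' fv'; exfalso.
    have : (A `&` B) (f v') by split=> //; rewrite fv'; apply: H1; exact: lt_trans d'd1.
    by rewrite (eqP AB).
  move=> /(_ H) N.
  have [d [d0 dP]] : exists d, 0 < d /\ [set y | `|y - 0| <= K] `<=` window d.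
    have N2 : \forall d \near (0 : R)^'+, 0 < d /\ [set y | `|y - 0| <= K] `<=` window d.
      by apply: filterI N; exact: nbhs_right_gt.
    by have [d [h1 h2]] := filter_ex N2; exists d.
  by exists d => // v vK; apply: dP; rewrite /= subr0.
exists d; first exact: d0.
move=> s s' sd s'd [p pl]; have [cp p0 fp] := pl.
have [s's|ss'] := leP (Num.min s' 1) (Num.min s 1).
  by exists p; split=> // r rs'; apply: fp; exact: le_trans s's.
have s1 : s < 1 by move: ss'; rewrite !lt_min !gt_min ltxx orbF => /andP[_ ->].
have s1' : Num.min s 1 = s by rewrite min_l// ltW.
rewrite s1' in ss' pl fp *.
have pK := bounded p s (ltW s1) pl.
have [g gs gP] := win (p s) pK s sd (fp s (lexx s)).
apply: (extend_lift cc pl (ltW ss') (g := g)); first by rewrite -fp.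
move=> r sr rs'; apply: gP.
have rs'' : r <= s' by move: rs'; rewrite le_min => /andP[].
by move: sd s'd; rewrite !ltr_norml => /andP[a1 a2] /andP[b1 b2]; clear - a1 b2 sr rs''; apply/andP; split; lra.
Qed.

(** Straight paths in [Y] lift, which gives a global section. It is also a left inverse of [f]: the
    ray through [v] and the section along its image are lifts of one path starting at 0. *)
Lemma covering_inverse (Y : normedModType R) (phi : Y -> M) (psi : M -> Y) :
  continuous phi -> continuous psi -> cancel psi phi ->
  (forall x : M, exists2 B, nbhs x B & forall u, B (f u) -> exists2 g : M -> X, g (f u) = u &
     forall x', B x' -> f (g x') = x' /\ {for x', continuous g}) ->
  exists G : M -> X, [/\ continuous G, cancel f G & cancel G f].
Proof.
move=> cphi cpsi phiK sections; pose y0 := psi (f 0).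
have [|||||H [H0 HP]] := @straight_section Y setT y0 phi 0.
- exact: openT.
- by [].
- by [].
- by move=> y _; exact: cphi.
- move=> y _; apply: (@path_lift (fun s => phi (y0 + s *: (y - y0))) 0) => //.
    by move=> s; apply: (@continuous_comp R Y M (fun s => y0 + s *: (y - y0)) phi); [exact: line_continuous | exact: cphi].
  by rewrite scale0r addr0 phiK.
have cG : continuous (H \o psi).
  by move=> x; apply: continuous_comp; [exact: cpsi | exact: (HP _ I).2].
have fG : cancel (H \o psi) f by move=> x; rewrite /= (HP _ I).1 phiK.
exists (H \o psi); split=> // v.
have cline : continuous (fun r : R => r *: v) by move=> r; exact: sd_cont (sd_linear r (blin_line v)).
have := @lift_unique (fun r => (H \o psi) (f (r *: v))) (fun r => r *: v) 0.
move=> L; rewrite -[in LHS](scale1r v) -[RHS]scale1r; apply: L.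
- move=> r; apply: (@continuous_comp R M X (fun r => f (r *: v)) (H \o psi)); last exact: cG.
  by apply: (@continuous_comp R X M (fun r => r *: v) f); [exact: cline | exact: f_cont].
- exact: cline.
- by move=> r; rewrite /= fG.
- by rewrite scale0r /= H0.
Qed.

End Lifting.

(** * The exponential map is a homeomorphism *)

Section RealGrowth.
Context {R : realType}.

Lemma curve_derive_sqrt (g : R -> R) t d : 0 < g t -> curve_derive g t d ->
  curve_derive (fun s => Num.sqrt (g s)) t (d / (2 * Num.sqrt (g t))).
Proof.
move=> g0 /curve_deriveP[dg dE]; apply/curve_deriveP.
have ig : is_derive t 1 g d by rewrite -dE derive1E; exact: DeriveDef.
have H := @is_derive1_comp _ _ _ _ _ _ (is_derive1_sqrt g0) ig.
split; first exact: (@ex_derive _ _ _ _ _ _ _ H).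
by rewrite derive1E (@derive_val _ _ _ _ _ _ _ H) mulrC.
Qed.

Lemma growth_le (f g : R -> R) a b : a <= b ->
  (forall x, a <= x -> x <= b -> {for x, continuous f}) ->
  (forall x, a <= x -> x <= b -> {for x, continuous g}) ->
  (forall x, a < x -> x < b -> exists d e, [/\ curve_derive f x d, curve_derive g x e & d <= e]) ->
  f b - f a <= g b - g a.
Proof.
move=> ab cf cg H.
have D x : x \in `]a, b[ -> exists2 d, curve_derive (fun x => g x - f x) x d & 0 <= d.
  rewrite in_itv /= => /andP[ax xb]; have [d [e [df dg de]]] := H x ax xb.
  by exists (e - d); [exact: curve_derive_sub | rewrite subr_ge0].
have := @ger0_derive1_le R (fun x => g x - f x) a b _ _ true false _ a b.
rewrite !in_itv /= lexx ab lexx /= => L.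
have {}L : g a - f a <= g b - f b.
  apply: L => //.
  - by move=> x /D[d /curve_deriveP[]].
  - by move=> x /D[d /curve_deriveP[_ ->]].
  apply: continuous_in_subspaceT => x /set_mem; rewrite /= in_itv /= => /andP[ax xb].
  by apply: (@continuousB _ R^o _ g f); [exact: cg | exact: cf].
by move: L; move: (f a) (f b) (g a) (g b) => *; lra.
Qed.

End RealGrowth.

Section RadialGrowth.
Context {R : realType} {M : riemannian_surface R}.
Implicit Types (i j : atlas_idx M) (x q : M).
Local Notation E := ('rV[R]_2).
Hypothesis complete : geodesically_complete M.
Hypothesis no_conj : no_conjugate_points M.
Local Notation expo := (expo complete).

Lemma nsq_strict q v : strict_derive (nsq q) v (fun h => 2 * inner (chart_at q) q v h).
Proof.
pose g a b : R := gmat (chart_at q) (crd (chart_at q) q) a b.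
have := sd_sum (fun a => sd_sum (fun b => sd_mul (sd_mul (sd_coord v a) (sd_cst (g a b) v)) (sd_coord v b))).
have -> : (fun u : E => \sum_i \sum_i0 u 0 i * g i i0 * u 0 i0) = nsq q.
  by apply/funext => u; rewrite /nsq innerE.
apply: sd_ext => h; rewrite innerE !sum_I2 /g.
rewrite (gmat_symE 1 0 (img_crd (mem_chart_at q))).
by move: (gmat _ _ _ _) (gmat _ _ _ _) (gmat _ _ _ _) (v 0 0) (v 0 1) (h 0 0) (h 0 1) => *; ring.
Qed.

Lemma nsq_ge0 q v : 0 <= nsq q v.
Proof. exact: inner_ge0 (mem_chart_at q). Qed.

Lemma nsq_continuous q : continuous (nsq q).
Proof. by move=> v; exact: sd_cont (nsq_strict q v). Qed.

(** By the Gauss lemma the derivative of the squared norm is twice the product of [w] with the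
    radial velocity, whose length is the norm of [p r]; Cauchy-Schwarz then bounds the derivative of
    the root. The shift by [e] keeps the root differentiable at the origin. *)
Lemma radial_growth q (p : R -> E) r p' i e : 0 < e -> dom i (expo q (p r)) -> curve_derive p r p' ->
  let w := p' *m dexpo complete q i (p r) in
  exists2 d, curve_derive (fun s => Num.sqrt (e + nsq q (p s))) r d &
    `|d| <= Num.sqrt (inner i (expo q (p r)) w w).
Proof.
move=> e0 ir dp w; set v := p r in ir w *.
have N0 : 0 < e + nsq q v by rewrite ltr_wpDr// nsq_ge0.
have dN := curve_derive_comp (nsq_strict q v) dp.
have c0 : curve_derive (fun=> e) r 0 by have := sd_curve (sd_cst e r).
exists ((0 + 2 * inner (chart_at q) q v p') / (2 * Num.sqrt (e + nsq q v))).
  by apply: (@curve_derive_sqrt R (fun s => e + nsq q (p s)) r _ N0); exact: curve_derive_add c0 dN.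
rewrite add0r -(expo_gauss p' ir) -/w.
have := abs_inner_le (velocity i (geo complete q v) 1) w ir.
rewrite geo_energy// => H.
have S0 : 0 < Num.sqrt (e + nsq q v) by rewrite sqrtr_gt0.
rewrite normrM normfV normrM (@ger0_norm _ 2)// (@gtr0_norm _ (2 * _)) ?mulr_gt0//.
rewrite -mulf_div divff ?mul1r// ler_pdivrMr// (le_trans H)// mulrC.
by rewrite ler_wpM2l ?sqrtr_ge0// ler_wsqrtr// lerDr ltW.
Qed.

(* By the Gauss lemma a lift moves radially no faster than its image moves. *)
Lemma lift_bounded q i (z w u : E) :
  (forall s, 0 <= s -> s <= 1 -> img i (z + s *: w)) ->
  exists K : R, forall p t, t <= 1 ->
    partial_lift (expo q) (fun s => prm i (z + clamp s *: w)) u t p -> `|p t| <= K.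
Proof.
move=> img_seg.
have icl r : img i (z + clamp r *: w) by apply: img_seg; [exact: clamp_ge0|exact: clamp_le1].
(* Squared speed of the chart segment; its maximum on [[0, 1]] bounds the growth of every lift. *)
pose mt (r : R) : R := metric i (z + clamp r *: w) w w.
have cmt : continuous mt.
  move=> r; have cz : {for r, continuous (fun r => z + clamp r *: w)}.
    by apply: (@continuous_comp R R E clamp (fun s => z + s *: w)); [exact: clamp_continuous | exact: line_continuous].
  have sd := sd_sum (fun a => sd_sum (fun b => sd_mul (sd_mul (sd_cst (w 0 a) _) (gmat_entry_strict a b (icl r))) (sd_cst (w 0 b) _))).
  exact: (@continuous_comp R E R _ _ r cz (sd_cont sd)).
have [|r1 _ r1max] := @EVT_max R mt 0 1 ler01; first exact: continuous_subspaceT.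
pose S := Num.sqrt (mt r1).
have [Kc Kc0 coer] := inner_coercive (mem_chart_at q).
pose N0 := Num.sqrt (1 + nsq q u).
(* From [a <= 1 + a ^+ 2] and the coercivity of the metric at [q]. *)
exists (1 + Kc * (N0 + S) ^+ 2) => p t t1 [cp p0 fp].
have Nt : Num.sqrt (1 + nsq q (p t)) <= N0 + S.
  have [t0|t0] := leP t 0; first by rewrite p0// lerDl sqrtr_ge0.
  suff : Num.sqrt (1 + nsq q (p t)) - Num.sqrt (1 + nsq q (p 0)) <= t * S - 0 * S.
    rewrite mul0r subr0 (p0 0 (lexx 0)) -/N0 lerBlDl => /le_trans; apply.
    by rewrite lerD2l ler_piMl ?sqrtr_ge0.
  apply: (@growth_le R (fun r => Num.sqrt (1 + nsq q (p r))) (fun r => r * S) 0 t (ltW t0)).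
  - move=> r _ _; apply: (@continuous_comp R R R (fun r => 1 + nsq q (p r)) Num.sqrt); last exact: sqrt_continuous.
    apply: (@continuousD _ R^o _ (fun=> 1) (fun r => nsq q (p r))); first exact: cvg_cst.
    by apply: (@continuous_comp R E R p (nsq q)); [exact: cp | exact: nsq_continuous].
  - by move=> r _ _; apply: (@continuousM _ _ id (fun=> S)); [exact: cvg_id | exact: cvg_cst].
  - move=> r r0 rt; have r1' := le_trans (ltW rt) t1.
    have clr : clamp (clamp r) = r by rewrite !clampE ?(ltW r0).
    have E0 : expo q (p r) = prm i (z + r *: w) by rewrite fp ?(ltW rt)// clr.
    have ir : dom i (expo q (p r)) by rewrite E0; apply: dom_prm; apply: img_seg; rewrite ?(ltW r0).
    have sA := expo_strict ir.
    have sf : strict_derive ((fun v => crd i (expo q v)) \o p) r (fun h => h *: w).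
      have sl := sd_add (sd_cst z r) (sd_linear r (blin_line w)).
      have {}sl := sd_ext (fun h : R => add0r (h *: w)) sl.
      apply: sd_near sl; apply/near_norm; exists (Num.min r (t - r)); first by rewrite lt_min r0 subr_gt0.
      move=> s; rewrite lt_min => /andP[]; rewrite !ltr_norml => /andP[s1 s2] /andP[s3 s4].
      have s0 : 0 <= s by clear - s1; lra.
      have st : s <= t by clear - s4; lra.
      have s5 := le_trans st t1.
      by rewrite /= fp// !clampE// prmK//; exact: img_seg.
    have dp := sd_curve (sd_lift (dexpo_unit no_conj ir) sA (cp r) sf).
    have [d dN dle] := radial_growth ltr01 ir dp.
    exists d, S; split; first exact: dN.
    + by have := sd_curve (sd_linear r (blin_line (S : R^o))) => H; rewrite -[S in X in curve_derive _ _ X]mul1r; exact: H.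
    + apply: le_trans (ler_norm _) _; apply: le_trans dle _.
      rewrite mulmxKV ?dexpo_unit// scale1r inner_metric E0 prmK; last by apply: img_seg; rewrite ?(ltW r0).
      have := r1max r; rewrite in_itv /= (ltW r0) r1' => /(_ isT).
      by rewrite /mt clampE ?(ltW r0)//; exact: ler_wsqrtr.
have b := coer (p t); rewrite -/(nsq q (p t)) in b.
have : 1 + nsq q (p t) <= (N0 + S) ^+ 2.
  rewrite -(sqr_sqrtr (addr_ge0 ler01 (nsq_ge0 q (p t)))) ler_sqr ?nnegrE ?sqrtr_ge0// ?addr_ge0 ?sqrtr_ge0//.
have := nsq_ge0 q (p t); have := normr_ge0 (p t).
move: b Kc0; move: (`|p t|) (nsq q (p t)) ((N0 + S) ^+ 2) => a b' c h1 k0 a0 b0 h2.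
have h3 : Kc * b' <= Kc * c by rewrite ler_pM2l//; clear - h2; lra.
by have := sqr_ge0 (a - 1); clear - h1 h3 a0; nra.
Qed.

(** The section through [u] is built along straight segments issuing from [y0], the coordinates of
    the image of [u], rather than from the centre: a ball is star-shaped about each of its points.
    The segments lift because [lift_bounded] confines their lifts to a ball. *)
Lemma expo_sections q (x : M) : exists2 B : set M, nbhs x B &
  forall u, B (expo q u) -> exists2 g : M -> E, g (expo q u) = u &
    forall x', B x' -> expo q (g x') = x' /\ {for x', continuous g}.
Proof.
pose i := chart_at x; have ix : dom i x by exact: mem_chart_at.
have [d d0 Hd] := iffLR (near_norm _ _) (nbhs_img (img_crd ix)).
pose C : set E := [set z | `|z - crd i x| < d].
exists [set x' | dom i x' /\ C (crd i x')].
  have N : \forall x' \near x, ball (crd i x) d (crd i x').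
    have := continuous_crd ix; move/(_ (ball (crd i x) d)) => H; apply: H; exact: nbhsx_ballx.
  apply: (@filterS M (nbhs x) _ _ _ _ (filterI N (nbhs_dom ix))) => x' [].
  by rewrite -ball_normE /= distrC.
move=> u [iu Cu]; set y0 := crd i (expo q u) in Cu.
have star y s : C y -> 0 <= s -> s <= 1 -> C (y0 + s *: (y - y0)).
  move=> Cy s0 s1; rewrite /C /=.
  have -> : y0 + s *: (y - y0) - crd i x = (1 - s) *: (y0 - crd i x) + s *: (y - crd i x) by linear_id.
  apply: (@le_lt_trans _ _ (Num.max `|y0 - crd i x| `|y - crd i x|)); last by rewrite gt_max Cu.
  rewrite (le_trans (ler_normD _ _))// !normrZ (ger0_norm s0) ger0_norm ?subr_ge0//.
  set m := Num.max _ _; have -> : m = (1 - s) * m + s * m by ring.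
  by apply: lerD; rewrite ler_wpM2l ?subr_ge0// le_max lexx ?orbT.
have [|||||H [H0 HP]] := @straight_section R _ M (expo q)
  (@expo_open _ _ complete no_conj q) (@expo_injective_near _ _ complete no_conj q) _ C y0 (prm i) u.
- have -> : C = ball (crd i x) d by apply/seteqP; split=> y; rewrite -ball_normE /C /= distrC.
  exact: ball_open.
- exact: Cu.
- exact: star.
- by move=> y /Hd; exact: continuous_prm.
- move=> y Cy.
  have iseg s : 0 <= s -> s <= 1 -> img i (y0 + s *: (y - y0)) by move=> s0 s1; apply: Hd; exact: star.
  have [K bd] := lift_bounded q u iseg.
  have [||p [cp p0 fp]] := path_lift_bounded (@surface_hausdorff _ M) (@expo_continuous _ _ complete q)
    (@expo_open _ _ complete no_conj q) (@expo_injective_near _ _ complete no_conj q) _ _ bd.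
  + move=> r; apply: (@continuous_comp R E M (fun s => y0 + clamp s *: (y - y0)) (prm i)).
      apply: (@continuous_comp R R E clamp (fun s => y0 + s *: (y - y0))); last exact: line_continuous.
      exact: clamp_continuous.
    by apply: continuous_prm; apply: iseg; [exact: clamp_ge0 | exact: clamp_le1].
  + by rewrite clamp_le0// scale0r addr0 crdK.
  exists p; split=> // s; rewrite fp clampE//; [exact: clamp_ge0 | exact: clamp_le1].
exists (H \o crd i); first exact: H0.
move=> x' [ix' Cx']; have [fH cH] := HP _ Cx'; split; first by rewrite /= fH crdK.
by apply: continuous_comp; [exact: continuous_crd | exact: cH].
Qed.

Hypothesis plane : homeomorphic M E.

Lemma expo_inverse q : exists G : M -> E, [/\ continuous G, cancel (expo q) G & cancel G (expo q)].
Proof.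
have [psi [phi [h1 h2 cpsi cphi]]] := plane.
apply: (covering_inverse (@expo_continuous _ _ complete q)
  (@expo_open _ _ complete no_conj q) (@expo_injective_near _ _ complete no_conj q)
  (phi := phi) (psi := psi) _ _ _ (expo_sections q)).
- exact/continuous_subspace_setT.
- exact/continuous_subspace_setT.
- by move=> x; have [] := h1 x I.
Qed.

End RadialGrowth.

(** * Distance and lines *)

Section DistanceFunction.
Context {R : realType} {M : riemannian_surface R}.
Implicit Types (i j : atlas_idx M) (x y q : M).
Local Notation E := ('rV[R]_2).
Hypothesis complete : geodesically_complete M.
Hypothesis no_conj : no_conjugate_points M.
Hypothesis plane : homeomorphic M E.
Local Notation geo := (geo complete).
Local Notation expo := (expo complete).

Definition logm q : M -> E := projT1 (cid (expo_inverse complete no_conj plane q)).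

Lemma logm_continuous q : continuous (logm q).
Proof. by rewrite /logm; case: cid => G []. Qed.

Lemma expoK q : cancel (expo q) (logm q).
Proof. by rewrite /logm; case: cid => G []. Qed.

Lemma logmK q : cancel (logm q) (expo q).
Proof. by rewrite /logm; case: cid => G []. Qed.

Lemma logm_self q : logm q q = 0.
Proof. by rewrite -[in X in logm q X](expo0 complete q) expoK. Qed.

(** The radial distance; [dist_dst] identifies it with the infimum of lengths. *)
Definition dst q x : R := Num.sqrt (nsq q (logm q x)).

Lemma dst_ge0 q x : 0 <= dst q x. Proof. exact: sqrtr_ge0. Qed.

Lemma dst_sqr q x : dst q x ^+ 2 = nsq q (logm q x).
Proof. by rewrite sqr_sqrtr ?nsq_ge0. Qed.

Lemma dst_expo q v : dst q (expo q v) = Num.sqrt (nsq q v).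
Proof. by rewrite /dst expoK. Qed.

Lemma nsqZ q a v : nsq q (a *: v) = a ^+ 2 * nsq q v.
Proof. by rewrite /nsq innerZl innerZr mulrA expr2. Qed.

Lemma dst_continuous q : continuous (dst q).
Proof.
move=> x; apply: (@continuous_comp M R R (fun x => nsq q (logm q x)) Num.sqrt); last exact: sqrt_continuous.
by apply: (@continuous_comp M E R (logm q) (nsq q)); [exact: logm_continuous | exact: nsq_continuous].
Qed.

Lemma dst_eq0 q x : dst q x = 0 -> x = q.
Proof.
move=> d0; have := dst_sqr q x; rewrite d0 expr0n /= => /esym/(inner_eq0 (mem_chart_at q)) l0.
by rewrite -(logmK q x) l0 expo0.
Qed.

Lemma dst_self q : dst q q = 0.
Proof. by rewrite /dst logm_self /nsq inner0r sqrtr0. Qed.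

(** [logm q] is a continuous lift of the identity through the exponential map, so [sd_lift]
    applies. *)
Lemma logm_strict q x i : dom i x -> strict_derive (fun z => logm q (prm i z)) (crd i x)
  (fun h => h *m invmx (dexpo complete q i (logm q x))).
Proof.
move=> ix; have iz := img_crd ix; have il : dom i (expo q (logm q x)) by rewrite logmK.
have := @sd_lift R E 2 (fun w => crd i (expo q w)) (fun z => logm q (prm i z)) (crd i x)
  (dexpo complete q i (logm q x)) id (dexpo_unit no_conj il).
apply.
- by rewrite crdK//; exact: expo_strict.
- by apply: (@continuous_comp E M E (prm i) (logm q)); [exact: continuous_prm | exact: logm_continuous].
- apply: sd_near (sd_linear _ (blin_id _)).
  by apply: (@filterS E (nbhs (crd i x)) _ _ _ _ (nbhs_img iz)) => z /prmK {1}<-; rewrite /= logmK.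
Qed.

Lemma logm_curve_derive q (c : R -> M) t i : smooth_curve c -> dom i (c t) ->
  curve_derive (fun s => logm q (c s)) t
    (velocity i c t *m invmx (dexpo complete q i (logm q (c t)))).
Proof.
move=> sc it; have := curve_derive_comp (logm_strict q it) (velocity_derive sc it).
apply: curve_derive_near.
have [d d0 near_i] := near_path (sc.1 t) (nbhs_dom it).
by apply/near_norm; exists d; [exact: d0 | move=> s /near_i is_; rewrite /= crdK].
Qed.

Lemma speedE (c : R -> M) t : speed c t = Num.sqrt (energy c t).
Proof. reflexivity. Qed.

Lemma speed_ge0 (c : R -> M) t : 0 <= speed c t. Proof. exact: sqrtr_ge0. Qed.

Lemma speed_continuous (c : R -> M) : smooth_curve c -> continuous (speed c).
Proof.
move=> sc t; pose i := chart_at (c t); have it : dom i (c t) by exact: mem_chart_at.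
have [d d0 near_i] := near_path (sc.1 t) (nbhs_dom it).
pose F s := Num.sqrt (\sum_a \sum_b velocity i c s 0 a * gmat i (crd i (c s)) a b * velocity i c s 0 b).
have N : \forall s \near t, F s = speed c s.
  apply/near_norm; exists d; first exact: d0.
  by move=> s /near_i is_; rewrite speedE (energyE sc is_) innerE.
rewrite /continuous_at -(nbhs_singleton N).
suff cF : {for t, continuous F} by apply: cvg_trans cF; exact: near_eq_cvg.
have dx := velocity_derive sc it; have dv := accel_derive sc it.
have H := curve_derive_sum2 (fun a => curve_derive_sum2 (fun b => curve_derive_mul (curve_derive_mul
  (curve_derive_coord a dv) (curve_derive_comp (gmat_entry_strict a b (img_crd it)) dx)) (curve_derive_coord b dv))).
apply: (@continuous_comp R R R (fun s => \sum_a \sum_b velocity i c s 0 a * gmat i (crd i (c s)) a b * velocity i c s 0 b) Num.sqrt).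
  exact: curve_derive_cont H.
exact: sqrt_continuous.
Qed.

(** [radial_growth] along [c]: the regularized norm of [logm q (c t)] grows no faster than arc
    length. *)
Lemma arc_length_dst q (c : R -> M) a b : smooth_curve c -> a <= b ->
  dst q (c b) - dst q (c a) <= arc_length c a b.
Proof.
move=> sc; rewrite le_eqVlt => /predU1P[<-|ab].
  by rewrite subrr; apply: Rintegral_ge0 => t _; exact: speed_ge0.
(* The shift by e makes the norm differentiable at the origin. *)
pose N (e t : R) := Num.sqrt (e + nsq q (logm q (c t))).
have cs := speed_continuous sc.
pose S t := Rintegral lebesgue_measure `[a, t] (speed c).
have S0 t : 0 <= S t by apply: Rintegral_ge0 => s _; exact: speed_ge0.
have dS t : a < t -> curve_derive S t (speed c t).
  move=> at_; apply/curve_deriveP.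
  apply: (@continuous_FTC1_closed R (speed c) a t (t + 1)); rewrite ?ltrDl//.
    by apply: continuous_compact_integrable; [exact: segment_compact | exact: continuous_subspaceT].
  exact: cs.
have cN e : continuous (N e).
  move=> t; apply: (@continuous_comp R R R (fun t => e + nsq q (logm q (c t))) Num.sqrt); last exact: sqrt_continuous.
  apply: (@continuousD _ R^o _ (fun=> e) (fun t => nsq q (logm q (c t)))); first exact: cvg_cst.
  apply: (@continuous_comp R E R (fun t => logm q (c t)) (nsq q)); last exact: nsq_continuous.
  by apply: (@continuous_comp R M E c (logm q)); [exact: sc.1 | exact: logm_continuous].
(* The integral is differentiated only at times after [a], so the estimate starts at some [s > a],
   and [step2] lets [s] tend to [a]. *)
have step (e s : R) : 0 < e -> a < s -> s <= b -> N e b - N e s <= S b.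
  move=> e0 as_ sb; apply: (@le_trans _ _ (S b - S s)); last by rewrite gerBl.
  apply: (growth_le sb).
  - by move=> t _ _; exact: cN.
  - by move=> t st _; exact: curve_derive_cont (dS t (lt_le_trans as_ st)).
  move=> t st tb; pose i := chart_at (c t); have it : dom i (c t) by exact: mem_chart_at.
  have dl := logm_curve_derive q sc it.
  have il : dom i (expo q (logm q (c t))) by rewrite logmK.
  have [d dN dle] := radial_growth e0 il dl.
  exists d, (speed c t); split; [exact: dN | exact: dS (lt_trans as_ st) |].
  apply: le_trans (ler_norm _) _; apply: le_trans dle _.
  by rewrite mulmxKV ?dexpo_unit// logmK.
have step2 (e : R) : 0 < e -> N e b - N e a <= S b.
  move=> e0; apply/ler_addgt0Pr => h h0.
  have [d d0 H] := iffLR (continuous_norm _ _) (cN e a) _ h0.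
  pose s := Num.min b (a + d / 2).
  have as_ : a < s by rewrite lt_min ab ltrDl divr_gt0.
  have sd : `|s - a| < d.
    rewrite gtr0_norm ?subr_gt0// ltrBlDl gt_min; apply/orP; right.
    by rewrite ltrD2l ltr_pdivrMr// ltr_pMr// ltr1n.
  have sb : s <= b by rewrite ge_min lexx.
  have := H s sd; rewrite ler_norml => /andP[_ Ns].
  have := step e s e0 as_ sb.
  by move: Ns; move: (N e b) (N e s) (N e a) (S b) => *; lra.
change (dst q (c b) - dst q (c a) <= S b); apply/ler_addgt0Pr => h h0.
(* With shift [h ^+ 2] the regularized norm exceeds the norm by at most [h]. *)
have e0 : 0 < h ^+ 2 by rewrite exprn_gt0.
have B t : dst q (c t) <= N (h ^+ 2) t by rewrite ler_wsqrtr// lerDr ltW.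
have A : N (h ^+ 2) a <= h + dst q (c a).
  rewrite -(@ler_sqr _ (N _ _)) ?nnegrE ?sqrtr_ge0 ?addr_ge0 ?dst_ge0 ?(ltW h0)//.
  rewrite sqr_sqrtr ?addr_ge0 ?nsq_ge0 ?(ltW e0)// sqrrD dst_sqr addrAC lerDl.
  by rewrite mulrn_wge0// mulr_ge0 ?dst_ge0// ltW.
have := step2 _ e0; have := B b; move: A.
by move: (dst q (c b)) (dst q (c a)) (N _ b) (N _ a) (S b) => *; lra.
Qed.

Lemma geo_arc_length q v : arc_length (geo q v) 0 1 = Num.sqrt (nsq q v).
Proof.
rewrite /arc_length (@eq_Rintegral _ _ _ _ _ (fun=> Num.sqrt (nsq q v))).
  by rewrite Rintegral_cst//= lebesgue_measure_itv/= lte_fin ltr01 oppr0 addr0 mulr1.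
by move=> t _; rewrite /speed geo_energy// ; exact: mem_chart_at.
Qed.

Lemma dst_path q x y l : piecewise_smooth_path x y l -> dst q y - dst q x <= l.
Proof.
elim=> [c a b sc ab|{}x {}y z {}l m _ IH1 _ IH2]; first exact: arc_length_dst.
by move: IH1 IH2; move: (dst q x) (dst q y) (dst q z) => *; lra.
Qed.

Lemma geo_path x y : piecewise_smooth_path x y (dst x y).
Proof.
have := path_segment (geo_geodesic complete x (logm x y)).1 ler01.
by rewrite geo_start -/(expo x (logm x y)) logmK geo_arc_length.
Qed.

(** No path is shorter than [dst] by [dst_path], and the radial geodesic attains it. *)
Lemma dist_dst q x : dist q x = dst q x.
Proof.
have lb : lbound [set l | piecewise_smooth_path q x l] (dst q x).
  by move=> l /= /(dst_path q); rewrite dst_self subr0.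
apply/eqP; rewrite eq_le; apply/andP; split.
  by apply: ge_inf; [exists (dst q x) | exact: geo_path].
by apply: lb_le_inf => //; exists (dst q x); exact: geo_path.
Qed.

Lemma dst_triangle x y z : dst x z <= dst x y + dst y z.
Proof. by have := dst_path x (geo_path y z); rewrite lerBlDl. Qed.

(** After rescaling, every geodesic segment is a radial one issuing from its first point; so
    geodesics minimize globally. *)
Lemma geodesic_dst c s t : geodesic c -> dst (c s) (c t) = `|t - s| * Num.sqrt (energy c 0).
Proof.
move=> gc; pose e r := c ((t - s) * r + s).
have ge : geodesic e by exact: geodesic_affine.
have e0 : e 0 = c s by rewrite /e mulr0 add0r.
have e1 : e 1 = c t by rewrite /e mulr1 subrK.
have is_ := mem_chart_at (c s).
have ie0 : dom (chart_at (c s)) (c ((t - s) * 0 + s)) by rewrite mulr0 add0r.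
have ve : velocity (chart_at (c s)) e 0 = (t - s) *: velocity (chart_at (c s)) c s.
  rewrite /e (velocity_affine gc.1 ie0) mulr0 add0r; reflexivity.
have E1 := geo_unique complete ge e0 ve.
clearbody e; rewrite -e1 E1 -[geo _ _ 1]/(expo _ _) dst_expo nsqZ.
rewrite sqrtrM; last exact: sqr_ge0.
rewrite sqrtr_sqr (energy_constant gc 0 s) (energyE gc.1 is_); reflexivity.
Qed.

Lemma dst_sym x y : dst x y = dst y x.
Proof.
pose v := logm x y.
have H' := geodesic_dst 1 0 (geo_geodesic complete x v).
have G := geodesic_dst 0 1 (geo_geodesic complete x v).
rewrite geo_start -/(expo x v) logmK in G H'.
rewrite G H'; congr (_ * _); exact: distrC.
Qed.

(** Rescaled to run from time [s] to time [t] in unit time, a geodesic has as initial velocity the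
    [logm] of its end point, which the two points determine. *)
Lemma two_points (c e : R -> M) s t : geodesic c -> geodesic e -> s != t -> c s = e s -> c t = e t -> c = e.
Proof.
move=> gc ge st cs ct.
suff param f : geodesic f -> f = fun r => expo (f s) (((r - s) / (t - s)) *: logm (f s) (f t)).
  by rewrite (param c gc) (param e ge) cs ct.
move=> gf; have gg : geodesic (fun r => f ((t - s) * r + s)) by exact: geodesic_affine.
have ts : t - s != 0 by rewrite subr_eq0 eq_sym.
set x := f s; pose v := velocity (chart_at x) (fun r => f ((t - s) * r + s)) 0.
have g0 : (fun r => f ((t - s) * r + s)) 0 = x by rewrite /= mulr0 add0r.
have E1 := geo_unique complete gg g0 (erefl v).
have H r : f ((t - s) * r + s) = expo x (r *: v) by rewrite -geo_expo -E1.
have -> : logm x (f t) = v.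
  by have := H 1; rewrite mulr1 subrK scale1r => ->; rewrite expoK.
by apply/funext => r; rewrite -H mulrCA divff// mulr1 subrK.
Qed.

(** The Gauss lemma in gradient form: half the squared distance to [q] has as gradient the end
    velocity of the radial geodesic. *)
Lemma dst_sqr_strict q x i : dom i x ->
  strict_derive (fun z => nsq q (logm q (prm i z))) (crd i x)
    (fun h => 2 * inner i x (velocity i (geo q (logm q x)) 1) h).
Proof.
move=> ix; have il : dom i (expo q (logm q x)) by rewrite logmK.
have E0 : logm q (prm i (crd i x)) = logm q x by rewrite crdK.
apply: sd_ext (sd_comp_eq (logm_strict q ix) E0 (nsq_strict q (logm q x))) => h /=.
by rewrite -(expo_gauss _ il) mulmxKV ?dexpo_unit// logmK.
Qed.

Lemma dst_derive q x i (h : E) : dom i x -> 0 < dst q x ->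
  curve_derive (fun s : R => dst q (prm i (crd i x + s *: h))) 0
    ((dst q x)^-1 * inner i x (velocity i (geo q (logm q x)) 1) h).
Proof.
move=> ix d0; have sl := sd_add (sd_cst (crd i x) 0) (sd_linear 0 (blin_line h)).
have E0 : crd i x + 0 *: h = crd i x by rewrite scale0r addr0.
have H := sd_curve (sd_comp_eq sl E0 (dst_sqr_strict q ix)).
rewrite /= add0r scale1r in H.
have N0 : 0 < nsq q (logm q (prm i (crd i x + 0 *: h))) by rewrite E0 crdK// -dst_sqr exprn_gt0.
have := curve_derive_sqrt N0 H; rewrite /= E0 crdK// -/(dst q x).
congr (curve_derive _ _ _); move: (dst q x) (inner _ _ _ _) d0 => a b a0.
by field; rewrite gt_eqF.
Qed.

Lemma curve_derive_min (f : R -> R) t d : curve_derive f t d ->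
  (\forall s \near t, f t <= f s) -> d = 0.
Proof.
move=> df /near_norm[r r0 fmin]; apply/eqP; apply: contraT => d0.
have e0 : 0 < `|d| / 2 by rewrite divr_gt0// normr_gt0.
have [h h0 fh] := df _ e0.
pose k := Num.min r h / 2; have k0 : 0 < k by rewrite divr_gt0// lt_min r0.
have kr : k < r /\ k < h.
  have : k < Num.min r h by rewrite ltr_pdivrMr// ltr_pMr ?ltr1n// lt_min r0.
  by rewrite lt_min => /andP[].
have A (s : R) : `|s| = k -> 0 <= s * d + `|d| / 2 * k.
  move=> sk; have E1 : t + s - t = s by ring.
  have st : `|t + s - t| = k by rewrite E1.
  have := fmin (t + s); rewrite st => /(_ kr.1).
  have := fh (t + s); rewrite st => /(_ kr.2); rewrite E1 ler_norml => /andP[_].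
  by move: (f (t + s)) (f t) => a b; rewrite -[s *: d]/(s * d); lra.
have := A k; rewrite gtr0_norm// => /(_ erefl).
have := A (- k); rewrite normrN gtr0_norm// => /(_ erefl).
move: k0 e0; clear; move: k => k k0 e0.
by move: e0; case: (ger0P d) => d0 e0 h1 h2; nra.
Qed.

(* At the middle point of an aligned triple the gradients of the distances to
   the two other points cancel. *)
Lemma aligned x y z : x != y -> y != z -> dst x z = dst x y + dst y z ->
  exists2 c, geodesic c & [/\ c (- dst x y) = x, c 0 = y & c (dst y z) = z].
Proof.
move=> xy yz al; set a := dst x y; set b := dst y z.
have a0 : 0 < a by rewrite lt_def dst_ge0 andbT; apply: contra xy => /eqP/dst_eq0 ->.
have b0 : 0 < b by rewrite lt_def dst_ge0 andbT; apply: contra yz => /eqP/dst_eq0 ->.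
pose i := chart_at y; have iy : dom i y by exact: mem_chart_at.
(* Unit speed geodesics through [y] at time 0: [e1] leaves [x] at time [- a], and [e2] reaches [z]
   at time [b]. *)
pose e1 r := geo x (logm x y) (a^-1 * r + 1).
pose e2 r := geo z (logm z y) (- b^-1 * r + 1).
have g1 : geodesic e1 by apply: geodesic_affine; exact: geo_geodesic.
have g2 : geodesic e2 by apply: geodesic_affine; exact: geo_geodesic.
have e10 : e1 0 = y by rewrite /e1 mulr0 add0r -/(expo _ _) logmK.
have e20 : e2 0 = y by rewrite /e2 mulr0 add0r -/(expo _ _) logmK.
set v1 := velocity i (geo x (logm x y)) 1; set v2 := velocity i (geo z (logm z y)) 1.
have V1 : velocity i e1 0 = a^-1 *: v1.
  rewrite /e1 velocity_affine ?mulr0 ?add0r; first reflexivity.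
    exact: (geo_geodesic complete x (logm x y)).1.
  by rewrite -/(expo _ _) logmK.
have V2 : velocity i e2 0 = - b^-1 *: v2.
  rewrite /e2 velocity_affine ?mulr0 ?add0r; first reflexivity.
    exact: (geo_geodesic complete z (logm z y)).1.
  by rewrite -/(expo _ _) logmK.
have bz : b = dst z y by exact: dst_sym.
pose w := a^-1 *: v1 + b^-1 *: v2.
have w0 : w = 0.
  apply: (inner_eq0 iy).
  have -> : inner i y w w = a^-1 * inner i y v1 w + b^-1 * inner i y v2 w.
    rewrite -!innerZl -innerDl; reflexivity.
  have d1 := dst_derive w iy a0.
  have b0' : 0 < dst z y by rewrite -bz.
  have d2 := dst_derive w iy b0'; rewrite -bz in d2.
  (* By the triangle inequality the sum of the distances to [x] and [z] is smallest at [y]. *)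
  apply: curve_derive_min (curve_derive_add d1 d2) _.
  apply/near_norm; exists 1 => // s _; rewrite scale0r addr0 crdK// -bz -/a -al.
  by rewrite (le_trans (dst_triangle x (prm i (crd i y + s *: w)) z))// (dst_sym z).
have e12 : e1 = e2.
  have V12 : velocity i e1 0 = velocity i e2 0.
    rewrite V1 V2 scaleNr; apply/eqP; rewrite -subr_eq0 opprK; apply/eqP; exact: w0.
  have i1 : dom i (e1 0) by rewrite e10.
  have i2 : dom i (e2 0) by rewrite e20.
  exact: (geodesic_unique g1 g2 i1 i2 (f_equal2 pair (f_equal (crd i) (etrans e10 (esym e20))) V12)).
exists e1; first exact: g1.
split; [| exact: e10 | rewrite e12].
- by rewrite /e1 mulrN mulVf ?gt_eqF// addNr geo_start.
- by rewrite /e2 mulNr mulVf ?gt_eqF// addNr geo_start.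
Qed.

(** Each ordered triple of points of [g] lies on a geodesic by [aligned]. Taking the times 0, 1 and
    [t], this geodesic is always the one through [g 0] and [g 1]. *)
Lemma metric_line_geodesic (g : R -> M) : (forall s t, dst (g s) (g t) = `|t - s|) -> geodesic g.
Proof.
move=> lg.
have ne s t : s < t -> g s != g t.
  move=> st; apply/eqP => e; have := lg s t; rewrite e dst_self => /eqP.
  by rewrite eq_sym normr_eq0 subr_eq0 gt_eqF.
have triple r s t : r < s -> s < t -> exists2 c, geodesic c & [/\ c r = g r, c s = g s & c t = g t].
  move=> rs st; have rt := lt_trans rs st.
  have [|c gc []] := aligned (ne r s rs) (ne s t st).
    by rewrite !lg !gtr0_norm ?subr_gt0//; ring.
  rewrite !lg !gtr0_norm ?subr_gt0// => c1 c2 c3.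
  exists (fun u => c (1 * u + - s)); first exact: geodesic_affine.
  by split; rewrite mul1r; [rewrite -c1; congr c; ring | rewrite subrr | rewrite -c3].
pose c := geo (g 0) (logm (g 0) (g 1)).
have c0 : c 0 = g 0 by exact: geo_start.
have c1 : c 1 = g 1 by rewrite -[LHS]/(expo _ _) logmK.
have gc : geodesic c by exact: geo_geodesic.
have key e : geodesic e -> e 0 = g 0 -> e 1 = g 1 -> e = c.
  move=> ge e0 e1; apply: (two_points (s := 0) (t := 1) ge gc); rewrite ?c0 ?c1//.
  by rewrite eq_sym oner_eq0.
suff -> : g = c by exact: gc.
apply/funext => t; have [t0|t0|->] := ltgtP t 0; last by rewrite c0.
- have [e ge [e1 e2 e3]] := triple t 0 1 t0 ltr01.
  by rewrite -(key e ge e2 e3).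
have [t1|t1|->] := ltgtP t 1; last by rewrite c1.
- have [e ge [e1 e2 e3]] := triple 0 t 1 t0 t1.
  by rewrite -(key e ge e1 e3).
- have [e ge [e1 e2 e3]] := triple 0 1 t ltr01 t1.
  by rewrite -(key e ge e1 e2).
Qed.

End DistanceFunction.

Lemma ultra_fmap (S T : Type) (f : S -> T) (U : set_system S) : UltraFilter U -> UltraFilter (f @ U).
Proof.
move=> UU; have PU := @ultra_proper _ _ UU.
split; first exact: fmap_proper_filter.
move=> G PG sub; apply/seteqP; split=> [A GA|A]; last exact: sub.
have [//|H] := in_ultra_setVsetC (f @^-1` A) UU.
have GC : G (~` A) by apply: sub.
by have [x []] := filter_ex (filterI GA GC).
Qed.

(** * Visibility and sides of a line *)

Section TangentNorm.
Context {R : realType} {M : riemannian_surface R}.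
Implicit Types (x y q p : M).
Local Notation E := ('rV[R]_2).

Definition nrm q (v : E) : R := Num.sqrt (nsq q v).

Lemma nrm_ge0 q v : 0 <= nrm q v. Proof. exact: sqrtr_ge0. Qed.

Lemma nrm_sqr q v : nrm q v ^+ 2 = nsq q v.
Proof. by rewrite sqr_sqrtr ?nsq_ge0. Qed.

Lemma nrmZ q a v : nrm q (a *: v) = `|a| * nrm q v.
Proof. by rewrite /nrm nsqZ sqrtrM ?sqr_ge0// sqrtr_sqr. Qed.

Lemma nrmN q v : nrm q (- v) = nrm q v.
Proof. by rewrite -scaleN1r nrmZ normrN normr1 mul1r. Qed.

Lemma nrmB q u v : nrm q (u - v) = nrm q (v - u).
Proof. by rewrite -opprB nrmN. Qed.

Lemma nrm_triangle q u v : nrm q (u + v) <= nrm q u + nrm q v.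
Proof.
rewrite -(@ler_sqr _ (nrm q (u + v))) ?nnegrE ?addr_ge0 ?nrm_ge0//.
have qq := mem_chart_at q.
have -> : nrm q (u + v) ^+ 2 = nsq q u + 2 * inner (chart_at q) q u v + nsq q v.
  rewrite nrm_sqr /nsq -[u]scale1r -[v]scale1r inner_combination// !scale1r.
  by rewrite expr1n !mul1r !mulr1.
have := le_trans (ler_norm _) (abs_inner_le u v qq).
rewrite -/(nsq q u) -/(nsq q v) -/(nrm q u) -/(nrm q v) -!nrm_sqr.
move: (nrm q u) (nrm q v) (inner _ _ _ _) => a b c H.
by rewrite sqrrD mulr2n; lra.
Qed.

Lemma nrm_dist q u v w : nrm q (u - w) <= nrm q (u - v) + nrm q (v - w).
Proof.
have -> : u - w = (u - v) + (v - w) by linear_id.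
exact: nrm_triangle.
Qed.

Lemma nrm_continuous q : continuous (nrm q).
Proof.
move=> v; apply: (@continuous_comp E R R (nsq q) Num.sqrt); [exact: nsq_continuous | exact: sqrt_continuous].
Qed.

Lemma nrm_eq0 q v : nrm q v = 0 -> v = 0.
Proof.
move=> v0; apply: (inner_eq0 (mem_chart_at q)).
by rewrite -/(nsq q v) -nrm_sqr v0 expr0n.
Qed.

Lemma finite_positive (I : finType) (F : I -> R) : (forall i, 0 < F i) ->
  exists2 e : R, 0 < e & forall i, e <= F i.
Proof.
move=> F0; pose S := \sum_i (F i)^-1.
have S0 i : (F i)^-1 <= S.
  by rewrite /S (bigD1 i)//= lerDl sumr_ge0// => j _; rewrite invr_ge0 ltW.
have S1 : 0 < 1 + S by rewrite ltr_wpDr// sumr_ge0// => j _; rewrite invr_ge0 ltW.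
exists (1 + S)^-1; first by rewrite invr_gt0.
move=> i; rewrite -[leRHS]invrK lef_pV2 ?posrE ?invr_gt0//.
by rewrite (le_trans (S0 i))// lerDr.
Qed.

(** Normalized vectors [(1, k)]: if two agree, the first entries force equal scaling factors and the
    second ones equal [k]. *)
Lemma separated_directions q n : exists (w : 'I_n -> E) (e : R),
  [/\ 0 < e, forall k, nrm q (w k) = 1 & forall k l, k != l -> 6 * e < nrm q (w k - w l)].
Proof.
pose u (k : 'I_n) : E := \row_a (if a == 0 then 1 else k%:R).
have u0 k : u k 0 0 = 1 by rewrite mxE.
have u1 k : u k 0 1 = k%:R by rewrite mxE.
have nu k : 0 < nrm q (u k).
  rewrite lt_neqAle nrm_ge0 andbT; apply/eqP => /esym/nrm_eq0/rowP/(_ 0).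
  by rewrite u0 mxE => /eqP; rewrite oner_eq0.
pose w k := (nrm q (u k))^-1 *: u k.
have nw k : nrm q (w k) = 1 by rewrite nrmZ gtr0_norm ?invr_gt0// mulVf ?gt_eqF.
pose F (kl : 'I_n * 'I_n) := if kl.1 == kl.2 then 1 else nrm q (w kl.1 - w kl.2).
have F0 kl : 0 < F kl.
  rewrite /F; case: eqVneq => // ne; rewrite lt_neqAle nrm_ge0 andbT; apply/eqP => /esym/nrm_eq0/eqP.
  rewrite subr_eq0 => /eqP/rowP e; move: (e 0) (e 1); rewrite !mxE /= !mulr1 => e0.
  rewrite e0 => /mulfI; rewrite invr_eq0 gt_eqF// => /(_ isT)/eqP; rewrite eqr_nat => /eqP/val_inj kl_eq.
  by rewrite kl_eq eqxx in ne.
have [e e0 eF] := finite_positive F0.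
exists w, (e / 7); split=> //; first by rewrite divr_gt0.
move=> k l kl; have := eF (k, l); rewrite /F /= (negbTE kl).
by move: (nrm q _) => a; lra.
Qed.

End TangentNorm.

Section Visibility.
Context {R : realType} {M : riemannian_surface R}.
Implicit Types (x y q : M).
Local Notation E := ('rV[R]_2).
Context (complete : geodesically_complete M) (no_conj : no_conjugate_points M)
  (plane : homeomorphic M E) (p : M).
Local Notation geo := (geo complete).
Local Notation expo := (expo complete).
Local Notation logm := (logm complete no_conj plane).
Local Notation dst := (dst complete no_conj plane).

Definition metric_line (g : R -> M) := forall s t, dst (g s) (g t) = `|t - s|.

(** Unit initial vector at [p] of the geodesic to [x]; distances between such vectors replace
    angles, so that the triangle inequality is available. *)
Definition dir x : E := (dst p x)^-1 *: logm p x.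

Lemma nrm_logm q x : nrm q (logm q x) = dst q x. Proof. by []. Qed.

Lemma near_direction x w (e : R) : 0 < dst p x ->
  (nrm p (dir x - w) <= e) = (nrm p (logm p x - dst p x *: w) <= e * dst p x).
Proof.
move=> d0; have -> : logm p x - dst p x *: w = dst p x *: (dir x - w).
  by rewrite scalerBr scalerA divff ?gt_eqF// scale1r.
by rewrite nrmZ gtr0_norm// mulrC ler_pM2r.
Qed.

(** Turns the angle bound into a chord bound: unit vectors whose angle has cosine [k] are at squared
    distance [2 - 2 * k]. *)
Lemma visibility_directions (e : R) : visibility_axiom p -> 0 < e -> exists2 r : R, 0 < r &
  forall c a b, geodesic c -> a <= b -> (forall t, a <= t -> t <= b -> r <= dst p (c t)) ->
    nrm p (dir (c a) - dir (c b)) <= e.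
Proof.
move=> vis e0; have e20 : 0 < e ^+ 2 / 2 by rewrite divr_gt0// exprn_gt0.
have [d d0 Hd] := iffLR (continuous_norm _ _) (@continuous_cos R 0) _ e20.
(* At most [pi], so that the cosine is decreasing on the range of angles compared. *)
pose h := Num.min (d / 2) pi; have h0 : 0 < h by rewrite lt_min divr_gt0// pi_gt0.
have cosh : 1 - e ^+ 2 / 2 <= cos h.
  have hd : `|h - 0| < d.
    by rewrite subr0 gtr0_norm// gt_min ltr_pdivrMr// ltr_pMr// ltr1n.
  have := Hd h hd; rewrite cos0 ler_norml => /andP[H _].
  by move: H; move: (cos h) (e ^+ 2) => a b; lra.
have [r r0 H] := vis h h0.
(* The axiom asks for a strict inequality on an infimum; the margin 1 provides it. *)
exists (r + 1); first by rewrite addr_gt0.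
move=> c a b gc ab far.
pose u := logm p (c a); pose v := logm p (c b).
have far_inf : r < dist_to_segment p c a b.
  apply: (@lt_le_trans _ _ (r + 1)); first by rewrite ltrDl.
  apply: lb_le_inf; first by exists (dist p (c a)), a => //=; rewrite in_itv /= lexx ab.
  move=> _ [t /= + <-]; rewrite in_itv /= => /andP[at_ tb].
  by rewrite (dist_dst complete no_conj plane); exact: far.
have := H c a b gc ab far_inf (geo p u) (geo p v) (geo_geodesic complete p u) (geo_start complete p u)
  (logmK complete no_conj plane p (c a)) (geo_geodesic complete p v) (geo_start complete p v)
  (logmK complete no_conj plane p (c b)).
rewrite /angle0 geo_start !geo_velocity -/(nsq p u) -/(nsq p v) -/(nrm p u) -/(nrm p v) => ang.
have pp := mem_chart_at p.
have na : 0 < nrm p u by have := far a (lexx a) ab; rewrite -nrm_logm; apply: lt_le_trans; rewrite addr_gt0.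
have nb : 0 < nrm p v by have := far b ab (lexx b); rewrite -nrm_logm; apply: lt_le_trans; rewrite addr_gt0.
set k := inner _ _ u v / _ in ang.
have kE : inner (chart_at p) p u v = k * (nrm p u * nrm p v) by rewrite /k divfK// mulf_neq0 ?gt_eqF.
have k1 : k \in `[-1, 1].
  rewrite in_itv /= -ler_norml /k normrM normfV (@gtr0_norm _ (_ * _)) ?mulr_gt0//.
  by rewrite ler_pdivrMr ?mulr_gt0// mul1r; exact: abs_inner_le.
have ck : cos h <= k.
  rewrite -(acosK k1) leNgt; apply/negP.
  have k1' : -1 <= k <= 1 by move: k1; rewrite in_itv.
  rewrite ltr_cos ?in_itv /= ?acos_ge0 ?acos_lepi ?(ltW h0) ?ge_min ?lexx ?orbT//.
  by rewrite ltNge ang.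
rewrite -(@ler_sqr _ _ e) ?nnegrE ?nrm_ge0 ?(ltW e0)//.
rewrite nrm_sqr /nsq /dir -scaleNr inner_combination// kE -!/(nsq p _) -!nrm_sqr -!nrm_logm -/u -/v.
have -> : (nrm p u)^-1 ^+ 2 * nrm p u ^+ 2 + 2 * (nrm p u)^-1 * - (nrm p v)^-1 * (k * (nrm p u * nrm p v))
   + (- (nrm p v)^-1) ^+ 2 * nrm p v ^+ 2 = 2 - 2 * k by field; rewrite !gt_eqF.
by move: cosh ck; move: (cos h) (e ^+ 2) => A B; lra.
Qed.

Lemma metric_line_reverse g : metric_line g -> metric_line (fun t => g (- t)).
Proof. by move=> lg s t; rewrite lg -opprD normrN. Qed.

Lemma metric_line_far g s t : metric_line g -> `|t - s| - dst p (g s) <= dst p (g t).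
Proof.
move=> lg; rewrite lerBlDl -(lg s t).
by rewrite (le_trans (dst_triangle complete no_conj plane _ p _))// (dst_sym _ _ _ (g s) p).
Qed.

(** The distance to [p] grows along a line, so every segment of a late tail stays outside the
    visibility radius. *)
Lemma metric_line_tail g (e : R) : visibility_axiom p -> metric_line g -> 0 < e ->
  exists T : R, forall s t, T <= s -> T <= t -> nrm p (dir (g s) - dir (g t)) <= e.
Proof.
move=> vis lg e0; have [r r0 H] := visibility_directions vis e0.
have gg := metric_line_geodesic lg.
pose T := Num.max 0 (r + dst p (g 0)).
have far t : T <= t -> r <= dst p (g t).
  rewrite ge_max => /andP[t0 tr]; apply: le_trans (metric_line_far 0 t lg).
  by rewrite subr0 ger0_norm// lerBrDr.
exists T => s t Ts Tt; wlog st : s t Ts Tt / s <= t => [wl|].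
  by have [st|/ltW ts] := leP s t; [exact: wl | rewrite nrmB; exact: wl].
by apply: H => // u su _; apply: far; exact: le_trans su.
Qed.

Lemma unit_geo_line x w : nrm x w = 1 -> metric_line (geo x w).
Proof.
move=> w1 s t; rewrite (geodesic_dst _ _ _ _ _ (geo_geodesic complete x w)).
have i0 : dom (chart_at x) (geo x w 0) by rewrite geo_start; exact: mem_chart_at.
rewrite (energyE (geo_geodesic complete x w).1 i0) (geo_energy i0) -/(nrm x w) w1; exact: mulr1.
Qed.

Lemma line_between x y : x != y -> exists2 c, metric_line c & c 0 = x /\ c (dst x y) = y.
Proof.
move=> xy; have d0 : 0 < dst x y.
  by rewrite lt_def dst_ge0 andbT; apply: contra xy => /eqP/dst_eq0 ->.
exists (geo x ((dst x y)^-1 *: logm x y)).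
  by apply: unit_geo_line; rewrite nrmZ gtr0_norm ?invr_gt0// nrm_logm mulVf ?gt_eqF.
split; first exact: geo_start.
by rewrite geo_expo scalerA divff ?gt_eqF// scale1r logmK.
Qed.

Lemma ball_compact x (r : R) : compact [set y | dst x y <= r].
Proof.
have [K K0 coer] := inner_coercive (mem_chart_at x).
pose A : set E := [set v | `|v - 0| <= 1 + K * r ^+ 2].
pose B : set E := [set v | nrm x v <= r].
have cB : closed B.
  apply: (@preimage_closed E R (nrm x) [set t | t <= r]); first by move=> v _; exact: nrm_continuous.
  exact: closed_le.
have cAB : compact (A `&` B) by apply: compact_closedI => //; exact: compact_cball.
have -> : [set y | dst x y <= r] = expo x @` (A `&` B).
  apply/seteqP; split=> [y /= yr|_ [v [_ Bv] <-]]; last by rewrite /= dst_expo; exact: Bv.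
  exists (logm x y); last exact: logmK.
  split; last exact: yr.
  have := coer (logm x y); rewrite /A /= subr0 -/(nsq x _) -dst_sqr.
  have := dst_ge0 complete no_conj plane x y; have := normr_ge0 (logm x y).
  move: yr K0; move: (dst x y) (`|logm x y|) => a b ar k0 b0 a0 h.
  have h3 : K * a ^+ 2 <= K * r ^+ 2 by rewrite ler_pM2l// ler_sqr ?nnegrE// (le_trans a0).
  by have := sqr_ge0 (b - 1); clear - h h3 b0; nra.
apply: continuous_compact => //; apply: continuous_subspaceT; exact: expo_continuous.
Qed.

(** Balls are compact, so pointwise limits exist along one ultrafilter refining the tails; distances
    are continuous, so the limit is again a line. Further properties pass to it as closed
    conditions. *)
Lemma limit_line (c : nat -> R -> M) (r : R) : (forall n, metric_line (c n)) ->
  (forall n, dst p (c n 0) <= r) -> exists2 g, metric_line g &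
  forall t (A : set M), closed A -> (exists N, forall n, (N <= n)%N -> A (c n t)) -> A (g t).
Proof.
move=> lc cr; have [U [UU sub]] := ultraFilterLemma (eventually_filter).
have PU : ProperFilter U by exact: (@ultra_proper _ _ UU).
have conv t : exists x, (c ^~ t) @ U --> x.
  have cK := @ball_compact p (r + `|t|); rewrite compact_ultra in cK.
  have [||x [_ ux]] := cK (c ^~ t @ U); last by exists x; exact: ux.
    exact: ultra_fmap.
  apply: (@filterS _ U _ setT) => [n _ /=|]; last exact: filterT.
  have := dst_triangle complete no_conj plane p (c n 0) (c n t).
  by move/le_trans; apply; rewrite lc subr0 lerD.
pose g t := projT1 (cid (conv t)).
have cg t : (c ^~ t) @ U --> g t by rewrite /g; case: cid.
exists g; last first.
  move=> t A cA [N HN].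
  have NA : \forall n \near U, A (c n t) by apply: sub; exists N => // n /= Nn; exact: HN.
  exact: (@closed_cvg nat M U PU (c ^~ t) A cA NA (g t) (cg t)).
move=> s t; apply/eqP; rewrite -subr_eq0 -normr_le0; apply/ler_addgt0Pr => e e0.
rewrite add0r; have e2 : 0 < e / 2 by rewrite divr_gt0.
have near u : U [set n | dst (g u) (c n u) < e / 2].
  have N : \forall x \near g u, dst (g u) x < e / 2.
    have := @dst_continuous _ _ complete no_conj plane (g u) (g u); move=> /(_ [set a | a < e / 2]); apply.
    by rewrite dst_self; apply: open_nbhs_nbhs; split; [exact: open_lt | ].
  exact: cg u _ N.
have [n [ns nt]] := filter_ex (filterI (near s) (near t)).
rewrite /= in ns nt.
have T := dst_triangle complete no_conj plane.
have T1 := T (g s) (c n s) (g t); have T2 := T (c n s) (c n t) (g t).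
have T3 := T (c n s) (g s) (c n t); have T4 := T (g s) (g t) (c n t).
rewrite (dst_sym _ _ _ (c n t) (g t)) in T2; rewrite (dst_sym _ _ _ (c n s) (g s)) in T3.
rewrite (lc n s t) in T2 T3.
move: ns nt T1 T2 T3 T4; move: (dst (g s) (c n s)) (dst (g t) (c n t)) (dst (g s) (g t)) (dst (c n s) (g t)) (dst (g s) (c n t)) (`|t - s|) => a b d d1 d2 k *.
by rewrite ler_norml; apply/andP; split; lra.
Qed.

(** * The two sides of a line *)

Section Sides.
Variable gamma : R -> M.
Hypothesis lg : metric_line gamma.

Let q := gamma 0.
Let gg : E := velocity (chart_at q) gamma 0.

Lemma gamma_geodesic : geodesic gamma. Proof. exact: metric_line_geodesic lg. Qed.

Lemma gammaE t : gamma t = expo q (t *: gg).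
Proof. by rewrite -geo_expo -(geo_unique complete gamma_geodesic). Qed.

Lemma logm_gamma t : logm q (gamma t) = t *: gg.
Proof. by rewrite gammaE expoK. Qed.

Lemma gg_neq0 : gg != 0.
Proof.
apply/eqP => g0; have := lg 0 1; rewrite subr0 normr1 /Defs.dist.
by rewrite (gammaE 0) (gammaE 1) g0 !scaler0 dst_self => /eqP; rewrite eq_sym oner_eq0.
Qed.

Definition cross (u v : E) : R := u 0 0 * v 0 1 - u 0 1 * v 0 0.

Lemma cross_eq0 u v : u != 0 -> cross u v = 0 -> exists k, v = k *: u.
Proof.
move=> u0 c0; have [e0|n0] := eqVneq (u 0 0) 0.
  have n1 : u 0 1 != 0.
    apply: contra u0 => /eqP e1; apply/eqP/rowP; apply: I2_ind; by rewrite mxE ?e0 ?e1.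
  exists (v 0 1 / u 0 1); apply/rowP; apply: I2_ind; rewrite !mxE; last by rewrite divfK.
  move: c0; rewrite /cross e0 mul0r sub0r mulr0 => /eqP.
  by rewrite oppr_eq0 mulf_eq0 (negbTE n1) => /eqP.
exists (v 0 0 / u 0 0); apply/rowP; apply: I2_ind; rewrite !mxE; first by rewrite divfK.
move: c0 => /eqP; rewrite subr_eq0 => /eqP c0.
by rewrite mulrAC [v 0 0 * _]mulrC -c0 [_ * v 0 1]mulrC mulfK.
Qed.

(** Oriented area in exponential coordinates at [gamma 0], where [gamma] is the axis spanned by
    [gg]; the zero set is [gamma] itself and the sign distinguishes its sides. *)
Definition side x : R := cross gg (logm q x).

Lemma cross_strict u v : strict_derive (cross u) v (cross u).
Proof.
have := sd_sub (sd_mul (sd_cst (u 0 0) v) (sd_coord v 1)) (sd_mul (sd_cst (u 0 1) v) (sd_coord v 0)).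
by apply: sd_ext => h; rewrite !mul0r !add0r.
Qed.

Lemma side_continuous : continuous side.
Proof.
move=> x; apply: (@continuous_comp M E R (logm q) (cross gg)); first exact: logm_continuous.
exact: sd_cont (cross_strict gg _).
Qed.

Lemma side_gamma t : side (gamma t) = 0.
Proof. by rewrite /side logm_gamma /cross !mxE; ring. Qed.

Lemma side_eq0 x : side x = 0 -> exists t, x = gamma t.
Proof.
by move=> /(cross_eq0 gg_neq0)[t xt]; exists t; rewrite gammaE -xt logmK.
Qed.

Lemma meet_twice c s1 s2 u1 u2 : metric_line c -> s1 != s2 -> c s1 = gamma u1 -> c s2 = gamma u2 ->
  forall t, side (c t) = 0.
Proof.
move=> lc s12 c1 c2 t; pose k := (u2 - u1) / (s2 - s1).
have s21 : s2 - s1 != 0 by rewrite subr_eq0 eq_sym.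
have -> : c = fun t => gamma (k * t + (u1 - k * s1)); last exact: side_gamma.
apply: (@two_points _ _ complete no_conj plane _ _ s1 s2) => //.
- exact: metric_line_geodesic lc.
- by apply: geodesic_affine; exact: gamma_geodesic.
- by rewrite c1; congr gamma; ring.
- by rewrite c2; congr gamma; rewrite /k; field.
Qed.

(** A change of side would produce one zero before [t] and one after it, and then [meet_twice] puts
    all of [c] on [gamma]. *)
Lemma same_side c (e a b t : R) : metric_line c -> 0 < e * side (c a) -> 0 < e * side (c b) ->
  a <= t -> t <= b -> 0 <= e * side (c t).
Proof.
move=> lc ca cb at_ tb; rewrite leNgt; apply/negP => ct.
pose f s := e * side (c s).
have cf : continuous f.
  move=> s; apply: (@continuousM _ R^o (fun=> e) (fun s => side (c s))); first exact: cvg_cst.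
  apply: (@continuous_comp R M R c side); last exact: side_continuous.
  exact: (metric_line_geodesic lc).1.1.
have zero s : f s = 0 -> exists u, c s = gamma u.
  move=> /eqP; rewrite mulf_eq0 => /orP[/eqP e0|/eqP/side_eq0//].
  by move: ca; rewrite e0 mul0r ltxx.
have [||s1 s1P f1] := @IVT R f a t 0 at_; first exact: continuous_subspaceT.
  by rewrite ge_min le_max (ltW ca) (ltW ct) orbT.
have [||s2 s2P f2] := @IVT R f t b 0 tb; first exact: continuous_subspaceT.
  by rewrite ge_min le_max (ltW cb) (ltW ct) orbT.
move: s1P s2P; rewrite !in_itv /= => /andP[_ s1t] /andP[ts2 _].
have s12 : s1 != s2.
  apply/eqP => e12; have : s1 = t by apply/eqP; rewrite eq_le s1t e12 ts2.
  by move=> e1; move: ct; rewrite -e1 -/(f s1) f1 ltxx.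
have [u1 c1] := zero s1 f1; have [u2 c2] := zero s2 f2.
by move: ct; rewrite (meet_twice lc s12 c1 c2) mulr0 ltxx.
Qed.

(* The function side has a minimum along c at t0, so c and gamma are tangent there. *)
Lemma touching c (e t0 : R) : metric_line c -> e != 0 -> (forall t, 0 <= e * side (c t)) ->
  side (c t0) = 0 -> exists k l, forall t, c t = gamma (k * t + l).
Proof.
move=> lc e0 c_side c0; have gc := metric_line_geodesic lc.
have [u0 cu] := side_eq0 c0; pose i := chart_at (c t0).
have it : dom i (c t0) by exact: mem_chart_at.
have dl := logm_curve_derive complete no_conj plane q gc.1 it.
have iu : dom i (gamma u0) by rewrite -cu.
have iu' : dom i (expo q (u0 *: gg)) by rewrite -gammaE.
rewrite cu logm_gamma in dl; set A := dexpo _ _ _ _ in dl.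
have uA : A \in unitmx by exact: dexpo_unit.
have ds := curve_derive_comp (cross_strict gg _) dl.
have de : curve_derive (fun t => e *: side (c t)) t0 (e *: cross gg (velocity i c t0 *m invmx A)).
  exact: (curve_derive_scale e ds).
have z : e *: cross gg (velocity i c t0 *m invmx A) = 0.
  apply: (curve_derive_min de); apply/near_norm; exists 1 => // s _.
  by rewrite c0 scaler0; exact: c_side.
have {z}z : cross gg (velocity i c t0 *m invmx A) = 0.
  by move/eqP: z; rewrite scaler_eq0 (negbTE e0) => /eqP.
have [k kE] := cross_eq0 gg_neq0 z.
have vk : velocity i c t0 = k *: (gg *m A) by rewrite scalemxAl -kE mulmxKV.
have vg : velocity i gamma u0 = gg *m A.
  apply: (curve_derive_unique (velocity_derive gamma_geodesic.1 iu)).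
  have sl := sd_curve (sd_linear u0 (blin_line gg)); rewrite scale1r in sl.
  have := curve_derive_comp (expo_strict iu') sl.
  by apply: curve_derive_near; apply/near_norm; exists 1 => // s _; rewrite -gammaE.
exists k, (u0 - k * t0) => t.
have ge : geodesic (fun t => gamma (k * t + (u0 - k * t0))) by apply: geodesic_affine; exact: gamma_geodesic.
have E0 : k * t0 + (u0 - k * t0) = u0 by ring.
have ie : dom i (gamma (k * t0 + (u0 - k * t0))) by rewrite E0.
have P : phase i c t0 = phase i (fun t => gamma (k * t + (u0 - k * t0))) t0.
  apply: (f_equal2 pair); first by rewrite /= E0 cu.
  by rewrite (velocity_affine gamma_geodesic.1 ie) E0 vg.
by rewrite [in LHS](geodesic_unique gc ge it ie P).
Qed.

End Sides.

End Visibility.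

(** * The partner line *)

Section Partner.
Context {R : realType} {M : riemannian_surface R}.
Implicit Types (x y q : M).
Local Notation E := ('rV[R]_2).
Context (complete : geodesically_complete M) (no_conj : no_conjugate_points M)
  (plane : homeomorphic M E) (p : M).
Local Notation expo := (expo complete).
Local Notation logm := (logm complete no_conj plane).
Local Notation dst := (dst complete no_conj plane).
Local Notation metric_line := (metric_line complete no_conj plane).
Local Notation dir := (dir complete no_conj plane p).
Local Notation side := (side complete no_conj plane).

Lemma constant_sign (f : R -> R) N : continuous f -> (forall t, N <= t -> f t != 0) ->
  (forall t, N <= t -> 0 < f t) \/ (forall t, N <= t -> f t < 0).
Proof.
move=> cf f0; have cfs a b : {within `[a, b], continuous f} by exact: continuous_subspaceT.
have [fN|fN|fN] := ltgtP (f N) 0; last by have := f0 N (lexx N); rewrite fN eqxx.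
- right=> t Nt; rewrite ltNge; apply/negP => ft.
  have [|s] := IVT (v := 0) Nt (cfs _ _); first by rewrite ge_min le_max (ltW fN) ft orbT.
  by rewrite in_itv /= => /andP[Ns _] fs; have := f0 s Ns; rewrite fs eqxx.
- left=> t Nt; rewrite ltNge; apply/negP => ft.
  have [|s] := IVT (v := 0) Nt (cfs _ _); first by rewrite ge_min le_max (ltW fN) ft orbT.
  by rewrite in_itv /= => /andP[Ns _] fs; have := f0 s Ns; rewrite fs eqxx.
Qed.

Lemma dst_ray w t : nrm p w = 1 -> 0 <= t -> dst p (expo p (t *: w)) = t.
Proof. by move=> w1 t0; rewrite dst_expo -/(nrm p _) nrmZ w1 mulr1 ger0_norm. Qed.

Lemma dir_ray w t : nrm p w = 1 -> 0 < t -> dir (expo p (t *: w)) = w.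
Proof.
by move=> w1 t0; rewrite /dir dst_ray// ?(ltW t0)// expoK scalerA mulVf ?gt_eqF// scale1r.
Qed.

Lemma line_upper g s t : metric_line g -> dst p (g t) <= dst p (g s) + `|t - s|.
Proof. by move=> lg; rewrite -(lg s t); exact: dst_triangle. Qed.

(** The sign [e] names the side of [gamma] containing [sigma]. The last clause involves absolute
    values of times, so it covers all four pairs of ends and is insensitive to orientation. *)
Lemma partner gamma : visibility_axiom p -> metric_line gamma ->
  exists sigma (e : R), [/\ metric_line sigma, e = 1 \/ e = -1,
    forall t, 0 < e * side gamma (sigma t) &
    forall C, exists T, forall t s, T <= `|t| -> T <= `|s| -> C < dst (gamma t) (sigma s)].
Proof.
move=> vis lg.
have [w [h [h0 nw sepw]]] := separated_directions p 5.
have [r r0 vis'] := visibility_directions complete no_conj plane vis h0.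
have [Tp HTp] := metric_line_tail vis lg h0.
have [Tm HTm] := metric_line_tail vis (metric_line_reverse lg) h0.
pose gp := dir (gamma Tp); pose gm := dir (gamma (- Tm)).
pose T0 := Num.max 0 (Num.max Tp Tm).
have T00 : 0 <= T0 by rewrite le_max lexx.
pose apart v := 3 * h < nrm p (v - gp) /\ 3 * h < nrm p (v - gm).
(* Late directions of [gamma] are within [h] of [gp] or [gm], so a vector more than [3 * h] away
   from both is not within [2 * h] of any of them. *)
have tail t v : T0 <= `|t| -> apart v -> nrm p (v - dir (gamma t)) <= 2 * h -> False.
  rewrite !ge_max => /and3P[_ tp tm] [ap am] H.
  have [t0|t0] := leP 0 t.
    rewrite ger0_norm// in tp; have H2 := HTp t Tp tp (lexx _).
    by have := nrm_dist p v (dir (gamma t)) gp; move: H H2 ap; rewrite -/gp; move: (nrm _ _) (nrm _ _) (nrm _ _) => a b c; lra.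
  rewrite ltr0_norm// in tm; have := HTm (- t) Tm tm (lexx _); rewrite opprK => H2.
  by have := nrm_dist p v (dir (gamma t)) gm; move: H H2 am; rewrite -/gm; move: (nrm _ _) (nrm _ _) (nrm _ _) => a b c; lra.
(* Points of [gamma] at times below [T0] in absolute value are closer to [p] than [N], so a ray can
   meet [gamma] beyond distance [N] only in a tail, which [tail] excludes. *)
pose N := 1 + dst p (gamma 0) + T0.
have N1 : 1 <= N by rewrite /N -addrA lerDl addr_ge0// dst_ge0.
have ray k : apart (w k) -> (forall t, N <= t -> 0 < side gamma (expo p (t *: w k))) \/
    (forall t, N <= t -> side gamma (expo p (t *: w k)) < 0).
  move=> ap; apply: constant_sign.
    move=> t; apply: (@continuous_comp R M R (fun t => expo p (t *: w k)) (side gamma)); last exact: side_continuous.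
    apply: (@continuous_comp R E M (fun t => t *: w k) (expo p)); last exact: expo_continuous.
    exact: sd_cont (sd_linear t (blin_line (w k))).
  move=> t Nt; apply/eqP => /(side_eq0 lg)[s es].
  have t0 : 0 < t by apply: lt_le_trans Nt; exact: lt_le_trans N1.
  have ds : dst p (gamma s) = t by rewrite -es dst_ray// ltW.
  have [sT|sT] := leP T0 `|s|.
    apply: (tail s (w k) sT ap); rewrite -es dir_ray// subrr.
    by rewrite /nrm /nsq inner0r sqrtr0 mulr_ge0// ltW.
  have := line_upper 0 s lg; rewrite ds subr0 => H.
  have := le_trans Nt H; rewrite /N leNgt => /negP; apply.
  by move: sT; move: (dst _ _) (`|s|) => a b; lra.
have [a [b [e [ab aa ab' e1 [sa sb]]]]] : exists a b e, [/\ a != b, apart (w a), apart (w b),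
    e = 1 \/ e = -1 & (forall t, N <= t -> 0 < e * side gamma (expo p (t *: w a))) /\
    (forall t, N <= t -> 0 < e * side gamma (expo p (t *: w b)))].
  pose pos k := forall t, N <= t -> 0 < side gamma (expo p (t *: w k)).
  (* Four classes of directions: close to one of the two ends of gamma, or
     eventually on one of its two sides. *)
  pose cls (k : 'I_5) : bool * bool :=
    if nrm p (w k - gp) <= 3 * h then (true, true) else
    if nrm p (w k - gm) <= 3 * h then (true, false) else (false, `[< pos k >]).
  have [a [b [ne eab]]] : exists a b, a != b /\ cls a = cls b.
    apply: contrapT => inj; have : (#|{: 'I_5}| <= #|{: bool * bool}|)%N.
      apply: (@leq_card _ _ cls) => a b eab; apply/eqP; apply: contraT => ne.
      by exfalso; apply: inj; exists a, b.
    by rewrite card_ord card_prod card_bool.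
  have close g : nrm p (w a - g) <= 3 * h -> nrm p (w b - g) <= 3 * h -> False.
    move=> ha hb; have := nrm_dist p (w a) g (w b); rewrite (nrmB p g) => H.
    by have := sepw a b ne; move: ha hb H; move: (nrm _ _) (nrm _ _) (nrm _ _) => x y z; lra.
  move: eab; rewrite /cls.
  case: leP => ap; case: (leP (nrm p (w b - gp))) => bp //.
  - by move=> _; exfalso; exact: (close gp).
  - by case: ifP.
  - by case: ifP.
  case: leP => am; case: (leP (nrm p (w b - gm))) => bm //.
  - by move=> _; exfalso; exact: (close gm).
  move=> -[eab].
  have [pa|npa] := pselect (pos a).
    have pb : pos b by apply/asboolP; rewrite -eab; exact/asboolP.
    exists a, b, 1; split; [exact: ne | exact: (conj ap am) | exact: (conj bp bm) | by left |].
    by split=> t Nt; rewrite mul1r; [exact: pa | exact: pb].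
  have npb : ~ pos b by move=> pb; apply: npa; apply/asboolP; rewrite eab; exact/asboolP.
  exists a, b, (-1); split; [exact: ne | exact: (conj ap am) | exact: (conj bp bm) | by right |].
  have [//|na] := ray a (conj ap am); have [//|nb] := ray b (conj bp bm).
  by split=> t Nt; rewrite mulN1r oppr_gt0; [exact: na | exact: nb].
have wab : 6 * h < nrm p (w a - w b) := sepw a b ab.
pose m (n : nat) := n%:R + N : R.
have mN n : N <= m n by rewrite /m lerDr.
have m0 n : 0 < m n by apply: lt_le_trans (mN n); exact: lt_le_trans N1.
pose P n := expo p (m n *: w a); pose Q n := expo p (m n *: w b).
(* The segment from [P n] to [Q n] comes within [r] of [p], since its ends are seen in directions
   more than [6 * h] apart. Time 0 is moved to such a point, so [c 0] stays bounded while both ends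
   recede to infinity. *)
have step n : exists c, [/\ metric_line c, dst p (c 0) <= r &
    exists A B, [/\ m n - r <= A, m n - r <= B, c (- A) = P n & c B = Q n]].
  have PQ : P n != Q n.
    apply/eqP => /(can_inj (expoK complete no_conj plane p))/(scalerI (lt0r_neq0 (m0 n))) ewab.
    by move: wab; rewrite ewab subrr /nrm /nsq inner0r sqrtr0 ltNge mulr_ge0// ltW.
  have [l ll [l0 ld]] := line_between complete no_conj plane PQ.
  have [t t0 [td tr]] : exists2 t, 0 <= t & t <= dst (P n) (Q n) /\ dst p (l t) <= r.
    apply: contrapT => H.
    have := vis' l 0 (dst (P n) (Q n)) (metric_line_geodesic ll) (dst_ge0 _ _ _ _ _).
    rewrite l0 ld !dir_ray// => /(_ _)/wrap[].
      move=> t t0 td; rewrite leNgt; apply/negP => /ltW tr; apply: H; exists t => //.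
    by move=> H2; move: wab H2; move: (nrm _ _) => z; lra.
  have lt_line : metric_line (fun s => l (s + t)).
    by move=> s s'; rewrite ll; congr `|_|; ring.
  exists (fun s => l (s + t)); split; [exact: lt_line | by rewrite add0r |].
  exists t, (dst (P n) (Q n) - t); split.
  - have := line_upper t 0 ll; rewrite l0 dst_ray ?(ltW (m0 n))// sub0r normrN (ger0_norm t0).
    by move: tr; move: (dst p (l t)) => z; lra.
  - have := line_upper t (dst (P n) (Q n)) ll; rewrite ld dst_ray ?(ltW (m0 n))//.
    rewrite ger0_norm ?subr_ge0//.
    by move: tr; move: (dst p (l t)) (dst (P n) (Q n)) => z z'; lra.
  - by rewrite addNr.
  - by rewrite subrK.
pose c n := projT1 (cid (step n)).
have cP n : [/\ metric_line (c n), dst p (c n 0) <= r &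
    exists A B, [/\ m n - r <= A, m n - r <= B, c n (- A) = P n & c n B = Q n]].
  by rewrite /c; case: cid.
have [sigma ls limP] := limit_line (fun n => let: And3 x _ _ := cP n in x) (fun n => let: And3 _ x _ := cP n in x).
have large (t : R) : exists K, forall n, (K <= n)%N -> `|t| <= m n - r.
  exists (Num.bound (`|t| + r)) => n Kn.
  have tr0 : 0 <= `|t| + r by rewrite addr_ge0// ltW.
  have H1 := archi_boundP tr0.
  have H2 : (Num.bound (`|t| + r))%:R <= n%:R :> R by rewrite ler_nat.
  by rewrite /m; move: H1 H2 N1; move: (`|t|) (_%:R) (_%:R) => z1 z2 z3; lra.
(* The limit inherits only the weak inequality; [side_neq0] makes it strict. *)
have side_ge0 t : 0 <= e * side gamma (sigma t).
  apply: (limP t [set x | 0 <= e * side gamma x]).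
    apply: (@preimage_closed M R (fun x => e * side gamma x) [set z | 0 <= z]).
      by move=> x _; apply: (@continuousM _ M (fun=> e) (side gamma)); [exact: cvg_cst | exact: side_continuous].
    exact: closed_ge.
  have [K HK] := large t; exists K => n /HK tm.
  have [lc _ [A [B [mA mB cA cB]]]] := cP n.
  have := le_trans tm mA; have := le_trans tm mB; rewrite !ler_norml => /andP[_ tB] /andP[tA _].
  by apply: (same_side lg lc (a := - A) (b := B)) => //; rewrite ?cA ?cB; [exact: sa | exact: sb].
have far_c n (s : R) : `|s| - r <= dst p (c n s).
  have [lc c0 _] := cP n; have := metric_line_far p 0 s lc; rewrite subr0.
  by move: c0; move: (dst _ _) (dst _ _) (`|s|) => z1 z2 z3; lra.
have far_sigma (t : R) : `|t| - r <= dst p (sigma t).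
  apply: (limP t [set x | `|t| - r <= dst p x]); last by exists 0%N => n _; exact: far_c.
  by apply: (@preimage_closed M R (dst p) [set z | `|t| - r <= z]); [move=> x _; exact: dst_continuous | exact: closed_ge].
(* Multiplied by the distance to [p], closeness of directions becomes a closed condition on all of
   [M], although [dir] is not continuous at [p]. *)
have dir_closed v : closed [set x | nrm p (logm p x - dst p x *: v) <= h * dst p x].
  pose f x := h * dst p x - nrm p (logm p x - dst p x *: v).
  have -> : [set x | nrm p (logm p x - dst p x *: v) <= h * dst p x] = [set x | 0 <= f x].
    by apply/seteqP; split=> x /=; rewrite /f subr_ge0.
  apply: (@preimage_closed M R f [set z | 0 <= z]); last exact: closed_ge.
  move=> x _; apply: (@continuousB _ R^o M (fun x => h * dst p x) (fun x => nrm p (logm p x - dst p x *: v))).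
    by apply: (@continuousM _ M (fun=> h) (dst p)); [exact: cvg_cst | exact: dst_continuous].
  apply: (@continuous_comp M E R (fun x => logm p x - dst p x *: v) (nrm p)); last exact: nrm_continuous.
  apply: (@continuousB _ E M (logm p) (fun x => dst p x *: v)); first exact: logm_continuous.
  apply: (@continuous_comp M R E (dst p) (fun z => z *: v)); first exact: dst_continuous.
  exact: sd_cont (sd_linear _ (blin_line v)).
have pos_sigma (t : R) : 2 * r <= `|t| -> 0 < dst p (sigma t).
  by move=> rt; apply: lt_le_trans (far_sigma t); move: rt r0; move: (`|t|) => z; lra.
have pos_c n (t : R) : 2 * r <= `|t| -> r <= dst p (c n t).
  by move=> rt; apply: le_trans (far_c n t); move: rt; move: (`|t|) => z; lra.
(* The part of [c n] from time [t] to [Q n] avoids the visibility radius, so [c n t] is seen within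
   [h] of [w b]; this passes to the limit. *)
have sigma_p t : 2 * r <= t -> nrm p (dir (sigma t) - w b) <= h.
  move=> rt; have t0 : 0 <= t by apply: le_trans rt; rewrite mulr_ge0// ltW.
  rewrite near_direction; last by apply: pos_sigma; rewrite ger0_norm.
  apply: (limP t _ (dir_closed (w b))).
  have [K HK] := large t; exists K => n /HK; rewrite ger0_norm// => tm.
  have [lc _ [A [B [mA mB cA cB]]]] := cP n.
  rewrite /= -near_direction; last by apply: lt_le_trans (pos_c n t _) => //; rewrite ger0_norm.
  rewrite -(dir_ray (nw b) (m0 n)) -[expo _ _]/(Q n) -cB.
  apply: vis'; [exact: metric_line_geodesic lc | exact: le_trans mB |].
  by move=> s ts _; apply: pos_c; rewrite ger0_norm; [exact: le_trans ts | exact: le_trans ts].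
have sigma_m t : 2 * r <= t -> nrm p (dir (sigma (- t)) - w a) <= h.
  move=> rt; have t0 : 0 <= t by apply: le_trans rt; rewrite mulr_ge0// ltW.
  rewrite near_direction; last by apply: pos_sigma; rewrite normrN ger0_norm.
  apply: (limP (- t) _ (dir_closed (w a))).
  have [K HK] := large t; exists K => n /HK; rewrite ger0_norm// => tm.
  have [lc _ [A [B [mA mB cA cB]]]] := cP n.
  rewrite /= -near_direction; last by apply: lt_le_trans (pos_c n (- t) _) => //; rewrite normrN ger0_norm.
  rewrite -(dir_ray (nw a) (m0 n)) -[expo _ _]/(P n) -cA nrmB.
  apply: vis'; [exact: metric_line_geodesic lc | by rewrite lerN2; exact: le_trans mA |].
  move=> s _ st; apply: pos_c; rewrite -normrN; have ts : t <= - s by rewrite lerNr.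
  by rewrite ger0_norm; [exact: le_trans ts | exact: le_trans ts].
have sigma_dir (t : R) : 2 * r <= `|t| -> exists2 v, apart v & nrm p (v - dir (sigma t)) <= h.
  have [t0|t0] := leP 0 t.
    by rewrite ger0_norm// => rt; exists (w b); [exact: ab' | rewrite nrmB; exact: sigma_p].
  rewrite ltr0_norm// => rt; exists (w a); first exact: aa.
  by rewrite nrmB -[t in sigma t]opprK; exact: sigma_m.
have e0 : e != 0 by case: e1 => ->; rewrite ?oppr_eq0 oner_eq0.
(* If [sigma] touched [gamma] it would be a reparametrization of it, and its late directions would
   be close both to an end of [gamma] and to [w a] or [w b]. *)
have side_neq0 t : side gamma (sigma t) != 0.
  apply/eqP => s0; have [k [l kl]] := touching lg ls e0 side_ge0 s0.
  have k1 : `|k| = 1.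
    have := ls 0 1; rewrite !kl lg; have -> : k * 1 + l - (k * 0 + l) = k by ring.
    by rewrite subr0 normr1.
  pose u := 2 * r + `|l| + T0.
  have u0 : 0 <= u by rewrite !addr_ge0// mulr_ge0// ltW.
  have ru : 2 * r <= `|u| by rewrite ger0_norm// /u -addrA lerDl addr_ge0.
  have [v av] := sigma_dir u ru; rewrite kl => dv.
  apply: (tail (k * u + l) v _ av).
    have := ler_normB (k * u + l) l; rewrite addrK normrM k1 mul1r ger0_norm// => H.
    by move: H r0; move: (`|k * u + l|) => z1; rewrite /u; move: (`|l|) => z2; lra.
  by apply: le_trans dv _; rewrite ler_peMl// ?(ltW h0)// ler1n.
exists sigma, e; split=> //.
  move=> t; rewrite lt_neqAle side_ge0 andbT eq_sym mulf_neq0//.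
(* If late points of the two lines were within [C], the segment joining them would stay at distance
   at least [r] from [p], and they would be seen in directions within [h] of each other. *)
move=> C; pose T := Num.max T0 (Num.max (2 * r) (r + C + dst p (gamma 0))).
have TP z : T <= z -> [/\ T0 <= z, 2 * r <= z & r + C + dst p (gamma 0) <= z].
  by rewrite /T ge_max [X in _ && X]ge_max => /and3P.
exists T => t s /TP[tT _ tC] /TP[_ sr _].
rewrite ltNge; apply/negP => dC.
have [v av dv] := sigma_dir s sr.
have xy : gamma t != sigma s.
  by apply/eqP => exy; have := side_neq0 s; rewrite -exy side_gamma// eqxx.
have [l ll [l0 ld]] := line_between complete no_conj plane xy.
have := vis' l 0 (dst (gamma t) (sigma s)) (metric_line_geodesic ll) (dst_ge0 _ _ _ _ _).
rewrite l0 ld => /(_ _)/wrap[].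
  move=> u u0 ud; have H1 := line_upper u 0 ll; rewrite sub0r normrN (ger0_norm u0) l0 in H1.
  have := metric_line_far p 0 t lg; rewrite subr0.
  by move: H1 ud dC tC; move: (dst p _) (dst _ _) (dst p _) (dst p _) (`|t|) => z1 z2 z3 z4 z5; lra.
move=> H; apply: (tail t v tT av).
have := nrm_dist p v (dir (sigma s)) (dir (gamma t)); rewrite (nrmB p (dir (sigma s))).
by move: H dv; move: (nrm _ _) (nrm _ _) (nrm _ _) => z1 z2 z3; lra.
Qed.

End Partner.

(** * The band between two lines *)

Section Gauge.
Context {R : realType} (a b : R -> R).
Hypothesis a_cont : continuous a.
Hypothesis b_cont : continuous b.
Hypothesis b_gt0 : forall t, 0 < b t.
Hypothesis slope_incr : forall s t, s < t -> a s / b s < a t / b t.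
Hypothesis proper : forall C, exists K, forall t, K <= `|t| -> C < `|a t| + b t.

(** Cotangent of the polar angle; [slope_incr] therefore says that the curve meets each ray from the
    origin at most once. *)
Definition slope t := a t / b t.

Lemma slope_continuous : continuous slope.
Proof.
move=> t; apply: (@continuousM _ R^o a (fun t => (b t)^-1)); first exact: a_cont.
by apply: cvgV; [rewrite gt_eqF | exact: b_cont].
Qed.

Lemma slope_lt s t : (slope s < slope t) = (s < t).
Proof.
have [st|ts|->] := ltgtP s t; [exact: slope_incr | | by rewrite ltxx].
by apply/negbTE; rewrite -leNgt; apply: ltW; exact: slope_incr.
Qed.

Lemma slope_inj s t : slope s = slope t -> s = t.
Proof.
by move=> e; have [st|ts|//] := ltgtP s t; [have := slope_lt s t | have := slope_lt t s];
  rewrite ?st ?ts e ltxx.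
Qed.

Definition cone (r t : R) : R * R := (r * a t, r * b t).

Lemma cone_inj r r' t t' : 0 < r -> 0 < r' -> cone r t = cone r' t' -> r = r' /\ t = t'.
Proof.
move=> r0 r'0 [ea eb].
have tt' : t = t'.
  apply: slope_inj; rewrite /slope.
  have -> : a t / b t = (r * a t) / (r * b t) by field; rewrite !gt_eqF.
  by rewrite ea eb; field; rewrite !gt_eqF.
by split=> //; move: eb; rewrite tt' => /mulIf; apply; rewrite gt_eqF.
Qed.

(* The gauge of the region between the horizontal axis and the curve (a, b),
   which is star-shaped about the origin; it vanishes on the rays missing the curve. *)
Definition gauge (z : R * R) : R := xget 0 [set r | 0 < r /\ exists t, z = cone r t].

Lemma gauge_cone r t : 0 < r -> gauge (cone r t) = r.
Proof.
move=> r0; have [r'0 [t' e]] : [set r' | 0 < r' /\ exists t', cone r t = cone r' t'] (gauge (cone r t)).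
  by apply: xgetPex; exists r; split=> //; exists t.
by have [] := cone_inj r0 r'0 e.
Qed.

Lemma gaugeP z : (exists r t, [/\ 0 < r, z = cone r t & gauge z = r]) \/
  (gauge z = 0 /\ forall r t, 0 < r -> z <> cone r t).
Proof.
have [[r [r0 [t e]]]|H] := pselect (exists r, 0 < r /\ exists t, z = cone r t).
  by left; exists r, t; rewrite e gauge_cone.
right; split=> [|r t r0 e]; last by apply: H; exists r; split=> //; exists t.
by rewrite /gauge; case: xgetP => // r _ [r0 e]; exfalso; apply: H; exists r.
Qed.

Lemma gauge_ge0 z : 0 <= gauge z.
Proof. by have [[r [t [r0 _ ->]]]|[-> _]] := gaugeP z; [exact: ltW | exact: lexx]. Qed.

Lemma gauge_le0 x y : y <= 0 -> gauge (x, y) = 0.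
Proof.
move=> y0; have [[r [t [r0 [_ e] _]]]|[-> //]] := gaugeP (x, y).
by move: y0; rewrite e leNgt mulr_gt0.
Qed.

Lemma gauge_scale k x y : 0 < k -> gauge (k * x, k * y) = k * gauge (x, y).
Proof.
move=> k0; have [[r [t [r0 [-> ->] ->]]]|[-> H]] := gaugeP (x, y).
  by rewrite !mulrA -/(cone (k * r) t) gauge_cone// mulr_gt0.
have [[r [t [r0 [ex ey] _]]]|[-> _]] := gaugeP (k * x, k * y); last by rewrite mulr0.
exfalso; apply: (H (k^-1 * r) t); first by rewrite mulr_gt0// invr_gt0.
by congr (_, _); rewrite -mulrA -?ex -?ey mulKf// gt_eqF.
Qed.

Lemma gauge_div k x y : 0 < k -> gauge (x / k, y / k) = gauge (x, y) / k.
Proof. by move=> k0; rewrite ![_ / k]mulrC gauge_scale ?invr_gt0. Qed.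

Lemma gauge_slope t : gauge (slope t, 1) = (b t)^-1.
Proof.
have -> : (slope t, 1) = cone (b t)^-1 t.
  by rewrite /cone mulVf ?gt_eqF// mulrC.
by rewrite gauge_cone// invr_gt0.
Qed.

Lemma gauge_eq1 z : gauge z = 1 -> exists t, z = (a t, b t).
Proof.
have [[r [t [r0 -> ->]]] ->|[-> _] /eqP] := gaugeP z; last by rewrite eq_sym oner_eq0.
by exists t; rewrite /cone !mul1r.
Qed.

Lemma gauge_curve t : gauge (a t, b t) = 1.
Proof. by have := @gauge_cone 1 t ltr01; rewrite /cone !mul1r. Qed.

Lemma near_proj1 (z : R * R) (e : R) : 0 < e -> \forall w \near z, `|w.1 - z.1| < e /\ `|w.2 - z.2| < e.
Proof.
move=> e0; apply/near_norm; exists e => // w; rewrite prod_normE /= gt_max => /andP[]; by split.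
Qed.

Lemma cone_continuous : continuous (fun rt : R * R => cone rt.1 rt.2).
Proof.
move=> rt; apply: (@continuous_pair (R * R)%type R R (fun rt => rt.1 * a rt.2) (fun rt => rt.1 * b rt.2)).
  apply: (@continuousM _ (R * R)%type (fun rt => rt.1) (fun rt => a rt.2)); first exact: cvg_fst.
  by apply: (@continuous_comp (R * R)%type R R snd a); [exact: cvg_snd | exact: a_cont].
apply: (@continuousM _ (R * R)%type (fun rt => rt.1) (fun rt => b rt.2)); first exact: cvg_fst.
by apply: (@continuous_comp (R * R)%type R R snd b); [exact: cvg_snd | exact: b_cont].
Qed.

(** Where the gauge is positive, nearby values are [w.2 / b s] with [s] found by inverting the
    slope. Where it vanishes, nearby points with gauge above [e] would lie in the image of a compact
    set of parameters, and this closed image misses the point. *)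
Lemma gauge_continuous : continuous gauge.
Proof.
move=> z; apply/cvgrPdistC_le => e e0.
have [[r [t [r0 ze ->]]]|[-> zN]] := gaugeP z; last first.
  have N1 := near_proj1 z ltr01.
  (* A point [cone r t] near [z] with [r > e] has [|a t| + b t <= C], so properness bounds [t]; the
     minimum of [b] over these [t] then bounds [r] by [rm]. *)
  pose C := (`|z.1| + `|z.2| + 2) / e.
  have [K HK] := proper C.
  have K0 : - `|K| <= `|K| by rewrite ge0_cp.
  have [|t0 _ t0min] := @EVT_min R b (- `|K|) `|K| K0; first exact: continuous_subspaceT.
  pose rm := (`|z.2| + 1) / b t0.
  pose Q : set (R * R) := (fun rt : R * R => cone rt.1 rt.2) @` (`[e, rm] `*` `[- `|K|, `|K|]).
  have cQ : closed Q.
    apply: compact_closed; first exact: norm_hausdorff.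
    apply: continuous_compact; last by apply: compact_setX; exact: segment_compact.
    exact: continuous_subspaceT cone_continuous.
  have zQ : (~` Q) z.
    move=> [[r t] [/= + _] zrt]; rewrite in_itv /= => /andP[er _].
    by apply: (zN r t); [exact: lt_le_trans er | rewrite zrt].
  have N2 : \forall w \near z, (~` Q) w by apply: open_nbhs_nbhs; split=> //; exact: closed_openC.
  apply: filterS2 N1 N2 => w [w1 w2] wQ; rewrite subr0 ger0_norm ?gauge_ge0// leNgt.
  apply/negP => ew; apply: wQ.
  have [[r [t [r0 we gw]]]|[gw _]] := gaugeP w; last by rewrite gw ltNge ltW in ew.
  rewrite gw in ew.
  have b1 : `|w.1| <= `|z.1| + 1.
    have -> : w.1 = (w.1 - z.1) + z.1 by ring.
    by rewrite (le_trans (ler_normD _ _))// addrC lerD2l ltW.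
  have b2 : `|w.2| <= `|z.2| + 1.
    have -> : w.2 = (w.2 - z.2) + z.2 by ring.
    by rewrite (le_trans (ler_normD _ _))// addrC lerD2l ltW.
  have tK : `|t| <= `|K|.
    rewrite leNgt; apply/negP => Kt.
    have := HK t (le_trans (ler_norm K) (ltW Kt)).
    rewrite /C ltr_pdivrMr// ltNge => /negP; apply.
    move: b1 b2; rewrite we /= !normrM (gtr0_norm r0) (gtr0_norm (b_gt0 t)) => b1 b2.
    have := b_gt0 t; have := normr_ge0 (a t).
    by move: ew b1 b2; clear; move: (`|a t|) (b t) (`|z.1|) (`|z.2|) => A B z1 z2 *; nra.
  exists (r, t); last by [].
  split; rewrite /= in_itv /=; last by rewrite -ler_norml.
  rewrite (ltW ew) /rm ler_pdivlMr//=.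
  have : b t0 <= b t by apply: t0min; rewrite in_itv /= -ler_norml.
  move: b2; rewrite we /= normrM (gtr0_norm r0) (gtr0_norm (b_gt0 t)) => b2 b3.
  by apply: le_trans b2; rewrite ler_pM2l.
have [ez1 ez2] : z.1 = r * a t /\ z.2 = r * b t by rewrite ze.
have z20 : 0 < z.2 by rewrite ez2 mulr_gt0.
have c1 : {for (z, t), continuous (fun ws : (R * R) * R => ws.1.2 / b ws.2)}.
  apply: (@continuousM _ (R * R * R)%type (fun ws => ws.1.2) (fun ws => (b ws.2)^-1)).
    by apply: (@continuous_comp (R * R * R)%type (R * R)%type R fst snd); [exact: cvg_fst | exact: cvg_snd].
  apply: (@cvgV _ _ _ _ (fun ws : R * R * R => b ws.2)); first by rewrite gt_eqF.
  by apply: (@continuous_comp (R * R * R)%type R R snd b); [exact: cvg_snd | exact: b_cont].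
have [d d0 Hd] := iffLR (continuous_norm _ _) c1 e e0.
have rE : z.2 / b t = r by rewrite ez2 mulfK// gt_eqF.
have c2 : {for z, continuous (fun w : R * R => w.1 / w.2)}.
  apply: (@continuousM _ (R * R)%type (fun w => w.1) (fun w => (w.2)^-1)); first exact: cvg_fst.
  by apply: (@cvgV _ _ _ _ (fun w : R * R => w.2)); [rewrite gt_eqF | exact: cvg_snd].
have slz : z.1 / z.2 = slope t by rewrite ez1 ez2 /slope; field; rewrite !gt_eqF.
have d20 : 0 < d / 2 by rewrite divr_gt0.
have d2d : d / 2 < d by rewrite ltr_pdivrMr// ltr_pMr// ltr1n.
pose t1 := t - d / 2; pose t2 := t + d / 2.
have N1 : \forall w \near z, slope t1 < w.1 / w.2 < slope t2.
  have : nbhs (z.1 / z.2) [set k | slope t1 < k < slope t2].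
    rewrite slz; have -> : [set k | slope t1 < k < slope t2] = `]slope t1, slope t2[%classic.
      by apply/seteqP; split=> k /=; rewrite in_itv.
    by apply: open_nbhs_nbhs; split; [exact: interval_open | rewrite /= in_itv /= !slope_lt /t1 /t2 gtrBl ltrDl d20].
  by move/c2.
have N2 : \forall w \near z, 0 < w.2.
  have := near_proj1 z z20; apply: filterS => w [_]; rewrite ltr_norml => /andP[+ _].
  by rewrite ltrBrDl subrr.
have N3 := near_proj1 z d0.
near=> w.
have /andP[w1 w2] : slope t1 < w.1 / w.2 < slope t2 by near: w.
have w0 : 0 < w.2 by near: w.
have [w3 w4] : `|w.1 - z.1| < d /\ `|w.2 - z.2| < d by near: w.
have t12 : t1 <= t2 by rewrite /t1 /t2 lerD2l ge0_cp// ltW.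
have [||s sP sw] := @IVT R slope t1 t2 (w.1 / w.2) t12.
- by apply: continuous_subspaceT; exact: slope_continuous.
- by rewrite ge_min le_max (ltW w1) (ltW w2) orbT.
have wE : w = cone (w.2 / b s) s.
  rewrite /cone divfK ?gt_eqF//; have -> : w.2 / b s * a s = w.2 * slope s by rewrite /slope mulrA mulrAC.
  by rewrite sw mulrC divfK ?gt_eqF//; case: (w).
have gw : gauge w = w.2 / b s by rewrite [in LHS]wE gauge_cone// divr_gt0.
rewrite gw -rE; have := Hd (w, s); apply.
rewrite prod_normE /= gt_max prod_normE /= gt_max w3 w4 /=.
move: sP; rewrite in_itv /= => /andP[s1 s2].
by move: s1 s2 d2d; rewrite /t1 /t2 ltr_norml; clear => s1 s2 d2d; apply/andP; split; lra.
Unshelve. all: by end_near.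
Qed.

(** * Straightening the range of slopes onto the line *)

Definition squash (t : R) : R := t / (1 + `|t|).

Lemma squash_den (t : R) : 0 < 1 + `|t|.
Proof. by rewrite ltr_pwDl. Qed.

Lemma squash_lt1 t : `|squash t| < 1.
Proof.
by rewrite /squash normrM normfV (gtr0_norm (squash_den t)) ltr_pdivrMr ?squash_den// mul1r ltrDr.
Qed.

Lemma squash_abs t : 1 - `|squash t| = (1 + `|t|)^-1.
Proof.
rewrite /squash normrM normfV (gtr0_norm (squash_den t)).
by have := squash_den t; move: (`|t|) => z z0; field; rewrite gt_eqF.
Qed.

Lemma squash_unsquash t : squash t / (1 - `|squash t|) = t.
Proof. by rewrite squash_abs invrK /squash divfK// gt_eqF// squash_den. Qed.

Lemma unsquash_squash (s : R) : `|s| < 1 -> squash (s / (1 - `|s|)) = s.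
Proof.
move=> s1; have d0 : 0 < 1 - `|s| by rewrite subr_gt0.
rewrite /squash normrM normfV (gtr0_norm d0).
have -> : 1 + `|s| / (1 - `|s|) = (1 - `|s|)^-1.
  by move: d0; move: (`|s|) => z z0; field; rewrite gt_eqF.
by rewrite invrK divfK// gt_eqF.
Qed.

Lemma squash_lt s t : s < t -> squash s < squash t.
Proof.
move=> st; rewrite /squash ltr_pdivrMr ?squash_den// mulrAC ltr_pdivlMr ?squash_den//.
by case: (ger0P s); case: (ger0P t) => t0 s0; nra.
Qed.

(* The inverse of slope, squashed into [-1, 1] and extended by monotonicity. *)
Definition param_of_slope (x : R) : R := sup ([set (-1)] `|` [set squash t | t in [set t | slope t <= x]]).

Local Notation f := param_of_slope.

Let fset x : set R := [set (-1)] `|` [set squash t | t in [set t | slope t <= x]].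

Let fset_ub x : ubound (fset x) 1.
Proof.
move=> y [->|[t _ <-]]; first by rewrite lerN10 || (apply: (@le_trans _ _ 0); rewrite ?oppr_le0).
exact: le_trans (ler_norm _) (ltW (squash_lt1 t)).
Qed.

Let fset_sup x : has_sup (fset x).
Proof. by split; [exists (-1); left | exists 1; exact: fset_ub]. Qed.

Lemma param_le1 x : f x <= 1.
Proof. by apply: ge_sup; [exists (-1); left | exact: fset_ub]. Qed.

Lemma param_geN1 x : -1 <= f x.
Proof. by apply: ub_le_sup; [exact: (fset_sup x).2 | left]. Qed.

Lemma param_abs x : `|f x| <= 1.
Proof. by rewrite ler_norml param_geN1 param_le1. Qed.

Lemma param_mono x y : x <= y -> f x <= f y.
Proof.
move=> xy; apply: ge_sup; first by exists (-1); left.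
move=> z [->|[t /= tx <-]]; first exact: param_geN1.
by apply: ub_le_sup; [exact: (fset_sup y).2 | right; exists t => //=; exact: le_trans xy].
Qed.

Lemma param_slope t : f (slope t) = squash t.
Proof.
apply/eqP; rewrite eq_le; apply/andP; split.
  apply: ge_sup; first by exists (-1); left.
  move=> z [->|[s /= st <-]]; first by have := squash_lt1 t; rewrite ltr_norml => /andP[/ltW].
  have [->//|ne] := eqVneq s t; apply/ltW/squash_lt.
  rewrite lt_neqAle ne /= leNgt; apply/negP => ts; move: st; rewrite leNgt slope_lt => /negP; exact.
by apply: ub_le_sup; [exact: (fset_sup _).2 | right; exists t => //=].
Qed.

(** The value of [f] determines a candidate [t]; if [x] were not [slope t], a slightly shifted
    parameter would have its slope between them, against monotonicity. *)
Lemma param_lt1 x : `|f x| < 1 -> exists t, x = slope t.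
Proof.
move=> f1; exists (f x / (1 - `|f x|)); set t := _ / _.
have ft : squash t = f x by exact: unsquash_squash.
have near s (e : R) : 0 < e -> exists2 d, 0 < d & `|slope (s + d) - slope s| <= e /\ `|slope (s - d) - slope s| <= e.
  move=> e0; have [d d0 H] := iffLR (continuous_norm _ _) (slope_continuous (x := s)) e e0.
  exists (d / 2); first by rewrite divr_gt0.
  have d2d : d / 2 < d by rewrite ltr_pdivrMr// ltr_pMr// ltr1n.
  have d20 : 0 < d / 2 by rewrite divr_gt0.
  by split; apply: H; rewrite addrAC subrr add0r ?normrN gtr0_norm.
have [tx|xt|//] := ltgtP (slope t) x.
  have e0 : 0 < x - slope t by rewrite subr_gt0.
  have [d d0 [H _]] := near t _ e0.
  have sx : slope (t + d) <= x by move: H; rewrite ler_norml => /andP[_]; rewrite lerD2r.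
  have := param_mono sx; rewrite param_slope -ft leNgt => /negP; case.
  by apply: squash_lt; rewrite ltrDl.
have e0 : 0 < slope t - x by rewrite subr_gt0.
have [d d0 [_ H]] := near t _ e0.
have sx : x <= slope (t - d).
  by move: H; rewrite ler_norml => /andP[+ _]; rewrite opprB => H; rewrite -(lerD2r (- slope t)).
have := param_mono sx; rewrite param_slope -ft leNgt => /negP; case.
by apply: squash_lt; rewrite gtrBl.
Qed.

(** [f] is monotone and takes every value [v] of the open interval at some [slope t]; choosing [v]
    between [f x] and the tolerance gives the radius on either side. *)
Lemma param_continuous : continuous f.
Proof.
move=> x; have up (e : R) : 0 < e -> exists2 d, 0 < d & forall y, y - x < d -> f y <= f x + e.
  move=> e0; have [fe|fe] := leP 1 (f x + e).
    by exists 1 => // y _; exact: le_trans (param_le1 y) fe.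
  pose v := f x + e / 2; have fv : f x < v by rewrite ltrDl divr_gt0.
  have ve : v < f x + e by rewrite ltrD2l ltr_pdivrMr// ltr_pMr// ltr1n.
  have v1 : `|v| < 1.
    rewrite ltr_norml (lt_trans ve fe) andbT; apply: le_lt_trans fv; exact: param_geN1.
  pose t := v / (1 - `|v|); have tv : squash t = v by exact: unsquash_squash.
  have xt : x < slope t.
    rewrite ltNge; apply/negP => tx; have := param_mono tx; rewrite param_slope tv.
    by rewrite leNgt fv.
  exists (slope t - x); first by rewrite subr_gt0.
  move=> y; rewrite ltrD2r => yt; apply: le_trans (param_mono (ltW yt)) _.
  by rewrite param_slope tv ltW.
have down (e : R) : 0 < e -> exists2 d, 0 < d & forall y, x - y < d -> f x - e <= f y.
  move=> e0; have [fe|fe] := leP (f x - e) (-1).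
    by exists 1 => // y _; exact: le_trans fe (param_geN1 y).
  pose v := f x - e / 2; have fv : v < f x by rewrite gtrBl divr_gt0.
  have ve : f x - e < v by rewrite ltrD2l ltrN2 ltr_pdivrMr// ltr_pMr// ltr1n.
  have v1 : `|v| < 1.
    rewrite ltr_norml (lt_trans fe ve) /=; apply: lt_le_trans fv _; exact: param_le1.
  pose t := v / (1 - `|v|); have tv : squash t = v by exact: unsquash_squash.
  have xt : slope t < x.
    rewrite ltNge; apply/negP => tx; have := param_mono tx; rewrite param_slope tv.
    by rewrite leNgt fv.
  exists (x - slope t); first by rewrite subr_gt0.
  move=> y; rewrite ltrD2l ltrN2 => yt; apply: le_trans (param_mono (ltW yt)).
  by rewrite param_slope tv ltW.
apply/continuous_norm => e e0; have [d1 d10 H1] := up e e0; have [d2 d20 H2] := down e e0.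
exists (Num.min d1 d2); first by rewrite lt_min d10.
move=> y; rewrite lt_min => /andP[y1 y2].
rewrite ler_norml lerBlDl lerBrDl H1 ?andbT; first by apply: H2; rewrite (le_lt_trans (ler_norm _))// distrC.
exact: le_lt_trans (ler_norm _) y1.
Qed.

(* For k < 1 an increasing bijection of the line, for k = 1 one from the interval
   of slopes of the curve onto the line. *)
Definition straighten (x k : R) : R := x + f x / (1 - k * `|f x|).

(** Keeps the denominator of [straighten] positive; at height [k = 1] it forces [x] to be a slope of
    the curve, by [param_lt1]. *)
Definition admissible (x k : R) : Prop := [/\ 0 <= k, k <= 1 & k < 1 \/ `|f x| < 1].

Lemma admissible_den x k : admissible x k -> 0 < 1 - k * `|f x|.
Proof.
move=> [k0 k1 H]; have := param_abs x; have := normr_ge0 (f x).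
by case: H => H; rewrite subr_gt0; move: H; move: (`|f x|) => z; nra.
Qed.

Lemma straighten_lt x x' k : x < x' -> admissible x k -> admissible x' k ->
  straighten x k < straighten x' k.
Proof.
move=> xx' ax ax'; have := admissible_den ax; have := admissible_den ax'.
have [k0 _ _] := ax; have := param_mono (ltW xx').
rewrite /straighten; move: (f x) (f x') => s s' ss' d' d; apply: ltr_leD => //.
rewrite ler_pdivrMr// mulrAC ler_pdivlMr//.
by move: d d'; case: (ger0P s); case: (ger0P s') => s'0 s0 d d'; nra.
Qed.

Lemma straighten_continuous (x k : R) : admissible x k ->
  {for (x, k), continuous (fun z : R * R => straighten z.1 z.2)}.
Proof.
move=> ad; have d0 := admissible_den ad.
have cf : {for (x, k), continuous (fun z : R * R => f z.1)}.
  by apply: (@continuous_comp (R * R)%type R R fst f); [exact: cvg_fst | exact: param_continuous].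
apply: (@continuousD _ R^o (R * R)%type (fun z => z.1) (fun z => f z.1 / (1 - z.2 * `|f z.1|))); first exact: cvg_fst.
apply: (@continuousM _ (R * R)%type (fun z => f z.1) (fun z => (1 - z.2 * `|f z.1|)^-1)); first exact: cf.
apply: (@cvgV _ _ _ _ (fun z : R * R => 1 - z.2 * `|f z.1|)); first by rewrite gt_eqF.
apply: (@continuousB _ R^o (R * R)%type (fun=> 1) (fun z => z.2 * `|f z.1|)); first exact: cvg_cst.
apply: (@continuousM _ (R * R)%type (fun z => z.2) (fun z => `|f z.1|)); first exact: cvg_snd.
apply: (@continuous_comp (R * R)%type R R (fun z => f z.1) (fun y => `|y|)); first exact: cf.
exact: norm_continuous.
Qed.

Lemma straighten_slope t : straighten (slope t) 1 = slope t + t.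
Proof. by rewrite /straighten param_slope mul1r squash_unsquash. Qed.

(** For [k < 1] the map differs from the identity by at most [1 / (1 - k)]; for [k = 1] the point is
    sought as [slope t], where the map is [slope t + t]. *)
Lemma straighten_onto s k : 0 <= k -> k <= 1 -> exists2 x, admissible x k & straighten x k = s.
Proof.
move=> k0; rewrite le_eqVlt => /predU1P[->|k1]; last first.
  have ad x : admissible x k by split=> //; [exact: ltW | left].
  pose m := (1 - k)^-1; have m0 : 0 < m by rewrite invr_gt0 subr_gt0.
  have bd x : `|f x / (1 - k * `|f x|)| <= m.
    have d0 := admissible_den (ad x).
    rewrite normrM normfV (gtr0_norm d0) ler_pdivrMr// mulrC ler_pdivlMr ?subr_gt0//.
    have := param_abs x; have := normr_ge0 (f x); move: (`|f x|) => z; nra.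
  have [|||x _ xs] := @IVT R (straighten ^~ k) (s - m) (s + m) s.
  - by rewrite lerD2l ge0_cp// ltW.
  - apply: continuous_subspaceT => x.
    apply: (@continuous_comp R (R * R)%type R (fun x => (x, k)) (fun z => straighten z.1 z.2)).
      by apply: (@continuous_pair R R R id (fun=> k)); [exact: cvg_id | exact: cvg_cst].
    exact: straighten_continuous.
  - have := bd (s - m); have := bd (s + m); rewrite !ler_norml ge_min le_max /straighten.
    move=> /andP[h1 _] /andP[_ h2]; apply/andP; split; apply/orP; [left|right].
      by move: h2; move: (_ / _) => z; lra.
    by move: h1; move: (_ / _) => z; lra.
  by exists x.
pose F t := slope t + t.
have cF : continuous F.
  by move=> t; apply: (@continuousD _ R^o R slope id); [exact: slope_continuous | exact: cvg_id].
pose m := `|s - slope 0|.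
have Fm : s <= F m.
  have h : slope 0 <= slope m by rewrite leNgt slope_lt -leNgt normr_ge0.
  have := ler_norm (s - slope 0); rewrite -/m /F; move: h; move: (slope m) (slope 0) => u v; lra.
have Fm' : F (- m) <= s.
  have h : slope (- m) <= slope 0 by rewrite leNgt slope_lt -leNgt oppr_le0 normr_ge0.
  have := ler_norm (- (s - slope 0)); rewrite normrN -/m /F; move: h; move: (slope (- m)) (slope 0) => u v; lra.
have [|||t _ ts] := @IVT R F (- m) m s.
- by rewrite (@le_trans _ _ 0)// ?oppr_le0 normr_ge0.
- exact: continuous_subspaceT.
- by rewrite ge_min le_max Fm' Fm orbT.
exists (slope t); last by rewrite straighten_slope.
by split=> //; right; rewrite param_slope; exact: squash_lt1.
Qed.

Definition unstraighten (s k : R) : R := xget 0 [set x | admissible x k /\ straighten x k = s].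

Lemma unstraightenP s k : 0 <= k -> k <= 1 ->
  admissible (unstraighten s k) k /\ straighten (unstraighten s k) k = s.
Proof.
move=> k0 k1; have [x ax xs] := straighten_onto s k0 k1.
by apply: (@xgetPex _ 0 [set x | admissible x k /\ straighten x k = s]); exists x.
Qed.

Lemma straightenK x k : admissible x k -> unstraighten (straighten x k) k = x.
Proof.
move=> ax; have [k0 k1 _] := ax; have [au us] := unstraightenP (straighten x k) k0 k1.
by have [lt|lt|//] := ltgtP (unstraighten (straighten x k) k) x;
  [have := straighten_lt lt au ax | have := straighten_lt lt ax au]; rewrite us ltxx.
Qed.

(** The images of [x0 - r] and [x0 + r] lie on either side of [s0] and move continuously with the
    height; monotonicity in the abscissa traps the inverse between these two points. *)
Lemma unstraighten_near (s0 k0 e : R) : 0 <= k0 -> k0 <= 1 -> 0 < e ->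
  \forall z \near (s0, k0), 0 <= z.2 -> z.2 <= 1 -> `|unstraighten z.1 z.2 - unstraighten s0 k0| <= e.
Proof.
move=> k00 k01 e0; have [ax xs] := unstraightenP s0 k00 k01; set x0 := unstraighten s0 k0 in ax xs *.
have [d d0 ad] : exists2 d : R, 0 < d & forall x, `|x - x0| < d -> admissible x k0.
  have [_ _ [lt|lt]] := ax; first by exists 1 => // x _; split=> //; left.
  have g0 : 0 < (1 - `|f x0|) / 2 by rewrite divr_gt0// subr_gt0.
  have [d d0 H] := iffLR (continuous_norm _ _) (param_continuous (x := x0)) _ g0.
  exists d => // x /H h; split=> //; right.
  have := ler_normD (f x - f x0) (f x0); rewrite subrK.
  by move: lt h; move: (`|f x|) (`|f x0|) (`|_ - _|) => u v w; lra.
pose r := Num.min d e / 2; have r0 : 0 < r by rewrite divr_gt0// lt_min d0.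
have [rd re] : r < d /\ r < e.
  have : r < Num.min d e by rewrite ltr_pdivrMr// ltr_pMr ?ltr1n// lt_min d0.
  by rewrite lt_min => /andP[].
have a1 : admissible (x0 - r) k0 by apply: ad; rewrite addrAC subrr add0r normrN gtr0_norm.
have a2 : admissible (x0 + r) k0 by apply: ad; rewrite addrAC subrr add0r gtr0_norm.
have s1 : straighten (x0 - r) k0 < s0 by rewrite -xs; apply: straighten_lt; rewrite ?gtrBl.
have s2 : s0 < straighten (x0 + r) k0 by rewrite -xs; apply: straighten_lt; rewrite ?ltrDl.
have cont x : admissible x k0 -> {for (s0, k0), continuous (fun z : R * R => straighten x z.2)}.
  move=> axk; apply: (@continuous_comp (R * R)%type (R * R)%type R (fun z => (x, z.2)) (fun z => straighten z.1 z.2)).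
    by apply: (@continuous_pair (R * R)%type R R (fun=> x) snd); [exact: cvg_cst | exact: cvg_snd].
  exact: straighten_continuous.
have adm x : admissible x k0 -> \forall z \near (s0, k0), 0 <= z.2 -> z.2 <= 1 -> admissible x z.2.
  move=> [_ _ [lt|lt]]; last by apply/near_norm; exists 1 => // z _ z0 z1; split=> //; right.
  have g0 : 0 < 1 - k0 by rewrite subr_gt0.
  have := near_proj1 (s0, k0) g0; apply: filterS => z [_ /= h] z0 z1; split=> //; left.
  by move: h; rewrite ltr_norml => /andP[_]; rewrite ltrD2r.
have g1 : 0 < (s0 - straighten (x0 - r) k0) / 2 by rewrite divr_gt0// subr_gt0.
have g2 : 0 < (straighten (x0 + r) k0 - s0) / 2 by rewrite divr_gt0// subr_gt0.
have [d1 d10 H1] := iffLR (continuous_norm _ _) (cont _ a1) _ g1.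
have [d2 d20 H2] := iffLR (continuous_norm _ _) (cont _ a2) _ g2.
have N1 : \forall z \near (s0, k0), `|z - (s0, k0)| < d1 by apply/near_norm; exists d1.
have N2 : \forall z \near (s0, k0), `|z - (s0, k0)| < d2 by apply/near_norm; exists d2.
have N3 := near_proj1 (s0, k0) g1; have N4 := near_proj1 (s0, k0) g2.
near=> z.
move=> z0 z1.
have b1 : admissible (x0 - r) z.2 by move: z0 z1; near: z; exact: adm.
have b2 : admissible (x0 + r) z.2 by move: z0 z1; near: z; exact: adm.
have h1 : `|straighten (x0 - r) z.2 - straighten (x0 - r) k0| <= (s0 - straighten (x0 - r) k0) / 2.
  by apply: (H1 z); near: z.
have h2 : `|straighten (x0 + r) z.2 - straighten (x0 + r) k0| <= (straighten (x0 + r) k0 - s0) / 2.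
  by apply: (H2 z); near: z.
have [h3 _] : `|z.1 - s0| < (s0 - straighten (x0 - r) k0) / 2 /\ `|z.2 - k0| < (s0 - straighten (x0 - r) k0) / 2.
  by near: z.
have [h4 _] : `|z.1 - s0| < (straighten (x0 + r) k0 - s0) / 2 /\ `|z.2 - k0| < (straighten (x0 + r) k0 - s0) / 2.
  by near: z.
have [au us] := unstraightenP z.1 z0 z1.
move: h1 h2 h3 h4; rewrite !ler_norml !ltr_norml => /andP[_ h1] /andP[h2 _] /andP[h3 _] /andP[_ h4].
have l1 : straighten (x0 - r) z.2 < z.1 := below_midpoint h1 h3.
have l2 : z.1 < straighten (x0 + r) z.2 := above_midpoint h2 h4.
have m1 : x0 - r < unstraighten z.1 z.2.
  rewrite ltNge; apply/negP; rewrite le_eqVlt => /predU1P[eq|lt].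
    by move: l1; rewrite -eq us ltxx.
  by have := straighten_lt lt au b1; rewrite us ltNge ltW.
have m2 : unstraighten z.1 z.2 < x0 + r.
  rewrite ltNge; apply/negP; rewrite le_eqVlt => /predU1P[eq|lt].
    by move: l2; rewrite eq us ltxx.
  by have := straighten_lt lt b2 au; rewrite us ltNge ltW.
exact: le_window m1 m2 re.
Unshelve. all: by end_near.
Qed.

End Gauge.

(** * The homeomorphism between the band and the region *)

Section Band.
Context {R : realType} {M : riemannian_surface R}.
Context (X Y : M -> R) (Psi : R * R -> M).
Hypothesis X_cont : continuous X.
Hypothesis Y_cont : continuous Y.
Hypothesis Psi_cont : continuous Psi.
Hypothesis PsiK : forall x, Psi (X x, Y x) = x.
Hypothesis X_Psi : forall z, X (Psi z) = z.1.
Hypothesis Y_Psi : forall z, Y (Psi z) = z.2.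
Context (gamma sigma : R -> M).
Hypothesis gammaE : forall t, gamma t = Psi (t, 0).
Hypothesis sigma_cont : continuous sigma.
Let a t := X (sigma t).
Let b t := Y (sigma t).
Hypothesis b_gt0 : forall t, 0 < b t.
Hypothesis slope_incr : forall s t, s < t -> a s / b s < a t / b t.
Hypothesis proper : forall C, exists K, forall t, K <= `|t| -> C < `|a t| + b t.

Let a_cont : continuous a.
Proof. by move=> t; apply: (@continuous_comp R M R sigma X); [exact: sigma_cont | exact: X_cont]. Qed.

Let b_cont : continuous b.
Proof. by move=> t; apply: (@continuous_comp R M R sigma Y); [exact: sigma_cont | exact: Y_cont]. Qed.

Let U := gauge a b.
Let f := param_of_slope a b.
Let B : set M := [set x | 0 <= Y x /\ U (X x, Y x) <= 1].
(** Division of the coordinates by [D] moves points along rays so that the height [Y / D] is 0 on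
    [gamma] and 1 on [sigma], where the gauge is 1; afterwards the abscissa is straightened.
    Homogeneity of the gauge shows that [1 / D] equals [den] at the rescaled point, which is how [h]
    undoes the division. *)
Let D (x : M) := Y x + 1 - U (X x, Y x).
Let ginv (x : M) : R * R := (straighten a b (X x / D x) (Y x / D x), Y x / D x).
Let den (z : R * R) := 1 - z.2 + U z.
Let pt (z : R * R) : R * R := (unstraighten a b z.1 z.2, z.2).
Let h (z : R * R) : M := Psi ((pt z).1 / den (pt z), (pt z).2 / den (pt z)).

Let U_cont : continuous U := gauge_continuous a_cont b_cont b_gt0 slope_incr proper.

Let XY_cont : continuous (fun x => (X x, Y x)).
Proof. by move=> x; apply: (@continuous_pair M R R X Y); [exact: X_cont | exact: Y_cont]. Qed.

Let UXY_cont : continuous (fun x => U (X x, Y x)).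
Proof.
move=> x; apply: (@continuous_comp M (R * R)%type R (fun x => (X x, Y x)) U); first exact: XY_cont.
exact: U_cont.
Qed.

Let sigmaE t : sigma t = Psi (a t, b t).
Proof. by rewrite PsiK. Qed.

(** At height 1 it is the gauge alone that keeps [den] positive: at a slope of the curve it equals
    [1 / b t]. *)
Let den_gt0 (x k : R) : admissible a b x k -> 0 < den (x, k).
Proof.
move=> [k0 k1 H]; have u0 := gauge_ge0 b_gt0 slope_incr (x, k); rewrite -/U in u0.
rewrite /den /=; have [lt|e] : k < 1 \/ k = 1 by move: k1; rewrite le_eqVlt => /predU1P[->|->]; [right|left].
  by move: u0 lt; move: (U _) => u; lra.
case: H => [lt|f1]; first by move: lt; rewrite e ltxx.
have [t ->] := param_lt1 a_cont b_cont b_gt0 slope_incr f1.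
by rewrite e subrr add0r /U gauge_slope// invr_gt0.
Qed.

Let D_gt0 x : B x -> 0 < D x.
Proof.
move=> [y0 u1]; rewrite /D; have [y0'|y0'] := leP (Y x) 0.
  have y00 : Y x = 0 by apply/eqP; rewrite eq_le y0'.
  by rewrite /U gauge_le0// y00; lra.
by move: y0' u1; move: (U _) => u; lra.
Qed.

Let B_h z : band z -> B (h z) /\ ginv (h z) = z.
Proof.
move=> /andP[k0 k1]; have [ad us] := unstraightenP a_cont b_cont b_gt0 slope_incr z.1 k0 k1.
set x := unstraighten a b z.1 z.2 in ad us; have d0 := den_gt0 ad.
set d := den (x, z.2) in d0.
have EX : X (h z) = x / d by rewrite /h X_Psi.
have EY : Y (h z) = z.2 / d by rewrite /h Y_Psi.
have EU : U (X (h z), Y (h z)) = U (x, z.2) / d.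
  by rewrite EX EY /U gauge_div.
have ED : D (h z) = d^-1.
  rewrite /D EU EY; have -> : U (x, z.2) = d - (1 - z.2) by rewrite /d /den /= addrC addKr.
  by field; rewrite gt_eqF.
split.
  split; first by rewrite EY divr_ge0// ltW.
  rewrite EU ler_pdivrMr// mul1r /d /den /=.
  by rewrite lerDr subr_ge0.
rewrite /ginv ED invrK EX EY !divfK ?gt_eqF// us.
by case: (z).
Qed.

Let B_admissible x : B x -> admissible a b (X x / D x) (Y x / D x).
Proof.
move=> Bx; have D0 := D_gt0 Bx; have [y0 u1] := Bx.
have k0 : 0 <= Y x / D x by rewrite divr_ge0// ltW.
have k1 : Y x / D x <= 1 by rewrite ler_pdivrMr// mul1r /D -addrA lerDl subr_ge0.
split=> //; have [u1'|u1'] := eqVneq (U (X x, Y x)) 1; last first.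
  by left; rewrite ltr_pdivrMr// mul1r /D -addrA ltrDl subr_gt0 lt_neqAle u1' u1.
right; have [t [Xt Yt]] := gauge_eq1 b_gt0 slope_incr u1'.
have -> : X x / D x = slope a b t.
  by rewrite /D u1' addrK Xt Yt.
by rewrite param_slope//; exact: squash_lt1.
Qed.

Let h_B x : B x -> band (ginv x) /\ h (ginv x) = x.
Proof.
move=> Bx; have D0 := D_gt0 Bx; have [y0 u1] := Bx.
have k0 : 0 <= Y x / D x by rewrite divr_ge0// ltW.
have k1 : Y x / D x <= 1 by rewrite ler_pdivrMr// mul1r /D -addrA lerDl subr_ge0.
split; first by rewrite /band /= k0 k1.
have ad := B_admissible Bx.
have Ept : pt (ginv x) = (X x / D x, Y x / D x) by rewrite /pt /ginv /= straightenK.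
rewrite /h Ept /=.
have -> : den (X x / D x, Y x / D x) = (D x)^-1.
  rewrite /den /= /U gauge_div// -/U.
  have -> : U (X x, Y x) = Y x + 1 - D x by rewrite /D; ring.
  by field; rewrite gt_eqF.
by rewrite !invrK !divfK ?gt_eqF// PsiK.
Qed.

Let h_cont : {within band, continuous h}.
Proof.
apply/subspace_continuousP => z /andP[k0 k1].
have [ad us] := unstraightenP a_cont b_cont b_gt0 slope_incr z.1 k0 k1.
have d0 := den_gt0 ad.
have cpt : pt w @[w --> within band (nbhs z)] --> pt z.
  apply/cvgrPdistC_le => e e0; rewrite near_withinE.
  have := unstraighten_near a_cont b_cont b_gt0 slope_incr z.1 k0 k1 e0.
  rewrite -surjective_pairing => N; have N2 := near_proj1 z e0.
  apply: filterS2 N N2 => w H [_ w2] /andP[w0 w1].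
  by rewrite prod_normE /= ge_max H// ltW.
have : {for pt z, continuous (fun w : R * R => Psi (w.1 / den w, w.2 / den w))}.
  have cden : {for pt z, continuous (fun w => (den w)^-1)}.
    apply: (@cvgV _ _ _ _ den); first by rewrite gt_eqF.
    apply: (@continuousD _ R^o (R * R)%type (fun w => 1 - w.2) U); last exact: U_cont.
    by apply: (@continuousB _ R^o (R * R)%type (fun=> 1) snd); [exact: cvg_cst | exact: cvg_snd].
  apply: (@continuous_comp (R * R)%type (R * R)%type M (fun w => (w.1 / den w, w.2 / den w)) Psi); last exact: Psi_cont.
  apply: (@continuous_pair (R * R)%type R R (fun w => w.1 / den w) (fun w => w.2 / den w)).
    by apply: (@continuousM _ (R * R)%type fst (fun w => (den w)^-1)); [exact: cvg_fst | exact: cden].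
  by apply: (@continuousM _ (R * R)%type snd (fun w => (den w)^-1)); [exact: cvg_snd | exact: cden].
move=> cP; exact: (cvg_comp _ _ cpt cP).
Qed.

Let g_cont : {within B, continuous ginv}.
Proof.
apply: continuous_in_subspaceT => x /set_mem Bx; have D0 := D_gt0 Bx.
have [/andP[k0 k1] _] := h_B Bx.
have cD : {for x, continuous (fun x => (D x)^-1)}.
  apply: (@cvgV _ _ _ _ D); first by rewrite gt_eqF.
  apply: (@continuousB _ R^o M (fun x => Y x + 1) (fun x => U (X x, Y x))); last exact: UXY_cont.
  by apply: (@continuousD _ R^o M Y (fun=> 1)); [exact: Y_cont | exact: cvg_cst].
have cX : {for x, continuous (fun x => X x / D x)}.
  by apply: (@continuousM _ M X (fun x => (D x)^-1)); [exact: X_cont | exact: cD].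
have cY : {for x, continuous (fun x => Y x / D x)}.
  by apply: (@continuousM _ M Y (fun x => (D x)^-1)); [exact: Y_cont | exact: cD].
have ad := B_admissible Bx.
apply: (@continuous_pair M R R (fun x => straighten a b (X x / D x) (Y x / D x)) (fun x => Y x / D x)); last exact: cY.
apply: (@continuous_comp M (R * R)%type R (fun x => (X x / D x, Y x / D x)) (fun z => straighten a b z.1 z.2)).
  exact: (@continuous_pair M R R (fun x => X x / D x) (fun x => Y x / D x)).
exact: straighten_continuous.
Qed.

Let B_closed : closed B.
Proof.
have -> : B = Y @^-1` [set y | 0 <= y] `&` (fun x => U (X x, Y x)) @^-1` [set u | u <= 1] by [].
apply: closedI.
  by apply: preimage_closed => [x _|]; [exact: Y_cont | exact: closed_ge].
by apply: preimage_closed => [x _|]; [exact: UXY_cont | exact: closed_le].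
Qed.

Let B_gamma t : B (gamma t) /\ ginv (gamma t) = (straighten a b t 0, 0).
Proof.
have EX : X (gamma t) = t by rewrite gammaE X_Psi.
have EY : Y (gamma t) = 0 by rewrite gammaE Y_Psi.
have EU : U (X (gamma t), Y (gamma t)) = 0 by rewrite EY /U gauge_le0.
have ED : D (gamma t) = 1 by rewrite /D EU EY; ring.
split; first by split; rewrite ?EU ?EY.
by rewrite /ginv ED !divr1 EX EY.
Qed.

Let B_sigma t : B (sigma t) /\ ginv (sigma t) = (straighten a b (slope a b t) 1, 1).
Proof.
have EU : U (X (sigma t), Y (sigma t)) = 1 by exact: gauge_curve.
have ED : D (sigma t) = Y (sigma t) by rewrite /D EU addrK.
split; first by split; rewrite ?EU//; exact/ltW/b_gt0.
by rewrite /ginv ED divff ?gt_eqF//; exact: b_gt0.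
Qed.

Let not_interior x (r : R -> M) : {for 0, continuous r} -> r 0 = x -> (forall s, 0 < s -> ~ B (r s)) ->
  ~ interior B x.
Proof.
move=> cr r0 out; rewrite -r0 => /cr/near_norm[d d0 H].
have d20 : 0 < d / 2 by rewrite divr_gt0.
apply: (out (d / 2) d20); apply: H.
by rewrite subr0 gtr0_norm// ltr_pdivrMr// ltr_pMr// ltr1n.
Qed.

(** Positive ordinate and gauge below 1 define an open set; from [gamma] the region is left through
    negative ordinates, from [sigma] outward along the ray. *)
Let B_frontier : closure B `\` interior B = range gamma `|` range sigma.
Proof.
have -> : closure B = B by apply/esym/closure_id; exact: B_closed.
apply/seteqP; split=> [x [[y0 u1] nB]|x [[t _ <-]|[t _ <-]]].
- have [Y0|Y0] := eqVneq (Y x) 0.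
    by left; exists (X x) => //; rewrite gammaE -Y0 PsiK.
  have [U1|U1] := eqVneq (U (X x, Y x)) 1.
    have [t [Xt Yt]] := gauge_eq1 b_gt0 slope_incr U1.
    by right; exists t => //; rewrite sigmaE -Xt -Yt PsiK.
  exfalso; apply: nB.
  pose O := Y @^-1` [set y | 0 < y] `&` (fun x => U (X x, Y x)) @^-1` [set u | u < 1].
  have oO : open O.
    apply: openI.
      by apply: open_comp => [z _|]; [exact: Y_cont | exact: open_gt].
    by apply: open_comp => [z _|]; [exact: UXY_cont | exact: open_lt].
  have Ox : O x by split=> /=; rewrite lt_neqAle ?y0 ?u1 ?andbT// eq_sym.
  apply: (@filterS M (nbhs x) _ O) (open_nbhs_nbhs (conj oO Ox)).
  by move=> z [z1 z2]; split; exact: ltW.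
- split; first exact: (B_gamma t).1.
  apply: (@not_interior _ (fun s => Psi (t, - s))).
  + apply: (@continuous_comp R (R * R)%type M (fun s => (t, - s)) Psi); last exact: Psi_cont.
    apply: (@continuous_pair R R R (fun=> t) (fun s => - s)); first exact: cvg_cst.
    exact: (@continuousN _ R^o R id).
  + by rewrite oppr0 gammaE.
  + by move=> s s0 [+ _]; rewrite Y_Psi /= oppr_ge0 leNgt s0.
- split; first exact: (B_sigma t).1.
  apply: (@not_interior _ (fun s => Psi (cone a b (1 + s) t))).
  + apply: (@continuous_comp R (R * R)%type M (fun s => cone a b (1 + s) t) Psi); last exact: Psi_cont.
    apply: (@continuous_comp R (R * R)%type (R * R)%type (fun s => (1 + s, t)) (fun rt => cone a b rt.1 rt.2)).
      apply: (@continuous_pair R R R (fun s => 1 + s) (fun=> t)); last exact: cvg_cst.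
      by apply: (@continuousD _ R^o R (fun=> 1) id); [exact: cvg_cst | exact: cvg_id].
    exact: cone_continuous.
  + by rewrite addr0 sigmaE /cone !mul1r.
  + move=> s s0 [_]; rewrite X_Psi Y_Psi -surjective_pairing /U gauge_cone ?addr_gt0//.
    by rewrite leNgt ltrDl s0.
Qed.

(** The band parameter is at least [t - 1] on [gamma] and equals [slope t + t] on [sigma], so both
    tend to plus infinity. *)
Lemma same_end_of_slopes : same_end gamma sigma.
Proof.
have hg t : gamma t = h (straighten a b t 0, 0).
  by have [Bt <-] := B_gamma t; rewrite (h_B Bt).2.
have hs t : sigma t = h (straighten a b (slope a b t) 1, 1).
  by have [Bt <-] := B_sigma t; rewrite (h_B Bt).2.
have band0 s : band (s, 0 : R) by rewrite /band /= lexx ler01.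
have band1 s : band (s, 1 : R) by rewrite /band /= lexx ler01.
exists B, h, (fun t => straighten a b t 0), (fun t => straighten a b (slope a b t) 1); split=> //.
- split.
  + by exists ginv; split; [exact: B_h | exact: h_B | exact: h_cont | exact: g_cont].
  + exact: B_closed.
  + exact: B_frontier.
  + apply/seteqP; split=> x [t _ <-]; first by exists (straighten a b t 0) => //; rewrite -hg.
    by exists ((pt (t, 0)).1 / den (pt (t, 0))) => //; rewrite gammaE /h /= mul0r.
  + apply/seteqP; split=> x [t _ <-]; first by exists (straighten a b (slope a b t) 1) => //; rewrite -hs.
    have [[_ _] H] := B_h (band1 t); have [ad us] := unstraightenP a_cont b_cont b_gt0 slope_incr t ler01 (lexx 1).
    have [_ _ [|f1]] := ad; first by rewrite ltxx.
    have [u eu] := param_lt1 a_cont b_cont b_gt0 slope_incr f1.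
    exists u => //; rewrite hs -eu us; reflexivity.
- apply/cvgryPge => A; near=> t; apply: (@le_trans _ _ (t - 1)).
    by rewrite lerBrDr; near: t; apply: nbhs_pinfty_ge; rewrite num_real.
  rewrite /straighten mul0r subr0 divr1 lerD2l; exact: param_geN1.
- apply/cvgryPge => A; near=> t.
  have t0 : 0 <= t by near: t; apply: nbhs_pinfty_ge; rewrite num_real.
  have tA : A - slope a b 0 <= t by near: t; apply: nbhs_pinfty_ge; rewrite num_real.
  rewrite straighten_slope//.
  have : slope a b 0 <= slope a b t by rewrite leNgt slope_lt// -leNgt.
  by move: tA; move: (slope a b 0) (slope a b t) => u v; lra.
Unshelve. all: by end_near.
Qed.

End Band.

(** * Coordinates in which [gamma] is the horizontal axis *)

Section Coordinates.
Context {R : realType} {M : riemannian_surface R}.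
Local Notation E := ('rV[R]_2).
Context (complete : geodesically_complete M) (no_conj : no_conjugate_points M)
  (plane : homeomorphic M E).
Local Notation expo := (expo complete).
Local Notation logm := (logm complete no_conj plane).
Local Notation dst := (dst complete no_conj plane).
Local Notation metric_line := (metric_line complete no_conj plane).
Local Notation side := (side complete no_conj plane).
Context (gamma sigma : R -> M) (e : R).
Hypothesis lg : metric_line gamma.
Hypothesis ls : metric_line sigma.
Hypothesis e2 : e * e = 1.
Hypothesis side_gt0 : forall t, 0 < e * side gamma (sigma t).

Let q := gamma 0.
Let gg : E := velocity (chart_at q) gamma 0.
Let N : R := gg 0 0 ^+ 2 + gg 0 1 ^+ 2.
(** [gg] turned by a right angle in the coordinate plane, not with respect to the metric; the sign
    [e] makes the ordinate positive on [sigma]. *)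
Let nn : E := \row_k (if k == 0 then - (e * gg 0 1) else e * gg 0 0).
Definition abscissa (x : M) : R := (gg 0 0 * logm q x 0 0 + gg 0 1 * logm q x 0 1) / N.
Definition ordinate (x : M) : R := e * side gamma x / N.
Definition from_coordinates (z : R * R) : M := expo q (z.1 *: gg + z.2 *: nn).

Local Notation X := abscissa.
Local Notation Y := ordinate.
Local Notation Psi := from_coordinates.

Lemma N_gt0 : 0 < N.
Proof.
rewrite lt_neqAle addr_ge0 ?sqr_ge0// andbT eq_sym paddr_eq0 ?sqr_ge0// !sqrf_eq0.
apply/negP => /andP[/eqP h0 /eqP h1]; have /eqP := gg_neq0 lg; apply.
by apply/rowP; apply: I2_ind; rewrite mxE.
Qed.

Lemma logm_coordinates x : logm q x = X x *: gg + Y x *: nn.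
Proof.
have N0 := N_gt0; rewrite /X /Y /side /cross -/q -/gg.
move: (logm q x) => v; apply/rowP; apply: I2_ind; rewrite !mxE /=.
  have -> : e * (gg 0 0 * v 0 1 - gg 0 1 * v 0 0) / N * - (e * gg 0 1) =
    (e * e) * - (gg 0 0 * v 0 1 - gg 0 1 * v 0 0) * gg 0 1 / N by ring.
  by rewrite e2 mul1r; move: N0; rewrite /N; move: (gg 0 0) (gg 0 1) (v 0 0) (v 0 1) => g0 g1 v0 v1 N0; field; rewrite gt_eqF.
have -> : e * (gg 0 0 * v 0 1 - gg 0 1 * v 0 0) / N * (e * gg 0 0) =
  (e * e) * (gg 0 0 * v 0 1 - gg 0 1 * v 0 0) * gg 0 0 / N by ring.
by rewrite e2 mul1r; move: N0; rewrite /N; move: (gg 0 0) (gg 0 1) (v 0 0) (v 0 1) => g0 g1 v0 v1 N0; field; rewrite gt_eqF.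
Qed.

Lemma from_coordinatesK x : Psi (X x, Y x) = x.
Proof. by rewrite /Psi -logm_coordinates logmK. Qed.

Lemma abscissa_from z : X (Psi z) = z.1.
Proof.
have N0 := N_gt0; rewrite /X /Psi expoK !mxE /=; move: N0; rewrite /N.
by move: (gg 0 0) (gg 0 1) => g0 g1 N0; field; rewrite gt_eqF.
Qed.

Lemma ordinate_from z : Y (Psi z) = z.2.
Proof.
have N0 := N_gt0; rewrite /Y /side /cross /Psi -/q -/gg expoK !mxE /=.
have -> : e * (gg 0 0 * (z.1 * gg 0 1 + z.2 * (e * gg 0 0)) - gg 0 1 * (z.1 * gg 0 0 + z.2 * - (e * gg 0 1))) =
  (e * e) * (z.2 * N) by rewrite /N; ring.
by rewrite e2 mul1r mulfK// gt_eqF.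
Qed.

Lemma ordinate_continuous : continuous Y.
Proof.
move=> x; apply: (@continuousM _ M (fun x => e * side gamma x) (fun=> N^-1)); last exact: cvg_cst.
by apply: (@continuousM _ M (fun=> e) (side gamma)); [exact: cvg_cst | exact: side_continuous].
Qed.

Lemma abscissa_continuous : continuous X.
Proof.
move=> x; apply: (@continuousM _ M (fun x => gg 0 0 * logm q x 0 0 + gg 0 1 * logm q x 0 1) (fun=> N^-1)); last exact: cvg_cst.
apply: (@continuous_comp M E R (logm q) (fun v => gg 0 0 * v 0 0 + gg 0 1 * v 0 1)); first exact: logm_continuous.
exact: sd_cont (sd_add (sd_mul (sd_cst (gg 0 0) _) (sd_coord _ 0)) (sd_mul (sd_cst (gg 0 1) _) (sd_coord _ 1))).
Qed.

Lemma from_coordinates_continuous : continuous Psi.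
Proof.
move=> z; apply: (@continuous_comp (R * R)%type E M (fun z => z.1 *: gg + z.2 *: nn) (expo q)); last exact: expo_continuous.
have d1 := sd_linear z (blin_comp (blin_line gg) (blin_fst R R)).
have d2 := sd_linear z (blin_comp (blin_line nn) (blin_snd R R)).
exact: sd_cont (sd_add d1 d2).
Qed.

Lemma gamma_coordinates t : gamma t = Psi (t, 0).
Proof. by rewrite /Psi /= scale0r addr0; exact: gammaE lg t. Qed.

Lemma sigma_continuous : continuous sigma.
Proof. exact: (metric_line_geodesic ls).1.1. Qed.

Lemma ordinate_gt0 t : 0 < Y (sigma t).
Proof. by rewrite divr_gt0// N_gt0. Qed.

(** The distance from [q] is at most a constant times the sum of the coordinates in absolute value,
    and along the line [sigma] it grows like the time. *)
Lemma proper_coordinates C : exists K, forall t, K <= `|t| -> C < `|X (sigma t)| + Y (sigma t).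
Proof.
pose m := 1 + nrm q gg + nrm q nn.
have g0 := nrm_ge0 q gg; have n0 := nrm_ge0 q nn.
have m0 : 0 < m by rewrite /m -addrA ltr_pwDl// addr_ge0.
exists (C * m + dst q (sigma 0) + 1) => t Kt.
have := metric_line_far q 0 t ls; rewrite subr0 -[dst q (sigma t)]nrm_logm logm_coordinates => far.
have tri := nrm_triangle q (X (sigma t) *: gg) (Y (sigma t) *: nn).
rewrite !nrmZ (gtr0_norm (ordinate_gt0 t)) in tri.
rewrite -(ltr_pM2r m0).
have Y0 := ordinate_gt0 t; have X0 := normr_ge0 (X (sigma t)).
move: Kt far tri g0 n0 Y0 X0; rewrite /m.
move: (nrm q gg) (nrm q nn) (nrm q _) (`|X _|) (Y _) (dst _ _) (`|t|) => u v w x y d k; nra.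
Qed.

(** Two points of [sigma] on one ray from [q] would make [sigma] a radial geodesic through [q],
    which lies on [gamma]. *)
Lemma slopes_inj s t : X (sigma s) / Y (sigma s) = X (sigma t) / Y (sigma t) -> s = t.
Proof.
move=> est; apply/eqP; apply: contraT => ne; exfalso.
have Ys := ordinate_gt0 s; have Yt := ordinate_gt0 t.
pose l := Y (sigma s) / Y (sigma t).
have lE : logm q (sigma s) = l *: logm q (sigma t).
  rewrite !logm_coordinates scalerDr !scalerA /l divfK ?gt_eqF//; congr (_ *: _ + _).
  have -> : X (sigma s) = X (sigma s) / Y (sigma s) * Y (sigma s) by rewrite divfK// gt_eqF.
  by rewrite est; ring.
pose v := logm q (sigma t).
have st : s - t != 0 by rewrite subr_eq0.
(* The affine parameter takes [t] to 1 and [s] to [l]; it is 0 at time [t - k^-1], where the curve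
   passes through [q]. *)
pose k := (l - 1) / (s - t).
pose c r := geo complete q v (k * r + (1 - k * t)).
have gc : geodesic c by apply: geodesic_affine; exact: geo_geodesic.
have ct : c t = sigma t.
  by rewrite /c (_ : k * t + (1 - k * t) = 1) ?geo_expo ?scale1r ?logmK//; ring.
have cs : c s = sigma s.
  rewrite /c (_ : k * s + (1 - k * t) = l); last by rewrite /k; field.
  by rewrite geo_expo -lE logmK.
have sc : sigma = c.
  by apply: (@two_points _ _ complete no_conj plane _ _ s t (metric_line_geodesic ls) gc).
have k0 : k != 0.
  apply/eqP => k0; have := ls s t; rewrite sc /c k0 !mul0r dst_self => /eqP.
  by rewrite eq_sym normr_eq0 subr_eq0 eq_sym (negbTE ne).
have := side_gt0 (t - k^-1); rewrite sc /c.
have -> : k * (t - k^-1) + (1 - k * t) = 0 by field.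
by rewrite geo_start /q side_gamma// mulr0 ltxx.
Qed.

(** The slope along [sigma] is continuous and injective, hence strictly monotone; if it decreases,
    it increases along the reversed curve. *)
Lemma same_end_or_reverse : same_end gamma sigma \/ same_end gamma (reverse sigma).
Proof.
pose F t := X (sigma t) / Y (sigma t).
have cF : continuous F.
  move=> t; apply: (@continuousM _ R (fun t => X (sigma t)) (fun t => (Y (sigma t))^-1)).
    by apply: (@continuous_comp R M R sigma X); [exact: sigma_continuous | exact: abscissa_continuous].
  apply: (@cvgV _ _ _ _ (fun t => Y (sigma t))); first by rewrite gt_eqF// ordinate_gt0.
  by apply: (@continuous_comp R M R sigma Y); [exact: sigma_continuous | exact: ordinate_continuous].
have [||inc|dec] := @itv_continuous_inj_mono R F `]-oo, +oo[.
- exact: continuous_subspaceT.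
- by move=> s t _ _; exact: slopes_inj.
- left; apply: (same_end_of_slopes abscissa_continuous ordinate_continuous from_coordinates_continuous
    from_coordinatesK abscissa_from ordinate_from gamma_coordinates sigma_continuous ordinate_gt0 _ proper_coordinates).
  by move=> s t st; rewrite -/(F s) -/(F t) inc.
- right; apply: (same_end_of_slopes abscissa_continuous ordinate_continuous from_coordinates_continuous
    from_coordinatesK abscissa_from ordinate_from gamma_coordinates).
  + move=> t; apply: (@continuous_comp R R M (fun t => - t) sigma); last exact: sigma_continuous.
    exact: (@continuousN _ R^o R id).
  + by move=> t; exact: ordinate_gt0.
  + by move=> s t st; rewrite /reverse -/(F (- s)) -/(F (- t)) dec// ltrN2.
  + move=> C; have [K HK] := proper_coordinates C; exists K => t; rewrite -normrN; exact: HK.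
Qed.

End Coordinates.

Theorem proposition1p3 (R : realType) (M : riemannian_surface R)
    (M_plane : homeomorphic M 'rV[R]_2)
    (M_complete : geodesically_complete M)
    (M_noconj : no_conjugate_points M)
    (p : M) (M_visible : visibility_axiom p)
    (gamma : R -> M) (gamma_line : line gamma) :
  exists sigma : R -> M, line sigma /\ weak_hyperbolic_pair gamma sigma.
Proof.
pose D := dist_dst M_complete M_noconj M_plane.
have lg : metric_line M_complete M_noconj M_plane gamma.
  by move=> s t; rewrite -D gamma_line.2 -normrN opprB.
have [sigma [e [ls e1 side_gt0 far]]] := partner M_visible lg.
have e2 : e * e = 1 by case: e1 => ->; rewrite ?mulrNN mulr1.
have sigma_line : line sigma.
  split; first exact: (metric_line_geodesic ls).1.
  by move=> t s; rewrite D ls -normrN opprB.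
(* Only the absolute values of the times enter, so this serves both ends and both orientations of
   [sigma]. *)
have nat_far (u v : nat -> R) : (forall k, `|u k| = k%:R) -> (forall k, `|v k| = k%:R) ->
    dist (gamma (u k)) (sigma (v k)) @[k --> \oo] --> +oo.
  move=> uk vk; apply/cvgryPge => A; have [T HT] := far A.
  have := nbhs_infty_ger T; apply: filterS => k Tk.
  by rewrite D; apply/ltW/HT; rewrite ?uk ?vk.
have pos k : `|k%:R| = k%:R :> R by rewrite normr_nat.
have neg k : `|- k%:R| = k%:R :> R by rewrite normrN normr_nat.
have to_pinfty : (k%:R : R) @[k --> \oo] --> +oo.
  by apply/cvgryPge => A; exact: nbhs_infty_ger.
have to_ninfty : (- k%:R : R) @[k --> \oo] --> -oo 
  by apply/cvgrNyPle => A; have := nbhs_infty_ger (- A); apply: filterS => k; rewrite lerNl.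
exists sigma; split=> //; split=> //.
  apply/seteqP; split=> // x [[t _ <-] [s _ es]].
  by have := side_gt0 s; rewrite es side_gamma// mulr0 ltxx.
have [se|se] := same_end_or_reverse lg ls e2 side_gt0.
  exists sigma; first by left.
  by split=> //; [exists (fun k => k%:R) => //; exact: nat_far | exists (fun k => - k%:R) => //; exact: nat_far].
exists (reverse sigma); first by right.
split=> //.
  by exists (fun k => k%:R) => //; apply: (nat_far (fun k => k%:R) (fun k => - k%:R)).
exists (fun k => - k%:R) => //; apply: (nat_far (fun k => - k%:R) (fun k => - - k%:R)) => // k.
by rewrite opprK.
Qed.
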